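(* Let $\mathbf{k}$ be a finite field of characteristic $p$ and $d\ge1$ an integer. Let $F\in\mathcal{KP}_d$ be finite dimensional and let $G_\bullet\in\mathcal{SP}_d$. Then there is an isomorphism, natural in $F$ and $G_\bullet$, $$\mathrm{Hom}_{\mathcal{DSP}_d}(\mathbf C^\infty(F),G_\bullet)\simeq\mathrm{colim}_i\,\mathrm{Hom}_{\mathcal{DP}_d}(F,\mathbf K'^i(G_i)).$$ In particular, for $F,G\in\mathcal P_d$ with $F$ finite dimensional, $$\mathrm{Hom}_{\mathcal{DSP}_d}(\mathbf C^\infty(F),\mathbf C^\infty(G)[s])\simeq\mathrm{colim}_i\,\mathrm{Ext}^s_{\mathcal P_{dp^i}}(F^{(i)},G^{(i)}).$$
   Context: **Strict polynomial functors.** $\mathcal V$ (resp. $\mathcal V'$) is the category of finite-dimensional (resp. all) $\mathbf{k}$-vector spaces, $\Gamma^d(X)=(X^{\otimes d})^{\Sigma_d}$, and $\Gamma^d\mathcal V$ has the objects of $\mathcal V$ with $\mathrm{Hom}_{\Gamma^d\mathcal V}(V,W)=\Gamma^d(\mathrm{Hom}_{\mathbf k}(V,W))$. $\mathcal P_d$ is the category of $\mathbf{k}$-linear functors $\Gamma^d\mathcal V\to\mathcal V'$ (no finiteness assumption). $F^{(i)}\in\mathcal P_{dp^i}$ is the $i$-th Frobenius twist, $F^{(i)}(V)=F(V^{(i)})$. $\widehat{\mathcal P}=\prod_{d>0}\mathcal P_d$. $\mathcal{KP}_d$, $\mathcal K\widehat{\mathcal P}$ are the categories of unbounded complexes, $\mathcal{DP}_d$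 the unbounded derived category; a complex is finite dimensional if it is bounded and its terms take finite-dimensional values. **Projective model structure on complexes.** Weak equivalences are quasi-isomorphisms, fibrations are epimorphisms, and cofibrations are monomorphisms, split in the underlying abelian category, with cofibrant cokernel; cofibrant complexes are those with property P: they admit an exhaustive filtration $\{M_j\}_{j\ge0}$ with each $M_j\subset M_{j+1}$ split in the underlying abelian category and each $M_{j+1}/M_j$ consisting of projectives with zero differential. **$\mathbf C'$ and $\mathbf K'$.** $\mathbf C$ is the Frobenius twist, $\mathbf C:\mathcal{KP}_d\to\mathcal{KP}_{pd}$, applied componentwise on $\mathcal K\widehat{\mathcal P}$. $\mathbf C':\mathcal K\widehat{\mathcal P}\to\mathcal K\widehat{\mathcal P}$ is a fixed left Quillen functor for the projective model structure, sending $\mathcal{KP}_d$ to $\mathcal{KP}_{pd}$, with an isomorphism of total left derived functors $\mathbf{LC}'\simeq\mathbf{LC}$; $\mathbf K'$ is its right adjoint. Explicitly, on $\mathcal{KP}_{pd}$, $\mathbf K'(F)(V)=\mathrm{Hom}_{\mathcal P_{pd}}(\widetilde X(V,-),F)$ (Hom complex), where $\widetilde X$ is a finite-dimensional (bounded) complex of strict polynomial bifunctors, contravariant of degree $d$ in $V$ and covariant of degree $pd$ in $W$, with $\widetilde X(V,-)$ consisting of projectives of $\mathcal P_{pd}$, resolving $(V,W)\mapsto\Gamma^d(V^*\otimes W^{(1)})$. **Spectra.** A spectrum $F_\bullet$ is a collection of $F_i\in\mathcal K\widehat{\mathcal P}$ ($i\ge0$) with cochain maps $\tau_i:\mathbf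 C'(F_i)\to F_{i+1}$; maps are families $\phi_i:F_i\to G_i$ commuting with the $\tau_i$. $\mathcal S\widehat{\mathcal P}$ is the category of spectra. $\mathbf C^\infty(F)$ is the spectrum with $\mathbf C^\infty(F)_i=\mathbf C'^i(F)$ and identity structure maps (derived where appropriate). $\mathcal S\widehat{\mathcal P}$ carries Hovey's stable model structure for $(\mathcal K\widehat{\mathcal P},\mathbf C')$ (M. Hovey, ''Spectra and symmetric spectra in general model categories''), i.e. the Bousfield localization of the levelwise (''projective'') model structure on spectra in which $\mathbf C'$ becomes a Quillen equivalence and whose fibrant objects are the spectra for which all maps $F_i\to\mathbf K'(F_{i+1})$ adjoint to $\tau_i$ are quasi-isomorphisms. $\mathcal{SP}_d$ is the full subcategory of spectra with $F_i\in\mathcal{KP}_{dp^i}$ for all $i\ge0$, with the inherited model structure, and $\mathcal{DSP}_d$ is its homotopy category, triangulated with shift $[s]$ the degreewise shift of complexes. The colimit in the first formula is over the maps induced by $G_i\to\mathbf K'(G_{i+1})$; in the second, over the maps given by Frobenius twist. *)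

(* Defs.v *)
From HB Require Import structures.
From mathcomp Require Import all_boot all_order all_fingroup all_algebra all_solvable.
From mathcomp Require Import boolp.
Set Implicit Arguments.
Unset Strict Implicit.
Unset Printing Implicit Defensive.
#[local] Obligation Tactic := idtac.
Import GRing.Theory.
Local Open Scope ring_scope.

Record cat := Cat {
  ob :> Type;
  mor : ob -> ob -> Type;
  idm : forall x, mor x x;
  comp : forall x y z, mor y z -> mor x y -> mor x z;
  compA : forall x y z t (h : mor z t) (g : mor y z) (f : mor x y),
    comp h (comp g f) = comp (comp h g) f;
  comp1m : forall x y (f : mor x y), comp (idm y) f = f;
  compm1 : forall x y (f : mor x y), comp f (idm x) = f }.

Arguments mor {c} x y.
Arguments idm {c} x.
Arguments comp {c x y z} g f.
Notation "g '\oc' f" := (comp g f) (at level 50, left associativity).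

Record functor (C D : cat) := Functor {
  fob :> C -> D;
  fmap : forall x y, mor x y -> mor (fob x) (fob y);
  fmap1 : forall x, fmap (idm x) = idm (fob x);
  fmapM : forall x y z (g : mor y z) (f : mor x y),
    fmap (g \oc f) = fmap g \oc fmap f }.

Arguments fmap {C D} F {x y} f : rename.

Definition fid (C : cat) : functor C C :=
  @Functor C C (fun x => x) (fun _ _ f => f) (fun _ => erefl) (fun _ _ _ _ _ => erefl).

Program Definition fcomp (C D E : cat) (G : functor D E) (F : functor C D) :
  functor C E := @Functor C E (fun x => G (F x)) (fun _ _ f => fmap G (fmap F f)) _ _.
Next Obligation. by move=> * /=; rewrite !fmap1. Qed.
Next Obligation. by move=> * /=; rewrite !fmapM. Qed.

(* [fiterl F i.+1 = F o F^i] and [fiterr F i.+1 = F^i o F] definitionally. *)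
Fixpoint fiterl (C : cat) (F : functor C C) (i : nat) : functor C C :=
  if i is j.+1 then fcomp F (fiterl F j) else fid C.
Fixpoint fiterr (C : cat) (F : functor C C) (i : nat) : functor C C :=
  if i is j.+1 then fcomp (fiterr F j) F else fid C.

Record nattrans (C D : cat) (F G : functor C D) := NatTrans {
  ntc :> forall x : C, mor (F x) (G x);
  ntcP : forall x y (f : mor x y), ntc y \oc fmap F f = fmap G f \oc ntc x }.

Definition is_iso (C : cat) (x y : C) (f : mor x y) :=
  exists g : mor y x, g \oc f = idm x /\ f \oc g = idm y.
Definition nat_iso (C D : cat) (F G : functor C D) :=
  exists t : nattrans F G, forall x, is_iso (t x).

Record adjunction (C D : cat) (L : functor C D) (R : functor D C) := Adj {
  adj_unit : nattrans (fid C) (fcomp R L);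
  adj_counit : nattrans (fcomp L R) (fid D);
  adj_triangleL : forall x, adj_counit (L x) \oc fmap L (adj_unit x) = idm (L x);
  adj_triangleR : forall y, fmap R (adj_counit y) \oc adj_unit (R y) = idm (R y) }.

Definition mono (C : cat) (x y : C) (f : mor x y) :=
  forall z (g h : mor z x), f \oc g = f \oc h -> g = h.
Definition epi (C : cat) (x y : C) (f : mor x y) :=
  forall z (g h : mor y z), g \oc f = h \oc f -> g = h.
Definition projective (C : cat) (P : C) :=
  forall x y (e : mor x y), epi e -> forall f : mor P y, exists g : mor P x, e \oc g = f.

(* r is meant to be an equivalence; elements of the quotient are its classes. *)
Definition quot (T : Type) (r : T -> T -> Prop) := {P : T -> Prop | exists x, P = r x}.
Definition cls (T : Type) (r : T -> T -> Prop) (x : T) : quot r :=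
  exist _ (r x) (ex_intro _ x erefl).

Section quot_theory.
Variables (T : Type) (r : T -> T -> Prop).
Hypotheses (rxx : forall x, r x x) (rC : forall x y, r x y -> r y x)
  (rT : forall x y z, r x y -> r y z -> r x z).

Lemma cls_surj (q : quot r) : exists x, q = cls r x.
Proof. by case: q => P [x e]; exists x; apply: eq_exist. Qed.

Lemma eq_cls x y : r x y -> cls r x = cls r y.
Proof.
move=> rxy; apply: eq_exist; apply: funext => z; apply: propext; split.
  by apply: rT; apply: rC.
exact: rT.
Qed.

Lemma cls_eq x y : cls r x = cls r y -> r x y.
Proof. by move=> /(congr1 (fun q => sval q y)) /= ->. Qed.

Definition rep (q : quot r) : T := sval (cid (cls_surj q)).
Lemma repK q : cls r (rep q) = q.
Proof. by rewrite /rep; case: cid. Qed.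
Lemma rep_cls x : r x (rep (cls r x)).
Proof. by apply: cls_eq; rewrite repK. Qed.
End quot_theory.

Definition mclass (C : cat) := forall x y : C, mor x y -> Prop.

(* Gabriel--Zisman localisation: morphisms are finite strings of morphisms of C *)
(* and formal inverses of members of W, modulo the congruence [zeq].            *)
Section localisation.
Variables (C : cat) (W : mclass C).

Inductive zz : C -> C -> Type :=
| zid x : zz x x
| zfw x y z : mor y z -> zz x y -> zz x z
| zbw x y z (w : mor z y) : W w -> zz x y -> zz x z.

Fixpoint zcat x y z (b : zz y z) : zz x y -> zz x z :=
  match b in zz y z return zz x y -> zz x z with
  | zid _ => fun a => a
  | zfw _ _ _ f b => fun a => zfw f (zcat b a)
  | zbw _ _ _ w Ww b => fun a => zbw Ww (zcat b a)
  end.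

Inductive zeq : forall x y, zz x y -> zz x y -> Prop :=
| zrefl x y (a : zz x y) : zeq a a
| zsym x y (a b : zz x y) : zeq a b -> zeq b a
| ztrans x y (a b c : zz x y) : zeq a b -> zeq b c -> zeq a c
| zcfw x y z (f : mor y z) (a b : zz x y) : zeq a b -> zeq (zfw f a) (zfw f b)
| zcbw x y z (w : mor z y) (Ww : W w) (a b : zz x y) :
    zeq a b -> zeq (zbw Ww a) (zbw Ww b)
| zfw1 x y (a : zz x y) : zeq (zfw (idm y) a) a
| zfwM x y z t (g : mor z t) (f : mor y z) (a : zz x y) :
    zeq (zfw (g \oc f) a) (zfw g (zfw f a))
| zbwK x y z (w : mor z y) (Ww : W w) (a : zz x y) : zeq (zfw w (zbw Ww a)) a
| zfwK x y z (w : mor z y) (Ww : W w) (a : zz x z) : zeq (zbw Ww (zfw w a)) a.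

Lemma zcat1 x y (b : zz x y) : zcat b (zid x) = b.
Proof. by elim: b => [//|u v w f b /= ->|u v w f Wf b /= ->]. Qed.
Lemma zcatA x y z t (c : zz z t) (b : zz y z) (a : zz x y) :
  zcat c (zcat b a) = zcat (zcat c b) a.
Proof. by elim: c y b a => [//|u v w f c IH y b a|u v w f Wf c IH y b a] /=; rewrite IH. Qed.
Lemma zcatl x y z (b : zz y z) (a a' : zz x y) : zeq a a' -> zeq (zcat b a) (zcat b a').
Proof.
move=> e; elim: b x a a' e => [//|u v w f b IH x a a' e|u v w f Wf b IH x a a' e] /=.
  by apply: zcfw; apply: IH.
by apply: zcbw; apply: IH.
Qed.
Lemma zcatr x y z (b b' : zz y z) (a : zz x y) : zeq b b' -> zeq (zcat b a) (zcat b' a).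
Proof.
move=> e; elim: e x a => /=.
- by move=> *; apply: zrefl.
- by move=> > _ IH *; apply: zsym.
- by move=> > _ IH _ IH' *; apply: ztrans (IH _ _) (IH' _ _).
- by move=> > _ IH *; apply: zcfw; apply: IH.
- by move=> > _ IH *; apply: zcbw; apply: IH.
- by move=> *; apply: zfw1.
- by move=> *; apply: zfwM.
- by move=> *; apply: zbwK.
- by move=> *; apply: zfwK.
Qed.

Definition lhom x y := quot (@zeq x y).
Definition lcls x y (a : zz x y) : lhom x y := cls (@zeq x y) a.
Definition lcomp x y z (g : lhom y z) (f : lhom x y) : lhom x z :=
  lcls (zcat (rep g) (rep f)).

Lemma lclsE x y (a b : zz x y) : zeq a b -> lcls a = lcls b.
Proof. by apply: eq_cls; [exact: (@zsym x y)|exact: (@ztrans x y)]. Qed.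
Lemma lcls_rep x y (f : lhom x y) : lcls (rep f) = f.
Proof. exact: repK. Qed.
Lemma lcompE x y z (b : zz y z) (a : zz x y) : lcomp (lcls b) (lcls a) = lcls (zcat b a).
Proof.
apply: lclsE; apply: ztrans (zcatl _ _) (zcatr _ _);
  by apply: zsym; apply: rep_cls; apply: zrefl.
Qed.

Program Definition Loc : cat :=
  @Cat C lhom (fun x => lcls (zid x)) (fun _ _ _ g f => lcomp g f) _ _ _.
Next Obligation.
move=> x y z t h g f; rewrite -(lcls_rep f) -(lcls_rep g) -(lcls_rep h).
by rewrite !lcompE zcatA.
Qed.
Next Obligation. by move=> x y f; rewrite -(lcls_rep f) lcompE. Qed.
Next Obligation. by move=> x y f; rewrite -(lcls_rep f) lcompE zcat1. Qed.

Program Definition loc : functor C Loc :=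
  @Functor C Loc (fun x => x) (fun _ _ f => lcls (zfw f (zid _))) _ _.
Next Obligation. by move=> x; apply: lclsE; apply: zfw1. Qed.
Next Obligation. by move=> x y z g f /=; rewrite lcompE; apply: lclsE; apply: zfwM. Qed.
End localisation.

Arguments loc {C} W.

Section loc_map.
Variables (C D : cat) (W : mclass C) (V : mclass D) (F : functor C D).
Hypothesis FW : forall x y (f : mor x y), W f -> V (fmap F f).

Fixpoint zmap x y (a : zz W x y) : zz V (F x) (F y) :=
  match a in zz _ x y return zz V (F x) (F y) with
  | zid x => zid V (F x)
  | zfw _ _ _ f a => zfw (fmap F f) (zmap a)
  | zbw _ _ _ w Ww a => zbw (FW Ww) (zmap a)
  end.

Lemma zmap_eq x y (a b : zz W x y) : zeq a b -> zeq (zmap a) (zmap b).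
Proof.
elim=> /=.
- by move=> *; apply: zrefl.
- by move=> > _ IH *; apply: zsym.
- by move=> > _ IH _ IH' *; apply: ztrans IH IH'.
- by move=> > _ IH *; apply: zcfw; apply: IH.
- by move=> > _ IH *; apply: zcbw; apply: IH.
- by move=> *; rewrite fmap1; apply: zfw1.
- by move=> *; rewrite fmapM; apply: zfwM.
- by move=> *; apply: zbwK.
- by move=> *; apply: zfwK.
Qed.

Lemma zmapM x y z (b : zz W y z) (a : zz W x y) : zmap (zcat b a) = zcat (zmap b) (zmap a).
Proof. by elim: b x a => [//|u v w f b IH x a|u v w f Wf b IH x a] /=; rewrite IH. Qed.

Program Definition Loc_map : functor (Loc W) (Loc V) :=
  @Functor (Loc W) (Loc V) F (fun x y f => lcls (zmap (rep f))) _ _.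
Next Obligation.
move=> x; apply: lclsE; apply: (@zmap_eq _ _ _ (zid W x)).
by apply: zsym; apply: rep_cls; apply: zrefl.
Qed.
Next Obligation.
move=> x y z g f /=; rewrite lcompE -zmapM; apply: lclsE; apply: zmap_eq.
by apply: zsym; apply: rep_cls; apply: zrefl.
Qed.
End loc_map.

(* (L, eps) is a total left derived functor of F : C -> D, i.e. the right Kan   *)
(* extension along C -> C[W^-1] of the composite C -> D -> D[V^-1].             *)
Definition is_left_derived (C D : cat) (W : mclass C) (V : mclass D)
    (F : functor C D) (L : functor (Loc W) (Loc V))
    (eps : nattrans (fcomp L (loc W)) (fcomp (loc V) F)) :=
  forall (G : functor (Loc W) (Loc V)) (a : nattrans (fcomp G (loc W)) (fcomp (loc V) F)),
    exists! b : nattrans G L, forall x : C, eps x \oc b (loc W x) = a x.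

Record lincat (k : pzRingType) := LinCat {
  lob :> Type;
  lmor : lob -> lob -> lmodType k;
  lid : forall x, lmor x x;
  lcmp : forall x y z, lmor y z -> lmor x y -> lmor x z;
  lcmpA : forall x y z t (h : lmor z t) (g : lmor y z) (f : lmor x y),
    lcmp h (lcmp g f) = lcmp (lcmp h g) f;
  lcmp1m : forall x y (f : lmor x y), lcmp (lid y) f = f;
  lcmpm1 : forall x y (f : lmor x y), lcmp f (lid x) = f;
  lcmp_linl : forall x y z (f : lmor x y), linear (fun g : lmor y z => lcmp g f);
  lcmp_linr : forall x y z (g : lmor y z), linear (fun f : lmor x y => lcmp g f) }.

Coercion lcat (k : pzRingType) (C : lincat k) : cat :=
  @Cat C (@lmor k C) (@lid k C) (@lcmp k C) (@lcmpA k C) (@lcmp1m k C) (@lcmpm1 k C).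

Definition lfull (k : pzRingType) (C : lincat k) (P : C -> Prop) : lincat k :=
  @LinCat k {x : C | P x} (fun x y => lmor (sval x) (sval y)) (fun x => lid (sval x))
    (fun _ _ _ g f => lcmp g f) (fun _ _ _ _ h g f => lcmpA h g f)
    (fun _ _ f => lcmp1m f) (fun _ _ f => lcmpm1 f)
    (fun _ _ _ f => lcmp_linl f) (fun _ _ _ g => lcmp_linr g).

Section gamma.
Variable k : finFieldType.

(* The e-th tensor power of the space with basis B, in coordinates. *)
Definition tens (e : nat) (B : finType) := {ffun {ffun 'I_e -> B} -> k^o}.

Definition permw (e : nat) (B : finType) (s : {perm 'I_e}) (t : {ffun 'I_e -> B}) :=
  [ffun i => t (s i)].
Definition tsym (e : nat) (B : finType) : {pred tens e B} :=
  fun f => [forall s : {perm 'I_e}, [forall t, f (permw s t) == f t]].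

Lemma tsymP e B (f : tens e B) :
  reflect (forall s t, f (permw s t) = f t) (f \in @tsym e B).
Proof.
apply: (iffP forallP) => [h s t|h s]; last by apply/forallP => t; rewrite h.
by have /forallP/(_ t)/eqP := h s.
Qed.

Lemma tsym_submod e B : submod_closed (@tsym e B).
Proof.
split; first by apply/tsymP => s t; rewrite !ffunE.
by move=> a f g /tsymP hf /tsymP hg; apply/tsymP => s t; rewrite !ffunE hf hg.
Qed.
HB.instance Definition _ e B :=
  GRing.isSubmodClosed.Build k (tens e B) (@tsym e B) (tsym_submod e B).

Record Gam (e : nat) (B : finType) := MkGam { gval : tens e B; _ : gval \in @tsym e B }.
HB.instance Definition _ e B := [isSub for @gval e B].
HB.instance Definition _ e B := [Choice of Gam e B by <:].
HB.instance Definition _ e B := [SubChoice_isSubLmodule of Gam e B by <:].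

Lemma gvalP e B (f : Gam e B) s t : gval f (permw s t) = gval f t.
Proof. by case: f => f /tsymP h /=. Qed.

(* Gamma^e Hom(k^m, k^n), the basis element (i, j) being the matrix unit        *)
(* e_i |-> e_j.                                                                 *)
Definition GHom (e m n : nat) := Gam e ('I_m * 'I_n)%type.

Definition gid_ e n : tens e ('I_n * 'I_n)%type :=
  [ffun t : {ffun 'I_e -> 'I_n * 'I_n} => \prod_(i < e) ((t i).1 == (t i).2)%:R].
Lemma gid_sym e n : gid_ e n \in @tsym e _.
Proof.
apply/tsymP => s t; rewrite !ffunE [RHS](reindex_inj (@perm_inj _ s)) /=.
by apply: eq_bigr => i _; rewrite ffunE.
Qed.
Definition gid e n : GHom e n n := MkGam (gid_sym e n).

Definition gcomp_ e l m n (g : GHom e m n) (f : GHom e l m) : tens e ('I_l * 'I_n)%type :=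
  [ffun t : {ffun 'I_e -> 'I_l * 'I_n} => \sum_(u : {ffun 'I_e -> 'I_m})
     gval f [ffun i => ((t i).1, u i)] * gval g [ffun i => (u i, (t i).2)]].
Lemma gcomp_sym e l m n (g : GHom e m n) (f : GHom e l m) : gcomp_ g f \in @tsym e _.
Proof.
apply/tsymP => s t; rewrite !ffunE.
rewrite (reindex_inj (h := permw s)); last first.
  move=> u v /ffunP h; apply/ffunP => i.
  by have := h ((s^-1)%g i); rewrite !ffunE permKV.
apply: eq_bigr => u _.
by congr (_ * _); rewrite -[RHS](gvalP _ s); congr (gval _ _); apply/ffunP => i; rewrite !ffunE.
Qed.
Definition gcomp e l m n (g : GHom e m n) (f : GHom e l m) : GHom e l n :=
  MkGam (gcomp_sym g f).

Lemma gam_eq e B (f g : Gam e B) : (forall t, gval f t = gval g t) -> f = g.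
Proof. by move=> h; apply: val_inj; apply/ffunP. Qed.

Lemma gcompA e l m n o (h : GHom e n o) (g : GHom e m n) (f : GHom e l m) :
  gcomp h (gcomp g f) = gcomp (gcomp h g) f.
Proof.
apply: gam_eq => t; rewrite !ffunE.
under eq_bigr do rewrite ffunE mulr_suml.
rewrite exchange_big /=; apply: eq_bigr => u _.
rewrite ffunE mulr_sumr; apply: eq_bigr => v _; rewrite mulrA.
by congr (_ * _ * _); congr (gval _ _); apply/ffunP => i; rewrite !ffunE.
Qed.

Lemma gid_val e n (t : {ffun 'I_e -> 'I_n}) (u : {ffun 'I_e -> 'I_n}) :
  gval (gid e n) [ffun i => (t i, u i)] = (t == u)%:R.
Proof.
rewrite ffunE; case: eqP => [->|ne].
  by rewrite big1 // => i _; rewrite ffunE eqxx.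
have [i nei] : exists i, t i != u i.
  by apply/existsP; apply: contra_notT ne => /existsPn h; apply/ffunP => i; apply/eqP/negPn.
by rewrite (bigD1 i) //= ffunE (negPf nei) mul0r.
Qed.

Lemma gcomp1m e m n (f : GHom e m n) : gcomp (gid e n) f = f.
Proof.
apply: gam_eq => t; rewrite ffunE (bigD1 [ffun i => (t i).2]) //= big1 ?addr0.
  rewrite [X in _ * X](_ : _ = 1) ?mulr1; last first.
    rewrite (_ : [ffun i => _] = [ffun i => ([ffun i => (t i).2] i, [ffun i => (t i).2] i)]).
      by rewrite gid_val eqxx.
    by apply/ffunP => i; rewrite !ffunE.
  by congr (gval _ _); apply/ffunP => i; rewrite !ffunE; case: (t i).
move=> u ne; rewrite (_ : [ffun i => (u i, _)] = [ffun i => (u i, [ffun i => (t i).2] i)]).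
  by rewrite gid_val (negPf ne) mulr0.
by apply/ffunP => i; rewrite !ffunE.
Qed.

Lemma gcompm1 e m n (f : GHom e m n) : gcomp f (gid e m) = f.
Proof.
apply: gam_eq => t; rewrite ffunE (bigD1 [ffun i => (t i).1]) //= big1 ?addr0.
  rewrite [X in X * _](_ : _ = 1) ?mul1r; last first.
    rewrite (_ : [ffun i => _] = [ffun i => ([ffun i => (t i).1] i, [ffun i => (t i).1] i)]).
      by rewrite gid_val eqxx.
    by apply/ffunP => i; rewrite !ffunE.
  by congr (gval _ _); apply/ffunP => i; rewrite !ffunE; case: (t i).
move=> u ne; rewrite (_ : [ffun i => (_, u i)] = [ffun i => ([ffun i => (t i).1] i, u i)]).
  by rewrite gid_val eq_sym (negPf ne) mul0r.
by apply/ffunP => i; rewrite !ffunE.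
Qed.

Lemma gcomp_linl e l m n (f : GHom e l m) : linear (fun g : GHom e m n => gcomp g f).
Proof.
move=> a g h; apply: gam_eq => t; rewrite !ffunE scaler_sumr -big_split /=.
by apply: eq_bigr => u _; rewrite !ffunE mulrDr /GRing.scale /= mulrCA.
Qed.
Lemma gcomp_linr e l m n (g : GHom e m n) : linear (fun f : GHom e l m => gcomp g f).
Proof.
move=> a f h; apply: gam_eq => t; rewrite !ffunE scaler_sumr -big_split /=.
by apply: eq_bigr => u _; rewrite !ffunE mulrDl /GRing.scale /= mulrA.
Qed.

(* frob is the map Gamma^(pe) Hom(V, W) -> Gamma^e Hom(V^(1), W^(1)) dual to the Frobenius      *)
(* S^e -> S^(pe): the coefficient of a word in frob g is the coefficient in g   *)
(* of the word with every letter repeated p times.                              *)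
Section frobenius.
Variables (p e e' : nat) (ee' : e' = (p * e)%N) (p_gt0 : (0 < p)%N).

Lemma pos_subproof (j : 'I_e') : (j %/ p < e)%N.
Proof. by rewrite ltn_divLR // mulnC -ee'. Qed.
Definition pos (j : 'I_e') : 'I_e := Ordinal (pos_subproof j).
Definition stretch (B : finType) (t : {ffun 'I_e -> B}) : {ffun 'I_e' -> B} :=
  [ffun j => t (pos j)].

Lemma lift_subproof (i : 'I_e) (r : 'I_p) : (i * p + r < e')%N.
Proof.
rewrite ee'; apply: (@leq_trans (i.+1 * p)%N); first by rewrite mulSnr ltn_add2l.
by rewrite mulnC leq_mul2l (ltn_ord i) orbT.
Qed.
Definition unpos (i : 'I_e) (r : 'I_p) : 'I_e' := Ordinal (lift_subproof i r).
Lemma rem_subproof (j : 'I_e') : (j %% p < p)%N.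
Proof. by rewrite ltn_mod. Qed.
Definition prem (j : 'I_e') : 'I_p := Ordinal (rem_subproof j).
Lemma pos_unpos i r : pos (unpos i r) = i.
Proof. by apply: val_inj; rewrite /= divnMDl // divn_small ?addn0. Qed.
Lemma prem_unpos i r : prem (unpos i r) = r.
Proof. by apply: val_inj; rewrite /= modnMDl modn_small. Qed.
Lemma unposK j : unpos (pos j) (prem j) = j.
Proof. by apply: val_inj; rewrite /= -divn_eq. Qed.

Lemma blockperm_inj (s : {perm 'I_e}) : injective (fun j => unpos (s (pos j)) (prem j)).
Proof.
move=> j j' h; rewrite -[j]unposK -[j']unposK.
have := congr1 pos h; rewrite !pos_unpos => /perm_inj ->.
by have := congr1 prem h; rewrite !prem_unpos => ->.
Qed.

Definition frob_ (B : finType) (g : Gam e' B) : tens e B := [ffun t => gval g (stretch t)].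
Lemma frob_sym B (g : Gam e' B) : frob_ g \in @tsym e B.
Proof.
apply/tsymP => s t; rewrite !ffunE -[RHS](gvalP g (perm (@blockperm_inj s))).
by congr (gval _ _); apply/ffunP => j; rewrite !ffunE permE pos_unpos.
Qed.
Definition frob (B : finType) (g : Gam e' B) : Gam e B := MkGam (frob_sym g).

Lemma frob_lin B : linear (@frob B).
Proof. by move=> a f g; apply: gam_eq => t; rewrite !ffunE. Qed.

Lemma frob1 n : frob (gid e' n) = gid e n.
Proof.
have E (t : {ffun 'I_e -> 'I_n * 'I_n}) :
  t = [ffun i => ([ffun i => (t i).1] i, [ffun i => (t i).2] i)].
  by apply/ffunP => i; rewrite !ffunE; case: (t i).
apply: gam_eq => t; rewrite ffunE.
rewrite (_ : stretch t = [ffun j => (stretch [ffun i => (t i).1] j, stretch [ffun i => (t i).2] j)]).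
  rewrite gid_val [t in RHS]E gid_val; congr (_ %:R); congr nat_of_bool.
  apply/eqP/eqP => [/ffunP h|-> //]; apply/ffunP => i.
  by have := h (unpos i (Ordinal p_gt0)); rewrite !ffunE pos_unpos.
by apply/ffunP => j; rewrite !ffunE; case: (t _).
Qed.
End frobenius.

End gamma.

Section frobenius_comp.
Variable k : finFieldType.

Lemma sum_pgroup_fix (aT : finGroupType) (sT : finType) (to : {action aT &-> sT})
    (p : nat) (phi : sT -> k) : p \in [pchar k] -> (p.-group [set: aT])%g ->
  (forall x a, phi (to x a) = phi x) ->
  \sum_x phi x = \sum_(x in 'Fix_to([set: aT])%g) phi x.
Proof.
move=> pk pG inv.
rewrite (partition_big phi predT) // [RHS](partition_big phi predT) //=.
apply: eq_bigr => c _.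
rewrite (eq_bigr (fun=> c)) => [|x /eqP //]; rewrite [RHS](eq_bigr (fun=> c)) => [|x /andP[_ /eqP] //].
rewrite !sumr_const -[LHS]mulr_natr -[RHS]mulr_natr; congr (_ * _).
have acts_S : ([acts [set: aT], on [set x | phi x == c] | to])%g.
  by apply/actsP => a _ x; rewrite !inE inv.
rewrite -(GRing.natr_mod_pchar pk) -[RHS](GRing.natr_mod_pchar pk); congr (_ %:R).
have := pgroup_fix_mod pG acts_S; rewrite cardsE => ->; congr (_ %% _)%N.
by apply: eq_card => x; rewrite [in RHS]unfold_in !inE andbC.
Qed.

Section shift_action.
Variables (q e e' : nat).
Let p := q.+2.
Variables (ee' : e' = (p * e)%N) (B : finType).
Hypothesis p_gt0 : (0 < p)%N.
Let V : finGroupType := 'rV['I_p]_e.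
Let po := pos ee' p_gt0.
Let pr := prem (e' := e') p_gt0.
Let un := @unpos p e e' ee'.

Definition bshift (a : V) (j : 'I_e') : 'I_e' := un (po j) (pr j + a 0 (po j)).
Lemma bshift_inj a : injective (bshift a).
Proof.
move=> j j' h; rewrite -(unposK ee' p_gt0 j) -(unposK ee' p_gt0 j').
have E : po j = po j' by have := congr1 (pos ee' p_gt0) h; rewrite /bshift !pos_unpos.
have : pr j + a 0 (po j) = pr j' + a 0 (po j').
  by have := congr1 (prem p_gt0) h; rewrite /bshift !prem_unpos.
by rewrite E => /addIr E'; rewrite -/po -/pr E E'.
Qed.

Definition sact_to (u : {ffun 'I_e' -> B}) (a : V) : {ffun 'I_e' -> B} :=
  permw (perm (@bshift_inj a)) u.
Lemma sact_to1 : sact_to^~ 1%g =1 id.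
Proof.
move=> u; apply/ffunP => j; rewrite ffunE permE /bshift /= mxE addr0.
by rewrite /un /po /pr unposK.
Qed.
Lemma sact_toM u : act_morph sact_to u.
Proof.
move=> a b; apply/ffunP => j; rewrite !ffunE !permE /bshift /po /pr /un !pos_unpos !prem_unpos /= mxE.
by congr (u (un _ _)); rewrite -addrA; congr (_ + _); rewrite addrC.
Qed.
Definition saction := TotalAction sact_to1 sact_toM.

Lemma saction_fix u :
  (u \in 'Fix_saction([set: V])%g) =
  (u == stretch ee' p_gt0 [ffun i => u (un i 0)]).
Proof.
apply/afixP/eqP => [h|-> a _].
  apply/ffunP => j; rewrite !ffunE.
  have := h (\row_i (- pr j)) (in_setT _).
  by move/ffunP/(_ j); rewrite ffunE permE /bshift mxE subrr => <-.
by apply/ffunP => j; rewrite !ffunE permE /bshift /un /po !pos_unpos.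
Qed.
End shift_action.

Variables (p e e' : nat) (ee' : e' = (p * e)%N) (p_gt0 : (0 < p)%N).
Hypothesis pk : p \in [pchar k].

Lemma frobM l m n (g : GHom k e' m n) (f : GHom k e' l m) :
  frob ee' p_gt0 (gcomp g f) = gcomp (frob ee' p_gt0 g) (frob ee' p_gt0 f).
Proof.
apply: gam_eq => t; rewrite !ffunE.
have p_pr := pcharf_prime pk.
case: p p_pr ee' p_gt0 pk => [//|[//|q]] p_pr ee q_gt0 qk.
pose po := pos ee q_gt0.
rewrite (sum_pgroup_fix (to := saction ee 'I_m q_gt0) qk); first last.
- move=> u a; congr (_ * _).
    rewrite -[RHS](gvalP f (perm (@bshift_inj _ _ _ ee q_gt0 a))).
    congr (gval _ _); apply/ffunP => j; rewrite !ffunE permE.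
    by rewrite /bshift !pos_unpos.
  rewrite -[RHS](gvalP g (perm (@bshift_inj _ _ _ ee q_gt0 a))).
  congr (gval _ _); apply/ffunP => j; rewrite !ffunE permE.
  by rewrite /bshift !pos_unpos.
- rewrite /pgroup cardsT card_mx card_ord mul1n pnatX.
  by rewrite pnat_id.
under eq_bigl do rewrite saction_fix.
rewrite (reindex_onto (@stretch _ _ _ ee q_gt0 'I_m)
  (fun u => [ffun i => u (unpos ee i (0 : 'I_q.+2))])) /=; last first.
  by move=> u /eqP.
apply: eq_big => [u|u _].
  have E : [ffun i => stretch ee q_gt0 u (unpos ee i (0 : 'I_q.+2))] = u.
    by apply/ffunP => i; rewrite !ffunE pos_unpos.
  by rewrite E !eqxx.
rewrite [gval (frob _ _ f) _]ffunE [gval (frob _ _ g) _]ffunE.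
by congr (_ * _); congr (gval _ _); apply/ffunP => j; rewrite !ffunE.
Qed.
End frobenius_comp.

Section spf.
Variable k : finFieldType.

(* k-linear functors Gamma^e V -> V'; the object n stands for k^n. *)
Record spf (e : nat) := Spf {
  sob :> nat -> lmodType k;
  sact : forall m n, GHom k e m n -> sob m -> sob n;
  sact_lin : forall m n (g : GHom k e m n), linear (sact g);
  sact_glin : forall m n (x : sob m), linear (fun g : GHom k e m n => sact g x);
  sact1 : forall n (x : sob n), sact (gid k e n) x = x;
  sactM : forall l m n (g : GHom k e m n) (f : GHom k e l m) x,
    sact (gcomp g f) x = sact g (sact f x) }.

Section nt.
Variable e : nat.

Record nt (F G : spf e) := Nt {
  ntv :> forall n, F n -> G n;
  nt_lin : forall n, linear (@ntv n);
  ntP : forall m n (g : GHom k e m n) x, ntv (sact g x) = sact g (ntv x) }.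
Arguments ntv {F G} _ {n} _.

Lemma nt_ext (F G : spf e) (f g : nt F G) : (forall n (x : F n), ntv f x = ntv g x) -> f = g.
Proof.
case: f g => [f fl fP] [g gl gP] /= h.
have E : f = g by apply: functional_extensionality_dep => n; apply: funext => x; apply: h.
by case: _ / E in gl gP *; congr Nt; apply: Prop_irrelevance.
Qed.

Lemma ntD (F G : spf e) (f : nt F G) n (x y : F n) : ntv f (x + y) = ntv f x + ntv f y.
Proof. by have := nt_lin f 1 x y; rewrite !scale1r. Qed.
Lemma nt0 (F G : spf e) (f : nt F G) n : ntv f (0 : F n) = 0.
Proof. by apply: (@addrI _ (ntv f (0 : F n))); rewrite -ntD !addr0. Qed.
Lemma ntZ (F G : spf e) (f : nt F G) n a (x : F n) : ntv f (a *: x) = a *: ntv f x.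
Proof. by have := nt_lin f a x 0; rewrite nt0 !addr0. Qed.

Lemma sactD (F : spf e) m n (g : GHom k e m n) (x y : F m) :
  sact g (x + y) = sact g x + sact g y.
Proof. by have := sact_lin g 1 x y; rewrite !scale1r. Qed.
Lemma sact0 (F : spf e) m n (g : GHom k e m n) : sact g (0 : F m) = 0.
Proof. by apply: (@addrI _ (sact g (0 : F m))); rewrite -sactD !addr0. Qed.
Lemma sactZ (F : spf e) m n (g : GHom k e m n) a (x : F m) : sact g (a *: x) = a *: sact g x.
Proof. by have := sact_lin g a x 0; rewrite sact0 !addr0. Qed.

Program Definition nt_zero (F G : spf e) : nt F G := @Nt F G (fun n _ => 0) _ _.
Next Obligation. by move=> F G n a x y; rewrite scaler0 addr0. Qed.
Next Obligation. by move=> F G m n g x; rewrite sact0. Qed.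
Program Definition nt_add (F G : spf e) (f g : nt F G) : nt F G :=
  @Nt F G (fun n x => ntv f x + ntv g x) _ _.
Next Obligation. by move=> F G f g n a x y /=; rewrite !nt_lin scalerDr addrACA. Qed.
Next Obligation. by move=> F G f g m n h x /=; rewrite !ntP sactD. Qed.
Program Definition nt_scale (F G : spf e) (a : k) (f : nt F G) : nt F G :=
  @Nt F G (fun n x => a *: ntv f x) _ _.
Next Obligation.
by move=> F G a f n b x y /=; rewrite nt_lin scalerDr !scalerA mulrC.
Qed.
Next Obligation. by move=> F G a f m n h x /=; rewrite ntP sactZ. Qed.
Definition nt_opp (F G : spf e) (f : nt F G) : nt F G := nt_scale (- 1) f.

HB.instance Definition _ (F G : spf e) := gen_eqMixin (nt F G).
HB.instance Definition _ (F G : spf e) := gen_choiceMixin (nt F G).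
Section ax.
Variables F G : spf e.
Lemma nt_addA : associative (@nt_add F G).
Proof. by move=> f g h; apply: nt_ext => n x /=; rewrite addrA. Qed.
Lemma nt_addC : commutative (@nt_add F G).
Proof. by move=> f g; apply: nt_ext => n x /=; rewrite addrC. Qed.
Lemma nt_add0 : left_id (nt_zero F G) (@nt_add F G).
Proof. by move=> f; apply: nt_ext => n x /=; rewrite add0r. Qed.
Lemma nt_addN : left_inverse (nt_zero F G) (@nt_opp F G) (@nt_add F G).
Proof. by move=> f; apply: nt_ext => n x /=; rewrite scaleN1r addNr. Qed.
HB.instance Definition _ :=
  GRing.isZmodule.Build (nt F G) nt_addA nt_addC nt_add0 nt_addN.
Lemma nt_scaleA a b (f : nt F G) : nt_scale a (nt_scale b f) = nt_scale (a * b) f.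
Proof. by apply: nt_ext => n x /=; rewrite scalerA. Qed.
Lemma nt_scale1 : left_id 1 (@nt_scale F G).
Proof. by move=> f; apply: nt_ext => n x /=; rewrite scale1r. Qed.
Lemma nt_scaleDr : right_distributive (@nt_scale F G) +%R.
Proof. by move=> a f g; apply: nt_ext => n x /=; rewrite scalerDr. Qed.
Lemma nt_scaleDl (f : nt F G) : {morph (fun a => nt_scale a f) : a b / a + b}.
Proof. by move=> a b; apply: nt_ext => n x /=; rewrite scalerDl. Qed.
HB.instance Definition _ :=
  GRing.Zmodule_isLmodule.Build k (nt F G) nt_scaleA nt_scale1 nt_scaleDr nt_scaleDl.
End ax.

Lemma ntE0 (F G : spf e) n (x : F n) : ntv (0 : nt F G) x = 0. Proof. by []. Qed.
Lemma ntED (F G : spf e) (f g : nt F G) n (x : F n) : ntv (f + g) x = ntv f x + ntv g x.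
Proof. by []. Qed.
Lemma ntEZ (F G : spf e) a (f : nt F G) n (x : F n) : ntv (a *: f) x = a *: ntv f x.
Proof. by []. Qed.

Program Definition nt_id (F : spf e) : nt F F := @Nt F F (fun n x => x) _ _.
Next Obligation. by []. Qed.
Next Obligation. by []. Qed.
Program Definition nt_comp (F G H : spf e) (g : nt G H) (f : nt F G) : nt F H :=
  @Nt F H (fun n x => ntv g (ntv f x)) _ _.
Next Obligation. by move=> F G H g f n a x y /=; rewrite !nt_lin. Qed.
Next Obligation. by move=> F G H g f m n h x /=; rewrite !ntP. Qed.

Program Definition Pcat : lincat k := @LinCat k (spf e) (fun F G => nt F G : lmodType k)
  nt_id nt_comp _ _ _ _ _.
Next Obligation. by move=> *; apply: nt_ext. Qed.
Next Obligation. by move=> *; apply: nt_ext. Qed.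
Next Obligation. by move=> *; apply: nt_ext. Qed.
Next Obligation. by move=> F G H f a g h; apply: nt_ext. Qed.
Next Obligation. by move=> F G H f a g h; apply: nt_ext => n x /=; rewrite nt_lin. Qed.

Program Definition spf0 : spf e :=
  @Spf e (fun _ => 'rV[k]_0 : lmodType k) (fun _ _ _ x => x) _ _ _ _.
Next Obligation. by []. Qed.
Next Obligation. by move=> m n x a f g; rewrite [LHS]thinmx0 [RHS]thinmx0. Qed.
Next Obligation. by []. Qed.
Next Obligation. by []. Qed.
Lemma spf0_eq n (x y : spf0 n) : x = y.
Proof. exact: etrans (@thinmx0 _ 1 x) (esym (@thinmx0 _ 1 y)). Qed.

End nt.
End spf.
Arguments ntv {k e F G} _ {n} _.

Section complexes.
Variable k : finFieldType.

(* The differentials are a family indexed by two degrees that is zero unless    *)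
(* the degrees are consecutive; this avoids casts along equations in int.      *)
Record cpx (e : nat) := Cpx {
  cterm :> int -> spf k e;
  cd : forall i j, nt (cterm i) (cterm j);
  cd0 : forall i j, j != i + 1 -> cd i j = 0;
  cdd : forall i j l, nt_comp (cd j l) (cd i j) = 0 }.

Definition cpx_qis (e : nat) (X Y : cpx e) (f : forall i, nt (X i) (Y i)) :=
  forall i n,
    (forall x : X i n, cd X i (i + 1) n x = 0 ->
       (exists y, f i n x = cd Y (i - 1) i n y) -> exists x', x = cd X (i - 1) i n x') /\
    (forall y : Y i n, cd Y i (i + 1) n y = 0 ->
       exists x z, cd X i (i + 1) n x = 0 /\ f i n x = y + cd Y (i - 1) i n z).

Program Definition cpx0 e : cpx e := @Cpx e (fun _ => spf0 k e) (fun _ _ => 0) _ _.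
Next Obligation. by []. Qed.
Next Obligation. by move=> *; apply: nt_ext. Qed.

Program Definition cpx_shift e (s : int) (X : cpx e) : cpx e :=
  @Cpx e (fun i => X (i + s)) (fun i j => (-1) ^ s *: cd X (i + s) (j + s)) _ _.
Next Obligation.
move=> e s X i j ne /=; rewrite cd0 ?scaler0 //.
by apply: contra ne => /eqP h; apply/eqP/(@addIr _ s); rewrite h addrAC.
Qed.
Next Obligation.
move=> e s X i j l; apply: nt_ext => n x /=; rewrite ?ntEZ ntZ.
have /(congr1 (fun f : nt _ _ => ntv f x)) /= -> := cdd X (i + s) (j + s) (l + s).
by rewrite ?ntE0 !scaler0.
Qed.

Program Definition stalk e (F : spf k e) : cpx e :=
  @Cpx e (fun i => if i == 0 then F else spf0 k e) (fun _ _ => 0) _ _.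
Next Obligation. by []. Qed.
Next Obligation. by move=> *; apply: nt_ext. Qed.

Definition stalk_map e (F G : spf k e) (f : nt F G) i : nt (stalk F i) (stalk G i) :=
  match i == 0 as b return
    nt (if b then F else spf0 k e) (if b then G else spf0 k e)
  with true => f | false => nt_id _ end.

Record pdeg := PDeg { dval :> nat; dval_gt0 : (0 < dval)%N }.

Definition khat := forall e : pdeg, cpx e.

Record khom (X Y : khat) := KHom {
  kc :> forall e i, nt (X e i) (Y e i);
  kcP : forall (e : pdeg) i j, nt_comp (kc e j) (cd (X e) i j) = nt_comp (cd (Y e) i j) (kc e i) }.

Lemma khom_ext (X Y : khat) (f g : khom X Y) :
  (forall e i n (x : X e i n), f e i n x = g e i n x) -> f = g.
Proof.
case: f g => [f fP] [g gP] /= h.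
have E : f = g.
  apply: functional_extensionality_dep => e; apply: functional_extensionality_dep => i.
  by apply: nt_ext => n x; apply: h.
by case: _ / E in gP *; congr KHom; apply: Prop_irrelevance.
Qed.

Lemma kcE (X Y : khat) (f : khom X Y) e i j n (x : X e i n) :
  f e j n (cd (X e) i j n x) = cd (Y e) i j n (f e i n x).
Proof. by have /(congr1 (fun f : nt _ _ => ntv f x)) := kcP f e i j. Qed.

Program Definition khom_zero (X Y : khat) : khom X Y := @KHom X Y (fun _ _ => 0) _.
Next Obligation. by move=> X Y e i j; apply: nt_ext => n x /=; rewrite nt0. Qed.
Program Definition khom_add (X Y : khat) (f g : khom X Y) : khom X Y :=
  @KHom X Y (fun e i => f e i + g e i) _.
Next Obligation.
by move=> X Y f g e i j; apply: nt_ext => n x /=; rewrite ?ntED ntD !kcE.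
Qed.
Program Definition khom_scale (X Y : khat) (a : k) (f : khom X Y) : khom X Y :=
  @KHom X Y (fun e i => a *: f e i) _.
Next Obligation.
by move=> X Y a f e i j; apply: nt_ext => n x /=; rewrite ?ntEZ ntZ !kcE.
Qed.
Definition khom_opp (X Y : khat) (f : khom X Y) := khom_scale (- 1) f.

HB.instance Definition _ (X Y : khat) := gen_eqMixin (khom X Y).
HB.instance Definition _ (X Y : khat) := gen_choiceMixin (khom X Y).
Section ax.
Variables X Y : khat.
Lemma khom_addA : associative (@khom_add X Y).
Proof. by move=> f g h; apply: khom_ext => e i n x /=; rewrite ?ntED addrA. Qed.
Lemma khom_addC : commutative (@khom_add X Y).
Proof. by move=> f g; apply: khom_ext => e i n x /=; rewrite ?ntED addrC. Qed.
Lemma khom_add0 : left_id (khom_zero X Y) (@khom_add X Y).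
Proof. by move=> f; apply: khom_ext => e i n x /=; rewrite ?ntED add0r. Qed.
Lemma khom_addN : left_inverse (khom_zero X Y) (@khom_opp X Y) (@khom_add X Y).
Proof. by move=> f; apply: khom_ext => e i n x /=; rewrite ?ntED ?ntEZ scaleN1r addNr. Qed.
HB.instance Definition _ :=
  GRing.isZmodule.Build (khom X Y) khom_addA khom_addC khom_add0 khom_addN.
Lemma khom_scaleA a b (f : khom X Y) : khom_scale a (khom_scale b f) = khom_scale (a * b) f.
Proof. by apply: khom_ext => e i n x /=; rewrite ?ntEZ scalerA. Qed.
Lemma khom_scale1 : left_id 1 (@khom_scale X Y).
Proof. by move=> f; apply: khom_ext => e i n x /=; rewrite ?ntEZ scale1r. Qed.
Lemma khom_scaleDr : right_distributive (@khom_scale X Y) +%R.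
Proof. by move=> a f g; apply: khom_ext => e i n x /=; rewrite ?(ntEZ, ntED) scalerDr. Qed.
Lemma khom_scaleDl (f : khom X Y) : {morph (fun a => khom_scale a f) : a b / a + b}.
Proof. by move=> a b; apply: khom_ext => e i n x /=; rewrite ?(ntEZ, ntED) scalerDl. Qed.
HB.instance Definition _ :=
  GRing.Zmodule_isLmodule.Build k (khom X Y) khom_scaleA khom_scale1 khom_scaleDr khom_scaleDl.
End ax.

Program Definition khom_id (X : khat) : khom X X := @KHom X X (fun e i => nt_id (X e i)) _.
Next Obligation. by move=> X e i j; apply: nt_ext. Qed.
Program Definition khom_comp (X Y Z : khat) (g : khom Y Z) (f : khom X Y) : khom X Z :=
  @KHom X Z (fun e i => nt_comp (g e i) (f e i)) _.
Next Obligation. by move=> X Y Z g f e i j; apply: nt_ext => n x /=; rewrite !kcE. Qed.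

Program Definition KP : lincat k := @LinCat k khat (fun X Y => khom X Y : lmodType k)
  khom_id khom_comp _ _ _ _ _.
Next Obligation. by move=> *; apply: khom_ext. Qed.
Next Obligation. by move=> *; apply: khom_ext. Qed.
Next Obligation. by move=> *; apply: khom_ext. Qed.
Next Obligation. by move=> X Y Z f a g h; apply: khom_ext. Qed.
Next Obligation.
by move=> X Y Z f a g h; apply: khom_ext => e i n x /=; rewrite ?(ntEZ, ntED) ntD ntZ.
Qed.

Definition qis : mclass KP := fun X Y f => forall e, cpx_qis (kc f e).

Definition conc (d : nat) (X : khat) :=
  forall e : pdeg, dval e != d -> forall i n (x : X e i n), x = 0.

(* KP_d as a full subcategory of K\hat P. *)
Definition KPd (d : nat) : lincat k := lfull (C := KP) (conc d).
Definition qis_d d : mclass (KPd d) := fun X Y f => qis f.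
Definition DP d : cat := Loc (@qis_d d).

Definition fin_dim (V : lmodType k) :=
  exists n (b : 'I_n -> V), forall x, exists c : 'I_n -> k, x = \sum_i c i *: b i.
Definition findim_cpx e (X : cpx e) :=
  (exists N : nat, forall i : int, (N < `|i|)%N -> forall n (x : X i n), x = 0) /\
  (forall i n, fin_dim (X i n)).

Definition degreewise_split (X Y : khat) (f : khom X Y) :=
  forall e i, exists r : nt (Y e i) (X e i), nt_comp r (f e i) = nt_id (X e i).

Definition short_exact (X Y Z : khat) (f : khom X Y) (q : khom Y Z) :=
  forall e i n,
    [/\ injective (f e i n), forall z : Z e i n, exists y, q e i n y = z &
        forall y : Y e i n, q e i n y = 0 <-> exists x, y = f e i n x].

Definition cofibrant (X : khat) :=
  exists (M : nat -> khat) (iota : forall j, khom (M j) (M j.+1)) (mu : forall j, khom (M j) X),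
    [/\ forall e i n (x : M 0%N e i n), x = 0,
        forall j, khom_comp (mu j.+1) (iota j) = mu j,
        forall j, mono (C := KP) (mu j),
        forall e i n (x : X e i n), exists j y, x = mu j e i n y &
        forall j, degreewise_split (iota j) /\
          exists (Q : khat) (q : khom (M j.+1) Q),
            [/\ short_exact (iota j) q,
                forall (e : pdeg) i, projective (C := Pcat k e) (Q e i) &
                forall (e : pdeg) i l, cd (Q e) i l = 0]].

Definition cofibration : mclass KP := fun X Y f =>
  [/\ mono (C := KP) f, degreewise_split f &
      exists (Z : khat) (q : khom Y Z), short_exact f q /\ cofibrant Z].

Definition left_quillen (F : functor KP KP) :=
  [/\ exists R : functor KP KP, inhabited (adjunction F R),
      forall (X Y : lcat KP) (f : mor X Y), cofibration f -> cofibration (fmap F f) &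
      forall (X Y : lcat KP) (f : mor X Y), cofibration f -> qis f ->
        cofibration (fmap F f) /\ qis (fmap F f)].

Definition kshift_ob (s : int) (X : khat) : khat := fun e => cpx_shift s (X e).
Program Definition kshift_map (s : int) (X Y : khat) (f : khom X Y) :
  khom (kshift_ob s X) (kshift_ob s Y) :=
  @KHom (kshift_ob s X) (kshift_ob s Y) (fun e i => f e (i + s)) _.
Next Obligation.
by move=> s X Y f e i j; apply: nt_ext => n x /=; rewrite ?ntEZ ntZ kcE.
Qed.
Program Definition kshift (s : int) : functor KP KP :=
  @Functor KP KP (kshift_ob s) (@kshift_map s) _ _.
Next Obligation. by move=> *; apply: khom_ext. Qed.
Next Obligation. by move=> *; apply: khom_ext. Qed.

Lemma conc_shift d s X : conc d X -> conc d (kshift s X).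
Proof. by move=> h e ne i n x; apply: h. Qed.

End complexes.

Section twist.
Variables (k : finFieldType) (p : nat) (pk : p \in [pchar k]).

Lemma p_gt0 : (0 < p)%N.
Proof. exact: prime_gt0 (pcharf_prime pk). Qed.

Section one_degree.
Variables (e e' : nat) (ee' : e' = (p * e)%N).

(* F^(1)(k^n) = F((k^n)^(1)), with (k^n)^(1) identified with k^n. *)
Program Definition twist (F : spf k e) : spf k e' :=
  @Spf k e' F (fun m n g x => sact (frob ee' p_gt0 g) x) _ _ _ _.
Next Obligation. by move=> F m n g a x y /=; rewrite sact_lin. Qed.
Next Obligation. by move=> F m n x a g h /=; rewrite frob_lin sact_glin. Qed.
Next Obligation. by move=> F n x /=; rewrite frob1 sact1. Qed.
Next Obligation. by move=> F l m n g f x /=; rewrite frobM // sactM. Qed.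

Program Definition twist_nt (F G : spf k e) (f : nt F G) : nt (twist F) (twist G) :=
  @Nt k e' (twist F) (twist G) (fun n => @ntv k e F G f n) _ _.
Next Obligation. by move=> F G f n a x y; exact: (@nt_lin _ _ _ _ f n a x y). Qed.
Next Obligation. by move=> F G f m n g x; exact: (@ntP _ _ _ _ f). Qed.

Program Definition twist_cpx (X : cpx k e) : cpx k e' :=
  @Cpx k e' (fun i => twist (X i)) (fun i j => twist_nt (cd X i j)) _ _.
Next Obligation. by move=> X i j ne /=; rewrite cd0 //; apply: nt_ext. Qed.
Next Obligation.
move=> X i j l; apply: nt_ext => n x /=.
exact: (congr1 (fun f : nt (X i) (X l) => @ntv _ _ _ _ f n x) (cdd X i j l)).
Qed.
End one_degree.

Lemma pdiv_subproof (e : pdeg) : (p %| e)%N -> (0 < e %/ p)%N.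
Proof. by move=> pe; rewrite divn_gt0 ?p_gt0 // dvdn_leq // dval_gt0. Qed.
Definition proot (e : pdeg) : option {q : pdeg | dval e = (p * q)%N} :=
  match @idP (p %| e)%N with
  | ReflectT pe => Some (exist _ (PDeg (pdiv_subproof pe)) (etrans (esym (divnK pe)) (mulnC _ _)))
  | ReflectF _ => None
  end.

(* On \hat P the twist moves the component of degree q to degree pq. *)
Definition Ctw_ob (X : khat k) : khat k := fun e =>
  match proot e with Some (exist q h) => twist_cpx h (X q) | None => cpx0 k e end.
Definition Ctw_nt (X Y : khat k) (f : khom X Y) e i : nt (Ctw_ob X e i) (Ctw_ob Y e i) :=
  match proot e as o return
    nt (match o with Some (exist q h) => twist_cpx h (X q) | None => cpx0 k e end i)
       (match o with Some (exist q h) => twist_cpx h (Y q) | None => cpx0 k e end i)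
  with Some (exist q h) => twist_nt h (f q i) | None => nt_id _ end.
Lemma Ctw_ntP (X Y : khat k) (f : khom X Y) (e : pdeg) i j :
  nt_comp (Ctw_nt f e j) (cd (Ctw_ob X e) i j) = nt_comp (cd (Ctw_ob Y e) i j) (Ctw_nt f e i).
Proof.
rewrite /Ctw_nt /Ctw_ob; case: (proot e) => [[q h]|]; apply: nt_ext => n x //=.
exact: kcE.
Qed.
Program Definition Ctw : functor (KP k) (KP k) :=
  @Functor (KP k) (KP k) Ctw_ob (fun X Y f => KHom (Ctw_ntP f)) _ _.
Next Obligation.
move=> X; apply: khom_ext => e i n /=; rewrite /Ctw_nt /Ctw_ob.
by case: (proot e) => [[q h]|].
Qed.
Next Obligation.
move=> X Y Z g f; apply: khom_ext => e i n /=; rewrite /Ctw_nt /Ctw_ob.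
by case: (proot e) => [[q h]|].
Qed.

Lemma Ctw_qis (X Y : khat k) (f : khom X Y) : qis f -> qis (fmap Ctw f).
Proof.
move=> h e; rewrite /cpx_qis /= /Ctw_nt /Ctw_ob; case: (proot e) => [[q E]|].
  exact: h.
move=> i n /=; split=> [x _ _|y _]; first by exists 0; apply: spf0_eq.
by exists 0, 0; split; apply: spf0_eq.
Qed.

Lemma conc_Ctw d (X : khat k) : conc d X -> conc (p * d) (Ctw X).
Proof.
move=> h e ne i n /=; rewrite /Ctw_ob; case: (proot e) => [[q E]|] /= x.
  by apply: h; apply: contra ne => /eqP <-; rewrite E.
exact: spf0_eq.
Qed.

(* The identity C(X[s]) -> C(X)[s]. *)
Definition Ctw_shift_nt s (X : khat k) e i :
    nt (Ctw_ob (kshift_ob s X) e i) (kshift_ob s (Ctw_ob X) e i) :=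
  match proot e as o return
    nt (match o with Some (exist q h) => twist_cpx h (kshift_ob s X q) | None => cpx0 k e end i)
       (match o with Some (exist q h) => twist_cpx h (X q) | None => cpx0 k e end (i + s))
  with Some (exist q h) => nt_id (twist h (X q (i + s))) | None => nt_id (spf0 k e) end.
Program Definition Ctw_shift s (X : khat k) :
    khom (Ctw_ob (kshift_ob s X)) (kshift_ob s (Ctw_ob X)) :=
  @KHom k (Ctw_ob (kshift_ob s X)) (kshift_ob s (Ctw_ob X)) (Ctw_shift_nt s X) _.
Next Obligation.
move=> s X e i j; rewrite /kshift_ob /Ctw_shift_nt /Ctw_ob /=.
case: (proot e) => [[q h]|]; apply: nt_ext => n x //=.
exact: spf0_eq.
Qed.

(* Strict polynomial bifunctors, contravariant of degree a in the first         *)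
(* variable and covariant of degree b in the second.                           *)
Record bispf (a b : nat) := BiSpf {
  bob :> nat -> spf k b;
  bact : forall l m, GHom k a l m -> nt (bob m) (bob l);
  bact_lin : forall l m, linear (@bact l m);
  bact1 : forall m, bact (gid k a m) = nt_id (bob m);
  bactM : forall l m n (g : GHom k a m n) (f : GHom k a l m),
    bact (gcomp g f) = nt_comp (bact f) (bact g) }.

Record bicpx (a b : nat) := BiCpx {
  bterm :> int -> bispf a b;
  bd : forall i j m, nt (bterm i m) (bterm j m);
  bdP : forall i j l m (g : GHom k a l m),
    nt_comp (bd i j l) (bact (bterm i) g) = nt_comp (bact (bterm j) g) (bd i j m);
  bd0 : forall i j m, j != i + 1 -> bd i j m = 0;
  bdd : forall i j l m, nt_comp (bd j l m) (bd i j m) = 0 }.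

Definition bislice a b (X : bicpx a b) (m : nat) : cpx k b :=
  @Cpx k b (fun i => X i m) (fun i j => bd X i j m) (fun i j => @bd0 _ _ X i j m)
    (fun i j l => @bdd _ _ X i j l m).

Program Definition hrep (e m : nat) : spf k e :=
  @Spf k e (fun n => GHom k e m n : lmodType k) (fun _ _ g x => gcomp g x) _ _ _ _.
Next Obligation. by move=> *; apply: gcomp_linr. Qed.
Next Obligation. by move=> *; apply: gcomp_linl. Qed.
Next Obligation. by move=> *; apply: gcomp1m. Qed.
Next Obligation. by move=> * /=; rewrite gcompA. Qed.

Program Definition hrep_map e l m (f : GHom k e l m) : nt (hrep e m) (hrep e l) :=
  @Nt k e (hrep e m) (hrep e l) (fun n x => gcomp x f) _ _.
Next Obligation. by move=> *; apply: gcomp_linl. Qed.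
Next Obligation. by move=> * /=; rewrite gcompA. Qed.

(* (V, W) |-> Gamma^e(V^* (x) W^(1)) = Gamma^e Hom(V, W^(1)) *)
Program Definition twisted_hom (e e' : nat) (ee' : e' = (p * e)%N) : bispf e e' :=
  @BiSpf e e' (fun m => twist ee' (hrep e m)) (fun l m f => twist_nt ee' (hrep_map f)) _ _ _.
Next Obligation. by move=> e e' ee' l m a f g; apply: nt_ext => n x /=; apply: gcomp_linr. Qed.
Next Obligation. by move=> *; apply: nt_ext => n x /=; apply: gcompm1. Qed.
Next Obligation. by move=> *; apply: nt_ext => n x /=; rewrite gcompA. Qed.

(* X is a resolution of the bifunctor J (a quasi-isomorphism X -> J[0] of       *)
(* complexes of bifunctors).                                                   *)
Definition resolves a b (X : bicpx a b) (J : bispf a b) :=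
  exists al : forall m i, nt (X i m) (stalk (J m) i),
    [/\ forall m i j, nt_comp (al m j) (bd X i j m) = nt_comp (cd (stalk (J m)) i j) (al m i),
        forall l m (g : GHom k a l m) i,
          nt_comp (al l i) (bact (X i) g) = nt_comp (stalk_map (bact J g) i) (al m i) &
        forall m, cpx_qis (X := bislice X m) (al m)].

Definition findim_bicpx a b (X : bicpx a b) :=
  (exists N : nat, forall i : int, (N < `|i|)%N -> forall m n (x : X i m n), x = 0) /\
  (forall i m n, fin_dim (X i m n)).

Definition good_resolution (e e' : nat) (ee' : e' = (p * e)%N) (X : bicpx e e') :=
  [/\ findim_bicpx X, forall i m, projective (C := Pcat k e') (X i m) & resolves X (twisted_hom ee')].

Section Kprime.

Lemma pmul_subproof (e : pdeg) : (0 < p * e)%N.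
Proof. by rewrite muln_gt0 p_gt0 dval_gt0. Qed.
Definition pmul (e : pdeg) : pdeg := PDeg (pmul_subproof e).

Section hom_complex.
Variables (a b : nat) (X : bicpx a b) (F : cpx k b).

(* The degree n part of Hom(X(k^m, -), F): families of maps X^i -> F^j that     *)
(* vanish unless j = i + n.                                                    *)
Record hc (n : int) (m : nat) := HC {
  hcv :> forall i j, nt (X i m) (F j);
  hc0 : forall i j, j != i + n -> hcv i j = 0 }.

Lemma hc_ext n m (f g : hc n m) : (forall i j, hcv f i j = hcv g i j) -> f = g.
Proof.
case: f g => [f f0] [g g0] /= h.
have E : f = g.
  apply: functional_extensionality_dep => i; apply: functional_extensionality_dep => j.
  exact: h.
by case: _ / E in g0 *; congr HC; apply: Prop_irrelevance.
Qed.

Section ax.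
Variables (n : int) (m : nat).
Program Definition hc_zero : hc n m := @HC n m (fun _ _ => 0) _.
Next Obligation. by []. Qed.
Program Definition hc_add (f g : hc n m) : hc n m := @HC n m (fun i j => f i j + g i j) _.
Next Obligation. by move=> f g i j ne /=; rewrite !hc0 ?addr0. Qed.
Program Definition hc_scale (c : k) (f : hc n m) : hc n m := @HC n m (fun i j => c *: f i j) _.
Next Obligation. by move=> c f i j ne /=; rewrite !hc0 ?scaler0. Qed.
Definition hc_opp (f : hc n m) := hc_scale (- 1) f.
HB.instance Definition _ := gen_eqMixin (hc n m).
HB.instance Definition _ := gen_choiceMixin (hc n m).
Lemma hc_addA : associative hc_add.
Proof. by move=> f g h; apply: hc_ext => i j /=; rewrite addrA. Qed.
Lemma hc_addC : commutative hc_add.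
Proof. by move=> f g; apply: hc_ext => i j /=; rewrite addrC. Qed.
Lemma hc_add0 : left_id hc_zero hc_add.
Proof. by move=> f; apply: hc_ext => i j /=; rewrite add0r. Qed.
Lemma hc_addN : left_inverse hc_zero hc_opp hc_add.
Proof. by move=> f; apply: hc_ext => i j /=; rewrite scaleN1r addNr. Qed.
HB.instance Definition _ := GRing.isZmodule.Build (hc n m) hc_addA hc_addC hc_add0 hc_addN.
Lemma hc_scaleA c c' f : hc_scale c (hc_scale c' f) = hc_scale (c * c') f.
Proof. by apply: hc_ext => i j /=; rewrite scalerA. Qed.
Lemma hc_scale1 : left_id 1 hc_scale.
Proof. by move=> f; apply: hc_ext => i j /=; rewrite scale1r. Qed.
Lemma hc_scaleDr : right_distributive hc_scale +%R.
Proof. by move=> c f g; apply: hc_ext => i j /=; rewrite scalerDr. Qed.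
Lemma hc_scaleDl f : {morph (fun c => hc_scale c f) : c c' / c + c'}.
Proof. by move=> c c'; apply: hc_ext => i j /=; rewrite scalerDl. Qed.
HB.instance Definition _ :=
  GRing.Zmodule_isLmodule.Build k (hc n m) hc_scaleA hc_scale1 hc_scaleDr hc_scaleDl.
End ax.

Lemma nt_compDl e (U V W : spf k e) (f : nt U V) c (g h : nt V W) :
  nt_comp (c *: g + h) f = c *: nt_comp g f + nt_comp h f.
Proof. exact: (@lcmp_linl _ (Pcat k e)). Qed.
Lemma nt_compDr e (U V W : spf k e) (g : nt V W) c (f h : nt U V) :
  nt_comp g (c *: f + h) = c *: nt_comp g f + nt_comp g h.
Proof. exact: (@lcmp_linr _ (Pcat k e)). Qed.
Lemma nt_comp0l e (U V W : spf k e) (f : nt U V) : nt_comp (0 : nt V W) f = 0.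
Proof. exact: nt_ext. Qed.
Lemma nt_comp0r e (U V W : spf k e) (g : nt V W) : nt_comp g (0 : nt U V) = 0.
Proof. by apply: nt_ext => n x /=; rewrite nt0. Qed.
Lemma nt_compZl e (U V W : spf k e) (f : nt U V) c (g : nt V W) :
  nt_comp (c *: g) f = c *: nt_comp g f.
Proof. exact: nt_ext. Qed.
Lemma nt_compZr e (U V W : spf k e) (g : nt V W) c (f : nt U V) :
  nt_comp g (c *: f) = c *: nt_comp g f.
Proof. by apply: nt_ext => n x /=; rewrite ntZ. Qed.
Lemma nt_compA e (U V W Z : spf k e) (h : nt W Z) (g : nt V W) (f : nt U V) :
  nt_comp h (nt_comp g f) = nt_comp (nt_comp h g) f.
Proof. exact: nt_ext. Qed.

Program Definition hc_spf (n : int) : spf k a :=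
  @Spf k a (fun m => hc n m : lmodType k)
    (fun l m g f => @HC n m (fun i j => nt_comp (f i j) (bact (X i) g)) _) _ _ _ _.
Next Obligation. by move=> n l m g f i j ne /=; rewrite hc0 // nt_comp0l. Qed.
Next Obligation. by move=> n l m g c f h; apply: hc_ext => i j /=; rewrite nt_compDl. Qed.
Next Obligation.
by move=> n l m f c g h; apply: hc_ext => i j /=; rewrite bact_lin nt_compDr.
Qed.
Next Obligation. by move=> n m f; apply: hc_ext => i j /=; rewrite bact1; apply: nt_ext. Qed.
Next Obligation.
by move=> n l m o g f h; apply: hc_ext => i j /=; rewrite bactM nt_compA.
Qed.

(* d f = d o f - (-1)^n f o d *)
Definition hc_d_fun (n n' : int) m (f : hc n m) i j : nt (X i m) (F j) :=
  if n' == n + 1 then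
    nt_comp (cd F (j - 1) j) (f i (j - 1)) -
    (-1) ^ n *: nt_comp (f (i + 1) j) (bd X i (i + 1) m)
  else 0.

Lemma hc_d_subproof n n' m (f : hc n m) i j : j != i + n' -> hc_d_fun n' f i j = 0.
Proof.
rewrite /hc_d_fun; case: (n' =P n + 1) => // -> ne.
rewrite !hc0 ?nt_comp0l ?nt_comp0r ?scaler0 ?subr0 //.
  by apply: contra ne => /eqP ->; rewrite addrA addrAC.
by apply: contra ne => /eqP h; rewrite addrA -h subrK.
Qed.

Program Definition hc_d (n n' : int) : nt (hc_spf n) (hc_spf n') :=
  @Nt k a (hc_spf n) (hc_spf n')
    (fun m f => @HC n' m (hc_d_fun n' f) (@hc_d_subproof n n' m f)) _ _.
Next Obligation.
move=> n n' m c f g; apply: hc_ext => i j /=.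
rewrite /hc_d_fun /=; case: eqP => _; last by rewrite scaler0 addr0.
by rewrite nt_compDr nt_compDl !scalerDr scalerN !scalerA [c * _]mulrC opprD addrACA.
Qed.
Next Obligation.
move=> n n' l m g f; apply: hc_ext => i j /=; rewrite /hc_d_fun /=.
case: eqP => _; last by rewrite nt_comp0l.
rewrite -[nt_comp (nt_comp (f (i + 1) j) _) _]nt_compA -bdP.
exact: nt_ext.
Qed.

Program Definition hom_cpx : cpx k a := @Cpx k a hc_spf hc_d _ _.
Next Obligation.
move=> n n' ne; apply: nt_ext => m f; apply: hc_ext => i j /=.
by rewrite /hc_d_fun (negPf ne).
Qed.
Next Obligation.
move=> n n' n''; apply: nt_ext => m f; apply: hc_ext => i j /=; rewrite {1}/hc_d_fun.
case: eqP => // _; rewrite /= /hc_d_fun.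
case: eqP => [->|_]; last by rewrite nt_comp0l nt_comp0r scaler0 subr0.
apply: nt_ext => o x /=; rewrite ntD !ntZ.
have E1 (y : F (j - 1 - 1) o) : cd F (j - 1) j o (cd F (j - 1 - 1) (j - 1) o y) = 0.
  exact: (congr1 (fun h : nt _ _ => ntv h y) (cdd F (j - 1 - 1) (j - 1) j)).
have E2 : bd X (i + 1) (i + 1 + 1) m o (bd X i (i + 1) m o x) = 0.
  exact: (congr1 (fun h : nt _ _ => ntv h x) (bdd X i (i + 1) (i + 1 + 1) m)).
rewrite E1 E2 nt0 !scaler0 addr0 add0r expfzDr ?oppr_eq0 ?oner_eq0 // expr1z.
by rewrite -scalerDr mulrN1 [X in _ *: X](_ : _ = 0) ?scaler0 // scaleNr subrr.
Qed.

End hom_complex.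
End Kprime.
End twist.

Section Kprime_functor.
Variables (k : finFieldType) (p : nat) (pk : p \in [pchar k]).
Variable X : forall e : pdeg, bicpx k e (pmul pk e).

Definition Kp_ob (F : khat k) : khat k := fun e => hom_cpx (X e) (F (pmul pk e)).
Program Definition Kp_nt (F G : khat k) (f : khom F G) e n : nt (Kp_ob F e n) (Kp_ob G e n) :=
  @Nt k e (Kp_ob F e n) (Kp_ob G e n)
    (fun m g => @HC _ _ _ (X e) (G (pmul pk e)) n m
       (fun i j => nt_comp (f (pmul pk e) j) (hcv g i j)) _) _ _.
Next Obligation. by move=> F G f e n m g i j ne /=; rewrite hc0 // nt_comp0r. Qed.
Next Obligation. by move=> F G f e n m c g h; apply: hc_ext => i j /=; rewrite nt_compDr. Qed.
Next Obligation. by move=> F G f e n l m h g; apply: hc_ext => i j /=; rewrite nt_compA. Qed.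
Program Definition Kp_map (F G : khat k) (f : khom F G) : khom (Kp_ob F) (Kp_ob G) :=
  @KHom k (Kp_ob F) (Kp_ob G) (Kp_nt f) _.
Next Obligation.
move=> F G f e n n'; apply: nt_ext => m g; apply: hc_ext => i j /=.
rewrite /hc_d_fun; case: eqP => _; last exact: nt_comp0r.
by apply: nt_ext => o x /=; rewrite ntD !ntZ kcE.
Qed.
Program Definition Kp : functor (KP k) (KP k) := @Functor (KP k) (KP k) Kp_ob Kp_map _ _.
Next Obligation. by move=> F; apply: khom_ext => e n m g; apply: hc_ext => i j; apply: nt_ext. Qed.
Next Obligation.
by move=> F G H f h; apply: khom_ext => e n m g; apply: hc_ext => i j; apply: nt_ext.
Qed.

Lemma Kp_lin (F G : khat k) : linear (@Kp_map F G).
Proof.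
by move=> c f g; apply: khom_ext => e n m h; apply: hc_ext => i j; apply: nt_ext.
Qed.

Lemma conc_Kp d F : conc (p * d) F -> conc d (Kp F).
Proof.
move=> h e ne n m g; apply: hc_ext => i j; apply: nt_ext => o x; apply: h.
by rewrite /= eqn_pmul2l ?(p_gt0 pk).
Qed.

Lemma conc_Kpi d i F : conc (d * p ^ i) F -> conc d (fiterr Kp i F).
Proof.
elim: i F => [|i IH] F h; first by rewrite muln1 in h.
by apply: IH; apply: conc_Kp; rewrite mulnCA -expnS.
Qed.

(* K'(F)[s] -> K'(F[s]), an isomorphism since the shift only reindexes. *)
Program Definition Kp_shift_nt s (F : khat k) e n :
    nt (kshift_ob s (Kp_ob F) e n) (Kp_ob (kshift_ob s F) e n) :=
  @Nt k e (kshift_ob s (Kp_ob F) e n) (Kp_ob (kshift_ob s F) e n)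
    (fun m g => @HC _ _ _ (X e) (kshift_ob s F (pmul pk e)) n m
      (fun i j => hcv g i (j + s)) _) _ _.
Next Obligation.
move=> s F e n m g i j ne /=; rewrite hc0 //.
by apply: contra ne; rewrite addrA => /eqP/addIr/eqP.
Qed.
Next Obligation. by move=> s F e n m c g h; apply: hc_ext. Qed.
Next Obligation. by move=> s F e n l m h g; apply: hc_ext. Qed.
Program Definition Kp_shift s (F : khat k) :
    khom (kshift_ob s (Kp_ob F)) (Kp_ob (kshift_ob s F)) :=
  @KHom k (kshift_ob s (Kp_ob F)) (Kp_ob (kshift_ob s F)) (Kp_shift_nt s F) _.
Next Obligation.
move=> s F e n n'; apply: nt_ext => m g; apply: hc_ext => i j /=.
rewrite /hc_d_fun /= [n + s + 1]addrAC (inj_eq (addIr s)).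
case: eqP => _; last by rewrite scaler0.
rewrite [j - 1 + s]addrAC; apply: nt_ext => o x /=.
rewrite !scalerDr !scalerA; congr (_ + _ *: _).
have E : (-1 : k) ^ s * (-1) ^ s = 1 by rewrite -expfzMl mulrNN mul1r exp1rz.
by rewrite expfzDr ?oppr_eq0 ?oner_eq0 // mulrAC mulrCA E mulr1 mulrC.
Qed.

Section spectra.
Variables (C' : functor (KP k) (KP k)) (adj : adjunction C' Kp).

Definition adjoint_map (F G : khat k) (f : khom (C' F) G) : khom F (Kp_ob G) :=
  khom_comp (Kp_map f) (adj_unit adj F).
Definition coadjoint_map (F G : khat k) (f : khom F (Kp_ob G)) : khom (C' F) G :=
  khom_comp (adj_counit adj G) (fmap C' f).

Lemma adjoint_mapK F G (f : khom (C' F) G) : coadjoint_map (adjoint_map f) = f.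
Proof.
rewrite /coadjoint_map /adjoint_map.
have -> : fmap C' (khom_comp (Kp_map f) (adj_unit adj F)) =
    fmap C' (fmap Kp f) \oc fmap C' (adj_unit adj F) by rewrite -fmapM.
have E : khom_comp (adj_counit adj G) (fmap C' (fmap Kp f) \oc fmap C' (adj_unit adj F)) =
  (adj_counit adj G \oc fmap (fcomp C' Kp) f) \oc fmap C' (adj_unit adj F).
  exact: (@compA (KP k) _ _ _ _ (adj_counit adj G) (fmap C' (fmap Kp f)) (fmap C' (adj_unit adj F))).
by rewrite [LHS]E ntcP -compA adj_triangleL compm1.
Qed.

Lemma C'_lin (F G : khat k) :
  linear (fun f : khom F G => fmap C' f : khom (C' F) (C' G)).
Proof.
move=> c f g; apply: (can_inj (@adjoint_mapK F (C' G))).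
have N (h : khom F G) : adjoint_map (fmap C' h) = khom_comp (adj_unit adj G) h.
  exact: esym (ntcP (adj_unit adj) h).
rewrite N; have D (h1 h2 : khom (C' F) (C' G)) :
    adjoint_map (c *: h1 + h2) = c *: adjoint_map h1 + adjoint_map h2.
  by rewrite /adjoint_map Kp_lin; exact: (@lcmp_linl _ (KP k)).
by rewrite D !N; exact: (@lcmp_linr _ (KP k)).
Qed.

Record spectrum := Spectrum {
  slev :> nat -> khat k;
  stau : forall i, khom (C' (slev i)) (slev i.+1) }.

Record smor (E E' : spectrum) := SMor {
  smv :> forall i, khom (E i) (E' i);
  smP : forall i, khom_comp (smv i.+1) (stau E i) = khom_comp (stau E' i) (fmap C' (smv i)) }.

Lemma smor_ext E E' (f g : smor E E') : (forall i, smv f i = smv g i) -> f = g.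
Proof.
case: f g => [f fP] [g gP] /= h.
have H : f = g by apply: functional_extensionality_dep.
by case: _ / H in gP *; congr SMor; apply: Prop_irrelevance.
Qed.

Section ax.
Variables E E' : spectrum.
Lemma C'_D (F G : khat k) (f g : khom F G) :
  fmap C' (f + g) = (fmap C' f : khom _ _) + fmap C' g.
Proof. by have := C'_lin 1 f g; rewrite !scale1r. Qed.
Lemma C'_0 (F G : khat k) : fmap C' (0 : khom F G) = (0 : khom _ _).
Proof. by apply: (@addrI _ (fmap C' (0 : khom F G) : khom _ _)); rewrite -C'_D !addr0. Qed.
Lemma C'_Z (F G : khat k) c (f : khom F G) : fmap C' (c *: f) = c *: (fmap C' f : khom _ _).
Proof. by have := C'_lin c f 0; rewrite C'_0 !addr0. Qed.

Lemma khom_compDl (F G H : khat k) (f : khom F G) (g h : khom G H) :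
  khom_comp (g + h) f = khom_comp g f + khom_comp h f.
Proof. exact: khom_ext. Qed.
Lemma khom_compDr (F G H : khat k) (g : khom G H) (f h : khom F G) :
  khom_comp g (f + h) = khom_comp g f + khom_comp g h.
Proof. by apply: khom_ext => e i n x /=; rewrite ntD. Qed.
Lemma khom_compZl (F G H : khat k) (f : khom F G) c (g : khom G H) :
  khom_comp (c *: g) f = c *: khom_comp g f.
Proof. exact: khom_ext. Qed.
Lemma khom_compZr (F G H : khat k) (g : khom G H) c (f : khom F G) :
  khom_comp g (c *: f) = c *: khom_comp g f.
Proof. by apply: khom_ext => e i n x /=; rewrite ntZ. Qed.
Lemma khom_comp0l (F G H : khat k) (f : khom F G) : khom_comp (0 : khom G H) f = 0.
Proof. exact: khom_ext. Qed.
Lemma khom_comp0r (F G H : khat k) (g : khom G H) : khom_comp g (0 : khom F G) = 0.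
Proof. by apply: khom_ext => e i n x /=; rewrite nt0. Qed.

Program Definition smor_zero : smor E E' := @SMor E E' (fun _ => 0) _.
Next Obligation. by move=> i; rewrite C'_0 khom_comp0l khom_comp0r. Qed.
Program Definition smor_add (f g : smor E E') : smor E E' := @SMor E E' (fun i => f i + g i) _.
Next Obligation. by move=> f g i; rewrite C'_D khom_compDl khom_compDr !smP. Qed.
Program Definition smor_scale (c : k) (f : smor E E') : smor E E' :=
  @SMor E E' (fun i => c *: f i) _.
Next Obligation. by move=> c f i; rewrite C'_Z khom_compZl khom_compZr !smP. Qed.
Definition smor_opp (f : smor E E') := smor_scale (- 1) f.
HB.instance Definition _ := gen_eqMixin (smor E E').
HB.instance Definition _ := gen_choiceMixin (smor E E').
Lemma smor_addA : associative smor_add.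
Proof. by move=> f g h; apply: smor_ext => i /=; rewrite addrA. Qed.
Lemma smor_addC : commutative smor_add.
Proof. by move=> f g; apply: smor_ext => i /=; rewrite addrC. Qed.
Lemma smor_add0 : left_id smor_zero smor_add.
Proof. by move=> f; apply: smor_ext => i /=; rewrite add0r. Qed.
Lemma smor_addN : left_inverse smor_zero smor_opp smor_add.
Proof. by move=> f; apply: smor_ext => i /=; rewrite scaleN1r addNr. Qed.
HB.instance Definition _ :=
  GRing.isZmodule.Build (smor E E') smor_addA smor_addC smor_add0 smor_addN.
Lemma smor_scaleA c c' f : smor_scale c (smor_scale c' f) = smor_scale (c * c') f.
Proof. by apply: smor_ext => i /=; rewrite scalerA. Qed.
Lemma smor_scale1 : left_id 1 smor_scale.
Proof. by move=> f; apply: smor_ext => i /=; rewrite scale1r. Qed.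
Lemma smor_scaleDr : right_distributive smor_scale +%R.
Proof. by move=> c f g; apply: smor_ext => i /=; rewrite scalerDr. Qed.
Lemma smor_scaleDl f : {morph (fun c => smor_scale c f) : c c' / c + c'}.
Proof. by move=> c c'; apply: smor_ext => i /=; rewrite scalerDl. Qed.
HB.instance Definition _ :=
  GRing.Zmodule_isLmodule.Build k (smor E E') smor_scaleA smor_scale1 smor_scaleDr smor_scaleDl.
End ax.

Program Definition smor_id (E : spectrum) : smor E E := @SMor E E (fun i => khom_id (E i)) _.
Next Obligation.
move=> E i; have -> : fmap C' (khom_id (E i)) = khom_id (C' (E i)) by exact: fmap1.
exact: khom_ext.
Qed.
Program Definition smor_comp (E E' E'' : spectrum) (g : smor E' E'') (f : smor E E') :
  smor E E'' := @SMor E E'' (fun i => khom_comp (g i) (f i)) _.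
Next Obligation.
move=> E E' E'' g f i.
have -> : fmap C' (khom_comp (g i) (f i)) = khom_comp (fmap C' (g i)) (fmap C' (f i)).
  exact: (@fmapM _ _ C' _ _ _ (g i) (f i)).
have A := @lcmpA _ (KP k) : forall F G H I (h : khom H I) (g : khom G H) (f : khom F G),
  khom_comp h (khom_comp g f) = khom_comp (khom_comp h g) f.
by rewrite -A smP A smP -A.
Qed.

Program Definition Spectra : lincat k := @LinCat k spectrum (fun E E' => smor E E' : lmodType k)
  smor_id smor_comp _ _ _ _ _.
Next Obligation. by move=> *; apply: smor_ext => i; apply: khom_ext. Qed.
Next Obligation. by move=> *; apply: smor_ext => i; apply: khom_ext. Qed.
Next Obligation. by move=> *; apply: smor_ext => i; apply: khom_ext. Qed.
Next Obligation. by move=> E E' E'' f c g h; apply: smor_ext => i; apply: khom_ext. Qed.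
Next Obligation.
by move=> E E' E'' g c f h; apply: smor_ext => i /=; rewrite khom_compDr khom_compZr.
Qed.

(* Hovey's stable model structure. Since all objects of K\hat P are fibrant,    *)
(* the fibrant objects are the spectra below; the stable equivalences are the   *)
(* maps inducing bijections on maps into fibrant objects in the levelwise       *)
(* homotopy category.                                                          *)
Definition level_we : mclass Spectra := fun E E' f => forall i, qis (smv f i).
Definition omega_spectrum (E : spectrum) := forall i, qis (adjoint_map (stau E i)).
Definition stable_we : mclass Spectra := fun E E' f =>
  forall Z : spectrum, omega_spectrum Z ->
    bijective (fun h : mor (c := Loc level_we) E' Z => h \oc fmap (loc level_we) f).

Definition inSPd (d : nat) (E : spectrum) := forall i, conc (d * p ^ i) (E i).
Definition SPd (d : nat) : lincat k := lfull (C := Spectra) (inSPd d).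
Definition stable_d d : mclass (SPd d) := fun E E' f => stable_we f.
Definition DSP d : cat := Loc (@stable_d d).

(* E[s], with structure maps adjoint to E_i[s] -> K'(E_(i+1))[s] = K'(E_(i+1)[s]). *)
Definition spectrum_shift (s : int) (E : spectrum) : spectrum :=
  Spectrum (slev := fun i => kshift_ob s (E i))
    (fun i => coadjoint_map (khom_comp (Kp_shift s (E i.+1))
                (kshift_map s (adjoint_map (stau E i))))).
Lemma inSPd_shift d s E : inSPd d E -> inSPd d (spectrum_shift s E).
Proof. by move=> h i; apply: conc_shift. Qed.
Definition SPd_shift d s (E : SPd d) : SPd d :=
  exist _ (spectrum_shift s (sval E)) (@inSPd_shift d s _ (svalP E)).

Hypothesis C'_deg : forall d F, conc d F -> conc (p * d) (C' F).

Lemma conc_C'i d i F : conc d F -> conc (d * p ^ i) (fiterl C' i F).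
Proof.
move=> h; elim: i => [|i IH]; first by rewrite muln1.
by rewrite expnS mulnCA; apply: C'_deg.
Qed.
Definition Cinf_ob (F : khat k) : spectrum :=
  Spectrum (slev := fiterl C' ^~ F) (fun i => khom_id (fiterl C' i.+1 F)).
Program Definition Cinf_map (F G : khat k) (f : khom F G) : smor (Cinf_ob F) (Cinf_ob G) :=
  @SMor (Cinf_ob F) (Cinf_ob G) (fun i => fmap (fiterl C' i) f) _.
Next Obligation. by move=> F G f i; apply: khom_ext. Qed.
Program Definition Cinf d : functor (KPd k d) (SPd d) :=
  @Functor (KPd k d) (SPd d)
    (fun F => exist _ (Cinf_ob (sval F)) (fun i => @conc_C'i d i _ (svalP F)))
    (fun F G f => Cinf_map f) _ _.
Next Obligation. by move=> d F; apply: smor_ext => i; apply: (@fmap1 _ _ (fiterl C' i)). Qed.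
Next Obligation. by move=> d F G H g f; apply: smor_ext => i; apply: (@fmapM _ _ (fiterl C' i)). Qed.

Definition KG d (G : SPd d) (i : nat) : KPd k d :=
  exist _ (fiterr Kp i (sval G i)) (conc_Kpi (svalP G i)).
Definition KG_step d (G : SPd d) i : lmor (KG G i) (KG G i.+1) :=
  fmap (fiterr Kp i) (adjoint_map (stau (sval G) i)).
Definition KG_map d (G G' : SPd d) (g : lmor G G') i : lmor (KG G i) (KG G' i) :=
  fmap (fiterr Kp i) (smv g i).
End spectra.
End Kprime_functor.

Section twisted_ext.
Variables (k : finFieldType) (p : nat) (pk : p \in [pchar k]).

Definition KPd_shift d s (F : KPd k d) : KPd k d :=
  exist _ (kshift_ob s (sval F)) (@conc_shift _ d s _ (svalP F)).

Lemma conc_CtwS d i F : conc (d * p ^ i) F -> conc (d * p ^ i.+1) (Ctw pk F).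
Proof. by rewrite expnS mulnCA; apply: conc_Ctw. Qed.
Program Definition CtwS d i : functor (KPd k (d * p ^ i)) (KPd k (d * p ^ i.+1)) :=
  @Functor (KPd k (d * p ^ i)) (KPd k (d * p ^ i.+1))
    (fun F => exist _ (Ctw pk (sval F)) (conc_CtwS (svalP F)))
    (fun F G f => fmap (Ctw pk) f) _ _.
Next Obligation. by move=> d i F; apply: (@fmap1 _ _ (Ctw pk)). Qed.
Next Obligation. by move=> d i F G H g f; apply: (@fmapM _ _ (Ctw pk)). Qed.
Lemma conc_exp0 d (F : khat k) : conc d F -> conc (d * p ^ 0) F.
Proof. by rewrite muln1. Qed.
Fixpoint twisti d (F : KPd k d) (i : nat) : KPd k (d * p ^ i) :=
  match i with
  | 0 => exist _ (sval F) (conc_exp0 (svalP F))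
  | j.+1 => CtwS d j (twisti F j)
  end.

Definition DCtwS d i : functor (DP k (d * p ^ i)) (DP k (d * p ^ i.+1)) :=
  Loc_map (F := CtwS d i) (fun F G f h => @Ctw_qis k p pk _ _ f h).

Definition twist_step d s (F G : KPd k d) i
    (a : mor (c := DP k (d * p ^ i)) (twisti F i) (KPd_shift s (twisti G i))) :
    mor (c := DP k (d * p ^ i.+1)) (twisti F i.+1) (KPd_shift s (twisti G i.+1)) :=
  fmap (loc (@qis_d k (d * p ^ i.+1)))
    (Ctw_shift pk s (sval (twisti G i))
      : mor (CtwS d i (KPd_shift s (twisti G i))) (KPd_shift s (twisti G i.+1)))
  \oc fmap (DCtwS d i) a.

End twisted_ext.

(* A set with the graph of an addition and the graph of a scalar action. *)
Record vset (k : pzRingType) := VSet {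
  vcar :> Type;
  vadd : vcar -> vcar -> vcar -> Prop;
  vscl : k -> vcar -> vcar -> Prop }.
Arguments vadd {k v}.
Arguments vscl {k v}.

Definition viso (k : pzRingType) (A B : vset k) (f : A -> B) :=
  [/\ bijective f,
      forall x y z, vadd x y z <-> vadd (f x) (f y) (f z) &
      forall c x y, vscl c x y <-> vscl c (f x) (f y)].

(* Morphisms x -> y in C[W^-1], for C k-linear. Addition is that of fractions   *)
(* with a common denominator: h = f + g when f = a u, g = b u and h = (a + b) u *)
(* for some a, b : z -> y in C and u : x -> z in C[W^-1].                      *)
Definition LocHom (k : pzRingType) (C : lincat k) (W : mclass C) (x y : C) : vset k :=
  @VSet k (mor (c := Loc W) x y)
    (fun f g h => exists (z : C) (u : mor (c := Loc W) x z) (a b : lmor z y),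
       [/\ f = fmap (loc W) a \oc u, g = fmap (loc W) b \oc u &
           h = fmap (loc W) (a + b) \oc u])
    (fun c f g => g = fmap (loc W) (c *: lid y) \oc f).

Section colimit.
Variables (k : pzRingType) (A : nat -> vset k) (t : forall i, A i -> A i.+1).

Inductive colim_eq : {i & vcar (A i)} -> {i & vcar (A i)} -> Prop :=
| colim_refl x : colim_eq x x
| colim_sym x y : colim_eq x y -> colim_eq y x
| colim_trans x y z : colim_eq x y -> colim_eq y z -> colim_eq x z
| colim_step i (a : A i) : colim_eq (existT _ i a) (existT _ i.+1 (t a)).

Definition colim_in i (a : A i) : quot colim_eq := cls colim_eq (existT _ i a).
Definition colim : vset k :=
  @VSet k (quot colim_eq)
    (fun x y z => exists i (a b c : A i),
       [/\ x = colim_in a, y = colim_in b, z = colim_in c & vadd a b c])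
    (fun c x y => exists i (a b : A i), [/\ x = colim_in a, y = colim_in b & vscl c a b]).
End colimit.

Section main.
Variables (k : finFieldType) (p : nat) (pk : p \in [pchar k]).

Definition findim d (F : KPd k d) := forall e : pdeg, findim_cpx (sval F e).

Definition Pd (d : nat) :=
  {F : forall e : pdeg, spf k e | forall e, dval e != d -> forall n (x : F e n), x = 0}.
Definition findimP d (F : Pd d) := forall e n, fin_dim (sval F e n).
Lemma conc_stalk d (F : Pd d) : conc d (fun e => stalk (sval F e)).
Proof.
by move=> e ne i n /=; case: (i == 0) => x; [exact: (svalP F)|exact: spf0_eq].
Qed.
Definition stalkd d (F : Pd d) : KPd k d := exist _ _ (@conc_stalk d F).

Definition locKP d : functor (KPd k d) (DP k d) := loc (@qis_d k d).
Definition HomDP d (F G : KPd k d) : vset k := LocHom (@qis_d k d) F G.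

Definition Ext d (s : int) (F G : KPd k d) : vset k := HomDP F (KPd_shift s G).
Definition colim_Ext d (s : int) (F G : Pd d) : vset k :=
  colim (A := fun i => Ext s (twisti pk (stalkd F) i) (twisti pk (stalkd G) i))
    (fun i a => twist_step a).

Definition left_derived_iso (F G : functor (KP k) (KP k)) :=
  exists (LF LG : functor (Loc (@qis k)) (Loc (@qis k)))
    (eF : nattrans (fcomp LF (loc (@qis k))) (fcomp (loc (@qis k)) F))
    (eG : nattrans (fcomp LG (loc (@qis k))) (fcomp (loc (@qis k)) G)),
    [/\ is_left_derived eF, is_left_derived eG & nat_iso LF LG].

Variables (X : forall e : pdeg, bicpx k e (pmul pk e)) (C' : functor (KP k) (KP k)).
Variable adj : adjunction C' (Kp X).

Definition locSP d : functor (SPd adj d) (DSP adj d) := loc (@stable_d _ _ _ _ _ adj d).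
Definition HomDSP d (E G : SPd adj d) : vset k := LocHom (@stable_d _ _ _ _ _ adj d) E G.

Definition colim_KG d (F : KPd k d) (G : SPd adj d) : vset k :=
  colim (A := fun i => HomDP F (KG G i))
    (fun i (a : mor (c := DP k d) F (KG G i)) => fmap (locKP d) (KG_step G i) \oc a).
Definition in_KG d (F : KPd k d) (G : SPd adj d) i (a : mor (c := DP k d) F (KG G i)) :
    colim_KG F G :=
  @colim_in k (fun i => HomDP F (KG G i)) _ i a.
End main.

(* Main.v *)
(** A finite dimensional functor of degree d has a finite resolution by finitely generated
projectives: the Koszul complexes resolve the functors Lambda^{l1} (x) ... (x) Lambda^{lr}, each of
which has a one dimensional top weight space, and one peels off top weights of an arbitrary functor
with them. Hence finite dimensional complexes are compact in the derived category, and K', a Hom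
complex out of finitely generated projectives, commutes with sequential colimits.

For a spectrum G let L(G) be the colimit of the complexes K'^i(G_i). The spectrum with i-th term
L(G_i, G_(i+1), ...) is an Omega-spectrum stably equivalent to G, so L factors through the stable
category, and the adjunction between C^oo and G |-> G_0 gives Hom(C^oo P, G) = Hom(P, L(G)) for
homotopically projective P. Compactness of F turns Hom(F, L(G)) into the first colimit.

For the second isomorphism, L commutes with shifts up to quasi-isomorphism, the adjunctions
C'^i -| K'^i identify Hom(P, K'^i Y) with Hom(C'^i P, Y), and C' agrees with the Frobenius twist on
homotopically projective complexes, naturally in the latter. *)

From HB Require Import structures.
From mathcomp Require Import all_boot all_order all_fingroup all_algebra.
From mathcomp Require Import boolp zify.
Require Import Defs.
Set Implicit Arguments.
Unset Strict Implicit.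
Unset Printing Implicit Defensive.
#[local] Obligation Tactic := idtac.
Import Order.TTheory GRing.Theory Num.Theory.
Local Open Scope ring_scope.

(** * Localisations and derived functors *)

(** A localisation is a category of zigzags, so its Hom sets are accessible only from objects whose
    outgoing maps are strict. The tool throughout is the path object: its two projections share a
    section that is a weak equivalence, so homotopic maps become equal after localisation, and for
    homotopically projective sources the converse holds. A comparison map between the path object of
    [K'Y] and [K'] of the path object of Y respects the projections strictly, and so the same
    argument reaches spectra.

    In the resolution theorem a functor F need not have any map to or from the product of exterior
    powers with the same top weight. Both are compared with the subfunctor of their direct sum
    generated by the pair of top vectors; the kernels and the cokernel that arise have only later
    weights. Weights are ordered by the sum of the letters of a word, small sums being the top.

    A sum in a localised Hom is a relation between fractions with a common denominator. That any two
    maps have a sum, and only one, is part of the proof; for spectra a common denominator is built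
    from the direct sum of a spectrum with itself. *)

Section isos.
Variable C : cat.

Lemma iso_id (x : C) : is_iso (idm x).
Proof. by exists (idm x); rewrite comp1m. Qed.

Definition iinv (x y : C) (f : mor x y) (h : is_iso f) : mor y x := sval (cid h).
Lemma iinvl (x y : C) (f : mor x y) (h : is_iso f) : iinv h \oc f = idm x.
Proof. by rewrite /iinv; case: cid => g []. Qed.
Lemma iinvr (x y : C) (f : mor x y) (h : is_iso f) : f \oc iinv h = idm y.
Proof. by rewrite /iinv; case: cid => g []. Qed.
Lemma iinv_iso (x y : C) (f : mor x y) (h : is_iso f) : is_iso (iinv h).
Proof. by exists f; rewrite iinvl iinvr. Qed.

Lemma iso_comp (x y z : C) (g : mor y z) (f : mor x y) : is_iso g -> is_iso f -> is_iso (g \oc f).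
Proof.
move=> [g' [gl gr]] [f' [fl fr]]; exists (f' \oc g'); split.
  by rewrite compA -(compA f' g' g) gl compm1.
by rewrite compA -(compA g f f') fr compm1.
Qed.

Lemma iso_mono (x y z : C) (f : mor y z) (a b : mor x y) : is_iso f -> f \oc a = f \oc b -> a = b.
Proof. by move=> [g [gl _]] /(congr1 (comp g)); rewrite !compA gl !comp1m. Qed.
Lemma iso_epi (x y z : C) (f : mor x y) (a b : mor y z) : is_iso f -> a \oc f = b \oc f -> a = b.
Proof. by move=> [g [_ gr]] /(congr1 (comp^~ g)); rewrite -!compA gr !compm1. Qed.
End isos.

Lemma fmap_iso (C D : cat) (F : functor C D) (x y : C) (f : mor x y) :
  is_iso f -> is_iso (fmap F f).
Proof. by move=> [g [gl gr]]; exists (fmap F g); rewrite -!fmapM gl gr !fmap1. Qed.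

Lemma bij_of_inj_surj (A B : Type) (f : A -> B) : injective f -> (forall y, exists x, f x = y) ->
  bijective f.
Proof. by move=> fI /choice [g fg]; exists g => // x; apply: fI. Qed.

Section loc_theory.
Variables (C : cat) (W : mclass C).

Lemma loc_iso (x y : C) (w : mor x y) : W w -> is_iso (fmap (loc W) w).
Proof.
move=> Ww; exists (lcls (zbw Ww (zid W y))); split; rewrite /= lcompE; apply: lclsE.
  exact: zfwK.
exact: zbwK.
Qed.

(* Every morphism of [C[W^-1]] is a string of morphisms of C and inverses of members of W. *)
Lemma Loc_ind (P : forall x y : C, mor (c := Loc W) x y -> Prop) :
  (forall x : C, P x x (idm (x : Loc W))) ->
  (forall (x y z : C) (f : mor y z) (g : mor (c := Loc W) x y), P x y g -> P x z (fmap (loc W) f \oc g)) ->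
  (forall (x y z : C) (w : mor z y) (g : mor (c := Loc W) x y) (g' : mor (c := Loc W) x z),
     W w -> P x y g -> fmap (loc W) w \oc g' = g -> P x z g') ->
  forall (x y : C) (f : mor (c := Loc W) x y), P x y f.
Proof.
move=> P1 Pf Pb x y f; rewrite -(lcls_rep f); move: (rep f) => {f}.
elim=> [z|u v w f a IH|u v w f Wf a IH].
- exact: P1.
- have -> : lcls (zfw f a) = fmap (loc W) f \oc (lcls a : mor (c := Loc W) u v).
    by rewrite /= lcompE.
  exact: Pf.
- apply: (Pb u v w f (lcls a) _ Wf IH).
  by rewrite /= lcompE; apply: lclsE; apply: zbwK.
Qed.

Section ext.
Variables (D : cat) (F : functor C D).
Hypothesis FW : forall x y (w : mor x y), W w -> is_iso (fmap F w).

Fixpoint zev x y (a : zz W x y) : mor (F x) (F y) :=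
  match a in zz _ x y return mor (F x) (F y) with
  | zid x => idm (F x)
  | zfw _ _ _ f a => fmap F f \oc zev a
  | zbw _ _ _ w Ww a => iinv (FW Ww) \oc zev a
  end.

Lemma zev_eq x y (a b : zz W x y) : zeq a b -> zev a = zev b.
Proof.
elim=> //=.
- by move=> > _ -> _ ->.
- by move=> > _ ->.
- by move=> > _ ->.
- by move=> > ; rewrite fmap1 comp1m.
- by move=> > ; rewrite fmapM compA.
- by move=> > ; rewrite compA iinvr comp1m.
- by move=> > ; rewrite compA iinvl comp1m.
Qed.

Lemma zevM x y z (b : zz W y z) (a : zz W x y) : zev (zcat b a) = zev b \oc zev a.
Proof.
elim: b x a => [u|u v w f b IH|u v w f Wf b IH] x a /=; first by rewrite comp1m.
  by rewrite IH compA.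
by rewrite IH compA.
Qed.

Program Definition Loc_ext : functor (Loc W) D :=
  @Functor (Loc W) D F (fun x y f => zev (rep f)) _ _.
Next Obligation.
move=> x; rewrite (_ : idm (F x) = zev (zid W x)) //; apply: zev_eq.
by apply: zsym; apply: rep_cls; apply: zrefl.
Qed.
Next Obligation.
move=> x y z g f /=; rewrite -zevM; apply: zev_eq.
by apply: zsym; apply: rep_cls; apply: zrefl.
Qed.

Lemma Loc_extE x y (f : mor x y) : fmap Loc_ext (fmap (loc W) f) = fmap F f.
Proof.
rewrite -[RHS]compm1; apply: (@zev_eq _ _ _ (zfw f (zid W x))).
by apply: zsym; apply: rep_cls; apply: zrefl.
Qed.
End ext.

(* A set-valued functor inverting W acts on the localisation; it is given here as a bare family *)
(* of types to escape the universe of the objects of a category.                             *)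
Section act.
Variables (H : C -> Type) (Hm : forall x y : C, mor x y -> H x -> H y).
Hypotheses (Hm1 : forall x q, Hm (idm x) q = q)
  (HmM : forall (x y z : C) (g : mor y z) (f : mor x y) q, Hm (g \oc f) q = Hm g (Hm f q))
  (HW : forall (x y : C) (w : mor x y), W w -> bijective (Hm w)).

Lemma HW_inv x y (w : mor x y) : W w -> exists g, cancel (Hm w) g /\ cancel g (Hm w).
Proof. by move=> /HW [g ? ?]; exists g. Qed.

Fixpoint zact x y (a : zz W x y) : H x -> H y :=
  match a in zz _ x y return H x -> H y with
  | zid x => id
  | zfw _ _ _ f a => fun q => Hm f (zact a q)
  | zbw _ _ _ w Ww a => fun q => sval (cid (HW_inv Ww)) (zact a q)
  end.

Lemma zact_eq x y (a b : zz W x y) : zeq a b -> zact a =1 zact b.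
Proof.
elim=> /=.
- by [].
- by move=> > _ IH q; rewrite IH.
- by move=> > _ IH _ IH' q; rewrite IH.
- by move=> > _ IH q; rewrite IH.
- by move=> > _ IH q; rewrite IH.
- by move=> ? ? ? q; rewrite Hm1.
- by move=> ? ? ? ? ? ? ? q; rewrite HmM.
- by move=> ? ? ? ? ? ? q; case: cid => g /= [].
- by move=> ? ? ? ? ? ? q; case: cid => g /= [].
Qed.

Definition Lact (x y : C) (f : mor (c := Loc W) x y) : H x -> H y := zact (rep f).
Lemma Lact_loc (x y : C) (f : mor x y) q : Lact (fmap (loc W) f) q = Hm f q.
Proof.
apply: (@zact_eq _ _ _ (zfw f (zid W x))).
by apply: zsym; apply: rep_cls; apply: zrefl.
Qed.
End act.

(** Formal inverses impose no further condition: the image of [w] under G is an isomorphism and can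
    be cancelled. *)
Lemma Loc_natural (D : cat) (F G : functor (Loc W) D) (t : forall x : C, mor (F x) (G x)) :
  (forall (x y : C) (f : mor x y),
     t y \oc fmap F (fmap (loc W) f) = fmap G (fmap (loc W) f) \oc t x) ->
  forall (x y : C) (f : mor (c := Loc W) x y), t y \oc fmap F f = fmap G f \oc t x.
Proof.
move=> tN; apply: Loc_ind => [x|x y z f g IH|x y z w g g' Ww IH E].
- by rewrite !fmap1 comp1m compm1.
- by rewrite !fmapM (compA (t z)) tN -(compA _ (t y)) IH compA.
- apply: (iso_mono (fmap_iso G (loc_iso Ww))).
  by rewrite !(compA (fmap G _)) -tN -(compA (t y)) -!fmapM E IH.
Qed.

End loc_theory.

Section loc_map_theory.
Variables (C D : cat) (W : mclass C) (V : mclass D) (F : functor C D).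
Hypothesis FW : forall (x y : C) (f : mor x y), W f -> V (fmap F f).

Lemma Loc_mapE (x y : C) (f : mor x y) :
  fmap (Loc_map FW) (fmap (loc W) f) = fmap (loc V) (fmap F f).
Proof.
apply: lclsE; apply: (@zmap_eq _ _ _ _ _ FW _ _ _ (zfw f (zid W x))).
by apply: zsym; apply: rep_cls; apply: zrefl.
Qed.
End loc_map_theory.

(* If [r] is a congruence on the maps out of P such that composition with members of W is     *)
(* bijective modulo r and r-related maps agree in the localisation, then maps out of P in    *)
(* the localisation are maps of C modulo r.                                                  *)
Section strict_maps.
Variables (C : cat) (W : mclass C) (P : C) (r : forall Y : C, mor P Y -> mor P Y -> Prop).
Hypotheses (rxx : forall Y f, r (Y := Y) f f) (rC : forall Y f g, r (Y := Y) f g -> r g f)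
  (rT : forall Y f g h, r (Y := Y) f g -> r g h -> r f h)
  (rM : forall Y Z (g : mor Y Z) f f', r f f' -> r (g \oc f) (g \oc f')).
Hypotheses (r_surj : forall Y Z (w : mor Y Z), W w -> forall f, exists f', r (w \oc f') f)
  (r_inj : forall Y Z (w : mor Y Z), W w -> forall f f', r (w \oc f) (w \oc f') -> r f f').
Hypothesis r_loc : forall Y f f', r (Y := Y) f f' -> fmap (loc W) f = fmap (loc W) f'.

(** A zigzag out of P is straightened from its source: forward arrows compose, and a backward arrow
    [w] is removed by lifting the strict map through [w] up to [r], which the localisation does not
    see. *)
Lemma loc_strict (Y : C) (h : mor (c := Loc W) P Y) : exists f, h = fmap (loc W) f.
Proof.
suff H (x : C) (k : mor P x) (h' : mor (c := Loc W) x Y) : exists f, h' \oc fmap (loc W) k = fmap (loc W) f.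
  by have [f E] := H P (idm P) h; exists f; rewrite -E fmap1 compm1.
move: x Y h' k {h} => x Y h'; move: x Y h'.
apply: (@Loc_ind C W (fun x Y h' => forall k : mor P x, exists f : mor P Y,
  h' \oc fmap (loc W) k = fmap (loc W) f)) => [z|y z t f g IH|y z t w g g' Ww IH E] k.
  by exists k; rewrite comp1m.
  by have [f' Ef] := IH k; exists (f \oc f'); rewrite -compA Ef fmapM.
have [f Ef] := IH k; have [f' Ef'] := r_surj Ww f.
exists f'; apply: (iso_mono (loc_iso Ww)).
by rewrite compA E Ef -fmapM; apply/esym/r_loc.
Qed.

Let qm (Y Z : C) (g : mor Y Z) (q : quot (@r Y)) : quot (@r Z) := cls (@r Z) (g \oc rep q).

Let qmE Y Z (g : mor Y Z) f : qm g (cls (@r Y) f) = cls (@r Z) (g \oc f).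
Proof.
apply: eq_cls; [exact: rC|exact: rT|].
by apply: rM; apply: rC; apply: rep_cls; apply: rxx.
Qed.

(** The classes of maps out of P modulo [r] form a set-valued functor that inverts W, hence they are
    acted on by the localisation; acting on the class of the identity recovers the class of a map
    from its image. *)
Lemma loc_strict_eq (Y : C) (f f' : mor P Y) : fmap (loc W) f = fmap (loc W) f' -> r f f'.
Proof.
have q1 x q : qm (idm x) q = q by rewrite -[q in LHS]repK qmE comp1m repK.
have qM x y z (g : mor y z) (h : mor x y) q : qm (g \oc h) q = qm g (qm h q).
  by rewrite -[q]repK !qmE compA.
have qW x y (w : mor x y) : W w -> bijective (qm w).
  move=> Ww; apply: bij_of_inj_surj => [q q'|q].
    rewrite -[q]repK -[q']repK !qmE => /(cls_eq (@rxx _)) h.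
    by apply: eq_cls; [exact: rC|exact: rT|exact: r_inj h].
  have [f0 hf0] := r_surj Ww (rep q); exists (cls (@r x) f0).
  by rewrite qmE -[RHS]repK; apply: eq_cls; [exact: rC|exact: rT|].
move=> /(congr1 (fun h => Lact qW h (cls (@r P) (idm P)))).
rewrite !Lact_loc // !qmE !compm1; exact: cls_eq.
Qed.
End strict_maps.

(** * Derived functors computed by resolutions *)

Section derived.
Variables (C D : cat) (W : mclass C) (V : mclass D) (F : functor C D) (Pr : C -> Prop).
Hypothesis resol : forall x : C, exists (P : C) (q : mor P x), Pr P /\ W q.
Hypothesis strict : forall (P Y : C) (h : mor (c := Loc W) P Y), Pr P -> exists f, h = fmap (loc W) f.
Hypothesis F_loc : forall (P Y : C) (f f' : mor P Y), Pr P ->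
  fmap (loc W) f = fmap (loc W) f' -> fmap (loc V) (fmap F f) = fmap (loc V) (fmap F f').

Let Q (x : C) : C := sval (cid (resol x)).
Let q (x : C) : mor (Q x) x := sval (cid (svalP (cid (resol x)))).
Let PrQ x : Pr (Q x). Proof. by rewrite /Q; case: cid => P /= [? []]. Qed.
Let Wq x : W (q x). Proof. exact: (proj2 (svalP (cid (svalP (cid (resol x)))))). Qed.
Let lq x : is_iso (fmap (loc W) (q x)). Proof. by apply: loc_iso; apply: Wq. Qed.

Let ex_lift (x y : C) (v : mor (c := Loc W) x y) :
  exists w : mor (Q x) (Q y), fmap (loc W) (q y) \oc fmap (loc W) w = v \oc fmap (loc W) (q x).
Proof.
have [w E] := strict (iinv (lq y) \oc (v \oc fmap (loc W) (q x))) (PrQ x).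
by exists w; rewrite -E compA iinvr comp1m.
Qed.
Let lift (x y : C) (v : mor (c := Loc W) x y) : mor (Q x) (Q y) := sval (cid (ex_lift v)).
Let liftE (x y : C) (v : mor (c := Loc W) x y) :
  fmap (loc W) (q y) \oc fmap (loc W) (lift v) = v \oc fmap (loc W) (q x).
Proof. by rewrite /lift; case: cid. Qed.
Let lift_uniq (x y : C) (v : mor (c := Loc W) x y) (w : mor (Q x) (Q y)) :
  fmap (loc W) (q y) \oc fmap (loc W) w = v \oc fmap (loc W) (q x) ->
  fmap (loc V) (fmap F (lift v)) = fmap (loc V) (fmap F w).
Proof.
move=> E; apply: F_loc => //; apply: (iso_mono (lq y)); by rewrite E liftE.
Qed.

(** F applied to chosen resolutions. The lifts are unique only after localisation, so functoriality
    is checked there, by [lift_uniq]. *)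
Let L0 : functor (Loc W) (Loc V).
Proof.
refine (@Functor (Loc W) (Loc V) (fun x => F (Q x)) (fun x y v => fmap (loc V) (fmap F (lift v))) _ _).
  move=> x; rewrite (@lift_uniq _ _ _ (idm _)) ?fmap1 //; by rewrite comp1m compm1.
move=> x y z g f; rewrite -(fmapM (loc V)) -(fmapM F); apply: lift_uniq.
have E : fmap (loc W) (lift g \oc lift f) = fmap (loc W) (lift g) \oc fmap (loc W) (lift f).
  exact: fmapM.
by rewrite E compA (liftE g) -[RHS]compA -(liftE f) !compA.
Defined.

Let eps0 : nattrans (fcomp L0 (loc W)) (fcomp (loc V) F).
Proof.
refine (@NatTrans _ _ (fcomp L0 (loc W)) (fcomp (loc V) F) (fun x => fmap (loc V) (fmap F (q x))) _).
move=> x y f /=.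
have -> : (lcomp (fmap (loc V) (fmap F (q y))) (fmap (loc V) (fmap F (lift (fmap (loc W) f))))) =
  fmap (loc V) (fmap F (q y \oc lift (fmap (loc W) f))) by rewrite fmapM [RHS]fmapM.
have -> : (lcomp (fmap (loc V) (fmap F f)) (fmap (loc V) (fmap F (q x)))) =
  fmap (loc V) (fmap F (f \oc q x)) by rewrite fmapM [RHS]fmapM.
by apply: F_loc => //; rewrite !fmapM liftE.
Defined.

Let L0q x : fmap L0 (fmap (loc W) (q x)) = eps0 (Q x).
Proof. exact: lift_uniq. Qed.

(** A transformation from G is determined by [a] on resolutions, and G inverts the maps [q]. This
    leaves the single candidate [a (Q x)] composed with the inverse of [G (q x)]. *)
Let eps0_derived : is_left_derived eps0.
Proof.
move=> G a; have Gq x : is_iso (fmap G (fmap (loc W) (q x))) by exact: fmap_iso.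
have aN x y (f : mor x y) : a y \oc fmap G (fmap (loc W) f) = fmap (loc V) (fmap F f) \oc a x.
  exact: (ntcP a f).
have bN (x y : Loc W) (v : mor x y) :
    (a (Q y) \oc iinv (Gq y)) \oc fmap G v = fmap L0 v \oc (a (Q x) \oc iinv (Gq x)).
  apply: (iso_epi (Gq x)); rewrite -[RHS]compA -[X in _ = _ \oc X]compA iinvl compm1.
  rewrite -[RHS](aN _ _ (lift v)) -[LHS]compA -fmapM -liftE fmapM -[LHS]compA.
  by congr (_ \oc _); rewrite compA iinvl comp1m.
have bP (x : C) : eps0 x \oc (a (Q x) \oc iinv (Gq x)) = a x.
  apply: etrans (compA _ _ _) _; apply: etrans (congr1 (comp^~ _) (esym (aN _ _ (q x)))) _.
  by rewrite -compA iinvr compm1.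
exists (@NatTrans _ _ G L0 (fun x => a (Q x) \oc iinv (Gq x)) bN); split=> [x|b' Eb'].
  exact: bP.
have E x : b' x = a (Q x) \oc iinv (Gq x).
  apply: (iso_epi (Gq x)); rewrite -compA iinvl compm1.
  by rewrite ntcP L0q -Eb'.
case: b' {Eb'} E => b' b'N /= E.
have {}E : b' = fun x => a (Q x) \oc iinv (Gq x).
  by apply: functional_extensionality_dep => x; rewrite E.
case: _ / (esym E) in b'N *; congr NatTrans; exact: Prop_irrelevance.
Qed.

Let eps0_iso P : Pr P -> is_iso (eps0 P).
Proof.
move=> PrP; have [r Er] := strict (iinv (lq P)) PrP.
have M (x y z : C) (g : mor y z) (f : mor x y) : fmap (loc V) (fmap F g) \oc fmap (loc V) (fmap F f) =
  fmap (loc V) (fmap F (g \oc f)) by rewrite !fmapM.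
have I x : fmap (loc V) (fmap F (idm x)) = idm _ by rewrite !fmap1.
exists (fmap (loc V) (fmap F r)); split.
  apply: etrans (M _ _ _ r (q P)) _; apply: etrans (I _).
  by apply: F_loc => //; rewrite fmapM -Er iinvl fmap1.
apply: etrans (M _ _ _ (q P) r) _; apply: etrans (I _).
by apply: F_loc => //; rewrite fmapM -Er iinvr fmap1.
Qed.

(** Two right Kan extensions of one functor are isomorphic over it, so the extension built from
    resolutions suffices. Its counit at P is F of the resolution of P, whose inverse in the
    localisation is represented by a strict map. *)
Lemma left_derived_iso_on (L : functor (Loc W) (Loc V))
    (eps : nattrans (fcomp L (loc W)) (fcomp (loc V) F)) :
  is_left_derived eps -> forall P, Pr P -> is_iso (eps P).
Proof.
move=> epsD P PrP.
have [b [Eb _]] := epsD _ eps0; have [c [Ec _]] := eps0_derived eps.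
(* Uniqueness in the universal property: an endomorphism compatible with the counit is the
   identity. *)
have H (K : functor (Loc W) (Loc V)) (e : nattrans (fcomp K (loc W)) (fcomp (loc V) F))
  (t : nattrans K K) : is_left_derived e -> (forall x, e x \oc t (loc W x) = e x) -> t P = idm (K P).
  move=> eD Et.
  have N (x y : Loc W) (f : mor x y) : idm (K y) \oc fmap K f = fmap K f \oc idm (K x).
    by rewrite comp1m compm1.
  have [t0 [_ U]] := eD _ e.
  have := U t Et; have := U (@NatTrans _ _ K K (fun x => idm (K x)) N) (fun x => compm1 _).
  by move=> E1 E2; rewrite -E2 E1.
have cbN (x y : Loc W) (f : mor x y) : (c y \oc b y) \oc fmap L0 f = fmap L0 f \oc (c x \oc b x).
  by rewrite -compA ntcP compA ntcP compA.
have bcN (x y : Loc W) (f : mor x y) : (b y \oc c y) \oc fmap L f = fmap L f \oc (b x \oc c x).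
  by rewrite -compA ntcP compA ntcP compA.
have cb := H L0 eps0 (@NatTrans _ _ L0 L0 (fun x => c x \oc b x) cbN) eps0_derived.
have bc := H L eps (@NatTrans _ _ L L (fun x => b x \oc c x) bcN) epsD.
have -> : eps P = eps0 P \oc c P by exact: esym (Ec P).
apply: iso_comp; first exact: eps0_iso.
exists (b P); split; [apply: bc|apply: cb] => x /=.
  exact: etrans (compA _ _ _) (etrans (congr1 (comp^~ (c x)) (Eb x)) (Ec x)).
exact: etrans (compA _ _ _) (etrans (congr1 (comp^~ (b x)) (Ec x)) (Eb x)).
Qed.
End derived.

(** Syntax of the additive expressions decided by the tactic [zmod], which compares the integer
    coefficients of each atom on the two sides. *)
Inductive zterm := ZVar of nat | ZZero | ZAdd of zterm & zterm | ZOpp of zterm.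

(** * Constructions with strict polynomial functors *)

Section zterm.
Variable V : zmodType.
Fixpoint zterm_eval (s : seq V) (t : zterm) : V :=
  match t with
  | ZVar i => s`_i
  | ZZero => 0
  | ZAdd t u => zterm_eval s t + zterm_eval s u
  | ZOpp t => - zterm_eval s t
  end.
Fixpoint zterm_coef (t : zterm) (i : nat) : int :=
  match t with
  | ZVar j => if j == i then 1 else 0
  | ZZero => 0
  | ZAdd t u => zterm_coef t i + zterm_coef u i
  | ZOpp t => - zterm_coef t i
  end.
Lemma zterm_evalE s t : zterm_eval s t = \sum_(i < size s) s`_i *~ zterm_coef t i.
Proof.
elim: t => [j||t IHt u IHu|t IHt] /=.
- have [lt|ge] := ltnP j (size s); last first.
    rewrite nth_default // big1 // => i _; case: eqP => // E.
    by move: (ltn_ord i); rewrite -E ltnNge ge.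
  rewrite (bigD1 (Ordinal lt)) //= eqxx big1 ?addr0 // => i ne.
  by rewrite -val_eqE eq_sym /= in ne; rewrite (negPf ne).
- by rewrite big1.
- by rewrite IHt IHu -big_split /=; apply: eq_bigr => i _; rewrite mulrzDr.
- by rewrite IHt -sumrN; apply: eq_bigr => i _; rewrite mulrNz.
Qed.
Lemma zterm_correct s t u :
  all (fun i => zterm_coef t i == zterm_coef u i) (iota 0 (size s)) ->
  zterm_eval s t = zterm_eval s u.
Proof.
move=> /allP h; rewrite !zterm_evalE; apply: eq_bigr => i _.
by rewrite (eqP (h i _)) // mem_iota /= add0n.
Qed.
End zterm.

(* Atoms are compared up to conversion: they may differ by the paths to their structures. *)
Ltac zmod_mem x s := match s with
  | [::] => false
  | ?y :: _ => let _ := match goal with _ => unify x y end in true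
  | _ :: ?s' => zmod_mem x s'
  end.
Ltac zmod_atoms s t := lazymatch t with
  | (?a + ?b)%R => let s' := zmod_atoms s a in zmod_atoms s' b
  | (- ?a)%R => zmod_atoms s a
  | 0%R => s
  | _ => lazymatch zmod_mem t s with true => s | false => constr:(t :: s) end
  end.
Ltac zmod_index x s := match s with
  | ?y :: _ => let _ := match goal with _ => unify x y end in constr:(0%N)
  | _ :: ?s' => let i := zmod_index x s' in constr:(S i)
  end.
Ltac zmod_reify s t := lazymatch t with
  | (?a + ?b)%R => let a' := zmod_reify s a in let b' := zmod_reify s b in constr:(ZAdd a' b')
  | (- ?a)%R => let a' := zmod_reify s a in constr:(ZOpp a')
  | 0%R => constr:(ZZero)
  | _ => let i := zmod_index t s in constr:(ZVar i)
  end.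
Ltac zmod := lazymatch goal with |- @eq ?T ?t ?u =>
    let s := zmod_atoms (@nil T) t in let s := zmod_atoms s u in
    let t' := zmod_reify s t in let u' := zmod_reify s u in
    exact: (@zterm_correct _ s t' u' isT)
  end.

Section modules.
Variable k : finFieldType.

Definition submodP (V : lmodType k) (U : V -> Prop) :=
  U 0 /\ forall a x y, U x -> U y -> U (a *: x + y).

Record subm (V : lmodType k) (U : V -> Prop) (hU : submodP U) := Subm { smval : V; smP : U smval }.
(** Quotients are realised as sets of chosen representatives: [choose] depends only on the
    predicate, so it is constant on cosets. *)
Definition canon (V : lmodType k) (U : V -> Prop) (x : V) : V :=
  choose (fun y => `[< U (y - x) >]) x.
Record quom (V : lmodType k) (U : V -> Prop) (hU : submodP U) :=
  Quom { qmval : V; qmP : canon U qmval = qmval }.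

Section sub_quotient.
Variables (V : lmodType k) (U : V -> Prop) (hU : submodP U).

Lemma submodP_Z a x : U x -> U (a *: x).
Proof. by move=> Ux; rewrite -[_ *: _]addr0; case: hU => U0 /(_ a _ _ Ux U0). Qed.
Lemma submodP_D x y : U x -> U y -> U (x + y).
Proof. by move=> Ux Uy; rewrite -[x]scale1r; case: hU => _; apply. Qed.
Lemma submodP_N x : U x -> U (- x).
Proof. by rewrite -scaleN1r; apply: submodP_Z. Qed.
Lemma submodP_B x y : U x -> U y -> U (x - y).
Proof. by move=> Ux Uy; apply: submodP_D => //; apply: submodP_N. Qed.

Local Notation subm := (subm hU).
Local Notation quom := (quom hU).
Local Notation canon := (canon U).
Local Notation Subm := (@Subm _ _ hU).
Local Notation Quom := (@Quom _ _ hU).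
Lemma subm_ext (x y : subm) : smval x = smval y -> x = y.
Proof. by case: x y => [x Ux] [y Uy] /= E; case: _ / E in Uy *; congr Subm; apply: Prop_irrelevance. Qed.
HB.instance Definition _ := gen_eqMixin subm.
HB.instance Definition _ := gen_choiceMixin subm.
Definition subm0 := Subm (proj1 hU).
Definition subm_add (x y : subm) := Subm (submodP_D (smP x) (smP y)).
Definition subm_opp (x : subm) := Subm (submodP_N (smP x)).
Definition subm_scale a (x : subm) := Subm (submodP_Z a (smP x)).
Lemma subm_addA : associative subm_add.
Proof. by move=> x y z; apply: subm_ext => /=; rewrite addrA. Qed.
Lemma subm_addC : commutative subm_add.
Proof. by move=> x y; apply: subm_ext => /=; rewrite addrC. Qed.
Lemma subm_add0 : left_id subm0 subm_add.
Proof. by move=> x; apply: subm_ext => /=; rewrite add0r. Qed.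
Lemma subm_addN : left_inverse subm0 subm_opp subm_add.
Proof. by move=> x; apply: subm_ext => /=; rewrite addNr. Qed.
HB.instance Definition _ := GRing.isZmodule.Build subm subm_addA subm_addC subm_add0 subm_addN.
Lemma subm_scaleA a b x : subm_scale a (subm_scale b x) = subm_scale (a * b) x.
Proof. by apply: subm_ext => /=; rewrite scalerA. Qed.
Lemma subm_scale1 : left_id 1 subm_scale.
Proof. by move=> x; apply: subm_ext => /=; rewrite scale1r. Qed.
Lemma subm_scaleDr : right_distributive subm_scale +%R.
Proof. by move=> a x y; apply: subm_ext => /=; rewrite scalerDr. Qed.
Lemma subm_scaleDl x : {morph (fun a => subm_scale a x) : a b / a + b}.
Proof. by move=> a b; apply: subm_ext => /=; rewrite scalerDl. Qed.
HB.instance Definition _ :=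
  GRing.Zmodule_isLmodule.Build k subm subm_scaleA subm_scale1 subm_scaleDr subm_scaleDl.

Lemma canonP x : U (canon x - x).
Proof. by apply/asboolP; apply: (@chooseP _ (fun y => `[< U (y - x) >])); apply/asboolP;
  rewrite subrr; case: hU. Qed.
Lemma canon_eq x y : U (x - y) -> canon x = canon y.
Proof.
move=> Uxy; have Uyx : U (y - x) by rewrite -opprB; apply: submodP_N.
have E : (fun z => `[< U (z - x) >]) =1 (fun z => `[< U (z - y) >]).
  move=> z; apply/asboolP/asboolP => h.
    by rewrite -(subrK x z) -addrA; apply: submodP_D.
  by rewrite -(subrK y z) -addrA; apply: submodP_D.
rewrite /canon (eq_choose E); apply: choose_id; apply/asboolP => //.
by rewrite subrr; case: hU.
Qed.
Lemma canonK x : canon (canon x) = canon x.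
Proof. exact/canon_eq/canonP. Qed.

Lemma quom_ext (x y : quom) : qmval x = qmval y -> x = y.
Proof. by case: x y => [x Ux] [y Uy] /= E; case: _ / E in Uy *; congr Quom; apply: Prop_irrelevance. Qed.
HB.instance Definition _ := gen_eqMixin quom.
HB.instance Definition _ := gen_choiceMixin quom.
Definition qpi (x : V) : quom := Quom (canonK x).
Lemma qpi_eq x y : U (x - y) -> qpi x = qpi y.
Proof. by move=> h; apply: quom_ext; apply: canon_eq. Qed.
Lemma qpiK x : qpi (qmval x) = x.
Proof. by apply: quom_ext => /=; rewrite qmP. Qed.
Definition quom_add (x y : quom) := qpi (qmval x + qmval y).
Definition quom_opp (x : quom) := qpi (- qmval x).
Definition quom_scale a (x : quom) := qpi (a *: qmval x).
Lemma qpi_add x y : quom_add (qpi x) (qpi y) = qpi (x + y).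
Proof. by apply: qpi_eq; rewrite opprD addrACA; apply: submodP_D; apply: canonP. Qed.
Lemma qpi_scale a x : quom_scale a (qpi x) = qpi (a *: x).
Proof. by apply: qpi_eq; rewrite -scalerBr; apply: submodP_Z; apply: canonP. Qed.
Lemma qpi_opp x : quom_opp (qpi x) = qpi (- x).
Proof. by apply: qpi_eq; rewrite -opprD; apply: submodP_N; apply: canonP. Qed.
Lemma quom_addA : associative quom_add.
Proof. by move=> x y z; rewrite -[x]qpiK -[y]qpiK -[z]qpiK !qpi_add addrA. Qed.
Lemma quom_addC : commutative quom_add.
Proof. by move=> x y; rewrite -[x]qpiK -[y]qpiK !qpi_add addrC. Qed.
Lemma quom_add0 : left_id (qpi 0) quom_add.
Proof. by move=> x; rewrite -[x]qpiK !qpi_add add0r. Qed.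
Lemma quom_addN : left_inverse (qpi 0) quom_opp quom_add.
Proof. by move=> x; rewrite -[x]qpiK qpi_opp !qpi_add addNr. Qed.
HB.instance Definition _ := GRing.isZmodule.Build quom quom_addA quom_addC quom_add0 quom_addN.
Lemma quom_scaleA a b x : quom_scale a (quom_scale b x) = quom_scale (a * b) x.
Proof. by rewrite -[x]qpiK !qpi_scale scalerA. Qed.
Lemma quom_scale1 : left_id 1 quom_scale.
Proof. by move=> x; rewrite -[x]qpiK !qpi_scale scale1r. Qed.
Lemma quom_scaleDr : right_distributive quom_scale +%R.
Proof.
move=> a x y; have E (u v : quom) : u + v = quom_add u v by [].
by rewrite -[x]qpiK -[y]qpiK !E !(qpi_add, qpi_scale) scalerDr. Qed.
Lemma quom_scaleDl x : {morph (fun a => quom_scale a x) : a b / a + b}.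
Proof. by move=> a b; rewrite -[x]qpiK !qpi_scale [RHS]qpi_add scalerDl. Qed.
HB.instance Definition _ :=
  GRing.Zmodule_isLmodule.Build k quom quom_scaleA quom_scale1 quom_scaleDr quom_scaleDl.

Lemma qpi_lin : linear qpi.
Proof. by move=> a x y; rewrite -[a *: qpi x]/(quom_scale a (qpi x)) qpi_scale [RHS]qpi_add. Qed.
Lemma qpi0 x : qpi x = 0 <-> U x.
Proof.
split=> [|Ux]; last by rewrite -[0]/(qpi 0); apply: qpi_eq; rewrite subr0.
rewrite -[0]/(qpi 0) => /(congr1 (@qmval _ _ _)) /= E.
have := canonP x; have := canonP 0; rewrite -E subr0 => h1 h2.
by rewrite -[x](subKr (canon x)); apply: submodP_B.
Qed.
End sub_quotient.

Definition prodm (I : Type) (V : I -> lmodType k) := forall i, V i.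
Section prodm.
Variables (I : Type) (V : I -> lmodType k).
HB.instance Definition _ := gen_eqMixin (prodm V).
HB.instance Definition _ := gen_choiceMixin (prodm V).
Let ext (x y : prodm V) : (forall i, x i = y i) -> x = y.
Proof. exact: functional_extensionality_dep. Qed.
Definition prodm_add (x y : prodm V) : prodm V := fun i => x i + y i.
Definition prodm_opp (x : prodm V) : prodm V := fun i => - x i.
Definition prodm_scale a (x : prodm V) : prodm V := fun i => a *: x i.
Lemma prodm_addA : associative prodm_add.
Proof. by move=> x y z; apply: ext => i; rewrite /prodm_add addrA. Qed.
Lemma prodm_addC : commutative prodm_add.
Proof. by move=> x y; apply: ext => i; rewrite /prodm_add addrC. Qed.
Lemma prodm_add0 : left_id ((fun i => 0) : prodm V) prodm_add.
Proof. by move=> x; apply: ext => i; rewrite /prodm_add add0r. Qed.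
Lemma prodm_addN : left_inverse ((fun i => 0) : prodm V) prodm_opp prodm_add.
Proof. by move=> x; apply: ext => i; rewrite /prodm_add addNr. Qed.
HB.instance Definition _ := GRing.isZmodule.Build (prodm V) prodm_addA prodm_addC prodm_add0 prodm_addN.
Lemma prodm_scaleA a b x : prodm_scale a (prodm_scale b x) = prodm_scale (a * b) x.
Proof. by apply: ext => i; rewrite /prodm_scale scalerA. Qed.
Lemma prodm_scale1 : left_id 1 prodm_scale.
Proof. by move=> x; apply: ext => i; rewrite /prodm_scale scale1r. Qed.
Lemma prodm_scaleDr : right_distributive prodm_scale +%R.
Proof. by move=> a x y; apply: ext => i; rewrite /prodm_scale scalerDr. Qed.
Lemma prodm_scaleDl x : {morph (fun a => prodm_scale a x) : a b / a + b}.
Proof. by move=> a b; apply: ext => i; rewrite /prodm_scale scalerDl. Qed.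
HB.instance Definition _ :=
  GRing.Zmodule_isLmodule.Build k (prodm V) prodm_scaleA prodm_scale1 prodm_scaleDr prodm_scaleDl.
Lemma prodm_ext (x y : prodm V) : (forall i, x i = y i) -> x = y.
Proof. exact: ext. Qed.
Lemma prodmED (x y : prodm V) i : (x + y) i = x i + y i. Proof. by []. Qed.
Lemma prodmEZ a (x : prodm V) i : (a *: x) i = a *: x i. Proof. by []. Qed.
End prodm.

(** Over a finite field finite dimension is finiteness of the underlying set, so later arguments may
    list all vectors. *)
Lemma fin_dimP (V : lmodType k) : fin_dim V <-> exists s : seq V, forall x, x \in s.
Proof.
split=> [[n [b hb]]|[s hs]].
  exists [seq \sum_i (c : {ffun 'I_n -> k}) i *: b i | c : {ffun 'I_n -> k}] => x.
  have [c ->] := hb x; apply/imageP; exists [ffun i => c i] => //.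
  by apply: eq_bigr => i _; rewrite ffunE.
exists (size s), (tnth (in_tuple s)) => x.
have xs := hs x; have lt : (index x s < size s)%N by rewrite index_mem.
exists (fun i => (i == Ordinal lt)%:R).
rewrite (bigD1 (Ordinal lt)) //= eqxx scale1r big1 ?addr0 ?(tnth_nth x) /= ?nth_index //.
by move=> i /negPf ->; rewrite scale0r.
Qed.
End modules.

Section functors.
Variables (k : finFieldType) (e : nat).
Implicit Types F G H : spf k e.

Lemma ntN F G (f : nt F G) n (x : F n) : f n (- x) = - f n x.
Proof. by rewrite -scaleN1r ntZ scaleN1r. Qed.
Lemma ntB F G (f : nt F G) n (x y : F n) : f n (x - y) = f n x - f n y.
Proof. by rewrite ntD ntN. Qed.
Lemma ntEN F G (f : nt F G) n (x : F n) : (- f : nt F G) n x = - f n x.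
Proof. by rewrite -[RHS]scaleN1r. Qed.
Lemma ntEB F G (f g : nt F G) n (x : F n) : (f - g : nt F G) n x = f n x - g n x.
Proof. by rewrite [LHS]ntED ntEN. Qed.
Lemma nt_sum F G (f : nt F G) n (I : Type) (r : seq I) (P : pred I) (x : I -> F n) :
  f n (\sum_(i <- r | P i) x i) = \sum_(i <- r | P i) f n (x i).
Proof. by apply: (big_morph (f n)) => [x' y|]; [exact: ntD|exact: nt0]. Qed.
Lemma sact_sum F m n (g : GHom k e m n) (I : Type) (r : seq I) (P : pred I) (x : I -> F m) :
  sact g (\sum_(i <- r | P i) x i) = \sum_(i <- r | P i) sact g (x i).
Proof. by apply: (big_morph (@sact _ _ F m n g)) => [x' y|]; [exact: sactD|exact: sact0]. Qed.
Lemma sactN F m n (g : GHom k e m n) (x : F m) : sact g (- x) = - sact g x.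
Proof. by rewrite -scaleN1r sactZ scaleN1r. Qed.
Lemma sact0l F m n (x : F m) : sact (0 : GHom k e m n) x = 0.
Proof.
have := @sact_glin _ _ F m n x 1 0 0; rewrite scale1r addr0 scale1r.
by move=> /(congr1 (fun y => y - sact 0 x)); rewrite subrr addrK.
Qed.
Lemma sactDl F m n (g h : GHom k e m n) (x : F m) : sact (g + h) x = sact g x + sact h x.
Proof. by have := @sact_glin _ _ F m n x 1 g h; rewrite !scale1r. Qed.
Lemma sactZl F m n a (g : GHom k e m n) (x : F m) : sact (a *: g) x = a *: sact g x.
Proof. by have := @sact_glin _ _ F m n x a g 0; rewrite sact0l !addr0. Qed.

Definition sclosed F (U : forall n, F n -> Prop) :=
  (forall n, submodP (U n)) /\ forall m n (g : GHom k e m n) x, U m x -> U n (sact g x).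

Section ssub.
Variables (F : spf k e) (U : forall n, F n -> Prop) (hU : sclosed U).
Program Definition ssub : spf k e :=
  @Spf k e (fun n => subm (proj1 hU n) : lmodType k)
    (fun m n g x => @Subm _ _ (@U n) (proj1 hU n) (sact g (smval x)) (proj2 hU m n g _ (smP x))) _ _ _ _.
Next Obligation. by move=> m n g a x y; apply: subm_ext; apply: sact_lin. Qed.
Next Obligation. by move=> m n x a g h; apply: subm_ext; apply: sact_glin. Qed.
Next Obligation. by move=> n x; apply: subm_ext; apply: sact1. Qed.
Next Obligation. by move=> l m n g f x; apply: subm_ext; apply: sactM. Qed.
Program Definition ssub_in : nt ssub F := @Nt k e ssub F (fun n x => smval x) _ _.
Next Obligation. by []. Qed.
Next Obligation. by []. Qed.
Program Definition ssub_lift G (f : nt G F) (hf : forall n x, U (f n x)) : nt G ssub :=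
  @Nt k e G ssub (fun n x => @Subm _ _ (@U n) (proj1 hU n) (f n x) (hf n x)) _ _.
Next Obligation. by move=> G f hf n a x y; apply: subm_ext; apply: nt_lin. Qed.
Next Obligation. by move=> G f hf m n g x; apply: subm_ext; apply: ntP. Qed.
End ssub.

Section squot.
Variables (F : spf k e) (U : forall n, F n -> Prop) (hU : sclosed U).
Let act m n (g : GHom k e m n) (x : quom (proj1 hU m)) : quom (proj1 hU n) :=
  qpi (proj1 hU n) (sact g (qmval x)).
Let actE m n (g : GHom k e m n) x : act g (qpi (proj1 hU m) x) = qpi (proj1 hU n) (sact g x).
Proof.
apply: qpi_eq; rewrite -sactN -sactD; apply: (proj2 hU); exact: (canonP (proj1 hU m)).
Qed.
Program Definition squot : spf k e :=
  @Spf k e (fun n => quom (proj1 hU n) : lmodType k) (fun m n g x => act g x) _ _ _ _.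
Next Obligation.
move=> m n g a x y; rewrite -[x]qpiK -[y]qpiK -qpi_lin !actE -qpi_lin; congr qpi.
exact: sact_lin.
Qed.
Next Obligation.
move=> m n x a g h; rewrite -[x]qpiK !actE -qpi_lin; congr qpi; exact: sact_glin.
Qed.
Next Obligation. by move=> n x; rewrite -[x]qpiK actE sact1. Qed.
Next Obligation. by move=> l m n g f x; rewrite -[x]qpiK !actE sactM. Qed.
Program Definition squot_pi : nt F squot := @Nt k e F squot (fun n x => qpi (proj1 hU n) x) _ _.
Next Obligation. by move=> n; apply: qpi_lin. Qed.
Next Obligation. by move=> m n g x; rewrite [RHS]actE. Qed.
Lemma squot_surj n (y : squot n) : exists x, squot_pi n x = y.
Proof. by exists (qmval y); exact: qpiK. Qed.
Lemma squot_pi0 n (x : F n) : squot_pi n x = 0 <-> U x.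
Proof. exact: qpi0. Qed.
Section lift.
Variables (G : spf k e) (f : nt F G) (hf : forall n x, U x -> f n x = 0).
Let fE n x : f n (qmval (qpi (proj1 hU n) x)) = f n x.
Proof. by apply/eqP; rewrite -subr_eq0 -ntB; apply/eqP; apply: hf; apply: (canonP (proj1 hU n)). Qed.
Program Definition squot_lift : nt squot G := @Nt k e squot G (fun n x => f n (qmval x)) _ _.
Next Obligation. by move=> n a x y; rewrite -[x]qpiK -[y]qpiK -qpi_lin !fE nt_lin. Qed.
Next Obligation. by move=> m n g x; rewrite [LHS](@fE n (sact g (qmval x))) ntP. Qed.
Lemma squot_liftE n x : squot_lift n (squot_pi n x) = f n x.
Proof. exact: fE. Qed.
End lift.
End squot.

Lemma ker_closed F G (f : nt F G) : sclosed (fun n x => f n x = 0).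
Proof.
split=> [n|m n g x E]; last by rewrite ntP E sact0.
by split=> [|a x y Ex Ey]; rewrite ?nt0 // nt_lin Ex Ey scaler0 addr0.
Qed.
Lemma im_closed F G (f : nt F G) : sclosed (fun n y => exists x, y = f n x).
Proof.
split=> [n|m n g y [x ->]]; last by exists (sact g x); rewrite ntP.
by split=> [|a y y' [x ->] [x' ->]]; [exists 0; rewrite nt0|exists (a *: x + x'); rewrite nt_lin].
Qed.
Definition sker F G (f : nt F G) := ssub (ker_closed f).
Definition scoker F G (f : nt F G) := squot (im_closed f).

Section sprod.
Variables (I : Type) (F : I -> spf k e).
Program Definition sprod : spf k e :=
  @Spf k e (fun n => prodm (fun i => F i n) : lmodType k) (fun m n g x i => sact g (x i)) _ _ _ _.
Next Obligation. by move=> m n g a x y; apply: prodm_ext => i; apply: sact_lin. Qed.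
Next Obligation. by move=> m n x a g h; apply: prodm_ext => i; apply: sact_glin. Qed.
Next Obligation. by move=> n x; apply: prodm_ext => i; apply: sact1. Qed.
Next Obligation. by move=> l m n g f x; apply: prodm_ext => i; apply: sactM. Qed.
End sprod.

Program Definition spair F G : spf k e :=
  @Spf k e (fun n => (F n * G n)%type : lmodType k) (fun m n g x => (sact g x.1, sact g x.2)) _ _ _ _.
Next Obligation. by move=> F G m n g a x y /=; rewrite !sact_lin. Qed.
Next Obligation. by move=> F G m n x a g h /=; rewrite !sact_glin. Qed.
Next Obligation. by move=> F G n [x y] /=; rewrite !sact1. Qed.
Next Obligation. by move=> F G l m n g f x /=; rewrite !sactM. Qed.
Program Definition sfst F G : nt (spair F G) F := @Nt k e (spair F G) F (fun n x => x.1) _ _.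
Next Obligation. by []. Qed.
Next Obligation. by []. Qed.
Program Definition ssnd F G : nt (spair F G) G := @Nt k e (spair F G) G (fun n x => x.2) _ _.
Next Obligation. by []. Qed.
Next Obligation. by []. Qed.
Program Definition snpair F G H (f : nt H F) (g : nt H G) : nt H (spair F G) :=
  @Nt k e H (spair F G) (fun n x => (f n x, g n x)) _ _.
Next Obligation. by move=> F G H f g n a x y; rewrite !nt_lin. Qed.
Next Obligation. by move=> F G H f g m n h x; rewrite /= !ntP. Qed.

Local Notation sproj P := (projective (C := Pcat k e) P).
Lemma surj_epi F G (f : nt F G) : (forall n y, exists x, f n x = y) -> epi (C := Pcat k e) f.
Proof.
move=> fs H g h E; apply: nt_ext => n y; have [x <-] := fs n y.
exact: (congr1 (fun t : nt F H => t n x) E).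
Qed.
Lemma projective_lift (P : spf k e) F G (q : nt F G) (f : nt P G) : sproj P ->
  (forall n y, exists x, q n x = y) -> exists g : nt P F, forall n x, q n (g n x) = f n x.
Proof.
move=> hP /surj_epi qe; have [g E] := hP _ _ q qe f; exists g => n x.
exact: (congr1 (fun t : nt P G => t n x) E).
Qed.
(** Lifting against the corestriction of [q] to its image, which is onto. *)
Lemma projective_lift_im (P : spf k e) F G (q : nt F G) (f : nt P G) : sproj P ->
  (forall n x, exists y, f n x = q n y) -> exists g : nt P F, forall n x, q n (g n x) = f n x.
Proof.
move=> hP h; pose I := ssub (im_closed q).
have qI n x : exists x0, q n x = q n x0 by exists x.
have [n [x y]|g Eg] := @projective_lift P F I (@ssub_lift _ _ (im_closed q) _ q qI)
  (@ssub_lift _ _ (im_closed q) _ f h) hP.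
  by rewrite /I /= in x y *; exists (sval (cid y)); apply: subm_ext => /=; case: cid.
by exists g => n x; exact: (congr1 (@smval _ _ _ _) (Eg n x)).
Qed.

Lemma retract_projective (P Q : spf k e) (i : nt P Q) (r : nt Q P) :
  (forall n x, r n (i n x) = x) -> sproj Q -> sproj P.
Proof.
move=> ri hQ F G q qe f; have [g E] := hQ _ _ q qe (nt_comp f r).
exists (nt_comp g i); apply: nt_ext => n x /=.
by have := congr1 (fun t : nt Q G => t n (i n x)) E; rewrite /= ri.
Qed.
Lemma spair_projective (P Q : spf k e) : sproj P -> sproj Q ->
  sproj (spair P Q).
Proof.
move=> hP hQ F G q qe f.
have in1_lin : exists i : nt P (spair P Q), forall n x, i n x = (x, 0).
  by exists (snpair (nt_id P) 0).
have in2_lin : exists i : nt Q (spair P Q), forall n x, i n x = (0, x).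
  by exists (snpair 0 (nt_id Q)).
have [[i1 E1] [i2 E2]] := (in1_lin, in2_lin).
have [g1 Eg1] := hP _ _ q qe (nt_comp f i1); have [g2 Eg2] := hQ _ _ q qe (nt_comp f i2).
exists (nt_comp g1 (sfst P Q) + nt_comp g2 (ssnd P Q)); apply: nt_ext => n [x y] /=.
rewrite ntD.
have -> : q n (g1 n x) = f n (x, 0) by rewrite -E1; exact: (congr1 (fun t : nt P G => t n x) Eg1).
have -> : q n (g2 n y) = f n (0, y) by rewrite -E2; exact: (congr1 (fun t : nt Q G => t n y) Eg2).
by rewrite -ntD; congr (f n _); congr pair; rewrite ?addr0 ?add0r.
Qed.

Program Definition yoneda F m (x : F m) : nt (hrep k e m) F :=
  @Nt k e (hrep k e m) F (fun n g => sact g x) _ _.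
Next Obligation. by move=> F m x n a g h; apply: sact_glin. Qed.
Next Obligation. by move=> F m x l n g h; apply: sactM. Qed.
Lemma nt_hrep F m (f : nt (hrep k e m) F) n (g : hrep k e m n) : f n g = sact g (f m (gid k e m)).
Proof. by rewrite -ntP /= gcompm1. Qed.
End functors.

Arguments GRing.opp : simpl never.

(** * Complexes up to homotopy *)

Section complexes.
Variables (k : finFieldType) (e : nat).
Implicit Types A B X Y P : cpx k e.

Definition ntE := (@ntEB k e, @ntED k e, @ntEN k e, @ntEZ k e, @ntE0 k e).

(** The transport along an equation between degrees, made total by the value 0 when they differ. No
    proof of equality has to be carried along, in keeping with the two-index differentials. From
    here on it hides the choice operator, which is written [boolp.cid]. *)
Definition cid (X : int -> spf k e) i j : nt (X i) (X j) :=
  match i =P j with ReflectT E => ecast z (nt (X i) (X z)) E (nt_id (X i)) | _ => 0 end.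
Lemma cidxx (X : int -> spf k e) i n (x : X i n) : cid X i i n x = x.
Proof. by rewrite /cid; case: eqP => // E; rewrite eq_axiomK. Qed.
Lemma cid0 (X : int -> spf k e) i j : i != j -> cid X i j = 0.
Proof. by rewrite /cid; case: eqP. Qed.
Lemma cid_nat (X Y : int -> spf k e) (f : forall i, nt (X i) (Y i)) i j n x :
  f j n (cid X i j n x) = cid Y i j n (f i n x).
Proof. by have [<-|ne] := eqVneq i j; rewrite ?cidxx // !cid0 // !ntE0 nt0. Qed.
Lemma cid_trans (X : int -> spf k e) i j l n x : i = j -> cid X j l n (cid X i j n x) = cid X i l n x.
Proof. by move=> <-; rewrite cidxx. Qed.

Lemma cdE0 X i j n (x : X i n) : j != i + 1 -> cd X i j n x = 0.
Proof. by move=> ne; rewrite cd0. Qed.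
Lemma cdK X i j l n (x : X i n) : cd X j l n (cd X i j n x) = 0.
Proof. exact: (congr1 (fun f : nt _ _ => f n x) (cdd X i j l)). Qed.
Lemma cd_cid X i j l n (y : X i n) :
  cd X j l n (cid X i j n y) = cid X (j + 1) l n (cd X i (j + 1) n y).
Proof.
have [<-|ne] := eqVneq i j; last first.
  by rewrite cid0 // ntE0 nt0 cdE0 ?nt0 // (inj_eq (addIr 1)) eq_sym.
rewrite cidxx; have [<-|ne] := eqVneq (i + 1) l; first by rewrite cidxx.
by rewrite cid0 // ntE0 cdE0 // eq_sym.
Qed.
Lemma cid_cd X i j l n (y : X i n) : j = i + 1 ->
  cid X j l n (cd X i j n y) = cd X (l - 1) l n (cid X i (l - 1) n y).
Proof.
move=> ->; rewrite cd_cid subrK cidxx; have [<-|ne] := eqVneq (i + 1) l; first by rewrite cidxx.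
by rewrite cid0 // ntE0 cdE0 // eq_sym.
Qed.

Record chom X Y := CHom {
  ch :> forall i, nt (X i) (Y i);
  chP : forall i j n x, ch j n (cd X i j n x) = cd Y i j n (ch i n x) }.

Lemma chomP X Y (f : forall i, nt (X i) (Y i)) :
  (forall i n x, f (i + 1) n (cd X i (i + 1) n x) = cd Y i (i + 1) n (f i n x)) ->
  forall i j n x, f j n (cd X i j n x) = cd Y i j n (f i n x).
Proof.
move=> h i j n x; have [->|ne] := eqVneq j (i + 1); first exact: h.
by rewrite !cdE0 // nt0.
Qed.

(** Stated in degree i + 1, as is [qisP] below, so that only additions of 1 occur in the types and i
    - 1 + 1 need not be simplified inside them. *)
Definition acyclic X := forall i n (x : X (i + 1) n), cd X (i + 1) (i + 1 + 1) n x = 0 ->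
  exists y : X i n, x = cd X i (i + 1) n y.

Lemma qisP X Y (f : chom X Y) : cpx_qis f <-> forall i n,
  (forall x : X (i + 1) n, cd X (i + 1) (i + 1 + 1) n x = 0 ->
     (exists y, f (i + 1) n x = cd Y i (i + 1) n y) -> exists x', x = cd X i (i + 1) n x') /\
  (forall y : Y (i + 1) n, cd Y (i + 1) (i + 1 + 1) n y = 0 ->
     exists x z, cd X (i + 1) (i + 1 + 1) n x = 0 /\ f (i + 1) n x = y + cd Y i (i + 1) n z).
Proof.
split=> h i n; first by have := h (i + 1) n; rewrite addrK.
by have := h (i - 1) n; rewrite subrK.
Qed.

Program Definition ccomp X Y Z (g : chom Y Z) (f : chom X Y) : chom X Z :=
  @CHom X Z (fun i => nt_comp (g i) (f i)) _.
Next Obligation. by move=> X Y Z g f i j n x; rewrite /= !chP. Qed.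
Program Definition cidm X : chom X X := @CHom X X (fun i => nt_id (X i)) _.
Next Obligation. by []. Qed.

Lemma qis_comp X Y Z (g : chom Y Z) (f : chom X Y) :
  cpx_qis f -> cpx_qis g -> cpx_qis (ccomp g f).
Proof.
move=> /qisP qf /qisP qg; apply/qisP => i n; have [f1 f2] := qf i n; have [g1 g2] := qg i n.
split=> [x dx [y Ey]|z dz].
  by apply: f1 => //; apply: g1; [rewrite -chP dx nt0|exists y].
have [y [z' [dy Ey]]] := g2 z dz; have [x [y' [dx Ex]]] := f2 y dy.
exists x, (z' + g i n y'); split=> //; by rewrite /= Ex ntD Ey chP ntD addrA.
Qed.
Lemma qis_cancell X Y Z (g : chom Y Z) (f : chom X Y) :
  cpx_qis g -> cpx_qis (ccomp g f) -> cpx_qis f.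
Proof.
move=> /qisP qg /qisP qgf; apply/qisP => i n; have [f1 f2] := qgf i n; have [g1 g2] := qg i n.
split=> [x dx [y Ey]|y dy].
  by apply: f1 => //; exists (g i n y); rewrite /= Ey chP.
have dgy : cd Z (i + 1) (i + 1 + 1) n (g (i + 1) n y) = 0 by rewrite -(chP g) dy nt0.
have [x [z [dx Ex]]] := f2 _ dgy.
have [||y' Ey'] := g1 (f (i + 1) n x - y).
- by rewrite ntB -(chP f) dx nt0 dy subr0.
- by exists z; rewrite ntB; move: Ex; rewrite /= => ->; rewrite [g _ _ _ + _]addrC addrK.
by exists x, y'; split=> //; rewrite -Ey' [y + _]addrC subrK.
Qed.
Lemma qis_bij X Y (f : chom X Y) :
  (forall i n x, f i n x = 0 -> x = 0) -> (forall i n y, exists x, f i n x = y) -> cpx_qis f.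
Proof.
move=> f_inj f_surj; apply/qisP => i n; split=> [x dx [y Ey]|y dy].
  have [x' Ex'] := f_surj i n y; exists x'; apply/eqP; rewrite -subr_eq0; apply/eqP.
  by apply: f_inj; rewrite ntB chP Ex' Ey subrr.
have [x Ex] := f_surj _ n y; exists x, 0; rewrite nt0 addr0; split=> //.
by apply: f_inj; rewrite chP Ex dy.
Qed.
Lemma qis_id X : cpx_qis (cidm X).
Proof. by apply: qis_bij => [i n x|i n y] //=; exists y. Qed.

Section cone.
Variables (A B : cpx k e) (w : chom A B).

Let dcone (i j : int) : nt (spair (A (i + 1)) (B i)) (spair (A (j + 1)) (B j)) :=
  snpair (- nt_comp (cd A (i + 1) (j + 1)) (sfst _ _))
    (nt_comp (cd B i j) (ssnd _ _) + nt_comp (nt_comp (cid B (i + 1) j) (w (i + 1))) (sfst _ _)).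
Let dconeE (i j : int) n (a : A (i + 1) n) (b : B i n) : dcone i j n (a, b) =
  (- cd A (i + 1) (j + 1) n a, cd B i j n b + cid B (i + 1) j n (w (i + 1) n a)).
Proof. by congr pair; rewrite ntEN. Qed.
Program Definition cone : cpx k e :=
  @Cpx k e (fun i => spair (A (i + 1)) (B i)) dcone _ _.
Next Obligation.
move=> i j ne; apply: nt_ext => n [a b]; rewrite dconeE !cdE0 //.
  by rewrite cid0 1?eq_sym // ntE0 oppr0 addr0.
by rewrite (inj_eq (addIr 1)).
Qed.
Next Obligation.
move=> i j l; apply: nt_ext => n [a b]; 
have -> : nt_comp (dcone j l) (dcone i j) n (a, b) = dcone j l n (dcone i j n (a, b)) by [].
rewrite !dconeE.
rewrite !ntD !ntN !cdK oppr0 add0r; congr pair; first by rewrite oppr0.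
by rewrite cd_cid chP subrr.
Qed.

Lemma coneE (i j : int) n (a : A (i + 1) n) (b : B i n) : cd cone i j n (a, b) =
  (- cd A (i + 1) (j + 1) n a, cd B i j n b + cid B (i + 1) j n (w (i + 1) n a)).
Proof. exact: dconeE. Qed.

Lemma cone_acyclic : cpx_qis w -> acyclic cone.
Proof.
move=> /qisP qw i n [a b]; rewrite coneE cidxx => -[/eqP]; rewrite oppr_eq0 => /eqP da Eb.
have [q1 _] := qw (i + 1) n; have [_ q2] := qw i n.
have [|a0 Ea0] := q1 a da.
  by exists (- b); rewrite ntN; apply/eqP; rewrite -addr_eq0 [X in X == _]addrC Eb.
have [|a1 [b1 [da1 Ea1]]] := q2 (b + w (i + 1) n a0).
  by rewrite ntD -chP -Ea0.
exists (a1 - a0, - b1); rewrite coneE cidxx ntB da1 sub0r opprK -Ea0; congr pair.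
by rewrite ntB Ea1 ntN [b + _ + _]addrAC addrK addrCA addNr addr0.
Qed.
End cone.

Definition nullh X Y (f : forall i, nt (X i) (Y i)) :=
  exists h : forall i j, nt (X i) (Y j), forall i n (x : X (i + 1) n),
    f (i + 1) n x = cd Y i (i + 1) n (h (i + 1) i n x) + h (i + 1 + 1) (i + 1) n (cd X (i + 1) (i + 1
      + 1) n x).
Definition hmt X Y (f g : chom X Y) := nullh (fun i => f i - g i : nt (X i) (Y i)).

Lemma nullh0 X Y (f : forall i, nt (X i) (Y i)) : (forall i n x, f i n x = 0) -> nullh f.
Proof. by move=> f0; exists (fun i j => 0) => i n x; rewrite f0 !ntE0 nt0 addr0. Qed.
Lemma nullhD X Y (f g : forall i, nt (X i) (Y i)) a : nullh f -> nullh g ->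
  nullh (fun i => a *: f i + g i : nt (X i) (Y i)).
Proof.
move=> [h H] [h' H']; exists (fun i j => a *: h i j + h' i j) => i n x.
by rewrite !(ntED, ntEZ) !ntD !ntZ H H' scalerDr addrACA.
Qed.
Lemma nullh_eq X Y (f g : forall i, nt (X i) (Y i)) :
  (forall i n x, f i n x = g i n x) -> nullh f -> nullh g.
Proof. by move=> E [h H]; exists h => i n x; rewrite -E. Qed.
Lemma nullh_compl X Y Z (g : chom Y Z) (f : forall i, nt (X i) (Y i)) :
  nullh f -> nullh (fun i => nt_comp (g i) (f i)).
Proof.
by move=> [h H]; exists (fun i j => nt_comp (g j) (h i j)) => i n x; rewrite /= H ntD chP.
Qed.
Lemma hmt_sym X Y (f g : chom X Y) : hmt f g -> hmt g f.
Proof.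
move=> /(nullhD (-1)) /(_ (@nullh0 X Y (fun i => 0 : nt (X i) (Y i)) (fun _ _ _ => erefl))).
by apply: nullh_eq => i n x; rewrite !ntE addr0 scaleN1r opprB.
Qed.

Lemma qis_hmt X Y (f g : chom X Y) : hmt f g -> cpx_qis f -> cpx_qis g.
Proof.
move=> [h H] /qisP qf; apply/qisP => i n; have [f1 f2] := qf i n.
have E x : cd X (i + 1) (i + 1 + 1) n x = 0 -> g (i + 1) n x = f (i + 1) n x - cd Y i (i + 1) n (h (i
  + 1) i n x).
  by move=> dx; have := H i n x; rewrite dx nt0 addr0 ntEB => <-; rewrite subKr.
split=> [x dx [y Ey]|y dy].
  apply: f1 => //; exists (y + h (i + 1) i n x).
  by move: Ey; rewrite E // => /eqP; rewrite subr_eq => /eqP ->; rewrite ntD.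
have [x [z [dx Ex]]] := f2 y dy; exists x, (z - h (i + 1) i n x); split=> //.
by rewrite E // Ex ntB addrA.
Qed.

(** K-projective complexes in the sense of Spaltenstein. *)
Definition hproj P := forall A (g : chom P A), acyclic A -> nullh g.

Lemma shift_acyclic s A : acyclic A -> acyclic (cpx_shift s A).
Proof.
move=> ac i n x; rewrite ntEZ => E.
have sN : (-1 : k) ^ s != 0 by rewrite expfz_neq0 ?oppr_eq0 ?oner_eq0.
have {}E : cd A (i + 1 + s) (i + 1 + 1 + s) n x = 0.
  by move: E => /eqP; rewrite scaler_eq0 (negPf sN) => /eqP.
have := ac (i + s) n; rewrite [i + s + 1]addrAC [i + 1 + s + 1]addrAC => /(_ x E) [y ->].
by exists (((-1) ^ s)^-1 *: y); rewrite [RHS]ntEZ ntZ scalerA divff ?scale1r.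
Qed.

Section hproj_lifting.
Variables (P Y Y' : cpx k e) (hP : hproj P) (w : chom Y Y') (qw : cpx_qis w).

(** The map (0, f) into the cone of [w] is null homotopic. The component of the homotopy in Y is the
    lift; the component in Y' is the homotopy between [f] and its lift followed by [w]. *)
Lemma hproj_surj (f : chom P Y') : exists f' : chom P Y, hmt (ccomp w f') f.
Proof.
have cg i j n x : (snpair 0 (f j) : nt (P j) (cone w j)) n (cd P i j n x) =
    cd (cone w) i j n ((snpair 0 (f i) : nt (P i) (cone w i)) n x).
  by rewrite coneE !ntE0 !nt0 oppr0 addr0 -chP.
have [h H] := @hP _ (@CHom P (cone w) (fun i => snpair 0 (f i)) cg) (cone_acyclic qw).
have [h1 [h2 hE]] : exists (h1 : forall i j : int, nt (P i) (Y (j + 1))) (h2 : forall i j, nt (P i) (Y' j)),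
    forall i j n x, h i j n x = (h1 i j n x, h2 i j n x).
  exists (fun i j => nt_comp (sfst _ _) (h i j)), (fun i j => nt_comp (ssnd _ _) (h i j)).
  by move=> i j n x /=; case: (h i j n x).
have H1 i n (x : P (i + 1) n) :
    cd Y (i + 1) (i + 1 + 1) n (h1 (i + 1) i n x) = h1 (i + 1 + 1) (i + 1) n (cd P (i + 1) (i + 1 + 1) n x).
  have /(congr1 fst) := H i n x; rewrite !hE coneE => /esym/eqP.
  by rewrite [X in X == _]addrC subr_eq0 => /eqP <-.
have H2 i n (x : P (i + 1) n) : f (i + 1) n x = cd Y' i (i + 1) n (h2 (i + 1) i n x) +
    w (i + 1) n (h1 (i + 1) i n x) + h2 (i + 1 + 1) (i + 1) n (cd P (i + 1) (i + 1 + 1) n x).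
  by have /(congr1 snd) := H i n x; rewrite !hE coneE cidxx.
pose f' i := nt_comp (cid Y (i - 1 + 1) i) (h1 i (i - 1)).
have f'E i n x : f' (i + 1) n x = h1 (i + 1) i n x.
  by rewrite /f' /= [in LHS](addrK 1 i) cidxx.
have cf' : forall i n x, f' (i + 1) n (cd P i (i + 1) n x) = cd Y i (i + 1) n (f' i n x).
  move=> i n; rewrite -[i](subrK 1); move: (i - 1) => {}i x.
  by rewrite !f'E H1.
exists (CHom (chomP cf')).
exists (fun i j => - h2 i j) => i n x.
rewrite ntEB -[ccomp w _ (i + 1) n x]/(w (i + 1) n (f' (i + 1) n x)) f'E H2 !ntEN ntN opprD opprD
  addrA addrA; congr (_ - _).
by rewrite addrAC subrr add0r.
Qed.

(** A null homotopy [u] of w f turns (f, - u) into a chain map to the acyclic complex cone(w)[-1].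
    The first component of a null homotopy of that map is one for [f]. *)
Lemma hproj_inj (f : chom P Y) : nullh (ccomp w f) -> nullh f.
Proof.
move=> [u U].
pose g i : nt (P i) (cpx_shift (- 1) (cone w) i) :=
  snpair (nt_comp (cid Y i (i - 1 + 1)) (f i)) (- u i (i - 1)).
have gE i n x : g i n x = (cid Y i (i - 1 + 1) n (f i n x), - u i (i - 1) n x).
  by congr pair; rewrite ntEN.
have dE i j n a b : cd (cpx_shift (- 1) (cone w)) i j n (a, b) =
    (cd Y (i - 1 + 1) (j - 1 + 1) n a,
     - (cd Y' (i - 1) (j - 1) n b + cid Y' (i - 1 + 1) (j - 1) n (w _ n a))).
  by rewrite ntEZ coneE exprN1 invrN1 scaleN1r; congr pair; rewrite opprK.
have cg i n x : g (i + 1) n (cd P i (i + 1) n x) = cd (cpx_shift (- 1) (cone w)) i (i + 1) n (g i n x).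
  rewrite !gE dE; congr pair.
    by rewrite chP cd_cid subrK !cidxx addrK; rewrite cidxx.
  congr (- _); rewrite ntN -cid_nat cid_trans ?subrK //.
  move: x; rewrite -[i](subrK 1); move: (i - 1) => {}i x.
  rewrite !addrK cidxx; have := U i n x; rewrite /= => ->.
  by rewrite addKr.
have [h H] := @hP _ (CHom (chomP cg)) (shift_acyclic (s := - 1) (cone_acyclic qw)).
exists (fun i j => nt_comp (cid Y (j - 1 + 1) j) (nt_comp (sfst _ _) (h i j))) => i n x.
have hE j l y : h j l n y = ((h j l n y).1, (h j l n y).2) by case: (h j l n y).
have := H i n x; rewrite hE dE [CHom _ _ _ _]gE => /(congr1 fst).
rewrite [RHS]/= [LHS]/= => /(congr1 (cid Y (i + 1 - 1 + 1) (i + 1) n)).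
rewrite cid_trans ?subrK // cidxx ntD => ->; congr (_ + _).
by rewrite cid_cd ?addrK.
Qed.
End hproj_lifting.

Definition bounded X := exists N : nat, forall i : int, (N < `|i|)%N -> forall n (x : X i n), x = 0.

(** Descending induction on the degree, starting above the last nonzero term; [m] measures how far
    below N the homotopy is already correct. *)
Lemma bounded_projective_hproj P : bounded P -> (forall i, projective (C := Pcat k e) (P i)) -> hproj P.
Proof.
move=> [N hN] pP A g ac.
have step m : exists h : forall i j, nt (P i) (A j), forall i : int, (N%:Z - m%:Z <= i)%R ->
    forall n (x : P (i + 1) n), g (i + 1) n x = cd A i (i + 1) n (h (i + 1) i n x) +
      h (i + 1 + 1) (i + 1) n (cd P (i + 1) (i + 1 + 1) n x).
  elim: m => [|m [h H]].
    exists (fun i j => 0) => i; rewrite subr0 => Ni n x.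
    have -> : x = 0 by apply: hN; move: Ni; lia.
    by rewrite !nt0 addr0.
  pose c := N%:Z - m.+1%:Z.
  (* The part of [g] not yet accounted for. Its values are cocycles, hence boundaries, so it lifts
     through the differential by projectivity. *)
  pose r : nt (P (c + 1)) (A (c + 1)) := g (c + 1) - nt_comp (h (c + 1 + 1) (c + 1)) (cd P (c + 1) (c
    + 1 + 1)).
  have [|v Ev] := @projective_lift_im _ _ (P (c + 1)) _ _ (cd A c (c + 1)) r (pP _).
    move=> n x; apply: ac; rewrite /r ntEB ntB /= -chP.
    have := H (c + 1) _ n (cd P (c + 1) (c + 1 + 1) n x); rewrite cdK nt0 addr0 => ->.
      by rewrite subrr.
    by rewrite /c; lia.
  pose T i := forall j, nt (P i) (A j).
  pose h' : forall i, T i := dfwith h (fun j => nt_comp (cid A c j) v : nt (P (c + 1)) (A j)).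
  exists h' => i ci n x.
  have out : i + 1 + 1 != c + 1 by rewrite /c; apply/eqP; move: ci; lia.
  have E2 : h' (i + 1 + 1) = h (i + 1 + 1) by rewrite /h' dfwith_out // eq_sym.
  rewrite E2; have [Ei|ne] := eqVneq i c.
    subst i; rewrite /h' dfwith_in /= cidxx Ev /r ntEB /= subrK //.
  have -> : h' (i + 1) = h (i + 1) by rewrite /h' dfwith_out // (inj_eq (addIr 1)) eq_sym.
  by apply: H; move: ci ne; rewrite /c => ? /eqP ?; lia.
(* The identity then holds from degree - N - 2 on; below it P vanishes. *)
have [h H] := step (N + N + 2)%N; exists h => i n x.
have [le|lt] := leP (N%:Z - (N + N + 2)%N%:Z) i; first exact: H.
by have -> : x = 0 by [apply: hN; lia]; rewrite !nt0 addr0.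
Qed.
End complexes.

(** * Perfect complexes *)

Section perfect_complexes.
Variables (k : finFieldType) (e : nat).
Implicit Types A B C M N P : cpx k e.
Implicit Types F G : spf k e.
Local Notation sproj P := (projective (C := Pcat k e) P).

Definition fd F := forall n, fin_dim (F n).
Definition perf M := exists P, [/\ bounded P, forall i, sproj (P i), forall i, fd (P i) &
  exists q : chom P M, cpx_qis q].

Lemma fin_dim_image (V W : lmodType k) (f : V -> W) :
  fin_dim V -> (forall y, exists x, f x = y) -> fin_dim W.
Proof.
move=> /fin_dimP [s hs] fs; apply/fin_dimP; exists (map f s) => y.
by have [x <-] := fs y; apply: map_f.
Qed.
Lemma fin_dim_inj (V W : lmodType k) (f : V -> W) : fin_dim W -> injective f -> fin_dim V.
Proof.
move=> /fin_dimP [s hs] fi; apply/fin_dimP.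
have /choice [g hg] : forall y, exists x, (exists x', f x' = y) -> f x = y.
  move=> y; have [[x' Ex]|nx] := EM (exists x', f x' = y); first by exists x'.
  by exists 0 => /nx.
exists (map g s) => x; have -> : x = g (f x) by apply/esym/fi; apply: hg; exists x.
exact: map_f.
Qed.
Lemma fin_dim_pair (V W : lmodType k) : fin_dim V -> fin_dim W -> fin_dim (V * W)%type.
Proof.
move=> /fin_dimP [s hs] /fin_dimP [t ht]; apply/fin_dimP.
exists [seq (x, y) | x <- s, y <- t] => -[x y]; exact: allpairs_f.
Qed.

Lemma perf_qis M N (f : chom M N) : cpx_qis f -> perf M -> perf N.
Proof.
move=> qf [P [bP pP fP [q qq]]]; exists P; split=> //.
by exists (ccomp f q); apply: qis_comp.
Qed.
Lemma perf_qis_inv M N (f : chom N M) : cpx_qis f -> perf M -> perf N.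
Proof.
move=> qf [P [bP pP fP [q qq]]]; exists P; split=> //.
have [f' Hf'] := hproj_surj (bounded_projective_hproj bP pP) qf q.
by exists f'; apply: qis_cancell qf _; apply: qis_hmt (hmt_sym Hf') qq.
Qed.

Section cone_map.
Variables (M N P Q : cpx k e) (w : chom M N) (v : chom P Q) (q : chom P M) (r : chom Q N).
Hypothesis H : hmt (ccomp r v) (ccomp w q).

(** The homotopy that makes the square commute corrects the second component. That the map is a
    quasi-isomorphism is the five lemma for the two triangles, checked on elements. *)
Lemma cone_map_ex : exists f : chom (cone v) (cone w), cpx_qis q -> cpx_qis r -> cpx_qis f.
Proof.
have [h Hh] := H.
have {}Hh i n x : r (i + 1) n (v (i + 1) n x) = w (i + 1) n (q (i + 1) n x) +
    cd N i (i + 1) n (h (i + 1) i n x) + h (i + 1 + 1) (i + 1) n (cd P (i + 1) (i + 1 + 1) n x).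
  have := Hh i n x; rewrite ntEB => /eqP; rewrite subr_eq => /eqP /= ->; zmod.
pose f (i : int) : nt (cone v i) (cone w i) := snpair (nt_comp (q (i + 1)) (sfst _ _))
   (nt_comp (r i) (ssnd _ _) + nt_comp (h (i + 1) i) (sfst _ _)).
have fE i n a b : f i n (a, b) = (q (i + 1) n a, r i n b + h (i + 1) i n a) by [].
have cf i n x : f (i + 1) n (cd (cone v) i (i + 1) n x) = cd (cone w) i (i + 1) n (f i n x).
  case: x => a b; rewrite coneE !fE coneE !ntN !cidxx !ntD -!chP; congr pair.
  rewrite Hh; zmod.
exists (CHom (chomP cf)) => /qisP qq /qisP qr; apply/qisP => i n.
have [q1 _] := qq (i + 1) n; have [_ q2] := qq i n; have [r1 _] := qr i n.
have [_ q2'] := qq (i + 1) n; have [_ r2] := qr i n; have [r1' _] := qr (i + 1) n.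
split=> [[a b]|[a b]].
  rewrite coneE cidxx => -[/eqP]; rewrite oppr_eq0 => /eqP da Eb [[m z]].
  rewrite [LHS]fE coneE cidxx => -[Em Ez].
  have [|p1 Ep1] := q1 a da; first by exists (- m); rewrite ntN.
  have [|p2 [m' [dp2 Ep2]]] := q2 (m + q (i + 1) n p1).
    by rewrite ntD -chP -Ep1 Em addrN.
  have := Hh i n p1; have := Hh i n p2; rewrite dp2 nt0 addr0 Ep2 -Ep1 => H2 H1.
  have [||b' Eb'] := r1 (b + v (i + 1) n p1 - v (i + 1) n p2).
  - by rewrite ntB ntD -!chP -Ep1 dp2 nt0 subr0.
  - exists (z + h (i + 1) i n p1 - h (i + 1) i n p2 - w i n m').
    have Er : r (i + 1) n b = cd N i (i + 1) n z + w (i + 1) n m - h (i + 1 + 1) (i + 1) n a.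
      by rewrite -Ez addrK.
    rewrite !(ntB, ntD) H1 H2 Er !ntD -chP; zmod.
  - exists (p2 - p1, b'); rewrite coneE cidxx !ntB dp2 -Ep1 -Eb'; congr pair; zmod.
rewrite coneE cidxx => -[/eqP]; rewrite oppr_eq0 => /eqP da Eb.
have [p1 [m [dp1 Ep1]]] := q2' a da.
have := Hh (i + 1) n p1; rewrite dp1 nt0 addr0 Ep1 ntD => H1.
have [||p0 Ep0] := r1' (v (i + 1 + 1) n p1).
- by rewrite -chP dp1 nt0.
- exists (w (i + 1) n m + h (i + 1 + 1) (i + 1) n p1 - b); rewrite H1 ntB ntD -chP.
  have -> : w (i + 1 + 1) n a = - cd N (i + 1) (i + 1 + 1) n b.
    by apply/eqP; rewrite -addr_eq0 [X in X == _]addrC Eb.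
  zmod.
have [|y [z [dy Ey]]] := r2 (r (i + 1) n p0 - w (i + 1) n m - h (i + 1 + 1) (i + 1) n p1 + b).
  rewrite ntD !ntB -!chP -Ep0 H1.
  have -> : w (i + 1 + 1) n a = - cd N (i + 1) (i + 1 + 1) n b.
    by apply/eqP; rewrite -addr_eq0 [X in X == _]addrC Eb.
  zmod.
exists (p1, y - p0), (- m, z); split; first by rewrite coneE cidxx ntB dp1 dy -Ep0; congr pair; zmod.
have addp (V W : zmodType) (x1 x2 : V) (y1 y2 : W) : (x1, y1) + (x2, y2) = (x1 + x2, y1 + y2) by [].
by rewrite [LHS]fE coneE cidxx ntB Ey !ntN Ep1 [RHS]addp; congr pair; zmod.
Qed.
End cone_map.

Lemma perf_cone M N (w : chom M N) : perf M -> perf N -> perf (cone w).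
Proof.
move=> [P [bP pP fP [q qq]]] [Q [bQ pQ fQ [r qr]]].
have [v Hv] := hproj_surj (bounded_projective_hproj bP pP) qr (ccomp w q).
have [f qf] := cone_map_ex Hv.
exists (cone v); split.
- move: bP bQ => [n hn] [m hm]; exists (n + m + 1)%N => i lt l [x y].
  by rewrite (hn _ _ _ x) ?(hm _ _ _ y) //; lia.
- by move=> i; apply: spair_projective.
- by move=> i n; apply: fin_dim_pair; [exact: fP|exact: fQ].
- by exists f; apply: qf.
Qed.

Lemma signN0 (s : int) : (-1 : k) ^ s != 0.
Proof. by rewrite expfz_neq0 ?oppr_eq0 ?oner_eq0. Qed.

Lemma cd_shiftE s M i j n (x : M (i + s) n) :
  cd (cpx_shift s M) i j n x = (-1) ^ s *: cd M (i + s) (j + s) n x.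
Proof. by []. Qed.
Lemma cd_shift1E M i j n (x : M (i + 1) n) : cd (cpx_shift 1 M) i j n x = - cd M (i + 1) (j + 1) n x.
Proof. by rewrite cd_shiftE expr1z scaleN1r. Qed.

Program Definition shiftm s M N (f : chom M N) : chom (cpx_shift s M) (cpx_shift s N) :=
  @CHom _ _ (cpx_shift s M) (cpx_shift s N) (fun i => f (i + s)) _.
Next Obligation. by move=> s M N f i j n x; rewrite !ntEZ ntZ chP. Qed.

Lemma shift_qis s M N (f : chom M N) : cpx_qis f -> cpx_qis (shiftm s f).
Proof.
move=> /qisP qf; apply/qisP => i n; have [] := qf (i + s) n.
rewrite [i + s + 1]addrAC [i + 1 + s + 1]addrAC => f1 f2.
have K j l m (x : M (j + s) m) : cd (cpx_shift s M) j l m x = 0 <-> cd M (j + s) (l + s) m x = 0.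
  rewrite cd_shiftE; split=> [/eqP|->]; last by rewrite scaler0.
  by rewrite scaler_eq0 (negPf (signN0 s)) => /eqP.
have K' j l m (x : N (j + s) m) : cd (cpx_shift s N) j l m x = 0 <-> cd N (j + s) (l + s) m x = 0.
  rewrite cd_shiftE; split=> [/eqP|->]; last by rewrite scaler0.
  by rewrite scaler_eq0 (negPf (signN0 s)) => /eqP.
split=> [x /K dx [y Ey]|y /K' dy].
  have [|x' ->] := f1 x dx; first by exists ((-1) ^ s *: y); rewrite Ey ntEZ ntZ.
  by exists (((-1) ^ s)^-1 *: x'); rewrite ntEZ ntZ scalerA divff ?signN0 // scale1r.
have [x [z [dx Ex]]] := f2 y dy; exists x, (((-1) ^ s)^-1 *: z); split; first exact/K.
by rewrite [LHS]Ex ntEZ ntZ scalerA divff ?signN0 // scale1r.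
Qed.

Lemma perf_shift s M : perf M -> perf (cpx_shift s M).
Proof.
move=> [P [[N hN] pP fP [q qq]]]; exists (cpx_shift s P); split.
- exists (N + `|s|)%N => i lt n x; apply: hN; lia.
- by move=> i; apply: pP.
- by move=> i; apply: fP.
- by exists (shiftm s q); apply: shift_qis.
Qed.

Lemma unshift_proof s M i j n (x : cpx_shift (- s) (cpx_shift s M) i n) :
  cid M (j - s + s) j n (cd (cpx_shift (- s) (cpx_shift s M)) i j n x) = cd M i j n (cid M (i - s + s) i n x).
Proof.
rewrite !ntEZ scalerA -expfzDr ?oppr_eq0 ?oner_eq0 // addNr expr0z scale1r.
rewrite cd_cid; have [->|ne] := eqVneq j (i + 1); last first.
  rewrite (cid0 M (i := i + 1)) 1?eq_sym // ntE0 cdE0 ?nt0 //.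
  by apply: contra ne => /eqP; rewrite !subrK => ->.
have E (y : M (i - s + s) n) : cid M (i + 1 - s + s) (i + 1) n (cd M (i - s + s) (i + 1 - s + s) n y) =
    cd M (i - s + s) (i + 1) n y by rewrite [i + 1 - s + s]subrK cidxx.
by rewrite cidxx E.
Qed.
Definition unshift s M : chom (cpx_shift (- s) (cpx_shift s M)) M :=
  CHom (@unshift_proof s M).
Lemma unshift_qis s M : cpx_qis (unshift s M).
Proof.
apply: qis_bij => i n x /=; last by exists (cid M i (i - s + s) n x); rewrite cid_trans ?subrK // cidxx.
move=> /(congr1 (cid M i (i - s + s) n)); rewrite nt0 cid_trans ?subrK //.
by rewrite cidxx.
Qed.
Lemma perf_unshift s M : perf (cpx_shift s M) -> perf M.
Proof. by move=> /(perf_shift (- s)); apply: perf_qis (unshift_qis s M). Qed.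

Section short_exact_complexes.
Variables (A B C : cpx k e) (f : chom A B) (g : chom B C).
Hypotheses (f_inj : forall i n x, f i n x = 0 -> x = 0)
  (g_surj : forall i n z, exists y, g i n y = z)
  (gf0 : forall i n x, g i n (f i n x) = 0)
  (exact_B : forall i n y, g i n y = 0 -> exists x, y = f i n x).

Let g_cone_proof i n (x : cone f i n) :
  g (i + 1) n (ssnd _ _ n (cd (cone f) i (i + 1) n x)) = cd C i (i + 1) n (g i n (ssnd _ _ n x)).
Proof. by case: x => a b; rewrite coneE cidxx /= ntD gf0 addr0 chP. Qed.
Let g_cone : chom (cone f) C :=
  CHom (chomP (f := fun i => nt_comp (g i) (ssnd (A (i + 1)) (B i)) : nt (cone f i) (C i)) g_cone_proof).

(** The projection from the cone of [f] to C is a quasi-isomorphism. *)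
Lemma perf_coker : perf A -> perf B -> perf C.
Proof.
move=> pA pB; apply: (@perf_qis _ _ g_cone) (perf_cone f pA pB).
apply/qisP => i n; split=> [[a b]|c dc].
  rewrite coneE cidxx => -[/eqP]; rewrite oppr_eq0 => /eqP da Eb [c Ec0].
  have Ec : g (i + 1) n b = cd C i (i + 1) n c by exact: Ec0.
  have [b0 Eb0] := g_surj c.
  have [|a0 Ea0] := @exact_B (i + 1) n (b - cd B i (i + 1) n b0).
    by rewrite ntB Ec chP Eb0 subrr.
  exists (a0, b0); rewrite coneE cidxx -Ea0; congr pair; last by zmod.
  apply/eqP; rewrite -addr_eq0; apply/eqP; apply: f_inj.
  rewrite ntD chP -Ea0 ntB cdK subr0; move: Eb => /eqP; rewrite addr_eq0 => /eqP ->; zmod.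
have [b Eb] := g_surj c.
have [|a Ea] := @exact_B (i + 1 + 1) n (cd B (i + 1) (i + 1 + 1) n b); first by rewrite chP Eb.
exists (- a, b), 0; rewrite nt0 addr0; split; last exact: Eb.
rewrite coneE cidxx !ntN Ea opprK addrN; congr pair; apply: f_inj.
by rewrite chP -Ea cdK.
Qed.

Let f_cone_proof i n (x : cpx_shift 1 A i n) :
  snpair (f (i + 1 + 1)) 0 n (cd (cpx_shift 1 A) i (i + 1) n x) =
  cd (cone g) i (i + 1) n (snpair (f (i + 1)) 0 n x).
Proof.
rewrite [RHS]coneE cidxx gf0 !ntE0 nt0 addr0; congr pair.
by rewrite cd_shift1E ntN chP.
Qed.
Let f_cone : chom (cpx_shift 1 A) (cone g) :=
  CHom (chomP (f := fun i => snpair (f (i + 1)) 0 : nt (cpx_shift 1 A i) (cone g i)) f_cone_proof).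
Let f_cone_qis : cpx_qis f_cone.
Proof.
apply/qisP => i n; split=> [a da [[b c]]|[b c]].
  rewrite coneE cidxx => -[Ea Ec].
  have [b0 Eb0] := g_surj c.
  have [|a' Ea'] := @exact_B (i + 1) n (b + cd B i (i + 1) n b0).
    by rewrite ntD chP Eb0 [X in X = _]addrC; exact: esym Ec.
  exists a'; rewrite cd_shift1E; apply/eqP; rewrite -addr_eq0; apply/eqP; apply: f_inj.
  by rewrite ntD [f _ _ a]Ea chP -Ea' ntD cdK addr0 addNr.
rewrite coneE cidxx => -[/eqP]; rewrite oppr_eq0 => /eqP db Ec.
have [b0 Eb0] := g_surj c.
have [|a Ea] := @exact_B (i + 1 + 1) n (b + cd B (i + 1) (i + 1 + 1) n b0).
  by rewrite ntD chP Eb0 [X in X = _]addrC; exact: Ec.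
exists a, (- b0, 0); split.
  rewrite cd_shift1E; apply/eqP; rewrite oppr_eq0; apply/eqP; apply: f_inj.
  by rewrite chP -Ea ntD db cdK addr0.
have addp (V W : zmodType) (x1 x2 : V) (y1 y2 : W) : (x1, y1) + (x2, y2) = (x1 + x2, y1 + y2) by [].
rewrite coneE cidxx !ntN nt0 Eb0 opprK add0r [RHS]addp addrN; congr pair.
by rewrite Ea.
Qed.

(** A[1] is quasi-isomorphic to the cone of [g]. *)
Lemma perf_ker : perf B -> perf C -> perf A.
Proof.
move=> pB pC; apply: (@perf_unshift 1); exact: perf_qis_inv f_cone_qis (perf_cone g pB pC).
Qed.

Let j_proof i n (x : C i n) :
  snpair 0 (nt_id (C (i + 1))) n (cd C i (i + 1) n x) = cd (cone g) i (i + 1) n (snpair 0 (nt_id (C i)) n x).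
Proof. by rewrite [RHS]coneE !ntE0 !nt0 oppr0 addr0. Qed.
Let j : chom C (cone g) :=
  CHom (chomP (f := fun i => snpair 0 (nt_id (C i)) : nt (C i) (cone g i)) j_proof).
Let jE i n x : j i n x = (0, x). Proof. by []. Qed.
Let pr_proof i n (x : cone j i n) :
  sfst _ _ n (ssnd _ _ n (cd (cone j) i (i + 1) n x)) = cd (cpx_shift 1 B) i (i + 1) n (sfst _ _ n
    (ssnd _ _ n x)).
Proof.
case: x => c [b c']; rewrite coneE jE cidxx coneE cidxx /= addr0.
by rewrite expr1z scaleN1r.
Qed.
Let pr : chom (cone j) (cpx_shift 1 B) :=
  CHom (chomP (f := fun i => nt_comp (sfst (B (i + 1)) (C i)) (ssnd (C (i + 1)) (spair (B (i + 1)) (C i)))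
     : nt (cone j i) (cpx_shift 1 B i)) pr_proof).

(** The triangle is rotated once more: the cone of the inclusion [j] of C in the cone of [g] is
    B[1], and the cone of [g] is A[1]. *)
Lemma perf_ext : perf A -> perf C -> perf B.
Proof.
move=> pA pC; apply: (@perf_unshift 1).
have pg : perf (cone g) by apply: perf_qis f_cone_qis _; apply: perf_shift.
apply: (perf_qis (f := pr) _ (perf_cone j pC pg)).
apply/qisP => i n; split=> [[c [b c']]|b db].
  rewrite coneE jE cidxx coneE cidxx => -[/eqP]; rewrite oppr_eq0 => /eqP dc /eqP.
  rewrite addr0 oppr_eq0 => /eqP db Ec [b0].
  rewrite -[pr _ _ _]/b cd_shift1E => Eb.
  exists (c' - g (i + 1) n b0, (b0, 0)); rewrite coneE jE cidxx coneE cidxx nt0 add0r.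
  have Ed : cd C (i + 1) (i + 1 + 1) n c' = - g _ n b - c.
    by apply/eqP; rewrite -subr_eq0; apply/eqP; rewrite -[RHS]Ec; zmod.
  congr pair.
    by rewrite ntB Ed Eb ntN -chP; zmod.
  have addp (V W : zmodType) (x1 x2 : V) (y1 y2 : W) : (x1, y1) + (x2, y2) = (x1 + x2, y1 + y2) by [].
  by rewrite [RHS]addp; congr pair; [rewrite -Eb addr0|zmod].
have {}db : cd B (i + 1 + 1) (i + 1 + 1 + 1) n b = 0.
  by move: db; rewrite cd_shift1E => /eqP; rewrite oppr_eq0 => /eqP.
exists (- g (i + 1 + 1) n b, (b, 0)), 0; split; last by rewrite nt0 addr0.
rewrite coneE jE cidxx coneE cidxx ntN -chP db !nt0 oppr0 add0r.
have addp (V W : zmodType) (x1 x2 : V) (y1 y2 : W) : (x1, y1) + (x2, y2) = (x1 + x2, y1 + y2) by [].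
rewrite [X in (_, X)]addp; transitivity ((0, (0, 0)) : cone j (i + 1 + 1) n); last by [].
by congr pair; [rewrite oppr0|congr pair; rewrite ?addr0 ?oppr0 ?addrN].
Qed.
End short_exact_complexes.

Lemma perf0 M : (forall i n (x : M i n), x = 0) -> perf M.
Proof.
move=> M0; have Z0 : forall i n (x : cpx0 k e i n), x = 0 by move=> *; apply: spf0_eq.
exists (cpx0 k e); split.
- by exists 0%N => *; apply: Z0.
- by move=> i F G q _ f; exists 0; apply: nt_ext => n x; rewrite (Z0 i n x) nt0 /= nt0.
- by move=> i n; apply/fin_dimP; exists [:: 0] => x; rewrite (Z0 i n x) inE.
have c i j n x : (fun i => 0 : nt (cpx0 k e i) (M i)) j n (cd (cpx0 k e) i j n x) = cd M i j n ((0 :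
  nt (cpx0 k e i) (M i)) n x).
  by rewrite !ntE0 nt0.
by exists (CHom c); apply: qis_bij => [i n x _|i n y]; [exact: Z0|exists 0; rewrite (M0 _ _ y)].
Qed.

Lemma perf_iso M N (f : chom M N) : (forall i n x, f i n x = 0 -> x = 0) ->
  (forall i n y, exists x, f i n x = y) -> perf M -> perf N.
Proof. by move=> fi fs; apply: perf_qis (qis_bij fi fs). Qed.

Definition stalk_chom F G (f : nt F G) : chom (stalk F) (stalk G).
Proof. by refine (@CHom _ _ (stalk F) (stalk G) (stalk_map f) _) => i j n x; rewrite nt0. Defined.

Definition pf F := perf (stalk F).

Lemma pf_proj F : sproj F -> fd F -> pf F.
Proof.
move=> pF fF; exists (stalk F); split.
- by exists 0%N => i lt n /=; case: eqP lt => [->//|_ _] x; apply: spf0_eq.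
- move=> i /=; case: (i == 0) => // G H q _ f; exists 0; apply: nt_ext => n x.
  by rewrite (spf0_eq x 0) !nt0.
- move=> i n /=; case: (i == 0); first exact: fF.
  by apply/fin_dimP; exists [:: 0] => x; rewrite (spf0_eq x 0) inE.
- by exists (cidm _); apply: qis_id.
Qed.

Section short_exact_functors.
Variables (F G H : spf k e) (f : nt F G) (g : nt G H).
Hypotheses (f_inj : forall n x, f n x = 0 -> x = 0) (g_surj : forall n z, exists y, g n y = z)
  (gf0 : forall n x, g n (f n x) = 0) (exact_G : forall n y, g n y = 0 -> exists x, y = f n x).

Let f_inj' i n x : stalk_chom f i n x = 0 -> x = 0.
Proof. by move: x; rewrite /= /stalk_map; case: (i == 0) => //=; exact: f_inj. Qed.
Let g_surj' i n z : exists y, stalk_chom g i n y = z.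
Proof. by move: z; rewrite /= /stalk_map; case: (i == 0) => //= z; exists z. Qed.
Let gf0' i n x : stalk_chom g i n (stalk_chom f i n x) = 0.
Proof. by move: x; rewrite /= /stalk_map; case: (i == 0) => //= x; apply: spf0_eq. Qed.
Let exact_G' i n y : stalk_chom g i n y = 0 -> exists x, y = stalk_chom f i n x.
Proof. by move: y; rewrite /= /stalk_map; case: (i == 0) => [|y _]; [exact: exact_G|exists y]. Qed.

Lemma pf_coker : pf F -> pf G -> pf H.
Proof. exact: perf_coker f_inj' g_surj' gf0' exact_G'. Qed.
Lemma pf_ker : pf G -> pf H -> pf F.
Proof. exact: perf_ker f_inj' g_surj' gf0' exact_G'. Qed.
Lemma pf_ext : pf F -> pf H -> pf G.
Proof. exact: perf_ext f_inj' g_surj' gf0' exact_G'. Qed.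
End short_exact_functors.

Lemma pf_iso F G (f : nt F G) : (forall n x, f n x = 0 -> x = 0) ->
  (forall n y, exists x, f n x = y) -> pf F -> pf G.
Proof.
move=> fi fs; apply: (perf_iso (f := stalk_chom f)) => i n; rewrite /= /stalk_map.
  by case: (i == 0) => // x; apply: fi.
by case: (i == 0) => y; [apply: fs|exists y].
Qed.
Lemma pf0 F : (forall n (x : F n), x = 0) -> pf F.
Proof.
move=> F0; apply: perf0 => i n /=; case: (i == 0) => x; [exact: F0|exact: spf0_eq].
Qed.

Definition sti F i : nt F (stalk F i) :=
  match i == 0 as b return nt F (if b then F else spf0 k e) with true => nt_id F | false => 0 end.

Section truncation.
Variable M : cpx k e.
(** The brutal truncation in degrees at least c. Writing it as a subfunctor of every term avoids a
    case distinction in the types of the differentials. *)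
Let U (c i : int) n (x : M i n) := (c <= i)%R \/ x = 0.
Let U_closed c i : sclosed (U c (i := i)).
Proof.
split=> [n|m n g x [?|->]]; [split=> [|a x y []]|by left|by right; rewrite sact0].
- by right.
- by left.
- by move=> -> [?|->]; [left|right; rewrite scaler0 addr0].
Qed.
Let T_term c i := ssub (U_closed c i).
Let U_cd c i j n (x : T_term c i n) : U c (nt_comp (cd M i j) (ssub_in (U_closed c i)) n x).
Proof.
case: x => x /= [ci|->]; last by right; rewrite nt0.
have [->|ne] := eqVneq j (i + 1); last by right; rewrite cdE0.
by left; lia.
Qed.
Let T (c : int) : cpx k e.
Proof.
refine (@Cpx k e (T_term c)
  (fun i j => ssub_lift (U_closed c j) (f := nt_comp (cd M i j) (ssub_in _)) (@U_cd c i j)) _ _).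
  by move=> i j ne; apply: nt_ext => n x; apply: subm_ext; rewrite /= cdE0.
by move=> i j l; apply: nt_ext => n x; apply: subm_ext; rewrite /= cdK.
Defined.
Let TE c i j n (x : T c i n) : smval (cd (T c) i j n x) = cd M i j n (smval x).
Proof. by []. Qed.

(** The quotient of two successive truncations is M c placed in degree c. *)
Let step c : pf (M c) -> perf (T (c + 1)) -> perf (T c).
Proof.
move=> pM pT.
have Uin i n (x : T (c + 1) i n) : U c (smval x).
  by case: x => x /= [ci|->]; [left; lia|right].
have fP i j n (x : T (c + 1) i n) :
    ssub_lift (U_closed c j) (f := ssub_in _) (Uin j) n (cd (T (c + 1)) i j n x) =
    cd (T c) i j n (ssub_lift (U_closed c i) (f := ssub_in _) (Uin i) n x).
  exact: subm_ext.
pose g i : nt (T c i) (cpx_shift (- c) (stalk (M c)) i) :=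
  nt_comp (sti (M c) (i - c)) (nt_comp (cid M i c) (ssub_in _)).
have gP i n (x : T c i n) : g (i + 1) n (cd (T c) i (i + 1) n x) =
    cd (cpx_shift (- c) (stalk (M c))) i (i + 1) n (g i n x).
  rewrite ntEZ /= scaler0; case: x => x /= [ci|->]; last by rewrite !nt0.
  by rewrite cid0 ?ntE0 ?nt0 //; apply/eqP; lia.
have pQ : perf (cpx_shift (- c) (stalk (M c))) by apply: perf_shift.
have G1 := @perf_ext (T (c + 1)) (T c) _ (@CHom k e (T (c + 1)) (T c) (fun i => ssub_lift (U_closed c
  i) (f := ssub_in _) (Uin i)) fP) (CHom (chomP gP)).
apply: G1 pT pQ.
- by move=> i n x /(congr1 (@smval _ _ _ _)) /= x0; apply: subm_ext.
- move=> i n z; have [E|ne] := eqVneq (i - c) 0.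
    move: E => /eqP; rewrite subr_eq0 => /eqP E; subst i.
    have [x Ex] : exists x, sti (M c) (c - c) n x = z.
      by move: z; rewrite /= /sti; case: eqP => [|/eqP]; rewrite ?subrr // => _ z; exists z.
    have Ux : U c x by left.
    by exists (@Subm _ _ (@U c c n) (proj1 (U_closed c c) n) x Ux); rewrite /= cidxx.
  exists 0; rewrite nt0; move: z; rewrite /=; case: eqP ne => // _ _ z; exact: spf0_eq.
- move=> i n [x [ci|E]] /=; last by rewrite E !nt0.
  by rewrite cid0 ?ntE0 ?nt0 //; apply/eqP; lia.
- move=> i n [x Ux] /= E.
  have Ux' : U (c + 1) x.
    have [Ei|ne] := eqVneq i c; last by case: Ux => [?|->]; [left; move/eqP: ne; lia|right].
    subst i; right; move: E; rewrite cidxx /sti; case: eqP => [|/eqP] //; by rewrite subrr.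
  by exists (@Subm _ _ (@U (c + 1) i n) (proj1 (U_closed (c + 1) i) n) x Ux'); apply: subm_ext.
Qed.

Lemma perf_terms : bounded M -> (forall i, pf (M i)) -> perf M.
Proof.
move=> [N hN] pM.
have H (m : nat) : perf (T (N%:Z + 1 - m%:Z)).
  elim: m => [|m IH].
    apply: perf0 => i n [x Ux]; apply: subm_ext => /=; case: Ux => // le.
    by apply: hN; move: le; lia.
  apply: step => //; have -> : N%:Z + 1 - m.+1%:Z + 1 = N%:Z + 1 - m%:Z by lia.
  exact: IH.
have fP i j n (x : T (N%:Z + 1 - (N + N + 2)%N%:Z) i n) :
  ssub_in _ n (cd (T _) i j n x) = cd M i j n (ssub_in _ n x) by [].
apply: (perf_iso (f := CHom fP)) (H _) => i n y.
  by move=> E; apply: subm_ext.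
have Uy : U (N%:Z + 1 - (N + N + 2)%N%:Z) y.
  have [le|lt] := leP (N%:Z + 1 - (N + N + 2)%N%:Z) i; first by left.
  by right; apply: hN; move: lt; lia.
by exists (@Subm _ _ (@U _ i n) (proj1 (U_closed _ i) n) y Uy).
Qed.
End truncation.
End perfect_complexes.

(** * Orbit sums and weights *)

Section words.
Variables (k : finFieldType) (e : nat).
Local Notation word B := {ffun 'I_e -> B}.

Lemma sactBl (F : spf k e) m n (f g : GHom k e m n) (x : F m) : sact (f - g) x = sact f x - sact g x.
Proof. by rewrite -[- g]scaleN1r sactDl sactZl scaleN1r. Qed.
Lemma permw1 (B : finType) (w : word B) : permw 1%g w = w.
Proof. by apply/ffunP => i; rewrite ffunE perm1. Qed.
Lemma permwM (B : finType) (s t : {perm 'I_e}) (w : word B) : permw s (permw t w) = permw (s * t)%g w.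
Proof. by apply/ffunP => i; rewrite !ffunE permM. Qed.
Lemma permwE (B : finType) (s : {perm 'I_e}) (w : word B) q : permw s w q = w (s q).
Proof. by rewrite ffunE. Qed.
Lemma permw_inj (B : finType) (s : {perm 'I_e}) : injective (@permw e B s).
Proof. by move=> u v E; rewrite -[u]permw1 -[v]permw1 -(mulVg s) -!permwM E. Qed.

Definition orb (B : finType) (t u : word B) := [exists s : {perm 'I_e}, u == permw s t].
Lemma orbP (B : finType) (t u : word B) : reflect (exists s, u = permw s t) (orb t u).
Proof. by apply: (iffP existsP) => [[s /eqP ->]|[s ->]]; exists s. Qed.
Lemma orb_refl (B : finType) (t : word B) : orb t t.
Proof. by apply/orbP; exists 1%g; rewrite permw1. Qed.
Lemma orb_sym (B : finType) (t u : word B) : orb t u = orb u t.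
Proof.
apply/idP/idP => /orbP [s ->]; apply/orbP; exists s^-1%g; by rewrite permwM mulVg permw1.
Qed.
Lemma orb_trans (B : finType) (t u v : word B) : orb t u -> orb u v -> orb t v.
Proof. by move=> /orbP [s ->] /orbP [s' ->]; apply/orbP; exists (s' * s)%g; rewrite permwM. Qed.
Lemma orb_permw (B : finType) (t u : word B) s : orb t (permw s u) = orb t u.
Proof.
have h : orb u (permw s u) by apply/orbP; exists s.
by apply/idP/idP => h'; [apply: orb_trans h' _; rewrite orb_sym|apply: orb_trans h' _].
Qed.

(* These functions form a basis of the symmetric functions. *)
Definition xi_ (B : finType) (t : word B) : tens k e B := [ffun u => (orb t u)%:R].
Lemma xi_sym (B : finType) (t : word B) : xi_ t \in @tsym k e B.
Proof. by apply/tsymP => s u; rewrite !ffunE orb_permw. Qed.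
Definition xi (B : finType) (t : word B) : Gam k e B := MkGam (xi_sym t).
Lemma xiE (B : finType) (t u : word B) : gval (xi t) u = (orb t u)%:R.
Proof. by rewrite ffunE. Qed.
Lemma gvalE (B : finType) a (f g : Gam k e B) t : gval (a *: f + g) t = a * gval f t + gval g t.
Proof. by rewrite !ffunE. Qed.

(** Induction on the size of the support: subtracting the multiple of [xi t] with the coefficient at
    [t] clears the whole orbit of [t], by symmetry. *)
Lemma Gam_ind (B : finType) (P : Gam k e B -> Prop) (S : pred (word B)) : P 0 ->
  (forall a f g, P f -> P g -> P (a *: f + g)) -> (forall t, S t -> P (xi t)) ->
  forall f, (forall t, gval f t != 0 -> S t) -> P f.
Proof.
move=> P0 Pl Px f; move: {2}#|_| (leqnn #|[set t | gval f t != 0]|) => N.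
elim: N f => [|N IH] f le fS.
  have -> : f = 0; last exact: P0.
  apply: gam_eq => t; rewrite ffunE; apply/eqP; apply: contraTT le => ft.
  by rewrite -ltnNge; apply/card_gt0P; exists t; rewrite inE.
have [/existsP [t ft]|/existsPn f0] := boolP [exists t, gval f t != 0]; last first.
  have -> : f = 0; last exact: P0.
  by apply: gam_eq => t; rewrite ffunE; apply/eqP; have := f0 t; rewrite negbK.
have E u : gval (f - (gval f t : k) *: xi t) u = gval f u - gval f t * (orb t u)%:R by rewrite !ffunE.
have Z u : gval (f - (gval f t : k) *: xi t) u != 0 -> gval f u != 0.
  rewrite E; case: orbP => [[s ->]|_]; last by rewrite mulr0 subr0.
  by rewrite gvalP mulr1 subrr eqxx.
rewrite -[f](subrK ((gval f t : k) *: xi t)) addrC; apply: Pl; first exact: Px (fS _ ft).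
apply: IH => [|u /Z /fS //]; rewrite -ltnS; apply: leq_trans le; apply: proper_card.
apply/properP; split; first by apply/subsetP => u; rewrite !inE; apply: Z.
by exists t; rewrite !inE // E orb_refl mulr1 subrr eqxx.
Qed.

Definition pw (B C : finType) (u : word B) (w : word C) : word (B * C)%type := [ffun i => (u i, w i)].
Lemma pw_eta (B C : finType) (t : word (B * C)%type) :
  t = pw [ffun i => (t i).1] [ffun i => (t i).2].
Proof. by apply/ffunP => i; rewrite !ffunE; case: (t i). Qed.
Lemma permw_pw (B C : finType) s (u : word B) (w : word C) : permw s (pw u w) = pw (permw s u) (permw s w).
Proof. by apply/ffunP => i; rewrite !ffunE. Qed.
Lemma pw_inj (B C : finType) (u u' : word B) (w w' : word C) : pw u w = pw u' w' -> u = u' /\ w = w'.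
Proof. by move=> /ffunP E; split; apply/ffunP => i; have := E i; rewrite !ffunE => -[]. Qed.
Lemma orb_pwP (B C : finType) (u u' : word B) (w w' : word C) :
  reflect (exists s, u' = permw s u /\ w' = permw s w) (orb (pw u w) (pw u' w')).
Proof.
apply: (iffP (orbP _ _)) => -[s]; first by rewrite permw_pw => /pw_inj [-> ->]; exists s.
by case=> -> ->; exists s; rewrite permw_pw.
Qed.
Lemma gcompE l m n (g : GHom k e m n) (f : GHom k e l m) a b :
  gval (gcomp g f) (pw a b) = \sum_u gval f (pw a u) * gval g (pw u b).
Proof.
rewrite ffunE; apply: eq_bigr => u _; congr (gval f _ * gval g _); apply/ffunP => i; by rewrite !ffunE.
Qed.
Lemma gam_eq_pw m n (f g : GHom k e m n) : (forall a b, gval f (pw a b) = gval g (pw a b)) -> f = g.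
Proof. by move=> h; apply: gam_eq => t; rewrite [t]pw_eta. Qed.

Lemma xi_diagl m n (j : word 'I_n) (g : GHom k e m n) a b :
  gval (gcomp (xi (pw j j)) g) (pw a b) = (orb j b)%:R * gval g (pw a b).
Proof.
rewrite gcompE (bigD1 b) //= big1 ?addr0 => [|u ne].
  rewrite xiE mulrC; congr (_%:R * _); congr nat_of_bool.
  by apply/orb_pwP/orbP => [[s [-> _]]|[s ->]]; exists s.
rewrite xiE; case: orb_pwP => [[s [Eu Eb]]|_]; last by rewrite mulr0.
by rewrite Eu Eb eqxx in ne.
Qed.
Lemma xi_diagr m n (i : word 'I_m) (g : GHom k e m n) a b :
  gval (gcomp g (xi (pw i i))) (pw a b) = (orb i a)%:R * gval g (pw a b).
Proof.
rewrite gcompE (bigD1 a) //= big1 ?addr0 => [|u ne].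
  rewrite xiE; congr (_%:R * _); congr nat_of_bool.
  by apply/orb_pwP/orbP => [[s [-> _]]|[s ->]]; exists s.
rewrite xiE; case: orb_pwP => [[s [Ea Eu]]|_]; last by rewrite mul0r.
by rewrite Eu Ea eqxx in ne.
Qed.
Lemma xi_idl m n (i : word 'I_m) (j : word 'I_n) : gcomp (xi (pw j j)) (xi (pw i j)) = xi (pw i j).
Proof.
apply: gam_eq_pw => a b; rewrite xi_diagl !xiE; case: orb_pwP => [[s [_ ->]]|]; last by rewrite mulr0.
by rewrite orb_permw orb_refl mul1r.
Qed.
Lemma xi_idr0 m n (i i' : word 'I_m) (j : word 'I_n) : ~~ orb i i' ->
  gcomp (xi (pw i j)) (xi (pw i' i')) = 0.
Proof.
move=> h; apply: gam_eq_pw => a b; rewrite xi_diagr !xiE [RHS]ffunE.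
case: orb_pwP => [[s [-> _]]|]; last by rewrite mulr0.
by rewrite orb_permw orb_sym (negPf h) mul0r.
Qed.

(** The two words have the same coincidences, so each is an injective renaming of the letters of the
    other and the sum over middle words has at most one nonzero term. Weights of the same shape are
    thereby isomorphic. *)
Lemma xi_factor m n (i : word 'I_m) (j : word 'I_n) :
  (forall q q', (i q == i q') = (j q == j q')) ->
  gcomp (xi (pw j i)) (xi (pw i j)) = xi (pw i i).
Proof.
move=> ij; apply: gam_eq_pw => a b; rewrite gcompE xiE.
case: orb_pwP => [[s [-> ->]]|no].
  rewrite (bigD1 (permw s j)) //= big1 ?addr0 => [|u ne].
    have h1 : orb (pw i j) (pw (permw s i) (permw s j)) by apply/orb_pwP; exists s.
    have h2 : orb (pw j i) (pw (permw s j) (permw s i)) by apply/orb_pwP; exists s.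
    by rewrite !xiE h1 h2 mulr1.
  rewrite xiE; case: orb_pwP => [[s' [Ei Eu]]|_]; last by rewrite mul0r.
  case/eqP: ne; rewrite Eu; apply/ffunP => q; rewrite !ffunE; apply/eqP; rewrite -ij.
  by move/ffunP/(_ q): Ei; rewrite !ffunE => ->.
rewrite big1 // => u _; rewrite !xiE; case: orb_pwP => [[s [Ea Eu]]|_]; last by rewrite mul0r.
case: orb_pwP => [[s' [Eu' Eb]]|_]; last by rewrite mulr0.
case: no; exists s; split=> //; rewrite Eb; apply/ffunP => q; rewrite !ffunE; apply/eqP; rewrite ij.
by have := Eu'; rewrite Eu => /ffunP/(_ q); rewrite !ffunE => ->.
Qed.

Lemma gid_diag n t : gval (gid k e n) t != 0 -> t = pw [ffun i => (t i).1] [ffun i => (t i).1].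
Proof.
have E : t = [ffun i => ([ffun i => (t i).1] i, [ffun i => (t i).2] i)].
  by apply/ffunP => i; rewrite !ffunE; case: (t i).
rewrite {1}E gid_val; have [h _|_] := eqVneq [ffun i => (t i).1] [ffun i => (t i).2];
  last by rewrite mulr0n eqxx.
rewrite {1}E; apply/ffunP => i; rewrite [in LHS]ffunE -{1}h [in RHS]ffunE.
by rewrite !ffunE.
Qed.

Section weights.
Variable F : spf k e.

Lemma weights0 n (y : F n) : (forall w : word 'I_n, sact (xi (pw w w)) y = 0) -> y = 0.
Proof.
move=> h; rewrite -[y]sact1.
apply: (@Gam_ind _ (fun g => sact g y = 0) [pred t : word ('I_n * 'I_n)%type | [exists w, t == pw w w]]).
- exact: sact0l.
- by move=> a f g Ef Eg; rewrite sactDl sactZl Ef Eg scaler0 addr0.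
- by move=> t /existsP [w /eqP ->].
- by move=> t /gid_diag E; apply/existsP; eexists; apply/eqP; exact: E.
Qed.

(** A word of length e uses at most e letters, so every weight idempotent factors through k^e; a
    functor of degree e is generated by its value there. *)
Lemma generated (U : forall n, F n -> Prop) : sclosed U -> (forall y : F e, U e y) -> forall n y, U n y.
Proof.
move=> [Um Ua] Ue n y; rewrite -[y]sact1.
apply: (@Gam_ind _ (fun g => U n (sact g y)) [pred t : word ('I_n * 'I_n)%type | [exists w, t == pw w w]]).
- by rewrite sact0l; case: (Um n).
- by move=> a f g Uf Ug; rewrite sactDl sactZl; case: (Um n) => _; apply.
- move=> t /existsP [w /eqP ->].
  (* Each letter is renamed to a chosen position at which it occurs, which is a letter of 'I_e. *)
  pose j : word 'I_e := [ffun q => odflt q [pick q' | w q' == w q]].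
  rewrite -(@xi_factor n e w j) ?sactM; first by apply: Ua; apply: Ue.
  have wj q : w (j q) = w q by rewrite ffunE; case: pickP => [q' /eqP|].
  move=> q q'; apply/eqP/eqP => [E|/(congr1 w)]; last by rewrite !wj.
  rewrite !ffunE E; case: pickP => // /(_ q'); by rewrite eqxx.
- by move=> t /gid_diag E; apply/existsP; eexists; apply/eqP; exact: E.
Qed.
End weights.

(** * Straightening of orbit sums *)

Section straightening.
Variable n : nat.
Implicit Types i j h w : word 'I_n.

(** The total is a coarse substitute for the dominance order on weights: replacing letters by
    smaller ones lowers it, and only finitely many values occur. *)
Definition tot w : nat := (\sum_q w q)%N.
Definition minw i j : word 'I_n := [ffun q => if (i q <= j q)%N then i q else j q].
Definition ptot (t : word ('I_n * 'I_n)%type) : nat := (\sum_q minn (t q).1 (t q).2)%N.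

Lemma tot_permw s w : tot (permw s w) = tot w.
Proof. by rewrite /tot [RHS](reindex_inj (@perm_inj _ s)); apply: eq_bigr => q _; rewrite ffunE. Qed.
Lemma tot_orb w w' : orb w w' -> tot w' = tot w.
Proof. by case/orbP => s ->; rewrite tot_permw. Qed.
Lemma minwE i j q : minw i j q = minn (i q) (j q) :> nat.
Proof. by rewrite ffunE; case: leqP; lia. Qed.
Lemma tot_minw i j : tot (minw i j) = ptot (pw i j).
Proof. by apply: eq_bigr => q _; rewrite minwE !ffunE. Qed.
Lemma tot_leif h i : (forall q, (h q <= i q)%N) -> (tot h <= tot i ?= iff (h == i))%N.
Proof.
move=> le; have -> : (h == i) = [forall q, h q == i q :> nat].
  by apply/eqP/forallP => [-> //|E]; apply/ffunP => q; apply/val_inj/eqP/E.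
have E := @leqif_sum 'I_e (fun=> true) (fun q => h q == i q :> nat) (fun q => h q) (fun q => i q).
have {}E := E (fun q _ => leqif_eq (le q)); split; [exact: E.1|rewrite [LHS]E.2].
by apply/eq_forallb.
Qed.

Lemma eq_count_orb (B : finType) (t u : word B) :
  (forall b, #|[set q | t q == b]| = #|[set q | u q == b]|) -> orb t u.
Proof.
move=> E; have P : perm_eq [tuple t q | q < e] [tuple u q | q < e].
  apply/allP => b _ /=; apply/eqP.
  have cE (v : word B) : count_mem b [tuple v q | q < e] = #|[set q | v q == b]|.
    rewrite -sum1_count big_map big_enum_cond -sum1_card; apply: eq_bigl => q.
    by rewrite inE.
  by rewrite !cE.
move: P; rewrite perm_sym => /tuple_permP [s Es]; apply/orbP; exists s; apply/ffunP => q; rewrite ffunE.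
have : nth (u q) [tuple u q | q < e] q = nth (u q) [tuple tnth [tuple t q | q < e] (s q) | q < e] q.
  by rewrite Es.
by rewrite -!tnth_nth !tnth_mktuple.
Qed.

(* With [h] the letterwise minimum of [i] and [j], [xi (h, j) o xi (i, h)] is [xi (i, j)] plus *)
(* orbit sums whose letterwise minimum is larger.                                           *)
Lemma straighten i j a b : gval (gcomp (xi (pw (minw i j) j)) (xi (pw i (minw i j))) - xi (pw i j))
  (pw a b) != 0 ->
  orb j b /\ (ptot (pw i j) < ptot (pw a b))%N.
Proof.
set h := minw i j.
have -> : gval (gcomp (xi (pw h j)) (xi (pw i h)) - xi (pw i j)) (pw a b) =
    \sum_u gval (xi (pw i h)) (pw a u) * gval (xi (pw h j)) (pw u b) - (orb (pw i j) (pw a b))%:R.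
  by rewrite -gcompE !ffunE.
have hi q : (h q <= i q)%N by rewrite minwE geq_minl.
have hj q : (h q <= j q)%N by rewrite minwE geq_minr.
(* A middle word that contributes lies letterwise below both [a] and [b] and has the total of [h];
   if the totals agree it is their minimum. *)
have hu u : orb (pw i h) (pw a u) -> orb (pw h j) (pw u b) ->
    (forall q, (u q <= minw a b q)%N) /\ tot u = tot h.
  case/orb_pwP => s [-> ->] /orb_pwP [s' [E ->]]; split; last exact: tot_permw.
  move=> q; rewrite minwE leq_min {2}E !permwE hj.
  by have := hi (s q); rewrite andbT.
have [oab|noab] := boolP (orb (pw i j) (pw a b)).
  have [s [Ea Eb]] := orb_pwP _ _ _ _ oab.
  have Eh : permw s h = minw a b by apply/ffunP => q; rewrite Ea Eb !ffunE.
  rewrite (bigD1 (permw s h)) //= big1 => [|u ne].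
    have h1 : orb (pw i h) (pw a (permw s h)) by apply/orb_pwP; exists s.
    have h2 : orb (pw h j) (pw (permw s h) b) by apply/orb_pwP; exists s.
    by rewrite !xiE h1 h2 mulr1 addr0 subrr eqxx.
  rewrite !xiE; have [o1|] := boolP (orb (pw i h) _); last by rewrite mul0r.
  have [o2|] := boolP (orb (pw h j) _); last by rewrite mulr0.
  have [le tu] := hu u o1 o2; have := (tot_leif le).2.
  by rewrite tu -Eh tot_permw eqxx (negPf ne).
rewrite subr0 => nz.
have [/existsP [u /andP [o1 o2]]|/existsPn no] := boolP [exists u, orb (pw i h) (pw a u) && orb (pw h
  j) (pw u b)]; last first.
  by case/eqP: nz; rewrite big1 // => u _; rewrite !xiE -natrM mulnb (negPf (no u)).
have [le tu] := hu u o1 o2; split; first by case/orb_pwP: o2 => s [_ ->]; apply/orbP; exists s.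
rewrite -!tot_minw -/h -tu ltn_neqAle (tot_leif le).1 andbT (tot_leif le).2.
(* Equality of totals would make the middle word the minimum of [a] and [b]. Counting the positions
   that carry each pair (x, y), separately for x < y, x > y and x = y, would then put (a, b) in the
   orbit of (i, j). *)
apply: contra noab => /eqP Eu; subst u.
have cnt (i1 i2 j1 j2 : word 'I_n) (x : 'I_n * 'I_n) : orb (pw i1 j1) (pw i2 j2) ->
    #|[set q | pw i1 j1 q == x]| = #|[set q | pw i2 j2 q == x]|.
  case/orbP => s ->; rewrite -[RHS](card_imset _ (@perm_inj _ s)); apply: eq_card => q.
  apply/idP/imsetP => [|[q' + ->]]; last by rewrite !inE permwE.
  by rewrite inE => Eq; exists (s^-1 q)%g; rewrite ?inE ?permwE permKV.
apply: eq_count_orb => -[x y].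
have L (i1 j1 : word 'I_n) q : (pw i1 j1 q == (x, y)) = (i1 q == x) && (j1 q == y).
  by rewrite ffunE.
have [lt|gt|Exy] := ltngtP x y.
- have := cnt _ _ _ _ (x, y) o2;
  have E (i1 j1 : word 'I_n) : [set q | pw (minw i1 j1) j1 q == (x, y)] = [set q | pw i1 j1 q == (x, y)].
    by apply/setP => q; rewrite !inE !L ffunE; case: leqP => ?; rewrite -!val_eqE /=; lia.
  by rewrite !E.
- have := cnt _ _ _ _ (x, y) o1;
  have E (i1 j1 : word 'I_n) : [set q | pw i1 (minw i1 j1) q == (x, y)] = [set q | pw i1 j1 q == (x, y)].
    by apply/setP => q; rewrite !inE !L ffunE; case: leqP => ?; rewrite -!val_eqE /=; lia.
  by rewrite !E.
have {Exy} Exy : x = y by apply: val_inj.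
subst y.
have C (i1 j1 : word 'I_n) : #|[set q | pw i1 (minw i1 j1) q == (x, x)]| =
    (#|[set q | pw i1 j1 q == (x, x)]| + #|[set q | (i1 q == x) && (x < j1 q)%N]|)%N.
  rewrite -cardsUI; have -> : [set q | pw i1 j1 q == (x, x)] :&: [set q | (i1 q == x) && (x < j1 q)%N] = set0.
    by apply/setP => q; rewrite !inE !L -!val_eqE /=; lia.
  rewrite cards0 addn0.
    by congr #|pred_of_set _|; apply/setP => q; rewrite !inE !L ffunE;
      case: (leqP (i1 q) (j1 q)) => ?; rewrite -!val_eqE /=; lia.
have D (i1 j1 : word 'I_n) : #|[set q | (i1 q == x) && (x < j1 q)%N]| =
    (\sum_(z : 'I_n | (x < z)%N) #|[set q | pw (minw i1 j1) j1 q == (x, z)]|)%N.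
  rewrite -sum1_card (partition_big j1 (fun z : 'I_n => (x < z)%N)) /=; last by move=> q;
    rewrite inE => /andP [].
  apply: eq_bigr => z xz; rewrite -sum1_card; apply: eq_bigl => q; rewrite !inE !ffunE xpair_eqE.
  by case: (leqP (i1 q) (j1 q)) => ?; rewrite -!val_eqE /=; lia.
have := cnt _ _ _ _ (x, x) o1; rewrite !C !D.
rewrite (eq_bigr _ (fun z _ => cnt _ _ _ _ (x, z) o2)); exact: addIn.
Qed.

(* If F has no weights of total below [tot w], then a vector of weight [w] generates only its *)
(* multiples in total [tot w].                                                            *)
Lemma top_weight (F : spf k e) w (x : F n) :
  (forall w', (tot w' < tot w)%N -> forall y : F n, sact (xi (pw w' w')) y = 0) ->
  sact (xi (pw w w)) x = x ->
  forall (g : GHom k e n n) j, tot j = tot w -> exists c, sact (xi (pw j j)) (sact g x) = c *: x.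
Proof.
move=> low Ex.
have no i j : ~~ orb w i -> exists c, sact (xi (pw i j)) x = c *: x.
  by move=> noi; exists 0; rewrite -{1}Ex -sactM xi_idr0 1?orb_sym // sact0l scale0r.
(* Descending induction on the total of the letterwise minimum, which is at most e * n. *)
suff H N i j : (e * n - ptot (pw i j) <= N)%N -> tot j = tot w -> exists c, sact (xi (pw i j)) x = c *: x.
  move=> g j Ej; rewrite -sactM.
  apply: (@Gam_ind _ (fun g => exists c, sact g x = c *: x) [pred t : word ('I_n * 'I_n)%type | orb j
    [ffun q => (t q).2]]).
  - by exists 0; rewrite sact0l scale0r.
  - move=> a f f' [c Ec] [c' Ec']; exists (a * c + c').
    by rewrite sactDl sactZl Ec Ec' scalerDl scalerA.
  - by move=> t /tot_orb Et; rewrite [t]pw_eta; apply: H (leqnn _) _; rewrite Et.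
  - move=> t; rewrite {1}[t]pw_eta xi_diagl /=; have [//|_] := boolP (orb j _).
    by rewrite mul0r eqxx.
elim: N i j => [|N IH] i j le Ej; have [oi|/no //] := boolP (orb w i).
all: have Ei := tot_orb oi.
all: have le_i : forall q, (minw i j q <= i q)%N by move=> q; rewrite minwE geq_minl.
all: have le_j : forall q, (minw i j q <= j q)%N by move=> q; rewrite minwE geq_minr.
all: have [Eh|neh] := eqVneq (minw i j) i.
- have Eij : i = j by apply/eqP; have := (tot_leif le_j).2; rewrite {1 2}Eh Ei Ej eqxx => /esym.
  subst j; exists 1; rewrite scale1r -[RHS]Ex; congr (sact _ _); apply: gam_eq => t; rewrite !xiE;
    congr (nat_of_bool _)%:R.
  have o2 : orb (pw i i) (pw w w) by case/orbP: oi => s ->; apply/orb_pwP; exists s^-1%g;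
    rewrite permwM mulVg permw1.
  by apply/idP/idP; apply: orb_trans => //; rewrite orb_sym.
- have lt : (ptot (pw i j) <= e * n)%N.
    rewrite -tot_minw /tot -[e in (e * n)%N]card_ord -sum_nat_const; apply: leq_sum => q _; exact: ltnW.
  have lt' : (tot (minw i j) < tot i)%N by rewrite ltn_neqAle (tot_leif le_i).1 andbT (tot_leif le_i).2.
  move: le lt'; rewrite leqn0 subn_eq0 tot_minw => le; rewrite -tot_minw ltnNge => /negP [];
    apply: leq_trans (_ : e * n <= _)%N.
    rewrite /tot -[e in (e * n)%N]card_ord -sum_nat_const; apply: leq_sum => q _; exact: ltnW.
  by rewrite tot_minw.
- have Eij : i = j by apply/eqP; have := (tot_leif le_j).2; rewrite {1 2}Eh Ei Ej eqxx => /esym.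
  subst j; exists 1; rewrite scale1r -[RHS]Ex; congr (sact _ _); apply: gam_eq => t; rewrite !xiE;
    congr (nat_of_bool _)%:R.
  have o2 : orb (pw i i) (pw w w) by case/orbP: oi => s ->; apply/orb_pwP; exists s^-1%g;
    rewrite permwM mulVg permw1.
  by apply/idP/idP; apply: orb_trans => //; rewrite orb_sym.
have lt : (tot (minw i j) < tot w)%N by rewrite -Ei ltn_neqAle (tot_leif le_i).1 andbT (tot_leif le_i).2.
(* This composite passes through the weight [minw i j], whose total is below that of [w], so it
   kills [x]; by [straighten] it differs from the orbit sum by terms that the induction covers. *)
pose g := gcomp (xi (pw (minw i j) j)) (xi (pw i (minw i j))).
have g0 : sact g x = 0 by rewrite sactM -(xi_idl i (minw i j)) sactM low // sact0.
suff [c Ec] : exists c, sact (g - xi (pw i j)) x = c *: x.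
  by exists (- c); rewrite scaleNr -Ec sactBl g0 sub0r opprK.
apply: (@Gam_ind _ (fun g => exists c, sact g x = c *: x)
  [pred t : word ('I_n * 'I_n)%type | orb j [ffun q => (t q).2] && (ptot (pw i j) < ptot t)%N]).
- by exists 0; rewrite sact0l scale0r.
- move=> a f f' [c Ec] [c' Ec']; exists (a * c + c').
  by rewrite sactDl sactZl Ec Ec' scalerDl scalerA.
- move=> t /andP [/tot_orb Et lt']; rewrite [t]pw_eta; apply: IH; last by rewrite Et.
  by rewrite -pw_eta; lia.
- by move=> t; rewrite {1}[t]pw_eta => /straighten [oj lt']; rewrite /= oj [t]pw_eta.
Qed.
End straightening.
End words.

Section image_factorisation.
Variables (k : finFieldType) (e : nat) (F G : spf k e) (f : nt F G).

Let im n (x : F n) : exists y, f n x = f n y. Proof. by exists x. Qed.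
Lemma pf_im : pf (sker f) -> pf F -> pf (ssub (im_closed f)).
Proof.
apply: (pf_coker (f := ssub_in (ker_closed f)) (g := ssub_lift (im_closed f) (f := f) im)).
- by move=> n x E; apply: subm_ext.
- by move=> n [z [y Ey]]; exists y; apply: subm_ext; rewrite /= Ey.
- by move=> n [x Ex]; apply: subm_ext.
- move=> n y /(congr1 (@smval _ _ _ _)) Ey.
  by exists (@Subm _ _ (fun x => f n x = 0) (proj1 (ker_closed f) n) y Ey).
Qed.
Lemma pf_source : pf (sker f) -> pf (ssub (im_closed f)) -> pf F.
Proof.
apply: (pf_ext (f := ssub_in (ker_closed f)) (g := ssub_lift (im_closed f) (f := f) im)).
- by move=> n x E; apply: subm_ext.
- by move=> n [z [y Ey]]; exists y; apply: subm_ext; rewrite /= Ey.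
- by move=> n [x Ex]; apply: subm_ext.
- move=> n y /(congr1 (@smval _ _ _ _)) Ey.
  by exists (@Subm _ _ (fun x => f n x = 0) (proj1 (ker_closed f) n) y Ey).
Qed.
Let coker_exact : [/\ forall n (x : ssub (im_closed f) n), ssub_in (im_closed f) n x = 0 -> x = 0,
  forall n z, exists y, squot_pi (im_closed f) n y = z,
  forall n x, squot_pi (im_closed f) n (ssub_in (im_closed f) n x) = 0 &
  forall n y, squot_pi (im_closed f) n y = 0 -> exists x, y = ssub_in (im_closed f) n x].
Proof.
split.
- by move=> n x E; apply: subm_ext.
- by move=> n z; apply: squot_surj.
- by move=> n [x Ux]; apply/squot_pi0.
- by move=> n y /squot_pi0 Uy; exists (@Subm _ _ (fun y => exists x, y = f n x) (proj1 (im_closed f) n) y Uy).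
Qed.
Lemma pf_im_target : pf G -> pf (scoker f) -> pf (ssub (im_closed f)).
Proof. by case: coker_exact => h1 h2 h3 h4; apply: pf_ker h1 h2 h3 h4. Qed.
Lemma pf_target : pf (ssub (im_closed f)) -> pf (scoker f) -> pf G.
Proof. by case: coker_exact => h1 h2 h3 h4; apply: pf_ext h1 h2 h3 h4. Qed.
End image_factorisation.

(** The projection to the cokernel and the zero map agree after [q]. *)
Lemma epi_surj (k : finFieldType) (e : nat) (F G : spf k e) (q : nt F G) :
  epi (C := Pcat k e) q -> forall n y, exists x, q n x = y.
Proof.
move=> qe n y; have E : nt_comp (squot_pi (im_closed q)) q = nt_comp 0 q.
  by apply: nt_ext => m x /=; apply/squot_pi0; exists x.
have /squot_pi0 [x Ex] := congr1 (fun t : nt G _ => t n y) (qe _ _ _ E).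
by exists x.
Qed.
Lemma hrep_projective (k : finFieldType) (e m : nat) : projective (C := Pcat k e) (hrep k e m).
Proof.
move=> F G q /epi_surj qs f; have [x Ex] := qs m (f m (gid k e m)).
by exists (yoneda x); apply: nt_ext => n g; rewrite /= ntP Ex -nt_hrep.
Qed.

(** * Products of divided and exterior powers *)

Section mixed_powers.
Variables (k : finFieldType) (e : nat).
Local Notation word n := {ffun 'I_e -> 'I_n}.
Implicit Types lab : 'I_e -> nat.

Definition tact m n (g : GHom k e m n) (f : tens k e 'I_m) : tens k e 'I_n :=
  [ffun w => \sum_u gval g (pw u w) * f u].
(** The e-th tensor power in coordinates, the words in 1, ..., n being the basis of the e-th tensor
    power of k^n. *)
Program Definition tp : spf k e :=
  @Spf k e (fun n => tens k e 'I_n : lmodType k) (fun m n g f => tact g f) _ _ _ _.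
Next Obligation.
move=> m n g a x y; apply/ffunP => w; rewrite !ffunE scaler_sumr -big_split /=.
by apply: eq_bigr => u _; rewrite !ffunE mulrDr -mulrCA.
Qed.
Next Obligation.
move=> m n x a g h; apply/ffunP => w; rewrite !ffunE scaler_sumr -big_split /=.
by apply: eq_bigr => u _; rewrite !ffunE mulrDl -mulrA.
Qed.
Next Obligation.
move=> n x; apply/ffunP => w; rewrite ffunE (bigD1 w) //= gid_val eqxx mul1r big1 ?addr0 //.
by move=> u ne; rewrite gid_val (negPf ne) mul0r.
Qed.
Next Obligation.
move=> l m n g f x; apply/ffunP => w; rewrite !ffunE.
under eq_bigr do rewrite gcompE mulr_suml.
rewrite exchange_big /=; apply: eq_bigr => v _; rewrite ffunE mulr_sumr.
by apply: eq_bigr => u _; rewrite -mulrA mulrCA.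
Qed.

Program Definition tpm (s : {perm 'I_e}) : nt tp tp :=
  @Nt k e tp tp (fun n f => ([ffun w => f (permw s w)] : tens k e 'I_n)) _ _.
Next Obligation. by move=> s n a f g; apply/ffunP => w; rewrite !ffunE. Qed.
Next Obligation.
move=> s m n g f; apply/ffunP => w; rewrite !ffunE (reindex_inj (@permw_inj _ _ s)) /=.
by apply: eq_bigr => u _; rewrite -permw_pw gvalP ffunE.
Qed.
Lemma tpmE s n (f : tp n) w : tpm s n f w = f (permw s w). Proof. by rewrite ffunE. Qed.

Lemma permw_tpermJ n (x y a b : 'I_e) (w : word n) :
  permw (tperm x y) (permw (tperm a b) w) =
  permw (tperm (tperm x y a) (tperm x y b)) (permw (tperm x y) w).
Proof. by rewrite !permwM -tpermJ conjgE tpermV -mulgA -mulgA tperm2 mulg1. Qed.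
Lemma permw_tpermK n x y (w : word n) : permw (tperm x y) (permw (tperm x y) w) = w.
Proof. by rewrite permwM tperm2 permw1. Qed.
Lemma permw_tperm_id n x y (w : word n) : w x = w y -> permw (tperm x y) w = w.
Proof. by move=> E; apply/ffunP => i; rewrite permwE; case: tpermP => [->|->|]. Qed.

(* Even labels are symmetric blocks of positions, odd labels are alternating blocks. *)
Definition mix lab n (f : tp n) := forall x y, x != y -> lab x = lab y -> forall w : word n,
  f (permw (tperm x y) w) = (-1) ^+ odd (lab x) * f w /\ (odd (lab x) -> w x = w y -> f w = 0).

(** Words are paired with their transposes. Words with equal letters at x and y are their own
    transposes, and in characteristic 2 antisymmetry alone would not make their terms vanish; hence
    the second hypothesis. *)
Lemma sum_alternating (n : nat) (a : word n -> k) x y :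
  (forall u, a (permw (tperm x y) u) = - a u) -> (forall u : word n, u x = u y -> a u = 0) -> \sum_u a u = 0.
Proof.
move=> aN a0; rewrite (bigID (fun u : word n => u x < u y)%N) /= [X in _ + X](bigID (fun u : word n
  => u y < u x)%N) /=.
rewrite [X in _ + (_ + X)]big1 ?addr0 => [|u]; last first.
  by rewrite -!leqNgt => /andP [le ge]; apply: a0; apply/val_inj/eqP; rewrite eqn_leq le ge.
rewrite [X in _ + X](reindex_inj (@permw_inj _ _ (tperm x y))) /=.
rewrite [X in _ + X](eq_bigl (fun u : word n => u x < u y)%N) => [|u]; last first.
  by rewrite !permwE tpermL tpermR -leqNgt; case: ltngtP.
by rewrite -big_split big1 //= => u _; rewrite aN addrN.
Qed.

Lemma mix_closed lab : sclosed (F := tp) (mix lab).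
Proof.
split=> [n|m n g f hf].
  split=> [x y _ _ w|a f g hf hg x y ne E w]; first by rewrite !ffunE mulr0.
  have [f1 f2] := hf x y ne E w; have [g1 g2] := hg x y ne E w.
  have E2 v : (a *: f + g) v = a * f v + g v by rewrite !ffunE.
  rewrite !E2 f1 g1 mulrDr mulrCA; split=> // o Ew.
  by rewrite f2 // g2 // mulr0 addr0.
move=> x y ne E w; split.
  rewrite -tpmE ntP /= !ffunE mulr_sumr; apply: eq_bigr => u _.
  by rewrite ffunE (proj1 (hf x y ne E u)) mulrCA.
move=> o Ew; rewrite ffunE; apply: (sum_alternating (x := x) (y := y)) => u.
  rewrite -{1}(permw_tperm_id Ew) -permw_pw gvalP (proj1 (hf x y ne E u)) o.
  by rewrite expr1 mulN1r mulrN.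
by move=> Eu; rewrite (proj2 (hf x y ne E u)) ?mulr0.
Qed.
(** The tensor product over all labels of divided powers (even) and exterior powers (odd). Cut out
    of one fixed tensor power by conditions on positions, these products need no tensor product of
    functors of varying degrees. *)
Definition Mix lab : spf k e := ssub (mix_closed lab).

Lemma Mix_fd lab : fd (Mix lab).
Proof.
move=> n; apply: (@fin_dim_inj _ _ (tp n) (fun x : Mix lab n => smval x)) => [|x y]; last exact: subm_ext.
by apply/fin_dimP; exists (enum {ffun {ffun 'I_e -> 'I_n} -> k}) => x;
  apply: (mem_enum predT (x : {ffun {ffun 'I_e -> 'I_n} -> k})).
Qed.

(** Induction on the number of moved positions: multiplying [s] by a transposition inside a block
    fixes one more of them. *)
Lemma mix_block lab n (f : tp n) (s : {perm 'I_e}) : mix lab f -> (forall q, lab (s q) = lab q) ->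
  exists c, (forall w, f (permw s w) = c * f w) /\ ((forall q, s q != q -> ~~ odd (lab q)) -> c = 1).
Proof.
move=> hf; move: {2}#|_| (leqnn #|[set q | s q != q]|) => N.
elim: N s => [|N IH] s le ls.
  exists 1; split=> // w; rewrite mul1r; congr (f _); apply/ffunP => q; rewrite permwE; congr (w _).
  by apply/eqP; move: le; rewrite leqn0 cards_eq0 => /eqP/setP/(_ q); rewrite !inE => /negbFE.
have [/existsP [q sq]|/existsPn s1] := boolP [exists q, s q != q]; last first.
  apply: IH => //; rewrite (_ : [set q | _] = set0) ?cards0 //.
  by apply/setP => q; rewrite !inE (negPf (s1 q)).
pose t := tperm q (s q).
have stq : (s * t)%g q = q by rewrite permM tpermR.
have stE z : s z = z -> (s * t)%g z = z.
  move=> Ez; rewrite permM Ez tpermD //; first by apply: contraNneq sq => Eqz; rewrite Eqz Ez.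
  by apply: contraNneq sq => Eqz; apply/eqP/(@perm_inj _ s); rewrite Eqz Ez.
have [||c [Ec c1]] := IH (s * t)%g.
- rewrite -ltnS; apply: leq_trans le; apply: proper_card; apply/properP; split.
    by apply/subsetP => z; rewrite !inE; apply: contraNneq => /stE ->.
  by exists q; rewrite !inE ?sq // stq eqxx.
- move=> z; rewrite permM /t; case: tpermP => [Ez|Ez|_ _]; last exact: ls.
  + by rewrite ls -Ez ls.
  + by rewrite -ls -[RHS]ls Ez.
exists (c * (-1) ^+ odd (lab q)); split=> [w|H].
  have -> : permw s w = permw (s * t)%g (permw t w) by rewrite permwM -mulgA tperm2 mulg1.
  by rewrite Ec -mulrA; congr (_ * _); apply: (proj1 (hf _ _ _ _ _)); rewrite 1?eq_sym ?ls.
rewrite (negPf (H q sq)) mulr1; apply: c1 => z nz; apply: H; by apply: contraNneq nz => /stE ->.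
Qed.

(** The identity of permutations that makes the double sum in d o d cancel in pairs. *)
Lemma tperm_klein (T : finType) (a b x y : T) :
  a != b -> a != x -> a != y -> b != x -> b != y -> y != x ->
  (tperm b x * tperm a y = tperm x y * (tperm a b * (tperm b y * tperm a x)))%g.
Proof.
move=> ab ax ay bx by' yx; have xy : x != y by rewrite eq_sym.
have N (u v : T) : u != v -> (u == v = false) * (v == u = false).
  by move=> h; rewrite (negPf h) eq_sym (negPf h).
have E := (N _ _ ab, N _ _ ax, N _ _ ay, N _ _ bx, N _ _ by', N _ _ xy).
apply/permP => i; rewrite !permM !permE /=.
have [E0|ia] := eqVneq i a; first by subst i; do 8!rewrite ?E ?eqxx /=.
have [E0|ib] := eqVneq i b; first by subst i; do 8!rewrite ?E ?eqxx /=.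
have [E0|ix] := eqVneq i x; first by subst i; do 8!rewrite ?E ?eqxx /=.
have [E0|iy] := eqVneq i y; first by subst i; do 8!rewrite ?E ?eqxx /=.
by do 8!rewrite ?(negPf ia) ?(negPf ib) ?(negPf ix) ?(negPf iy) /=.
Qed.

(** * Koszul complexes between divided and exterior powers *)

Section koszul.
Variables b b' : nat.
Hypotheses (ob : odd b) (ob' : ~~ odd b').
Definition upd lab q c : 'I_e -> nat := fun x => if x == q then c else lab x.

(* The Koszul differential moves position [q0] from a symmetric block to the alternating block. *)
Definition dlt lab q0 : nt tp tp := nt_id tp - \sum_(q | lab q == b) tpm (tperm q0 q).
Lemma dltE lab q0 n (f : tp n) w :
  dlt lab q0 n f w = f w - \sum_(q | lab q == b) f (permw (tperm q0 q) w).
Proof.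
rewrite /dlt ntEB.
have -> : (\sum_(q | lab q == b) tpm (tperm q0 q) : nt tp tp) n f = \sum_(q | lab q == b) tpm (tperm
  q0 q) n f.
  by apply: (big_morph (fun g : nt tp tp => g n f)) => [g h|]; rewrite ?ntE.
rewrite !ffunE sum_ffunE; congr (_ - _); by apply: eq_bigr => q _; rewrite tpmE.
Qed.

(** The new condition concerns [q0] together with an old alternating position [q1]: exchanging them
    swaps the leading term with the [q1] term of the sum and changes the sign of the others. *)
Lemma dlt_mix lab q0 n (f : tp n) : lab q0 = b' -> mix lab f -> mix (upd lab q0 b) (dlt lab q0 n f).
Proof.
move=> E0 hf.
have n0 q : lab q = b -> q0 != q by move=> E; apply: contraNneq ob' => Eq; rewrite -E0 Eq E.
have AA x y (w : word n) : x != y -> lab x = b -> lab y = b -> f (permw (tperm x y) w) = - f w.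
  by move=> ne Ex Ey; rewrite (proj1 (hf x y ne _ w)) ?Ex ?Ey // ob expr1 mulN1r.
have A0 x y (w : word n) : x != y -> lab x = b -> lab y = b -> w x = w y -> f w = 0.
  by move=> ne Ex Ey; apply: (proj2 (hf x y ne _ w)); rewrite Ex ?Ey.
have H01 q1 (w : word n) : lab q1 = b ->
    dlt lab q0 n f (permw (tperm q0 q1) w) = - dlt lab q0 n f w /\ (w q0 = w q1 -> dlt lab q0 n f w = 0).
  move=> E1; rewrite !dltE (bigD1 q1) ?E1 //= permw_tpermK [in X in _ /\ X](bigD1 q1) ?E1 //=.
  rewrite [in X in _ = X](bigD1 q1) ?E1 //=; split.
    rewrite (eq_bigr (fun q => - f (permw (tperm q0 q) w))) => [|q /andP [/eqP Eq ne]].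
      by rewrite sumrN; set S := \sum_(_ | _) _; zmod.
    have E' : tperm q0 q q1 = q1 by rewrite tpermD // n0.
    by rewrite permw_tpermJ tpermL E' [LHS]AA.
  move=> Ew; rewrite permw_tperm_id // big1 ?addr0 ?subrr // => q /andP [/eqP Eq ne].
  by apply: (A0 q q1); rewrite // !permwE tpermR tpermD ?n0.
move=> x y ne; rewrite /upd; have [Ex|nx] := eqVneq x q0; have [Ey|ny] := eqVneq y q0.
- by rewrite Ex Ey eqxx in ne.
- by move=> Eb w; subst x; rewrite ob expr1 mulN1r; have [] := H01 y w (esym Eb).
- move=> Eb w; subst y; rewrite Eb ob expr1 mulN1r tpermC; have [h1 h2] := H01 x w Eb.
  by split=> // _ /esym.
move=> El w; have [Eb|nb] := eqVneq (lab x) b; last first.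
  have fix_q q : lab q = b -> tperm x y q = q.
    move=> Eq; rewrite tpermD //; first by apply: contraNneq nb => ->; rewrite Eq.
    by apply: contraNneq nb; rewrite El => ->; rewrite Eq.
  split.
    rewrite !dltE (proj1 (hf _ _ ne El w)) mulrBr mulr_sumr; congr (_ - _); apply: eq_bigr => q /eqP Eq.
    rewrite -(proj1 (hf _ _ ne El _)) [in RHS]permw_tpermJ (fix_q q) //.
    by rewrite [tperm x y q0]tpermD.
  move=> o Ew; rewrite dltE (proj2 (hf _ _ ne El w)) // big1 ?subr0 // => q /eqP Eq.
  apply: (proj2 (hf _ _ ne El _)) => //; rewrite !permwE !tpermD //; last 2 first.
  - by rewrite eq_sym.
  - by apply: contraNneq nb => <-; rewrite Eq.
  - by rewrite eq_sym.
  - by apply: contraNneq nb; rewrite El => <-; rewrite Eq.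
have Eby : lab y = b by rewrite -El.
rewrite Eb ob expr1 mulN1r; split.
  rewrite !dltE AA // opprB addrC -sumrN [X in X - _](reindex_inj (@perm_inj _ (tperm x y))) /=.
  congr (_ - _); under eq_bigl => q.
    rewrite (_ : (lab (tperm x y q) == b) = (lab q == b)); first over.
    by case: tpermP => [->|->|]; rewrite ?Eb ?Eby.
  apply: eq_bigr => q /eqP Eq; have -> : q0 = tperm x y q0 by rewrite tpermD.
  by rewrite -permw_tpermJ AA // opprK; congr (f (permw (tperm _ _) _)); rewrite tpermD.
move=> _ Ew; rewrite dltE (A0 x y) // (bigD1 x) ?Eb //= (bigD1 y) ?Eby ?(eq_sym y) ?eqxx ?ne //=.
rewrite big1 ?addr0 => [|q /andP [/andP [/eqP Eq nqx] nqy]]; last first.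
  by apply: (A0 x y) => //; rewrite !permwE !tpermD // 1?eq_sym.
have -> : permw (tperm q0 y) w = permw (tperm x y) (permw (tperm q0 x) w).
  by rewrite permw_tpermJ tpermL tpermD // (permw_tperm_id Ew).
by rewrite (AA x y) // addrN subr0.
Qed.

(** In the double sum the terms of (x, y) and (y, x) cancel by [tperm_klein]; the remaining single
    sums cancel by the symmetry of [f] in [q0] and [q1]. *)
Lemma dlt_dlt lab q0 q1 n (f : tp n) : lab q0 = b' -> lab q1 = b -> mix (upd lab q1 b') f ->
  dlt lab q0 n (dlt (upd lab q1 b') q1 n f) = 0.
Proof.
move=> E0 E1 hf; apply/ffunP => w; rewrite [RHS]ffunE.
have ne : q0 != q1 by apply: contraNneq ob' => E; rewrite -E0 E E1.
have bb' : b' != b by apply: contraNneq ob' => ->.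
have A1E q : (upd lab q1 b' q == b) = (lab q == b) && (q != q1).
  by rewrite /upd; case: (eqVneq q q1) => _; rewrite ?andbF ?andbT ?(negPf bb').
have n0 q : lab q == b -> q0 != q by move=> /eqP E; apply: contraNneq ob' => Eq; rewrite -E0 Eq E.
have S01 v : f (permw (tperm q0 q1) v) = f v.
  rewrite (proj1 (hf _ _ ne _ _)) /upd ?eqxx (negPf ne) E0 // (negPf ob') mul1r //.
have Axy x y v : x != y -> (lab x == b) && (x != q1) -> (lab y == b) && (y != q1) -> f (permw (tperm
  x y) v) = - f v.
  move=> nxy /andP [/eqP Ex nx] /andP [/eqP Ey ny].
  by rewrite (proj1 (hf _ _ nxy _ _)) /upd (negPf nx) ?(negPf ny) ?Ex ?Ey // ob expr1 mulN1r.
rewrite dltE (bigD1 q1) ?E1 //=.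
have gE v : dlt (upd lab q1 b') q1 n f v = f v - \sum_(q | (lab q == b) && (q != q1)) f (permw (tperm
  q1 q) v).
  by rewrite dltE; congr (_ - _); apply: eq_bigl.
under [X in _ - (_ + X)]eq_bigr do rewrite gE.
rewrite !gE S01 sumrB.
have -> : \sum_(q | (lab q == b) && (q != q1)) f (permw (tperm q1 q) (permw (tperm q0 q1) w)) =
    \sum_(q | (lab q == b) && (q != q1)) f (permw (tperm q0 q) w).
  apply: eq_bigr => q /andP [Eq nq]; rewrite -S01 permw_tpermJ permw_tpermK tpermR tpermD ?n0 //.
  by rewrite eq_sym.
have -> : \sum_(i | (lab i == b) && (i != q1)) \sum_(q | (lab q == b) && (q != q1))
    f (permw (tperm q1 q) (permw (tperm q0 i) w)) = \sum_(q | (lab q == b) && (q != q1)) f (permw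
      (tperm q1 q) w).
  under eq_bigr => i Ai do rewrite (bigD1 i) //=.
  rewrite big_split /= [X in _ + X = _](_ : _ = 0) ?addr0.
    apply: eq_bigr => i /andP [Ei ni]; rewrite permw_tpermJ tpermR [tperm q1 i q0]tpermD ?S01 //.
      by rewrite eq_sym.
    by rewrite eq_sym n0.
  rewrite pair_big_dep /=.
  rewrite (bigID (fun p : 'I_e * 'I_e => p.1 < p.2)%N) /= [X in _ + X](reindex_inj (h := fun p =>
    (p.2, p.1))) /=; last first.
    by move=> [x1 x2] [y1 y2] /= [-> ->].
  rewrite [X in _ + X](eq_bigl (fun p : 'I_e * 'I_e => ((lab p.1 == b) && (p.1 != q1) &&
      ((lab p.2 == b) && (p.2 != q1) && (p.2 != p.1)) && (p.1 < p.2)%N))) => [|[x y]]; last first.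
    rewrite /= -leqNgt (eq_sym x y) ltn_neqAle val_eqE (eq_sym x y).
    by case: (lab x == b); case: (x != q1); case: (lab y == b); case: (y != q1); case: (y != x);
      rewrite ?andbF ?andbT.
  rewrite -big_split big1 //= => -[x y] /= /andP [/andP [Ax /andP [Ay nyx]] _].
  have [/andP [Ex nx] /andP [Ey ny]] := (Ax, Ay).
  have -> : permw (tperm q1 x) (permw (tperm q0 y) w) =
      permw (tperm x y) (permw (tperm q0 q1) (permw (tperm q1 y) (permw (tperm q0 x) w))).
    rewrite !permwM -?mulgA; congr permw; apply: tperm_klein => //; rewrite ?n0 //; rewrite eq_sym //.
  have nxy : x != y by rewrite eq_sym.
  by set v := permw (tperm q1 y) _; rewrite (Axy x y) // S01 addrN.
by set S1 := \sum_(_ | _) _; set S2 := \sum_(_ | _) _; zmod.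
Qed.

(* The contracting homotopy moves the smallest letter of the symmetric block to position [q1], *)
(* provided it is smaller than all the letters of the alternating block.                     *)
Definition hmin lab q1 n (f : tp n) : tp n := [ffun w : word n =>
  let r := [arg min_(r < q1 | lab r == b') (w r : nat)] in
  if [forall q, (lab q == b) ==> (w r < w q)%N] then f (permw (tperm q1 r) w) else 0].

Section homotopy.
Variables (lab : 'I_e -> nat) (q1 : 'I_e) (n : nat) (f : tp n).
Hypotheses (E1 : lab q1 = b) (hf : mix lab f).
Let lab1 := upd lab q1 b'.
Let bb' : b' != b. Proof. by apply: contraNneq ob' => ->. Qed.
Let L1 : lab1 q1 = b'. Proof. by rewrite /lab1 /upd eqxx. Qed.
Let L1E q : q != q1 -> lab1 q = lab q. Proof. by rewrite /lab1 /upd => /negPf ->. Qed.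
Let symf x y (w : word n) : x != q1 -> y != q1 -> lab1 x = b' -> lab1 y = b' -> f (permw (tperm x y) w) = f w.
Proof.
move=> nx ny; rewrite !L1E // => Ex Ey; have [->|ne] := eqVneq x y; first by rewrite permw_tperm_id.
by rewrite (proj1 (hf ne _ _)) ?Ex // (negPf ob') mul1r.
Qed.

Let indep r r' (w : word n) : lab1 r = b' -> lab1 r' = b' -> w r = w r' ->
  f (permw (tperm q1 r) w) = f (permw (tperm q1 r') w).
Proof.
move=> Er Er' Ew; have [->|ne] := eqVneq r r'; first by [].
have [E|nr] := eqVneq r q1; first by subst r; rewrite (permw_tperm_id Ew) tperm1 permw1.
have [E|nr'] := eqVneq r' q1; first by subst r'; rewrite permw_tperm_id // tperm1 permw1.
by rewrite -(symf (x := r) (y := r')) // permw_tpermJ tpermL tpermD // [permw (tperm r r') w]permw_tperm_id.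
Qed.

Lemma hminE (w : word n) r : lab1 r = b' -> (forall r', lab1 r' = b' -> (w r <= w r')%N) ->
  hmin lab1 q1 f w = if [forall q, (lab1 q == b) ==> (w r < w q)%N] then f (permw (tperm q1 r) w) else 0.
Proof.
move=> Er min_r; rewrite ffunE; case: arg_minnP => [|r' /eqP Er' min_r']; first by rewrite L1.
have Ew : w r = w r' by apply/val_inj/eqP; rewrite eqn_leq min_r // min_r' // Er.
by rewrite Ew (indep Er Er' Ew).
Qed.

Lemma hmin_ex (w : word n) : exists r, lab1 r = b' /\ forall r', lab1 r' = b' -> (w r <= w r')%N.
Proof.
have [|r /eqP Er min_r] := @arg_minnP _ q1 (fun r => lab1 r == b') (fun r => w r : nat); first by rewrite L1.
by exists r; split=> // r' /eqP; apply: min_r.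
Qed.

Lemma hmin_mix : mix lab1 (hmin lab1 q1 f).
Proof.
move=> x y ne El w; have [r [Er min_r]] := hmin_ex w.
have [Ex|nx] := eqVneq (lab1 x) b'.
  have Ey : lab1 y = b' by rewrite -El.
  rewrite Ex (negPf ob') mul1r; split=> //.
  have permU z : lab1 (tperm x y z) = b' -> lab1 z = b' by case: tpermP => [->|->|].
  have Er' : lab1 (tperm x y r) = b' by apply: permU; rewrite tpermK.
  rewrite (hminE Er') => [|r' Er'']; last by rewrite !permwE tpermK min_r //; apply: permU; rewrite tpermK.
  rewrite (hminE Er min_r) permwE tpermK.
  rewrite (@eq_forallb _ _ (fun q => (lab1 q == b) ==> (w r < w q)%N)) => [|q]; last first.
    case: eqVneq => //= Eq; rewrite permwE tpermD //; apply: contraNneq bb' => Exq.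
      by rewrite -Ex Exq Eq.
    by rewrite -Ey Exq Eq.
  case: ifP => // _.
  suff G u : u != q1 -> lab1 u = b' -> f (permw (tperm q1 (tperm q1 u r)) (permw (tperm q1 u) w)) = f
    (permw (tperm q1 r) w).
    have [Ex1|nx1] := eqVneq x q1; first by subst x; apply: G; rewrite // eq_sym.
    have [Ey1|ny1] := eqVneq y q1; first by subst y; rewrite !(tpermC x); apply: G.
    have {1}-> : q1 = tperm x y q1 by rewrite tpermD.
    by rewrite -permw_tpermJ symf.
  move=> nu Eu; have [Eru|nru] := eqVneq r u; first by subst u; rewrite tpermR tperm1 permw1.
  have [Er1|nr1] := eqVneq r q1; first by rewrite Er1 tpermL tperm1 permw1 permw_tpermK.
  have Eur : tperm q1 u r = r by rewrite tpermD // eq_sym.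
  have Eru : tperm q1 r u = u by rewrite tpermD // eq_sym.
  by rewrite Eur permw_tpermJ tpermL Eru symf.
have nx1 : x != q1 by apply: contraNneq nx => ->; rewrite L1.
have ny1 : y != q1 by apply: contraNneq nx => Ey; rewrite El Ey L1.
have fixU r' : lab1 r' = b' -> tperm x y r' = r'.
  move=> E'; rewrite tpermD //; first by apply: contraNneq nx => ->; rewrite E'.
  by apply: contraNneq nx; rewrite El => ->; rewrite E'.
have [elab ne'] : lab x = lab y /\ lab1 x = lab x by rewrite -!L1E.
rewrite (hminE Er min_r) (hminE Er) => [|r' Er']; last by rewrite !permwE !fixU //; apply: min_r.
rewrite permwE fixU //; split.
  have -> : [forall q, (lab1 q == b) ==> (w r < permw (tperm x y) w q)%N] = [forall q, (lab1 q == b)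
    ==> (w r < w q)%N].
    have P q : (lab1 (tperm x y q) == b) = (lab1 q == b) by case: tpermP => [->|->|] //; rewrite El.
    apply/forallP/forallP => H q; have := H (tperm x y q); by rewrite P permwE ?tpermK.
  case: ifP => _; last by rewrite mulr0.
  rewrite -{1}(fixU q1 L1) -{1}(fixU r Er) -permw_tpermJ (proj1 (hf ne elab _)) ne' //.
move=> o Ew; case: ifP => // _; apply: (proj2 (hf ne elab _)); rewrite -?ne' // !permwE.
have fx z : lab1 z = lab1 x -> tperm q1 r z = z.
  move=> Ez; rewrite tpermD //; first by apply: contraNneq nx => E'; rewrite -Ez -E' L1.
  by apply: contraNneq nx => E'; rewrite -Ez -E' Er.
by rewrite !fx.
Qed.

Let altf x y (w : word n) : x != y -> lab x = b -> lab y = b -> f (permw (tperm x y) w) = - f w.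
Proof. by move=> ne Ex Ey; rewrite (proj1 (hf ne _ _)) ?Ex ?Ey // ob expr1 mulN1r. Qed.
Let A1E q : (lab1 q == b) = (lab q == b) && (q != q1).
Proof. by rewrite /lab1 /upd; case: (eqVneq q q1) => _; rewrite ?andbF ?andbT ?(negPf bb'). Qed.
Let dltE1 w : dlt lab1 q1 n (hmin lab1 q1 f) w =
  hmin lab1 q1 f w - \sum_(q | (lab q == b) && (q != q1)) hmin lab1 q1 f (permw (tperm q1 q) w).
Proof. by rewrite dltE; congr (_ - _); apply: eq_bigl => q; rewrite A1E. Qed.

(** Let [c] be the alternating position with the smallest letter. Bringing any other position to
    [q1] leaves the letter of [c] in the alternating block, not above the symmetric letters, so
    [hmin] vanishes there and only the term of [c] survives. *)
Lemma hmin_big (w : word n) : {in [pred q | lab q == b] &, injective w} ->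
  (forall r, lab r = b' -> exists q, lab q = b /\ (w q <= w r)%N) ->
  dlt lab1 q1 n (hmin lab1 q1 f) w = f w.
Proof.
move=> w_inj nmin.
have [|c /eqP Ec min_c] := @arg_minnP _ q1 (fun q => lab q == b) (fun q => w q : nat); first by rewrite E1.
have cU r : lab r = b' -> (w c <= w r)%N.
  by move=> /nmin [q [/eqP Eq le]]; apply: leq_trans (min_c q Eq) le.
have H q : lab q = b -> hmin lab1 q1 f (permw (tperm q1 q) w) = if q == c then f (permw (tperm q1 q)
  w) else 0.
  move=> Eq; set v := permw _ w.
  have vU r : lab1 r = b' -> r != q1 -> lab r = b' /\ v r = w r.
    move=> Er nr; rewrite -L1E //; split=> //; rewrite permwE tpermD 1?eq_sym //.
    by apply: contraNneq bb' => Erq; rewrite -Er L1E // Erq Eq.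
  have v1 : v q1 = w q by rewrite permwE tpermL.
  case: eqVneq => [Eqc|nqc].
    subst q; rewrite (hminE (r := q1)) // => [|r Er].
      rewrite tperm1 permw1; case: forallP => // -[] q; apply/implyP; rewrite A1E => /andP [Eq' nq].
      rewrite v1 permwE ltn_neqAle; have := tpermP q1 c q; case=> [E|E|_ /eqP nqc];
        first by rewrite E eqxx in nq.
        by rewrite min_c ?E1 // andbT; apply: contraNneq nq => /val_inj /w_inj;
          rewrite !inE E Ec E1 eqxx => /(_ isT isT) ->.
      by rewrite min_c // andbT; apply: contraNneq nqc => /val_inj /w_inj;
        rewrite !inE Ec Eq' eqxx => /(_ isT isT) ->.
    have [->|nr] := eqVneq r q1; first by [].
    by have [Er' ->] := vU r Er nr; rewrite v1 cU.
  have [r [Er min_r]] := hmin_ex v; rewrite (hminE Er min_r) //; case: forallP => // /(_ (tperm q1 q c)).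
  have Ev : v (tperm q1 q c) = w c by rewrite permwE tpermK.
  rewrite Ev A1E => /implyP Hq; exfalso.
  have : (w c <= v r)%N.
    have [->|nr] := eqVneq r q1; first by rewrite v1 min_c ?Eq.
    by have [Er' ->] := vU r Er nr; rewrite cU.
  rewrite leqNgt Hq //; case: tpermP => [E|E|]; rewrite ?Eq ?Ec ?eqxx //=.
  - by rewrite -E.
  - by rewrite E eqxx in nqc.
  - by move=> /eqP.
rewrite dltE1; have E11 : permw (tperm q1 q1) w = w by rewrite tperm1 permw1.
have H1 := H q1 E1; rewrite E11 in H1; rewrite H1.
have [Eq1c|nq1c] := eqVneq q1 c.
  rewrite big1 ?subr0 // => q /andP [/eqP Eq nq]; rewrite H // -Eq1c (negPf nq) //.
rewrite (bigD1 c) /= ?Ec ?eqxx 1?eq_sym // H // eqxx big1 => [|q /andP [/andP [/eqP Eq nq] nqc]].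
  by rewrite addr0 altf // sub0r opprK.
by rewrite H // (negPf nqc).
Qed.

(** In every term the smallest symmetric letter is the one at [r] and lies below the alternating
    letters, so no term is cut off. *)
Lemma hmin_small (w : word n) r : lab r = b' -> (forall r', lab r' = b' -> (w r <= w r')%N) ->
  (forall q, lab q = b -> (w r < w q)%N) -> dlt lab1 q1 n (hmin lab1 q1 f) w =
  f (permw (tperm q1 r) w) - \sum_(q | (lab q == b) && (q != q1)) f (permw (tperm q1 r) (permw (tperm
    q1 q) w)).
Proof.
move=> Er min_r rA.
have nr : r != q1 by apply: contraNneq bb' => E; rewrite -Er E E1.
have Er1 : lab1 r = b' by rewrite L1E.
have H q : lab q = b -> hmin lab1 q1 f (permw (tperm q1 q) w) = f (permw (tperm q1 r) (permw (tperm q1 q) w)).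
  move=> Eq; have nrq : q != r by apply: contraNneq bb' => E; rewrite -Er -E Eq.
  have vr : permw (tperm q1 q) w r = w r by rewrite permwE tpermD // eq_sym.
  rewrite (hminE Er1) => [|r' Er']; rewrite vr.
    case: forallP => // -[] q'; apply/implyP; rewrite A1E => /andP [Eq' nq'].
    by rewrite permwE; apply: rA; case: tpermP => [E'|E'|_ _]; [exact: Eq|exact: E1|exact/eqP].
  rewrite permwE; case: tpermP => [_|E'|/eqP nq _].
  - exact: ltnW (rA _ Eq).
  - exact: ltnW (rA _ E1).
  - by apply: min_r; rewrite -L1E.
rewrite dltE1; have E11 : permw (tperm q1 q1) w = w by rewrite tperm1 permw1.
have H1 := H q1 E1; rewrite E11 in H1; rewrite H1; congr (_ - _).
by apply: eq_bigr => q /andP [/eqP Eq _]; apply: H.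
Qed.
End homotopy.

(** Exactness at an inner spot. On words with a repeated alternating letter both sides vanish; if an
    alternating letter is not above the symmetric ones, [hmin_big] applies; otherwise [hmin_small]
    gives a sum that the cocycle condition, read at the word with [q0] and [r] exchanged, evaluates
    to [f]. *)
Lemma ker_dlt lab q0 q1 n (f : tp n) : lab q0 = b' -> lab q1 = b -> mix lab f ->
  dlt lab q0 n f = 0 -> dlt (upd lab q1 b') q1 n (hmin (upd lab q1 b') q1 f) = f.
Proof.
move=> E0 E1 hf df; apply/ffunP => w.
have ne : q0 != q1 by apply: contraNneq ob' => E; rewrite -E0 E E1.
have bb' : b' != b by apply: contraNneq ob' => ->.
have [w_inj|] := boolP [forall x, forall y, (lab x == b) && (lab y == b) && (w x == w y) ==> (x ==
  y)]; last first.
  rewrite negb_forall => /existsP [x]; rewrite negb_forall => /existsP [y].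
  rewrite negb_imply => /andP [/andP [/andP [/eqP Ex /eqP Ey] /eqP Ew] nxy].
  have [_ ->] := hf x y nxy (etrans Ex (esym Ey)) w; rewrite ?Ex //.
  have := @dlt_mix (upd lab q1 b') q1 n _ _ (hmin_mix (q1 := q1) hf); rewrite {1}/upd eqxx => /(_ erefl) hd.
  have L z : upd (upd lab q1 b') q1 b z = lab z by rewrite /upd; case: eqP => // ->.
  by have [_ ->] := hd x y nxy (etrans (L x) (etrans Ex (esym (etrans (L y) Ey)))) w; rewrite ?L ?Ex.
have {}w_inj : {in [pred q | lab q == b] &, injective w}.
  by move=> x y; rewrite !inE => Ex Ey Ew; move/forallP/(_ x)/forallP/(_ y): w_inj;
    rewrite Ex Ey Ew eqxx => /eqP.
have [r /eqP Er min_r] := @arg_minnP _ q0 (fun r => lab r == b') (fun r => w r : nat) (introT eqP E0).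
have {}min_r r' : lab r' = b' -> (w r <= w r')%N by move=> /eqP; apply: min_r.
have [/forallP sm|/forallPn [c]] := boolP [forall q, (lab q == b) ==> (w r < w q)%N]; last first.
  rewrite negb_imply -leqNgt => /andP [/eqP Ec le]; apply: hmin_big => // r' /min_r ler.
  by exists c; split=> //; apply: leq_trans le ler.
rewrite (hmin_small E1 hf Er min_r) => [|q /eqP Eq]; last by have := sm q; rewrite Eq.
have S v : f (permw (tperm q0 r) v) = f v.
  have [->|nr] := eqVneq q0 r; first by rewrite tperm1 permw1.
  by rewrite (proj1 (hf _ _ nr _ _)) ?E0 // (negPf ob') mul1r.
have T q : lab q = b -> f (permw (tperm q0 q) (permw (tperm q0 r) w)) = f (permw (tperm r q) w).
  move=> Eq; rewrite -S permw_tpermJ permw_tpermK tpermL tpermD //.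
    by apply: contraNneq bb' => E; rewrite -E0 E Eq.
  by apply: contraNneq bb' => E; rewrite -Er E Eq.
have := congr1 (fun g : tp n => g (permw (tperm q0 r) w)) df; rewrite /= dltE [RHS]ffunE S.
move=> /eqP; rewrite subr_eq0 => /eqP ->; rewrite [RHS](bigD1 q1) ?E1 //= (T q1) // tpermC; congr (_ + _).
rewrite -sumrN; apply: eq_bigr => q /andP [/eqP Eq nq]; rewrite T //.
have nrq : q1 != r by apply: contraNneq bb' => E; rewrite -Er -E E1.
have nqr : q != r by apply: contraNneq bb' => E; rewrite -Er -E Eq.
have -> : permw (tperm r q) w = permw (tperm q1 q) (permw (tperm q1 r) (permw (tperm q1 q) w)).
  by rewrite [in RHS]permw_tpermJ permw_tpermK tpermL tpermD // tpermC.
have nq' : q1 != q by rewrite eq_sym.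
by rewrite [RHS](proj1 (hf q1 q nq' _ _)) ?E1 ?Eq // ob expr1 mulN1r tpermC.
Qed.

Definition dltM lab q0 : nt (Mix lab) tp := nt_comp (dlt lab q0) (ssub_in (mix_closed lab)).

(** Induction on the size of the alternating block [b]. The kernel of each differential is the image
    of the previous one, which starts with one alternating position fewer; for an empty block the
    differential is the inclusion. *)
Lemma pf_dlt_im lab q0 : lab q0 = b' ->
  (forall lab', (#|[set q | odd (lab' q)]| <= #|[set q | odd (lab q)]|)%N -> pf (Mix lab')) ->
  pf (ssub (im_closed (dltM lab q0))).
Proof.
move: {2}#|_| (erefl #|[set q | lab q == b]|) => N.
elim: N lab q0 => [|N IH] lab q0 EN E0 pM; apply: pf_im (pM _ (leqnn _)).
  apply: pf0 => n [[f hf] /= df]; apply: subm_ext; apply: subm_ext => /=; apply/ffunP => w.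
  move/(congr1 (fun g : tp n => g w)): df; rewrite /= dltE !ffunE big1 ?subr0 // => q Eq.
  by move/eqP: EN; rewrite cards_eq0 => /eqP/setP/(_ q); rewrite !inE Eq.
have [q1] : exists q1, q1 \in [set q | lab q == b] by apply/set0Pn; rewrite -card_gt0 EN.
rewrite inE => /eqP E1; pose lab1 := upd lab q1 b'.
have ne : q0 != q1 by apply: contraNneq ob' => E; rewrite -E0 E E1.
have bb' : b' != b by apply: contraNneq ob' => ->.
have L1 : lab1 q1 = b' by rewrite /lab1 /upd eqxx.
have L z : upd lab1 q1 b z = lab z by rewrite /lab1 /upd; case: eqP => // ->.
have EN1 : #|[set q | lab1 q == b]| = N.
  apply: succn_inj; rewrite -EN (cardsD1 q1 [set q | lab q == b]) inE E1 eqxx add1n; congr _.+1.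
  by apply: eq_card => q; rewrite !inE /lab1 /upd; case: (eqVneq q q1) => _ //=; rewrite (negPf bb').
have pM1 lab' : (#|[set q | odd (lab' q)]| <= #|[set q | odd (lab1 q)]|)%N -> pf (Mix lab').
  move=> le; apply: pM; apply: leq_trans le _; apply: subset_leq_card; apply/subsetP => q.
  by rewrite !inE /lab1 /upd; case: eqP => // _; rewrite (negPf ob').
have mixL n (f : tp n) : mix (upd lab1 q1 b) f -> mix lab f.
  by move=> hf x y nxy E w; have := hf x y nxy; rewrite !L => /(_ E w).
have Uim n (z : ssub (im_closed (dltM lab1 q1)) n) : mix lab (smval z).
  by case: (smP z) => -[f hf] ->; apply: mixL; apply: dlt_mix.
have Uker n (z : ssub (im_closed (dltM lab1 q1)) n) :
    dltM lab q0 n (ssub_lift (mix_closed lab) (f := ssub_in _) Uim n z) = 0.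
  by rewrite /=; case: (smP z) => -[f hf] ->; apply: dlt_dlt.
apply: (pf_iso (f := ssub_lift (ker_closed (dltM lab q0))
  (f := ssub_lift (mix_closed lab) (f := ssub_in _) Uim) Uker)) (IH lab1 q1 EN1 L1 pM1).
- by move=> n x /(congr1 (fun y => smval (smval y))) E; apply: subm_ext.
- move=> n [[f hf] df].
  have Uf : exists g, f = dltM lab1 q1 n g.
    exists (@Subm _ _ (mix lab1 (n := n)) (proj1 (mix_closed lab1) n) (hmin lab1 q1 f) (hmin_mix (q1
      := q1) hf)).
    exact: esym (ker_dlt E0 E1 hf df).
  exists (@Subm _ _ (fun y => exists x, y = dltM lab1 q1 n x) (proj1 (im_closed (dltM lab1 q1)) n) f Uf).
  by apply: subm_ext; apply: subm_ext.
Qed.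

Lemma pf_Mix_step lab q1 : lab q1 = b -> (forall q, lab q != b') ->
  (forall lab', (#|[set q | odd (lab' q)]| < #|[set q | odd (lab q)]|)%N -> pf (Mix lab')) -> pf (Mix lab).
Proof.
move=> E1 nb' pM; pose lab1 := upd lab q1 b'.
have bb' : b' != b by apply: contraNneq ob' => ->.
have L1 : lab1 q1 = b' by rewrite /lab1 /upd eqxx.
have L z : upd lab1 q1 b z = lab z by rewrite /lab1 /upd; case: eqP => // ->.
have pM1 lab' : (#|[set q | odd (lab' q)]| <= #|[set q | odd (lab1 q)]|)%N -> pf (Mix lab').
  move=> le; apply: pM; apply: leq_ltn_trans le _; apply: proper_card; apply/properP; split.
    by apply/subsetP => q; rewrite !inE /lab1 /upd; case: eqP => // _; rewrite (negPf ob').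
  by exists q1; rewrite !inE ?E1 ?ob // L1.
have mixL n (f : tp n) : mix (upd lab1 q1 b) f -> mix lab f.
  by move=> hf x y nxy E w; have := hf x y nxy; rewrite !L => /(_ E w).
have Uim n (z : ssub (im_closed (dltM lab1 q1)) n) : mix lab (smval z).
  by case: (smP z) => -[f hf] ->; apply: mixL; apply: dlt_mix.
apply: (pf_iso (f := ssub_lift (mix_closed lab) (f := ssub_in _) Uim)) (pf_dlt_im L1 pM1).
- by move=> n x /(congr1 (@smval _ _ _ _)) E; apply: subm_ext.
- move=> n [f hf]; have Uf : exists g, f = dltM lab1 q1 n g.
    exists (@Subm _ _ (mix lab1 (n := n)) (proj1 (mix_closed lab1) n) (hmin lab1 q1 f) (hmin_mix (q1
      := q1) hf)).
    apply/ffunP => w /=.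
    have [w_inj|] := boolP [forall x, forall y, (lab x == b) && (lab y == b) && (w x == w y) ==> (x
      == y)]; last first.
      rewrite negb_forall => /existsP [x]; rewrite negb_forall => /existsP [y].
      rewrite negb_imply => /andP [/andP [/andP [/eqP Ex /eqP Ey] /eqP Ew] nxy].
      have [_ ->] := hf x y nxy (etrans Ex (esym Ey)) w; rewrite ?Ex //.
      have hd := mixL _ _ (dlt_mix L1 (hmin_mix (q1 := q1) hf)).
      by have [_ ->] := hd x y nxy (etrans Ex (esym Ey)) w; rewrite ?Ex.
    rewrite hmin_big // => [x y|r /eqP]; last by rewrite (negPf (nb' r)).
    rewrite !inE => Ex Ey Ew; move/forallP/(_ x)/forallP/(_ y): w_inj.
    by rewrite Ex Ey Ew eqxx => /eqP.
  exists (@Subm _ _ (fun y => exists x, y = dltM lab1 q1 n x) (proj1 (im_closed (dltM lab1 q1)) n) f Uf).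
  exact: subm_ext.
Qed.
End koszul.

(** * Products of divided powers are projective *)

Section symmetric.
Variables (lab : 'I_e -> nat) (ev : forall q, ~~ odd (lab q)).
(** Large enough for every label to be a letter of 'I_r; [p] is the labelling read as a word. *)
Let r : nat := (\sum_q lab q).+1.
Let p : word r := [ffun q => inord (lab q)].
Let pE x y : p x = p y -> lab x = lab y.
Proof.
have lt z : (lab z < r)%N by rewrite ltnS (bigD1 z) //= leq_addr.
by rewrite !ffunE => /(congr1 val); rewrite /= !inordK.
Qed.
Let inv n (f : tp n) (s : {perm 'I_e}) (w : word n) : mix lab f -> permw s p = p -> f (permw s w) = f w.
Proof.
move=> hf Es; have [|c [Ec c1]] := mix_block (s := s) hf; last by rewrite Ec c1 ?mul1r // => q _; apply: ev.
by move=> q; apply: pE; rewrite -[in RHS]Es permwE.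
Qed.

Let spread_ n (f : tp n) : tens k e ('I_r * 'I_n)%type := [ffun t : {ffun 'I_e -> 'I_r * 'I_n} =>
  (if [pick s | [ffun i => (t i).1] == permw s p] is Some s
  then f (permw s^-1%g [ffun i => (t i).2]) else 0) : k^o].
Let spread_pw n (f : tp n) s (w : word n) : mix lab f -> spread_ f (pw (permw s p) w) = f (permw s^-1%g w).
Proof.
move=> hf; rewrite ffunE.
have -> : [ffun i => (pw (permw s p) w i).1] = permw s p by apply/ffunP => i; rewrite !ffunE.
have -> : [ffun i => (pw (permw s p) w i).2] = w by apply/ffunP => i; rewrite !ffunE.
case: pickP => [s' /eqP Es|/(_ s)]; last by rewrite eqxx.
have -> : permw s'^-1%g w = permw (s'^-1 * s)%g (permw s^-1%g w) by rewrite permwM -mulgA mulgV mulg1.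
by apply: inv; rewrite // -permwM Es permwM mulVg permw1.
Qed.
Let spread_pw0 n (f : tp n) a (w : word n) : ~~ orb p a -> spread_ f (pw a w) = 0.
Proof.
move=> no; rewrite ffunE; have -> : [ffun i => (pw a w i).1] = a by apply/ffunP => i; rewrite !ffunE.
by case: pickP => // s /eqP E; case/negP: no; apply/orbP; exists s.
Qed.
Let spread_sym n (f : tp n) : mix lab f -> spread_ f \in @tsym k e _.
Proof.
move=> hf; apply/tsymP => s t; rewrite [t]pw_eta permw_pw; set a := [ffun i => _]; set w := [ffun i => _].
have [/orbP [s' ->]|no] := boolP (orb p a); last by rewrite !spread_pw0 ?orb_permw.
by rewrite permwM !spread_pw // permwM invMg -mulgA mulVg mulg1.
Qed.
Let spread : nt (Mix lab) (hrep k e r).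
Proof.
refine (@Nt k e (Mix lab) (hrep k e r) (fun n f => MkGam (spread_sym (smP f))) _ _).
  move=> n a [f hf] [g hg]; apply: gam_eq => t; rewrite gvalE /= !ffunE.
  by case: pickP => [s _|_]; rewrite ?ffunE // mulr0 addr0.
move=> m n g [f hf]; apply: gam_eq_pw => a w; rewrite gcompE /=.
have hgf : mix lab (tact g f) by apply: (proj2 (mix_closed lab)).
have [/orbP [s ->]|no] := boolP (orb p a); last first.
  by rewrite spread_pw0 // big1 // => u _; rewrite spread_pw0 // mul0r.
rewrite spread_pw // ffunE (reindex_inj (@permw_inj _ _ s^-1%g)) /=; apply: eq_bigr => u _.
by rewrite spread_pw // -permw_pw gvalP mulrC.
Defined.
Let slice_mix n (g : hrep k e r n) : mix lab ([ffun w => gval g (pw p w)] : tp n).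
Proof.
move=> x y ne E w; rewrite (negPf (ev x)) mul1r; split=> //; rewrite !ffunE.
have Ep : p x = p y by rewrite !ffunE E.
by rewrite -[in RHS](gvalP g (tperm x y)) permw_pw (permw_tperm_id Ep).
Qed.
Let slice : nt (hrep k e r) (Mix lab).
Proof.
refine (@Nt k e (hrep k e r) (Mix lab)
  (fun n g => @Subm _ _ (mix lab (n := n)) (proj1 (mix_closed lab) n) _ (slice_mix g)) _ _).
  by move=> n a f g; apply: subm_ext; apply/ffunP => w; rewrite !ffunE.
move=> m n h g; apply: subm_ext; apply/ffunP => w; rewrite ffunE gcompE !ffunE.
by apply: eq_bigr => u _; rewrite !ffunE mulrC.
Defined.

(** A product of divided powers is the direct summand of weight [p] of the representable functor at
    k^r: [slice] restricts to words with first component [p], and [spread] extends by symmetry over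
    the orbit of [p] and by 0 elsewhere. *)
Lemma Mix_projective : projective (C := Pcat k e) (Mix lab).
Proof.
apply: (retract_projective (i := spread) (r := slice)); last exact: hrep_projective.
move=> n [f hf]; apply: subm_ext; apply/ffunP => w; rewrite ffunE /=.
by have := spread_pw 1%g w hf; rewrite permw1 invg1 permw1.
Qed.
End symmetric.

Lemma pf_Mix lab : pf (Mix lab).
Proof.
move: {2}#|_| (leqnn #|[set q | odd (lab q)]|) => N; elim: N lab => [|N IH] lab le.
  apply: pf_proj (@Mix_fd lab); apply: Mix_projective => q.
  by move: le; rewrite leqn0 cards_eq0 => /eqP/setP/(_ q); rewrite !inE => ->.
have [/existsP [q1 o1]|/existsPn ev] := boolP [exists q, odd (lab q)]; last first.
  by apply: pf_proj (@Mix_fd lab); apply: Mix_projective.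
(* An even label larger than all labels in use. *)
pose b' := ((\sum_q lab q).+1).*2.
apply: (@pf_Mix_step (lab q1) b' o1 _ lab q1) => //; first by rewrite /b' odd_double.
  move=> q; rewrite neq_ltn; apply/orP; left; rewrite /b' -addnn; apply: leq_trans (leq_addr _ _).
  by rewrite ltnS (bigD1 q) //= leq_addr.
by move=> lab' lt; apply: IH; rewrite -ltnS; apply: leq_trans lt le.
Qed.
End mixed_powers.

(** Elements of S outside I exceed all elements of I outside S, and there are equally many of
    both. *)
Lemma init_sum n (S I : {set 'I_n}) : #|S| = #|I| ->
  (forall a b : 'I_n, a \in I -> (b < a)%N -> b \in I) ->
  (\sum_(a in I) a <= \sum_(a in S) a ?= iff (S == I))%N.
Proof.
move=> card_SI init; have [->|ne] := eqVneq S I; first exact: leqif_refl.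
have card_D : #|S :\: I| = #|I :\: S|.
  by move: (cardsID I S) (cardsID S I); rewrite [I :&: S]setIC card_SI; lia.
have lt : (\sum_(a in I) a < \sum_(a in S) a)%N.
  rewrite (big_setID S) /= [X in (_ < X)%N](big_setID I) /= setIC ltn_add2l.
  have D0 : (0 < #|S :\: I|)%N.
    rewrite card_gt0; apply: contraNneq ne => D0; rewrite eqEcard card_SI leqnn andbT.
    by rewrite -setD_eq0 D0.
  have [b0 b0D] := card_gt0P D0.
  have [b bD min_b] := arg_minnP (fun a : 'I_n => a : nat) b0D.
  have bI : b \notin I.
    have bD' : b \in S :\: I by exact: bD.
    by move: bD'; rewrite inE => /andP [].
  have b_gt a : a \in I :\: S -> (a < b)%N.
    rewrite inE => /andP [_ aI]; rewrite ltnNge leq_eqVlt negb_or; apply/andP; split.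
      by apply: contraNneq bI => /val_inj ->.
    by apply: contra bI => /(init a b aI).
  apply: (@leq_trans (\sum_(a in S :\: I) b)%N); last by apply: leq_sum => a; apply: min_b.
  rewrite sum_nat_const card_D -sum_nat_const.
  have [a0 a0D] : exists a, a \in I :\: S by apply/card_gt0P; rewrite -card_D.
  rewrite (bigD1 a0) //= [X in (_ < X)%N](bigD1 a0) //= -addSn leq_add ?b_gt //.
  by apply: leq_sum => a /andP [/b_gt /ltnW].
by split; [exact: ltnW|exact: ltn_eqF].
Qed.

(** * Finite global dimension *)

Section finite_dimensional.
Variables (k : finFieldType) (e : nat).
Implicit Types F G : spf k e.

Lemma fd_ssub F (U : forall n, F n -> Prop) (hU : sclosed U) : fd F -> fd (ssub hU).
Proof.
move=> fF n; apply: (@fin_dim_inj _ (ssub hU n) (F n) (@smval _ _ _ _)) => // x y; exact: subm_ext.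
Qed.
Lemma fd_squot F (U : forall n, F n -> Prop) (hU : sclosed U) : fd F -> fd (squot hU).
Proof. by move=> fF n; apply: (fin_dim_image (f := squot_pi hU n) (fF n)) => y; apply: squot_surj. Qed.
Lemma fd_spair F G : fd F -> fd G -> fd (spair F G).
Proof. by move=> fF fG n; apply: fin_dim_pair. Qed.
End finite_dimensional.

(** * Products of exterior powers and their top weight *)

Section top_object.
Variables (k : finFieldType) (e : nat).
Local Notation word := {ffun 'I_e -> 'I_e}.
Variable w : word.
Hypothesis dec : forall r r' : 'I_e, (r < r')%N -> (#|[set q | w q == r']| <= #|[set q | w q == r]|)%N.

Let pos r := [seq q <- enum 'I_e | w q == r].
Let size_pos r : size (pos r) = #|[set q | w q == r]|.
Proof.
rewrite size_filter -sum1_count big_enum_cond -sum1_card; apply: eq_bigl => q; by rewrite inE.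
Qed.
Let pos_uniq r : uniq (pos r). Proof. by rewrite filter_uniq ?enum_uniq. Qed.
Let mem_pos q r : (q \in pos r) = (w q == r). Proof. by rewrite mem_filter mem_enum andbT. Qed.
Let idx_lt q : (index q (pos (w q)) < e)%N.
Proof.
have : (index q (pos (w q)) < size (pos (w q)))%N by rewrite index_mem mem_pos.
by move=> /leq_trans -> //; rewrite size_pos -[X in (_ <= X)%N]card_ord; apply: max_card.
Qed.
(* The columns of the diagram of [w]: the i-th occurrences of all letters. *)
Let col q : 'I_e := Ordinal (idx_lt q).
(** Odd labels make the columns alternate, so [Mix] of this labelling is the product of exterior
    powers given by the conjugate of the partition of [w]. *)
Definition top_lab q : nat := (col q).*2.+1.

Let lab_col x y : top_lab x = top_lab y -> col x = col y.
Proof. by move=> /succn_inj /double_inj E; apply: val_inj. Qed.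
Let col_inj x y : col x = col y -> w x = w y -> x = y.
Proof.
move=> /(congr1 val) /= E Ew; have xp : x \in pos (w x) by rewrite mem_pos.
have yp : y \in pos (w x) by rewrite mem_pos Ew.
by rewrite -(nth_index x xp) E -Ew nth_index.
Qed.
Let col_init x (r : 'I_e) : (r < w x)%N -> exists y, col y = col x /\ w y = r.
Proof.
move=> lt; have ltx : (index x (pos (w x)) < size (pos r))%N.
  rewrite size_pos; apply: leq_trans (dec lt); rewrite -size_pos index_mem mem_pos //.
have yp := mem_nth x ltx; have Ey := yp; rewrite mem_pos in Ey.
exists (nth x (pos r) (index x (pos (w x)))); split; last exact/eqP.
by apply: val_inj => /=; rewrite (eqP Ey) index_uniq.
Qed.

(** Letters within a column are distinct, and by [dec] those of [w] form an initial segment, which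
    has the least possible sum. A word of no larger total therefore carries the same set of letters
    as [w] in every column. *)
Lemma top_orbit (f : tp k e e) (w' : word) : mix top_lab f -> f w' != 0 -> (tot w' <= tot w)%N ->
  exists s : {perm 'I_e}, (forall q, top_lab (s q) = top_lab q) /\ w' = permw s w.
Proof.
move=> hf fw le.
have inj' x y : col x = col y -> w' x = w' y -> x = y.
  move=> E Ew; apply/eqP; apply: contraNT fw => nxy.
  have [_ ->] := hf x y nxy (congr1 (fun c : 'I_e => c.*2.+1) E) w' => //.
  by rewrite /top_lab /= odd_double.
have totE (u : word) : (forall x y, col x = col y -> u x = u y -> x = y) ->
    tot u = (\sum_(c : 'I_e) \sum_(a in u @: [set q | col q == c]) a)%N.
  move=> u_inj; rewrite /tot (partition_big col predT) //; apply: eq_bigr => c _.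
  rewrite big_imset /=; first by apply: eq_bigl => q; rewrite inE.
  by move=> x y; rewrite !inE => /eqP Ex /eqP Ey; apply: u_inj; rewrite Ex.
have leC c : (\sum_(a in w @: [set q | col q == c]) a <= \sum_(a in w' @: [set q | col q == c]) a
    ?= iff (w' @: [set q | col q == c] == w @: [set q | col q == c]))%N.
  apply: init_sum.
    rewrite !card_in_imset //; move=> x y; rewrite !inE => /eqP Ex /eqP Ey.
      by apply: col_inj; rewrite Ex.
    by apply: inj'; rewrite Ex.
  move=> _ b /imsetP [x + ->] lt; rewrite inE => /eqP Ex; have [y [Ey Eb]] := col_init lt.
  by apply/imsetP; exists y; rewrite ?Eb // inE Ey Ex.
have := @leqif_sum _ predT _ _ _ (fun c _ => leC c); rewrite -!totE // => E.
have [_ /esym] := E; rewrite eqn_leq E.1 le => /forallP eqC.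
have ex q : exists y, col y = col q /\ w y = w' q.
  have /imsetP [y] : w' q \in w @: [set x | col x == col q].
    by rewrite -(eqP (eqC (col q))); apply: imset_f; rewrite inE.
  by rewrite inE => /eqP Ey Ew; exists y.
have [s Es] := choice ex.
have s_inj : injective s.
  move=> x y Exy; have [Cx Wx] := Es x; have [Cy Wy] := Es y.
  by apply: inj'; rewrite -?Cx -?Cy -?Wx -?Wy Exy.
exists (perm s_inj); split=> [q|]; first by rewrite permE /top_lab (Es q).1.
by apply/ffunP => q; rewrite permwE permE (Es q).2.
Qed.

Let stab (s : {perm 'I_e}) := [forall q, top_lab (s q) == top_lab q].
(** The antisymmetrisation of [w] over the column stabiliser; it spans the top weight space. *)
Definition top_fun : tp k e e := [ffun w' : word => \sum_(s | stab s) (-1) ^+ odd_perm s * (w' ==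
  permw s w)%:R].
Lemma top_fun_mix : mix top_lab top_fun.
Proof.
move=> x y ne E w'; have odd_lab : odd (top_lab x) by rewrite /top_lab /= odd_double.
rewrite odd_lab expr1 mulN1r !ffunE; split=> [|_ Ew].
  rewrite -sumrN (reindex_inj (mulgI (tperm x y))) /=; apply: eq_big => [s|s _].
    have LT z : top_lab (tperm x y z) = top_lab z by case: tpermP => [->|->|].
    by apply/forallP/forallP => H q; have := H (tperm x y q); rewrite permM ?tpermK LT.
  rewrite odd_permM odd_tperm ne signr_addb mulN1r mulNr -permwM (inj_eq (@permw_inj _ _ _)) //.
rewrite big1 // => s /forallP Hs; case: eqP => [E'|_]; last by rewrite mulr0.
case/eqP: ne; apply/(@perm_inj _ s)/col_inj; last by move: Ew; rewrite E' !permwE.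
by apply: lab_col; rewrite (eqP (Hs x)) (eqP (Hs y)).
Qed.
Lemma top_funw : top_fun w = 1.
Proof.
rewrite ffunE (bigD1 1%g) /=; last by apply/forallP => q; rewrite perm1.
rewrite odd_perm1 expr0 mul1r permw1 eqxx big1 ?addr0 // => s /andP [/forallP Hs ns].
case: eqP => [E|_]; last by rewrite mulr0.
case/eqP: ns; apply/permP => q; rewrite perm1; apply: col_inj; first by apply/lab_col/eqP.
by rewrite [in RHS]E permwE.
Qed.
Lemma top_fun_orb w' : top_fun w' != 0 -> orb w w'.
Proof.
apply: contraNT => no; rewrite ffunE big1 // => s _; case: eqP => [E|_]; last by rewrite mulr0.
by case/negP: no; apply/orbP; exists s.
Qed.

Lemma top_unique (f : tp k e e) : mix top_lab f -> (forall w', f w' != 0 -> tot w' = tot w) ->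
  f w = 0 -> f = 0.
Proof.
move=> hf supp fw; apply/ffunP => w'; rewrite [RHS]ffunE; apply/eqP; apply: contraTT isT => nz.
have [|s [Es E]] := top_orbit hf nz; first by rewrite supp.
have [c [Ec _]] := mix_block hf Es; by rewrite E Ec fw mulr0 eqxx in nz.
Qed.
End top_object.

Section finite_global_dimension.
Variables (k : finFieldType) (e : nat).
Implicit Types F G : spf k e.
Local Notation word := {ffun 'I_e -> 'I_e}.
Local Notation wt w := (xi k (pw w w)).

Definition low F v := forall w : word, (tot w < v)%N -> forall y : F e, sact (wt w) y = 0.

Lemma tot_le (w : word) : (tot w <= e * e)%N.
Proof.
rewrite /tot -[X in (_ <= X * _)%N]card_ord -sum_nat_const; apply: leq_sum => q _; exact: ltnW.
Qed.

Lemma low_zero F v : (e * e < v)%N -> low F v -> forall n (x : F n), x = 0.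
Proof.
move=> lt lF; apply: (@generated _ _ _ (fun n x => x = 0)); last first.
  by move=> y; apply: weights0 => w; apply: lF; apply: leq_ltn_trans (tot_le w) lt.
split=> [n|m n g x ->]; last by rewrite sact0.
by split=> // a x y -> ->; rewrite scaler0 addr0.
Qed.

Lemma tact_wt (w : word) (f : tp k e e) w' : sact (wt w) f w' = (orb w w')%:R * f w'.
Proof.
rewrite /= ffunE (bigD1 w') //= big1 ?addr0 => [|u ne].
  rewrite xiE; congr (_%:R * _); congr nat_of_bool.
  by apply/orb_pwP/orbP => [[s [_ ->]]|[s ->]]; exists s.
rewrite xiE; case: orb_pwP => [[s [Eu Ew]]|_]; last by rewrite mul0r.
by rewrite Eu Ew eqxx in ne.
Qed.

(* Otherwise exchanging two letters would lower the total. *)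
Lemma top_decreasing F v (w : word) (x : F e) : low F v -> tot w = v -> sact (wt w) x = x -> x != 0 ->
  forall r r' : 'I_e, (r < r')%N -> (#|[set q | w q == r']| <= #|[set q | w q == r]|)%N.
Proof.
move=> lF tw Ex nx r r' lt; rewrite leqNgt; apply: contra nx => gt.
pose w' : word := [ffun q => tperm r r' (w q)].
have E : gcomp (xi k (pw w' w)) (xi k (pw w w')) = wt w.
  by apply: xi_factor => q q'; rewrite !ffunE (inj_eq (@perm_inj _ _)).
rewrite -Ex -E sactM -(xi_idl k w w') sactM lF ?sact0 //.
have cnt r1 : #|[set q | w q == r1]| = (\sum_q (w q == r1))%N.
  by rewrite -sum1_card big_mkcond /=; apply: eq_bigr => q _; rewrite inE; case: eqP.
have T : (tot w' + (r * #|[set q | w q == r]| + r' * #|[set q | w q == r']|) =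
    tot w + (r' * #|[set q | w q == r]| + r * #|[set q | w q == r']|))%N.
  rewrite /tot !cnt !big_distrr -!big_split /=; apply: eq_bigr => q _; rewrite ffunE.
  have [E1 E2] : (r == r') = false /\ (r' == r) = false by rewrite -!val_eqE ltn_eqF // gtn_eqF.
  by case: tpermP => [->|->|/eqP /negPf n1 /eqP /negPf n2];
    rewrite ?eqxx ?E1 ?E2 ?n1 ?n2 /= ?muln0 ?muln1; lia.
rewrite tw in T; nia.
Qed.

Section step.
Variable v : nat.
Hypothesis IH : forall F, fd F -> low F v.+1 -> pf F.

Section split_off.
Variables (F : spf k e) (w : word) (x : F e).
Hypotheses (fF : fd F) (lF : low F v) (tw : tot w = v) (Ex : sact (wt w) x = x) (nx : x != 0).
Let dec := top_decreasing lF tw Ex nx.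
Let M := Mix k (top_lab w).
Let m : M e := @Subm _ _ (mix (top_lab w) (n := e)) (proj1 (mix_closed k (top_lab w)) e) _
  (@top_fun_mix k e w).
Let Y : nt (hrep k e e) (spair M F) := @yoneda k e (spair M F) e (m, x).
(** The correspondence generated by the two top vectors; its projections [a] and [c] replace the
    missing map between [M] and F. *)
Let Z := ssub (im_closed Y).
Let a : nt Z M := nt_comp (sfst M F) (ssub_in (im_closed Y)).
Let c : nt Z F := nt_comp (ssnd M F) (ssub_in (im_closed Y)).

Let lM : low M v.
Proof.
move=> w' lt y; apply: subm_ext; apply/ffunP => u; rewrite [RHS]ffunE.
rewrite -[LHS]/(sact (s := tp k e) (wt w') (smval y) u) tact_wt.
case o: (orb w' u); last by rewrite mul0r.
rewrite mul1r; apply/eqP; apply: contraLR lt => nz; rewrite -leqNgt -tw -(tot_orb o).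
have [le|/ltnW //] := leqP (tot u) (tot w).
by have [s [_ ->]] := top_orbit dec (smP y) nz le; rewrite tot_permw.
Qed.
Let m_top : sact (wt w) m = m.
Proof.
apply: subm_ext; apply/ffunP => u; rewrite -[LHS]/(sact (s := tp k e) (wt w) (top_fun k w) u) tact_wt.
have [o|no] := boolP (orb w u); first by rewrite mul1r.
by rewrite mul0r; apply/esym/eqP; apply: contraNT no; apply: top_fun_orb.
Qed.
Let m_neq0 c' : c' *: m = 0 -> c' = 0.
Proof.
move=> E0; have := congr1 (fun y : M e => smval y w) E0; rewrite [RHS]ffunE => <-.
by rewrite -[LHS]mulr1 -(top_funw k w) [RHS]ffunE.
Qed.
Let mB (g : M e) c' u : smval (g - c' *: m) u = smval g u - c' * top_fun k w u.
Proof. by rewrite !ffunE. Qed.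
(** A functor generated by a vector of its lowest total contains, in that total, only multiples of
    the generator. *)
Let top_Z (z : Z e) w' : (tot w' <= v)%N -> exists c', sact (wt w') (smval z) = c' *: (m, x).
Proof.
have lMF : low (spair M F) v by move=> w1 lt [y1 y2];
  rewrite -[LHS]/(sact (wt w1) y1, sact (wt w1) y2) lM // lF.
rewrite leq_eqVlt => /orP [/eqP Ew|lt]; last by exists 0; rewrite scale0r; apply: lMF.
case: (smP z) => g ->; apply: (@top_weight _ _ _ (spair M F) w (m, x)); last by rewrite Ew.
  by rewrite tw; apply: lMF.
by rewrite -[LHS]/(sact (wt w) m, sact (wt w) x) m_top Ex.
Qed.
Let fZ : fd Z. Proof. by apply/fd_ssub/fd_spair => //; apply: Mix_fd. Qed.

(** The kernel and the cokernel of [a] have no weight of total at most v: multiples of (m, x) map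
    injectively to [M], and weight vectors of [M] of total at most v are multiples of [m]. Both fall
    under the induction hypothesis. *)
Let pf_Z : pf Z.
Proof.
apply: (pf_source (f := a)).
  apply: IH => [|w' lt y]; first exact: fd_ssub.
  have [c' Ec] := top_Z (smval y) lt.
  have c0 : c' = 0.
    apply: m_neq0; have : a e (sact (wt w') (smval y)) = 0 by rewrite ntP (smP y) sact0.
    by rewrite -[a e _]/((sact (wt w') (smval (smval y))).1) Ec.
  by apply: subm_ext; apply: subm_ext; rewrite -[LHS]/(sact (wt w') (smval (smval y))) Ec c0 scale0r.
apply: pf_im_target; first exact: pf_Mix.
apply: IH => [|w' lt y]; first by apply: fd_squot; apply: Mix_fd.
have [f <-] := squot_surj y; rewrite -ntP; apply/squot_pi0.
have [c' Ec'] : exists c', sact (wt w') f = c' *: m.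
  exists (smval (sact (wt w') f) w); apply/eqP; rewrite -subr_eq0; apply/eqP; apply: subm_ext.
  apply: (top_unique dec) => [|u|]; first exact: smP.
    apply: contraNeq => neu; rewrite mB.
    rewrite -[X in X - _]/(sact (s := tp k e) (wt w') (smval f) u) tact_wt.
    have -> : top_fun k w u = 0.
      by apply/eqP; apply: contraNT neu => /top_fun_orb /tot_orb ->.
    rewrite mulr0 subr0; have [o|] := boolP (orb w' u); last by rewrite mul0r.
    rewrite mul1r; apply/eqP; have [//|nz] := eqVneq (smval f u) 0.
    case/eqP: neu; have [le|gt] := leqP (tot u) (tot w).
      by have [s [_ ->]] := top_orbit dec (smP f) nz le; rewrite tot_permw.
    by move: gt lt; rewrite (tot_orb o) tw; lia.
  by rewrite mB top_funw mulr1 subrr.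
exists (c' *: @Subm _ _ (fun y => exists g, y = Y e g) (proj1 (im_closed Y) e) (m, x)
   (ex_intro _ (gid k e e) (esym (sact1 (s := spair M F) (m, x))))).
by rewrite Ec' ntZ.
Qed.

(** The image of [c] is the subfunctor generated by [x], and its kernel has only weights of total
    above v because [x] is not zero. So F is an extension of the given quotient by a functor with a
    finite resolution. *)
Lemma split_off : pf (squot (im_closed (yoneda x))) -> pf F.
Proof.
move=> pQ; apply: (pf_target (f := c)).
  apply: pf_im; last exact: pf_Z.
  apply: IH => [|w' lt y]; first exact: fd_ssub.
  have [c' Ec] := top_Z (smval y) lt.
  have c0 : c' = 0.
    have : c e (sact (wt w') (smval y)) = 0 by rewrite ntP (smP y) sact0.
    rewrite -[c e _]/((sact (wt w') (smval (smval y))).2) Ec => /eqP.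
    by rewrite scaler_eq0 (negPf nx) orbF => /eqP.
  by apply: subm_ext; apply: subm_ext; rewrite -[LHS]/(sact (wt w') (smval (smval y))) Ec c0 scale0r.
have h1 n (y : F n) : (exists g, y = yoneda x n g) -> squot_pi (im_closed c) n y = 0.
  move=> [g ->]; apply/squot_pi0.
  by exists (@Subm _ _ (fun y => exists g, y = Y n g) (proj1 (im_closed Y) n) (Y n g) (ex_intro _ g erefl)).
apply: (pf_iso (f := squot_lift (im_closed (yoneda x)) h1)) pQ => n y; last first.
  by have [y' <-] := squot_surj y; exists (squot_pi _ n y'); rewrite squot_liftE.
have [y' <-] := squot_surj y; rewrite squot_liftE => /squot_pi0 [z Ez]; apply/squot_pi0.
by rewrite Ez; case: (smP z) => g Eg; exists g; rewrite /c /= Eg.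
Qed.
End split_off.

Lemma pf_step F : fd F -> low F v -> pf F.
Proof.
move=> fF lF.
(* The vectors of total v are killed one at a time: G runs through quotients of F, and [xs] lists
   weight vectors of F that still generate the weights of G of total v. *)
suff inner (xs : seq (F e)) : forall (G : spf k e) (q : nt F G), fd G -> low G v -> 
    (forall n y, exists x, q n x = y) ->
    (forall x, x \in xs -> exists w : word, tot w = v /\ sact (wt w) x = x) ->
    (forall U : forall n, G n -> Prop, sclosed U -> (forall x, x \in xs -> U e (q e x)) ->
       forall w : word, tot w = v -> forall y : G e, U e (sact (wt w) y)) -> pf G.
  have [s hs] := (fin_dimP _).1 (fF e).
  apply: (inner [seq sact (wt w) y | w <- [seq w : word <- enum {: word} | tot w == v], y <- s] F
    (nt_id F)) => //.
  - by move=> n y; exists y.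
  - move=> _ /allpairsP [[w y] /= [+ _ ->]]; rewrite mem_filter => /andP [/eqP tw _].
    by exists w; split=> //; rewrite -sactM xi_idl.
  - move=> U _ h w tw y; apply: h; apply: allpairs_f; last exact: hs.
    by rewrite mem_filter tw eqxx mem_enum.
elim: xs => [|x xs IHxs] G q fG lG qs top span.
  apply: IH => // w; rewrite ltnS leq_eqVlt => /orP [/eqP tw|]; last exact: lG.
  apply: (span (fun n y => y = 0)) => //; split=> [n|m n g y ->]; last by rewrite sact0.
  by split=> // a y z -> ->; rewrite scaler0 addr0.
have top' z : z \in xs -> exists w : word, tot w = v /\ sact (wt w) z = z.
  by move=> zx; apply: top; rewrite inE zx orbT.
have [qx0|nx] := eqVneq (q e x) 0.
  apply: (IHxs G q) => // U hU Uxs; apply: span => // z; rewrite inE => /orP [/eqP ->|]; last exact: Uxs.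
  by rewrite qx0; case: hU => /(_ e) [].
have [|w [tw Ex]] := top x; first by rewrite inE eqxx.
have Eqx : sact (wt w) (q e x) = q e x by rewrite -ntP Ex.
apply: (split_off fG lG tw Eqx nx).
pose pi := squot_pi (im_closed (yoneda (q e x))).
apply: (IHxs _ (nt_comp pi q)) => //.
- exact: fd_squot.
- by move=> w' lt y; have [y' <-] := squot_surj y; rewrite -ntP lG // nt0.
- by move=> n y; have [y' <-] := squot_surj y; have [z <-] := qs n y'; exists z.
- move=> U hU Uxs w' tw' y; have [y' <-] := squot_surj y; rewrite -ntP.
  apply: (span (fun n z => U n (pi n z))) => //.
    split=> [n|m n g z Uz]; last by rewrite ntP; apply: (proj2 hU).
    have [U0 Ul] := proj1 hU n; split=> [|a z z' Uz Uz']; first by rewrite nt0.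
    by rewrite nt_lin; apply: Ul.
  move=> z; rewrite inE => /orP [/eqP ->|]; last exact: Uxs.
  have -> : pi e (q e x) = 0; last by case: (proj1 hU e).
  by apply/squot_pi0; exists (gid k e e); rewrite /= sact1.
Qed.
End step.

(** Descending induction on the lower bound v for the totals; letters are below e, so no total
    exceeds e * e. *)
Theorem pf_fd F : fd F -> pf F.
Proof.
suff H N v : (e * e < v + N)%N -> forall G, fd G -> low G v -> pf G.
  by move=> fF; apply: (H (e * e).+1 0%N) => // w; rewrite ltn0.
elim: N v => [|N IHN] v lt G fG lG; first by apply: pf0; apply: low_zero lG; rewrite addn0 in lt.
apply: (@pf_step v) => // G' fG' lG'; apply: IHN lG' => //; by rewrite addSnnS.
Qed.

Theorem perf_fd (M : cpx k e) : bounded M -> (forall i, fd (M i)) -> perf M.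
Proof. by move=> bM fM; apply: perf_terms => // i; apply: pf_fd. Qed.
End finite_global_dimension.

(** * Projective resolutions of unbounded complexes *)

Section finite_support_sums.
Variables (I : eqType) (V : nmodType) (s t : seq I) (F : I -> V).
Lemma sum_uniq_support : uniq s -> uniq t ->
  (forall i, i \notin s -> F i = 0) -> (forall i, i \notin t -> F i = 0) ->
  \sum_(i <- s) F i = \sum_(i <- t) F i.
Proof.
move=> us ut Fs Ft.
rewrite (bigID (mem t)) /= [X in _ + X]big1 ?addr0; last by move=> i /Ft.
rewrite [RHS](bigID (mem s)) /= [X in _ = _ + X]big1 ?addr0; last by move=> i /Fs.
rewrite -[LHS]big_filter -[RHS]big_filter; apply: perm_big; apply: uniq_perm; rewrite ?filter_uniq // => i.
by rewrite !mem_filter andbC.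
Qed.
End finite_support_sums.

Section enough_projectives.
Variables (k : finFieldType) (e : nat).
Local Notation sproj P := (projective (C := Pcat k e) P).

(** A copy of an arbitrary type that carries the classical equality test needed for finite
    supports. *)
Definition cell (I : Type) := I.
HB.instance Definition _ (I : Type) := gen_eqMixin (cell I).

Section free.
Variables (I : Type) (deg : I -> nat).
Let H := sprod (fun i : I => hrep k e (deg i)).
Let finsupp n (x : H n) := exists s : seq (cell I), forall i : cell I, i \notin s -> x i = 0.
Let finsupp_closed : sclosed finsupp.
Proof.
split=> [n|m n g x [s hs]]; last by exists s => i /hs E; rewrite -[LHS]/(sact g (x i)) E sact0.
split=> [|a x y [s hs] [t ht]]; first by exists [::].
exists (s ++ t) => i; rewrite mem_cat negb_or => /andP [/hs E /ht E'].
by rewrite prodmED prodmEZ E E' scaler0 addr0.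
Qed.
Definition free := ssub finsupp_closed.
Let supp n (x : free n) : seq (cell I) := undup (sval (boolp.cid (smP x))).
Let supp_uniq n (x : free n) : uniq (supp x). Proof. exact: undup_uniq. Qed.
Let suppP n (x : free n) (i : cell I) : i \notin supp x -> smval x i = 0.
Proof. by rewrite mem_undup; case: boolp.cid => s /= hs; apply: hs. Qed.

Section fsum.
Variables (F : spf k e) (v : forall i, F (deg i)).
Let fs n (x : free n) : F n := \sum_(i <- supp x) sact (smval x i) (v i).
Let fsE n (x : free n) (s : seq (cell I)) : uniq s -> (forall i : cell I, i \notin s -> smval x i = 0) ->
  fs x = \sum_(i <- s) sact (smval x i) (v i).
Proof.
move=> us hs; apply: sum_uniq_support => // i; first by move/suppP => ->; apply: sact0l.
by move/hs => ->; apply: sact0l.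
Qed.
Program Definition fsum : nt free F := @Nt k e free F fs _ _.
Next Obligation.
move=> n a x y; set s := undup (supp x ++ supp y).
have us : uniq s by apply: undup_uniq.
have hx (i : cell I) : i \notin s -> smval x i = 0.
  by rewrite mem_undup mem_cat negb_or => /andP [/suppP].
have hy (i : cell I) : i \notin s -> smval y i = 0.
  by rewrite mem_undup mem_cat negb_or => /andP [_ /suppP].
rewrite (fsE us hx) (fsE us hy) (@fsE n _ s) // => [|i ni].
  by rewrite scaler_sumr -big_split; apply: eq_bigr => i _; apply: sact_glin.
by rewrite -[LHS]/(a *: smval x i + smval y i) hx // hy // scaler0 addr0.
Qed.
Next Obligation.
move=> m n g x; rewrite (@fsE n _ (supp x)) // => [|i /suppP E]; last first.
  by rewrite -[LHS]/(sact g (smval x i)) E sact0.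
by rewrite sact_sum; apply: eq_bigr => i _; rewrite -sactM.
Qed.
Lemma fsumE n (x : free n) (s : seq (cell I)) : uniq s -> (forall i : cell I, i \notin s -> smval x i = 0) ->
  fsum n x = \sum_(i <- s) sact (smval x i) (v i).
Proof. exact: fsE. Qed.
End fsum.

Let delta_ (i : cell I) n (x : hrep k e (deg i) n) : H n := dfwith (fun j : cell I => 0 : hrep k e
  (deg j) n) x.
Let delta_supp (i : cell I) n (x : hrep k e (deg i) n) : finsupp (delta_ x).
Proof. by exists [:: i] => j; rewrite inE => ne; rewrite /delta_ dfwith_out // eq_sym. Qed.
Definition delta (i : cell I) n (x : hrep k e (deg i) n) : free n :=
  @Subm _ _ (@finsupp n) (proj1 finsupp_closed n) _ (delta_supp x).
Lemma fsum_delta (F : spf k e) (v : forall i, F (deg i)) (i : cell I) n (x : hrep k e (deg i) n) :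
  fsum v n (delta x) = sact x (v i).
Proof.
rewrite (@fsumE _ _ _ _ [:: i]) // => [|j]; first by rewrite big_seq1 /= /delta_ dfwith_in.
by rewrite inE => ne; rewrite /= /delta_ dfwith_out // eq_sym.
Qed.
Lemma free_delta n (x : free n) : x = \sum_(i <- supp x) delta (smval x i).
Proof.
apply: subm_ext; rewrite (big_morph (@smval _ _ _ _) (id1 := 0) (op1 := +%R)) //.
apply: prodm_ext => j; rewrite (big_morph (fun z : H n => z j) (id1 := 0) (op1 := +%R)) //.
have [js|nj] := boolP ((j : cell I) \in supp x).
  rewrite (bigD1_seq (j : cell I)) //= /delta_ dfwith_in big1 ?addr0 // => i ne.
  by rewrite dfwith_out.
rewrite (suppP nj) big_seq big1 // => i si; rewrite /= /delta_ dfwith_out //.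
by apply: contraNneq nj => <-.
Qed.
Lemma free_projective : sproj free.
Proof.
move=> F G q /epi_surj qs f.
have H0 (i : cell I) : exists y, q (deg i) y = f (deg i) (delta (gid k e (deg i))) by apply: qs.
pose v i := sval (boolp.cid (H0 i)).
have Ev i : q (deg i) (v i) = f (deg i) (delta (gid k e (deg i))) := svalP (boolp.cid (H0 i)).
exists (fsum v); apply: nt_ext => n x; rewrite [x]free_delta !nt_sum; apply: eq_bigr => i _.
rewrite -[LHS]/(q n (fsum v n (delta (smval x i)))) fsum_delta ntP Ev -ntP; congr (f n _).
apply: subm_ext; apply: prodm_ext => j; rewrite -[LHS]/(sact (smval x i) (smval (delta (gid k e (deg i))) j)).
rewrite /= /delta_; have [->|ne] := eqVneq i j; first by rewrite !dfwith_in gcompm1.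
rewrite !dfwith_out //; exact: (@sact0 k e (hrep k e _)).
Qed.
End free.

Lemma enough_projectives (W : spf k e) : exists (Q : spf k e) (q : nt Q W), sproj Q /\ forall n y,
  exists x, q n x = y.
Proof.
exists (free (fun i : {n & W n} => tag i)), (fsum (fun i : {n & W n} => tagged i)).
split; first exact: free_projective.
move=> n y; pose i : cell {n & W n} := Tagged (fun n => W n) y.
by exists (@delta {n & W n} (fun i => tag i) i n (gid k e n)); rewrite fsum_delta sact1.
Qed.
End enough_projectives.

Lemma squot_eq (k : finFieldType) (e : nat) (F : spf k e) (U : forall n, F n -> Prop) (hU : sclosed
  U) n (x y : F n) :
  squot_pi hU n x = squot_pi hU n y <-> U n (x - y).
Proof.
rewrite -(squot_pi0 hU) ntB; split=> [->|E]; first by rewrite subrr.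
by apply/eqP; rewrite -subr_eq0 E.
Qed.

(** * Sequential colimits *)

Section sequential_colimit.
Variables (k : finFieldType) (e : nat) (C : nat -> spf k e) (t : forall j, nt (C j) (C j.+1)).

Let cidn i j : nt (C i) (C j) :=
  match i =P j with ReflectT E => ecast z (nt (C i) (C z)) E (nt_id (C i)) | _ => 0 end.
Let cidnn i n (x : C i n) : cidn i i n x = x.
Proof. by rewrite /cidn; case: eqP => // E; rewrite eq_axiomK. Qed.

Fixpoint tr j m : nt (C j) (C (m + j)) :=
  match m with 0 => nt_id (C j) | m'.+1 => nt_comp (t (m' + j)) (tr j m') end.

Fixpoint trn j i : nt (C j) (C i) :=
  match i with
  | 0 => cidn j 0
  | i'.+1 => if (j <= i')%N then nt_comp (t i') (trn j i') else cidn j i'.+1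
  end.
Let trnn j n (x : C j n) : trn j j n x = x.
Proof. by case: j x => [|j] x /=; rewrite ?ltnn cidnn. Qed.
Let trnS j i n (x : C j n) : (j <= i)%N -> trn j i.+1 n x = t i n (trn j i n x).
Proof. by move=> /= ->. Qed.
Let trn_tr j m n (x : C j n) : trn j (m + j) n x = tr j m n x.
Proof.
elim: m => [|m IH]; first by rewrite trnn.
by rewrite -[in LHS]/((m + j).+1) trnS ?leq_addl // IH.
Qed.
(* Sequences compatible with the transition maps from some stage on, modulo those eventually zero. *)
Let coh n (x : sprod C n) := exists N, forall j, (N <= j)%N -> x j.+1 = t j n (x j).
Let coh_closed : sclosed coh.
Proof.
split=> [n|m n g x [N hN]]; last by exists N => j /hN E; rewrite -[LHS]/(sact g (x j.+1)) E ntP.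
split=> [|a x y [N hN] [M hM]]; first by exists 0%N => j _; rewrite nt0.
exists (maxn N M) => j; rewrite geq_max => /andP [/hN E /hM E'].
by rewrite !prodmED !prodmEZ E E' nt_lin.
Qed.
Let S := ssub coh_closed.
Let ez n (x : S n) := exists N, forall j, (N <= j)%N -> smval x j = 0.
Let ez_closed : sclosed ez.
Proof.
split=> [n|m n g x [N hN]]; last by exists N => j /hN E; rewrite -[LHS]/(sact g (smval x j)) E sact0.
split=> [|a x y [N hN] [M hM]]; first by exists 0%N.
exists (maxn N M) => j; rewrite geq_max => /andP [/hN E /hM E'].
by rewrite -[LHS]/(a *: smval x j + smval y j) E E' scaler0 addr0.
Qed.
Definition scolim := squot ez_closed.

Let sin_ j n (x : C j n) : sprod C n := fun i => if (j <= i)%N then trn j i n x else 0.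
Let sin_coh j n (x : C j n) : coh (sin_ x).
Proof. by exists j => i le; rewrite /sin_ le (leqW le) trnS. Qed.
Let sinS j : nt (C j) S.
Proof.
refine (@Nt k e (C j) S (fun n x => @Subm _ _ (@coh n) (proj1 coh_closed n) _ (sin_coh x)) _ _).
  move=> n a x y; apply: subm_ext; apply: prodm_ext => i; rewrite -[RHS]/(a *: sin_ x i + sin_ y i) /= /sin_.
  by case: ifP => _; rewrite ?nt_lin // scaler0 addr0.
move=> m n g x; apply: subm_ext; apply: prodm_ext => i; rewrite /= /sin_.
by case: ifP => _; rewrite ?ntP // sact0.
Defined.
Let sinSE j n (x : C j n) i : smval (sinS j n x) i = sin_ x i. Proof. by []. Qed.
Let smB n (x y : S n) i : smval (x - y) i = smval x i - smval y i. Proof. by []. Qed.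
Definition sin j : nt (C j) scolim := nt_comp (squot_pi ez_closed) (sinS j).

Lemma sin_step j n (x : C j n) : sin j.+1 n (t j n x) = sin j n x.
Proof.
apply/squot_eq; exists j.+1 => i le; rewrite smB !sinSE /sin_ le (ltnW le).
have E : forall i, (j.+1 <= i)%N -> trn j i n x = trn j.+1 i n (t j n x).
  elim=> [//|i' IH]; rewrite leq_eqVlt => /orP [/eqP [<-]|lt]; first by rewrite trnn trnS // trnn.
  by rewrite !trnS // ?IH // ltnW.
by rewrite E // subrr.
Qed.
Lemma sin_tr j m n (x : C j n) : sin (m + j) n (tr j m n x) = sin j n x.
Proof. by elim: m => [//|m IH]; rewrite -IH -[RHS]sin_step. Qed.
Lemma sin_surj n (y : scolim n) : exists j x, y = sin j n x.
Proof.
have [[x [N hN]] <-] := squot_surj y; exists N, (x N).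
apply/squot_eq; exists N => i le; rewrite smB sinSE /= /sin_ le.
suff -> : x i = trn N i n (x N) by rewrite subrr.
elim: i le => [|i IH]; first by rewrite leqn0 => /eqP ->; rewrite trnn.
rewrite leq_eqVlt => /orP [/eqP <-|le]; first by rewrite trnn.
by rewrite trnS // hN // IH.
Qed.
Lemma sin_zero j n (x : C j n) : sin j n x = 0 -> exists m, tr j m n x = 0.
Proof.
move=> /squot_pi0 [N hN]; exists N; rewrite -trn_tr.
have := hN (N + j)%N (leq_addr _ _); by rewrite sinSE /sin_ leq_addl.
Qed.
Lemma scolim_ext (G : spf k e) (f g : nt scolim G) :
  (forall j n x, f n (sin j n x) = g n (sin j n x)) -> f = g.
Proof. by move=> h; apply: nt_ext => n y; have [j [x ->]] := sin_surj y. Qed.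

Section lift.
Variables (G : spf k e) (f : forall j, nt (C j) G).
Hypothesis ft : forall j n x, f j.+1 n (t j n x) = f j n x.
Let lim n (x : S n) : {z : G n | exists N, forall j, (N <= j)%N -> f j n (smval x j) = z}.
Proof.
apply: boolp.cid; case: (smP x) => N hN; exists (f N n (smval x N)), N.
elim=> [|j IH]; first by rewrite leqn0 => /eqP ->.
by rewrite leq_eqVlt => /orP [/eqP <- //|le]; rewrite hN // ft IH.
Qed.
Let limE n (x : S n) z : (exists N, forall j, (N <= j)%N -> f j n (smval x j) = z) -> sval (lim x) = z.
Proof.
case: (lim x) => z' /= [N hN] [M hM]; by rewrite -(hN (maxn N M)) ?leq_maxl // hM ?leq_maxr.
Qed.
Let limP n (x : S n) : exists N, forall j, (N <= j)%N -> f j n (smval x j) = sval (lim x).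
Proof. exact: svalP (lim x). Qed.
Let g : nt S G.
Proof.
refine (@Nt k e S G (fun n x => sval (lim x)) _ _).
  move=> n a x y; apply: limE; have [N hN] := limP x; have [M hM] := limP y.
  exists (maxn N M) => j; rewrite geq_max => /andP [/hN <- /hM <-]; exact: nt_lin.
move=> m n h x; apply: limE; have [N hN] := limP x; exists N => j /hN <-; exact: ntP.
Defined.
Let g0 n (x : S n) : ez x -> g n x = 0.
Proof. by move=> [N hN]; apply: limE; exists N => j /hN E; rewrite E nt0. Qed.
Definition slift : nt scolim G := squot_lift ez_closed g0.
Lemma sliftE j n (x : C j n) : slift n (sin j n x) = f j n x.
Proof.
rewrite [LHS]squot_liftE; apply: limE; exists j; elim=> [|i IH].
  by rewrite leqn0 => /eqP E; subst j; rewrite sinSE /sin_ /= cidnn.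
rewrite leq_eqVlt => /orP [/eqP E|le]; first by subst j; rewrite sinSE /sin_ leqnn trnn.
have le' : (j <= i)%N by [].
by have := IH le'; rewrite !sinSE /sin_ le' (leqW le') trnS // ft.
Qed.
End lift.
End sequential_colimit.

Section colimit_of_complexes.
Variables (k : finFieldType) (e : nat) (C : nat -> cpx k e) (t : forall j, chom (C j) (C j.+1)).
Let T i j : nt (C j i) (C j.+1 i) := t j i.
Let cdin i l j := nt_comp (sin (T l) j) (cd (C j) i l).
Let cdin_t i l j n x : cdin i l j.+1 n (T i j n x) = cdin i l j n x.
Proof.
by apply: etrans (sin_step (T l) (cd (C j) i l n x)); rewrite /cdin /T /= -(chP (t j)).
Qed.
Program Definition ccolim : cpx k e :=
  @Cpx k e (fun i => scolim (T i)) (fun i l => slift (@cdin_t i l)) _ _.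
Next Obligation.
move=> i l ne; apply: scolim_ext => j n x; rewrite [LHS](sliftE (@cdin_t i l)).
by rewrite -[LHS]/(sin (T l) j n (cd (C j) i l n x)) cdE0 // !ntE0 nt0.
Qed.
Next Obligation.
move=> i l m; apply: scolim_ext => j n x.
rewrite -[LHS]/(slift (@cdin_t l m) n (slift (@cdin_t i l) n (sin (T i) j n x))).
by rewrite (sliftE (@cdin_t i l)) [LHS](sliftE (@cdin_t l m)) ntE0 -[LHS]/(sin (T m) j n _) cdK nt0.
Qed.
Lemma ccin_proof j i l n (x : C j i n) : sin (T l) j n (cd (C j) i l n x) = cd ccolim i l n (sin (T i) j n x).
Proof. by rewrite [RHS](sliftE (@cdin_t i l)). Qed.
Definition ccin j : chom (C j) ccolim := 
  @CHom k e (C j) ccolim (fun i => sin (T i) j) (fun i l n x => @ccin_proof j i l n x).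

Lemma ccin_step j i n x : ccin j.+1 i n (t j i n x) = ccin j i n x.
Proof. exact: (sin_step (T i)). Qed.
Lemma ccin_surj i n (y : ccolim i n) : exists j x, y = ccin j i n x.
Proof. exact: sin_surj. Qed.
Fixpoint ctr j m : chom (C j) (C (m + j)) :=
  match m with 0 => cidm (C j) | m'.+1 => ccomp (t (m' + j)) (ctr j m') end.
Lemma ctrE j m i n x : ctr j m i n x = tr (T i) j m n x.
Proof. by elim: m => [//|m IH]; rewrite /= IH. Qed.
Lemma ccin_tr j m i n x : ccin (m + j) i n (ctr j m i n x) = ccin j i n x.
Proof. by rewrite ctrE; apply: (sin_tr (T i)). Qed.
Lemma ccin_zero j i n x : ccin j i n x = 0 -> exists m, ctr j m i n x = 0.
Proof. by move=> /(@sin_zero _ _ _ (T i)) [m]; rewrite -ctrE; exists m. Qed.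

Section lift.
Variables (Y : cpx k e) (f : forall j, chom (C j) Y).
Hypothesis ft : forall j i n x, f j.+1 i n (t j i n x) = f j i n x.
Let ft' i j n x : f j.+1 i n (T i j n x) = f j i n x. Proof. exact: ft. Qed.
Let lift_proof i l n (x : ccolim i n) : slift (@ft' l) n (cd ccolim i l n x) = cd Y i l n (slift
  (@ft' i) n x).
Proof. by have [j [x' ->]] := ccin_surj x; rewrite -ccin_proof !sliftE chP. Qed.
Definition cclift : chom ccolim Y := CHom lift_proof.
Lemma ccliftE j i n x : cclift i n (ccin j i n x) = f j i n x.
Proof. exact: (sliftE (@ft' i)). Qed.
End lift.
End colimit_of_complexes.

(** * Semifree resolutions *)

Section semifree.
Variables (k : finFieldType) (e : nat).
Implicit Types A M P Y : cpx k e.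

Lemma acyclicP A : acyclic A -> forall i j l, j = i + 1 -> l = j + 1 -> forall n (x : A j n),
  cd A j l n x = 0 -> exists y, x = cd A i j n y.
Proof. by move=> ac i _ _ -> -> n x; apply: ac. Qed.

Section attach_cells.
Variables (P Y : cpx k e) (f : chom P Y).
(** A cocycle z of P together with a reason y for its image to be a boundary. The cell attached to
    such a pair kills the class of z; for z = 0 it adds the class of the cocycle y. *)
Let W i n (c : spair (P (i + 1)) (Y i) n) :=
  cd P (i + 1) (i + 1 + 1) n c.1 = 0 /\ f (i + 1) n c.1 = cd Y i (i + 1) n c.2.
Let W_closed i : sclosed (F := spair (P (i + 1)) (Y i)) (W (i := i)).
Proof.
split=> [n|m n g [z y] [/= dz Ez]]; last first.
  split; first by rewrite -[LHS]/(cd _ _ _ n (sact g z)) ntP dz sact0.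
  by rewrite -[LHS]/(f _ n (sact g z)) -[RHS]/(cd _ _ _ n (sact g y)) !ntP Ez.
split=> [|a [z y] [z' y'] [/= dz Ez] [/= dz' Ez']]; first by split; rewrite !nt0.
split; first by rewrite -[LHS]/(cd _ _ _ n (a *: z + z')) nt_lin dz dz' scaler0 addr0.
rewrite -[LHS]/(f _ n (a *: z + z')) -[RHS]/(cd _ _ _ n (a *: y + y')) !nt_lin Ez Ez' //.
Qed.
Let Q i : spf k e := sval (boolp.cid (enough_projectives (ssub (@W_closed i)))).
Let q i : nt (Q i) (ssub (@W_closed i)) := sval (boolp.cid (svalP (boolp.cid (enough_projectives
  (ssub (@W_closed i)))))).
Let Q_proj i : projective (C := Pcat k e) (Q i).
Proof. exact: (proj1 (svalP (boolp.cid (svalP (boolp.cid (enough_projectives (ssub (@W_closed i)))))))). Qed.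
Let q_surj i n y : exists x, q i n x = y.
Proof. exact: (proj2 (svalP (boolp.cid (svalP (boolp.cid (enough_projectives (ssub (@W_closed i)))))))). Qed.
Let bdy i : nt (Q i) (P (i + 1)) := nt_comp (sfst _ _) (nt_comp (ssub_in (@W_closed i)) (q i)).
Let val i : nt (Q i) (Y i) := nt_comp (ssnd _ _) (nt_comp (ssub_in (@W_closed i)) (q i)).
Let bdy_cocycle i l n x : cd P (i + 1) l n (bdy i n x) = 0.
Proof.
have [->|ne] := eqVneq l (i + 1 + 1); last by rewrite cdE0.
by have [] := smP (q i n x).
Qed.
Let bdy_val i n x : f (i + 1) n (bdy i n x) = cd Y i (i + 1) n (val i n x).
Proof. by have [] := smP (q i n x). Qed.
Let q_cell i n z y : cd P (i + 1) (i + 1 + 1) n z = 0 -> f (i + 1) n z = cd Y i (i + 1) n y ->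
  exists x, bdy i n x = z /\ val i n x = y.
Proof.
move=> dz Ez; have Wc : W (i := i) (n := n) (z, y) by [].
have [x Ex] := q_surj (i := i) (@Subm _ _ (@W i n) (proj1 (@W_closed i) n) (z, y) Wc).
by exists x; rewrite /bdy /val /= Ex.
Qed.

Let da i l : nt (spair (P i) (Q i)) (spair (P l) (Q l)) :=
  snpair (nt_comp (cd P i l) (sfst _ _) + nt_comp (nt_comp (cid P (i + 1) l) (bdy i)) (ssnd _ _)) 0.
Let daE i l n p x : da i l n (p, x) = (cd P i l n p + cid P (i + 1) l n (bdy i n x), 0).
Proof. by []. Qed.
Program Definition attach : cpx k e := @Cpx k e (fun i => spair (P i) (Q i)) da _ _.
Next Obligation.
move=> i l ne; apply: nt_ext => n [p x]; rewrite daE cdE0 // cid0 1?eq_sym //.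
by rewrite ntE0 addr0.
Qed.
Next Obligation.
move=> i l m; apply: nt_ext => n [p x]; rewrite -[LHS]/(da l m n (da i l n (p, x))) !daE nt0 nt0 addr0.
rewrite ntD cdK add0r; congr pair; rewrite cd_cid bdy_cocycle nt0 //.
Qed.
Let attachE i l n p x : cd attach i l n (p, x) = (cd P i l n p + cid P (i + 1) l n (bdy i n x), 0).
Proof. by []. Qed.
Program Definition attach_in : chom P attach := @CHom k e P attach (fun i => snpair (nt_id (P i)) 0) _.
Next Obligation.
move=> i l n x; rewrite -[snpair _ _ _ _]/(cd P i l n x, 0) -[snpair _ _ _ x]/(x, 0) attachE !nt0 addr0 //.
Qed.
Let am i : nt (attach i) (Y i) := nt_comp (f i) (sfst _ _) + nt_comp (val i) (ssnd _ _).
Let amE i n p x : am i n (p, x) = f i n p + val i n x.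
Proof. by []. Qed.
Program Definition attach_map : chom attach Y := @CHom k e attach Y am _.
Next Obligation.
move=> i l n [p x]; rewrite attachE !amE [val l n 0]nt0 addr0 !ntD chP; congr (_ + _).
have [<-|ne] := eqVneq (i + 1) l; first by rewrite cidxx bdy_val.
by rewrite cid0 // ntE0 nt0 cdE0 // eq_sym.
Qed.
Lemma attach_mapE i n x : attach_map i n (attach_in i n x) = f i n x.
Proof. by rewrite [LHS]amE [val i n 0]nt0 addr0. Qed.

Lemma attach_kill i n z y : cd P (i + 1) (i + 1 + 1) n z = 0 -> f (i + 1) n z = cd Y i (i + 1) n y ->
  exists x, attach_in (i + 1) n z = cd attach i (i + 1) n x /\ attach_map i n x = y.
Proof.
move=> dz Ez; have [x [Ex Ey]] := q_cell dz Ez; exists (0, x); rewrite attachE nt0 add0r cidxx Ex.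
by split=> //; rewrite -Ey [LHS]amE [f i n 0]nt0 add0r.
Qed.

(** On the new cells, [g] minus the given homotopy of the boundary is a cocycle of the acyclic A,
    and projectivity lifts it through the differential. The old homotopy is extended strictly, so
    that the stages can be glued. *)
Lemma attach_homotopy A (ac : acyclic A) (g : chom attach A) (h : forall i j, nt (P i) (A j)) :
  (forall i n (x : P (i + 1) n), g (i + 1) n (attach_in (i + 1) n x) =
     cd A i (i + 1) n (h (i + 1) i n x) + h (i + 1 + 1) (i + 1) n (cd P (i + 1) (i + 1 + 1) n x)) ->
  exists h' : forall i j, nt (attach i) (A j),
    (forall i n (x : attach (i + 1) n), g (i + 1) n x =
       cd A i (i + 1) n (h' (i + 1) i n x) + h' (i + 1 + 1) (i + 1) n (cd attach (i + 1) (i + 1 + 1) n x)) /\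
    forall i j n x, h' i j n (attach_in i n x) = h i j n x.
Proof.
move=> hh.
have hh' i n (x : P i n) : g i n (attach_in i n x) =
    cd A (i - 1) i n (h i (i - 1) n x) + h (i + 1) i n (cd P i (i + 1) n x).
  by have := hh (i - 1) n; rewrite subrK => /(_ x).
have ex i : exists w : nt (Q i) (A (i - 1)), forall n x,
    cd A (i - 1) i n (w n x) = g i n (0, x) - h (i + 1) i n (bdy i n x).
  have [|w Ew] := @projective_lift_im _ _ (Q i) _ _ (cd A (i - 1) i)
    (nt_comp (g i) (snpair 0 (nt_id _)) - nt_comp (h (i + 1) i) (bdy i)) (@Q_proj i).
    move=> n x; apply: (acyclicP ac _ (l := i + 1));
      rewrite ?subrK // ntEB ntB /= -(chP g) attachE nt0 add0r cidxx.
    rewrite -[(bdy i n x, 0)]/(attach_in (i + 1) n (bdy i n x)) hh bdy_cocycle nt0 addr0.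
    exact: subrr.
  by exists w => n x; rewrite Ew ntEB.
pose w i := sval (boolp.cid (ex i)).
have wE i n x : cd A (i - 1) i n (w i n x) = g i n (0, x) - h (i + 1) i n (bdy i n x).
  exact: (svalP (boolp.cid (ex i)) n x).
pose h' i j : nt (attach i) (A j) :=
  nt_comp (h i j) (sfst _ _) + nt_comp (nt_comp (cid A (i - 1) j) (w i)) (ssnd _ _).
have h'E i j n p x : h' i j n (p, x) = h i j n p + cid A (i - 1) j n (w i n x) by [].
exists h'; split=> [i n [p x]|i j n x]; last first.
  by rewrite -[attach_in i n x]/(x, 0) h'E [w i n 0]nt0 nt0 addr0.
rewrite attachE !h'E [w (i + 1 + 1) n 0]nt0 nt0 addr0 [cid P _ _ _ _]cidxx !ntD cd_cid cidxx wE.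
have -> : g (i + 1) n (p, x) = g (i + 1) n (attach_in (i + 1) n p) + g (i + 1) n (0, x).
  by rewrite -ntD; congr (g (i + 1) n _); congr pair; rewrite ?addr0 ?add0r.
by rewrite hh; zmod.
Qed.
End attach_cells.

Section resolution.
Variable Y : cpx k e.
Let stage := {P : cpx k e & chom P Y}.
Let z0 i j n x : (fun i => 0 : nt (cpx0 k e i) (Y i)) j n (cd (cpx0 k e) i j n x) =
  cd Y i j n ((fun i => 0 : nt (cpx0 k e i) (Y i)) i n x).
Proof. by rewrite !ntE0 nt0. Qed.
Fixpoint stages (j : nat) : stage :=
  match j with
  | 0 => existT _ (cpx0 k e) (CHom z0)
  | j'.+1 => existT _ (attach (tagged (stages j'))) (attach_map (tagged (stages j')))
  end.
Let C j := tag (stages j).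
Let t j : chom (C j) (C j.+1) := attach_in (tagged (stages j)).
Let f j : chom (C j) Y := tagged (stages j).
Let ft j i n x : f j.+1 i n (t j i n x) = f j i n x.
Proof. exact: attach_mapE. Qed.
Definition semifree := ccolim t.
Definition semifree_map : chom semifree Y := cclift ft.

Lemma semifree_qis : cpx_qis semifree_map.
Proof.
apply/qisP => i n; split=> [x dx [y Ey]|y dy].
  have [j [z Ez]] := ccin_surj x; subst x.
  move: dx; rewrite -(chP (ccin t j)) => /ccin_zero [m Em].
  pose z' := ctr t j m (i + 1) n z.
  have dz : cd (C (m + j)) (i + 1) (i + 1 + 1) n z' = 0 by rewrite /z' -chP.
  have Ez' : ccin t j (i + 1) n z = ccin t (m + j) (i + 1) n z' by rewrite ccin_tr.
  move: Ey; rewrite Ez' [LHS]ccliftE => Ey.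
  have [x [Ex _]] := attach_kill dz Ey; exists (ccin t (m + j).+1 i n x).
  rewrite -(chP (ccin t (m + j).+1)) -[in RHS]/(attach (f (m + j))) -Ex.
  by rewrite -[RHS]/(ccin t (m + j).+1 (i + 1) n (t (m + j) (i + 1) n z')) (ccin_step t).
(* Every cocycle of Y is reached at the first stage already, by a cell with zero boundary. *)
have [||x [Ex Ey]] := @attach_kill _ _ (f 0%N) (i + 1) n 0 y; first exact: nt0.
  by rewrite dy nt0.
exists (ccin t 1%N (i + 1) n x), 0; rewrite nt0 addr0 -chP; split; last by rewrite [LHS]ccliftE.
by rewrite -[cd _ _ _ _ x]Ex !nt0.
Qed.

(** The null homotopies chosen on the stages extend one another strictly, hence define one on the
    colimit. *)
Lemma semifree_hproj : hproj semifree.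
Proof.
move=> A g ac.
pose good j (h : forall i l, nt (C j i) (A l)) := forall i n (x : C j (i + 1) n),
  g (i + 1) n (ccin t j (i + 1) n x) = cd A i (i + 1) n (h (i + 1) i n x) +
    h (i + 1 + 1) (i + 1) n (cd (C j) (i + 1) (i + 1 + 1) n x).
have ext j (h : {h : forall i l, nt (C j i) (A l) | good j h}) :
    {h' : {h : forall i l, nt (C j.+1 i) (A l) | good j.+1 h} |
       forall i l n x, sval h' i l n (t j i n x) = sval h i l n x}.
  apply: boolp.cid; case: h => h hh.
  have [|h' [hh' Eh']] := @attach_homotopy _ _ (f j) A ac (ccomp g (ccin t j.+1)) h.
    move=> i n x; rewrite -hh -[LHS]/(g (i + 1) n (ccin t j.+1 (i + 1) n (t j (i + 1) n x))).
    by rewrite (ccin_step t).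
  by exists (exist (good j.+1) h' hh').
have h0 : {h : forall i l, nt (C 0 i) (A l) | good 0%N h}.
  exists (fun i l => 0) => i n x; rewrite !ntE0 nt0 addr0.
  by rewrite (spf0_eq x 0) !nt0.
pose hs := fix hs j : {h : forall i l, nt (C j i) (A l) | good j h} :=
  match j with 0 => h0 | j'.+1 => sval (ext j' (hs j')) end.
have hsS j i l n x : sval (hs j.+1) i l n (t j i n x) = sval (hs j) i l n x.
  exact: (svalP (ext j (hs j))).
pose H i l : nt (semifree i) (A l) := slift (f := fun j => sval (hs j) i l) (fun j n x => hsS j i l n x).
have HE i l j n (x : C j i n) : H i l n (ccin t j i n x) = sval (hs j) i l n x.
  exact: (sliftE (f := fun j => sval (hs j) i l)).
exists H => i n x; have [j [z ->]] := ccin_surj x.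
by rewrite -(chP (ccin t j)) !HE; apply: (svalP (hs j)).
Qed.
End resolution.
End semifree.

(** * The derived category *)

Section khat_homotopy.
Variable k : finFieldType.
Implicit Types X Y Z P : khat k.

Definition kch X Y (f : khom X Y) e : chom (X e) (Y e) := @CHom k e (X e) (Y e) (f e) (@kcE k X Y f e).
Program Definition kof X Y (F : forall e, chom (X e) (Y e)) : khom X Y := @KHom k X Y (fun e i => F e i) _.
Next Obligation. by move=> X Y F e i j; apply: nt_ext => n x; exact: (chP (F e)). Qed.

Lemma khomE X Y (f g : khom X Y) (c : k) e i n x :
  [/\ (f + g) e i n x = f e i n x + g e i n x, (f - g) e i n x = f e i n x - g e i n x,
     (c *: f) e i n x = c *: f e i n x & (0 : khom X Y) e i n x = 0].
Proof. by split=> //; rewrite -[LHS]/(f e i n x + (-1) *: g e i n x) scaleN1r. Qed.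
Lemma khomB X Y (f g : khom X Y) e i n x : (f - g) e i n x = f e i n x - g e i n x.
Proof. by have [] := khomE f g 0 x. Qed.

Lemma kbij_iso X Y (f : khom X Y) : (forall e i n x, f e i n x = 0 -> x = 0) ->
  (forall e i n y, exists x, f e i n x = y) -> is_iso (f : mor (c := KP k) X Y).
Proof.
move=> fI fS; have fI' e i n x x' : f e i n x = f e i n x' -> x = x'.
  by move=> E; apply/eqP; rewrite -subr_eq0; apply/eqP/fI; rewrite ntB E subrr.
pose g e i n y := sval (boolp.cid (fS e i n y)).
have fg e i n y : f e i n (g e i n y) = y := svalP (boolp.cid (fS e i n y)).
have gl e i n : linear (g e i n) by move=> a y y'; apply: fI'; rewrite nt_lin !fg.
have gn (e : pdeg) i m n (h : GHom k e m n) (y : Y e i m) : g e i n (sact h y) = sact h (g e i m y).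
  by apply: fI'; rewrite ntP !fg.
pose G e i : nt (Y e i) (X e i) := Nt (gl e i) (gn e i).
have Gc e i j n (y : Y e i n) : G e j n (cd (Y e) i j n y) = cd (X e) i j n (G e i n y).
  by apply: fI'; rewrite kcE [LHS]fg [in RHS]fg.
exists (kof (fun e => CHom (Gc e))); split; apply: khom_ext => e i n x /=; last exact: fg.
by apply: fI'; rewrite [LHS]fg.
Qed.

Definition knull X Y (f : khom X Y) := forall e, nullh (fun i => f e i).
Definition khmt X Y (f g : khom X Y) := knull (f - g).
Definition khp P := forall e, hproj (P e).

Lemma knull_eq X Y (f g : khom X Y) : f = g -> knull f -> knull g.
Proof. by move=> ->. Qed.
Lemma knullD X Y (f g : khom X Y) a : knull f -> knull g -> knull (a *: f + g).
Proof. by move=> hf hg e; apply: nullhD. Qed.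
Lemma khmt_refl X Y (f : khom X Y) : khmt f f.
Proof. by move=> e; apply: nullh0 => i n x; rewrite khomB subrr. Qed.
Lemma khmt_sym X Y (f g : khom X Y) : khmt f g -> khmt g f.
Proof.
move=> h; apply: knull_eq (knullD (-1) h (khmt_refl 0)).
by rewrite scaleN1r opprB subr0 addr0.
Qed.
Lemma khmt_trans X Y (f g h : khom X Y) : khmt f g -> khmt g h -> khmt f h.
Proof. by move=> h1 h2; apply: knull_eq (knullD 1 h1 h2); rewrite scale1r addrA subrK. Qed.
Lemma knull_compl X Y Z (g : khom Y Z) (f : khom X Y) : knull f -> knull (khom_comp g f).
Proof. by move=> h e; apply: nullh_eq (nullh_compl (kch g e) (h e)). Qed.
Lemma khmt_compl X Y Z (g : khom Y Z) (f f' : khom X Y) :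
  khmt f f' -> khmt (khom_comp g f) (khom_comp g f').
Proof.
move=> /(knull_compl g); apply: knull_eq; apply: khom_ext => e i n x.
by rewrite khomB -[LHS]/(g e i n ((f - f') e i n x)) khomB ntB.
Qed.

Section lifting.
Variables (P Y Y' : khat k) (hP : khp P) (w : khom Y Y') (qw : qis w).
Lemma khp_surj (f : khom P Y') : exists f' : khom P Y, khmt (khom_comp w f') f.
Proof.
have H e := hproj_surj (@hP e) (w := kch w e) (qw e) (kch f e).
exists (kof (fun e => sval (boolp.cid (H e)))) => e.
apply: nullh_eq (svalP (boolp.cid (H e))) => i n x.
by rewrite [RHS]khomB [LHS]ntEB.
Qed.
Lemma khp_inj (f f' : khom P Y) : khmt (khom_comp w f) (khom_comp w f') -> khmt f f'.
Proof.
move=> h e; apply: (@hproj_inj _ _ _ _ _ (@hP e) (kch w e) (qw e) (kch (f - f') e)).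
by apply: nullh_eq (h e) => i n x; rewrite [LHS]khomB -[RHS]/(w e i n ((f - f') e i n x)) khomB ntB.
Qed.
End lifting.
End khat_homotopy.

(** * Path objects *)

Section path_objects.
Variable k : finFieldType.

Lemma nullh_adj e (X Y : cpx k e) (f : forall i, nt (X i) (Y i)) (h : forall i j, nt (X i) (Y j)) :
  (forall i n (x : X (i + 1) n), f (i + 1) n x =
     cd Y i (i + 1) n (h (i + 1) i n x) + h (i + 1 + 1) (i + 1) n (cd X (i + 1) (i + 1 + 1) n x)) ->
  forall i n (x : X i n), f i n x =
     cd Y (i - 1) i n (h i (i - 1) n x) + h (i + 1) i n (cd X i (i + 1) n x).
Proof. by move=> H i n; have := H (i - 1) n; rewrite subrK. Qed.

Section pth.
Variables (e : nat) (Y : cpx k e).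
Let T i := spair (Y i) (spair (Y i) (Y (i - 1))).
Let dp i j : nt (T i) (T j) := snpair (nt_comp (cd Y i j) (sfst _ _))
  (snpair (nt_comp (cd Y i j) (nt_comp (sfst _ _) (ssnd _ _)))
    (nt_comp (cid Y i (j - 1)) (sfst _ _ - nt_comp (sfst _ _) (ssnd _ _))
      - nt_comp (cd Y (i - 1) (j - 1)) (nt_comp (ssnd _ _) (ssnd _ _)))).
Let dpE i j n x y z : dp i j n (x, (y, z)) =
  (cd Y i j n x, (cd Y i j n y, cid Y i (j - 1) n (x - y) - cd Y (i - 1) (j - 1) n z)).
Proof.
congr (_, (_, _)); rewrite [LHS]ntEB; congr (_ - _).
by rewrite -[LHS]/(cid Y i (j - 1) n (_ n (x, (y, z)))) [X in cid _ _ _ _ X]ntEB.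
Qed.
(** The cocylinder of Y: a chain map into it is a pair of chain maps with a homotopy between
    them. *)
Program Definition pth : cpx k e := @Cpx k e T dp _ _.
Next Obligation.
move=> i j ne; apply: nt_ext => n [x [y z]]; rewrite dpE !cdE0 //.
  by rewrite cid0 ?ntE0 ?subr0 // eq_sym; apply: contra ne => /eqP <-; rewrite subrK.
by apply: contra ne => /eqP/(congr1 (fun u => u + 1)); rewrite !subrK => ->.
Qed.
Next Obligation.
move=> i j l; apply: nt_ext => n [x [y z]].
rewrite -[LHS]/(dp j l n (dp i j n (x, (y, z)))) !dpE !cdK -ntB; congr (_, (_, _)).
rewrite [cd Y (j - 1) (l - 1) n (_ - _)]ntB cdK subr0; have [->|ne] := eqVneq j (i + 1); last first.
  rewrite cdE0 // nt0 sub0r cid0 ?ntE0 ?nt0 ?oppr0 //.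
  by rewrite eq_sym; apply: contra ne => /eqP <-; rewrite subrK.
by rewrite cd_cid subrK subrr.
Qed.
Lemma pthE i j n x y z : cd pth i j n (x, (y, z)) =
  (cd Y i j n x, (cd Y i j n y, cid Y i (j - 1) n (x - y) - cd Y (i - 1) (j - 1) n z)).
Proof. exact: dpE. Qed.

Let f0 i : nt (pth i) (Y i) := sfst _ _.
Let f1 i : nt (pth i) (Y i) := nt_comp (sfst _ _) (ssnd _ _).
Let fd i : nt (Y i) (pth i) := snpair (nt_id _) (snpair (nt_id _) 0).
Let f0P i j n x : f0 j n (cd pth i j n x) = cd Y i j n (f0 i n x).
Proof. by []. Qed.
Let f1P i j n x : f1 j n (cd pth i j n x) = cd Y i j n (f1 i n x).
Proof. by []. Qed.
Let fdP i j n x : fd j n (cd Y i j n x) = cd pth i j n (fd i n x).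
Proof. by rewrite -[fd i n x]/(x, (x, 0)) pthE subrr !nt0 subr0. Qed.
Definition pth0 : chom pth Y := CHom f0P.
Definition pth1 : chom pth Y := CHom f1P.
Definition pth_diag : chom Y pth := CHom fdP.

Lemma pth0_qis : cpx_qis pth0.
Proof.
apply/qisP => i n; split=> [[x [y z]]|y dy]; last first.
  exists (y, (y, 0)), 0; rewrite nt0 addr0; split=> //.
  by rewrite pthE dy subrr !nt0 subr0.
rewrite pthE => -[_ _ E] [x' Ex']; rewrite -[pth0 _ _ _]/x in Ex'.
exists (x', (x' - cid Y (i + 1 - 1) i n z, 0)); rewrite pthE nt0 subr0 subKr cid_trans ?addrK // cidxx.
rewrite -Ex' ntB; congr (_, (_, _)); rewrite cd_cid -Ex'.
move: E => /eqP; rewrite subr_eq0 => /eqP /(congr1 (cid Y (i + 1 + 1 - 1) (i + 1) n)).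
rewrite cid_trans ?addrK // cidxx => E; rewrite -[LHS](subKr x); congr (_ - _); rewrite E.
move: z E; rewrite !addrK => z E; by rewrite cidxx.
Qed.
Lemma pth_diag_qis : cpx_qis pth_diag.
Proof.
apply: (@qis_cancell _ _ _ _ _ pth0 pth_diag pth0_qis).
exact: (@qis_id _ _ Y).
Qed.

Section lift.
Variables (X : cpx k e) (f g : chom X Y) (h : forall i j, nt (X i) (Y j)).
Hypothesis H : forall i n (x : X (i + 1) n), (f (i + 1) - g (i + 1)) n x =
     cd Y i (i + 1) n (h (i + 1) i n x) + h (i + 1 + 1) (i + 1) n (cd X (i + 1) (i + 1 + 1) n x).
Let l i : nt (X i) (pth i) := snpair (f i) (snpair (g i) (h i (i - 1))).
Let lE i n x : l i n x = (f i n x, (g i n x, h i (i - 1) n x)). Proof. by []. Qed.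
Let lP i n x : l (i + 1) n (cd X i (i + 1) n x) = cd pth i (i + 1) n (l i n x).
Proof.
rewrite !lE pthE !chP; congr (_, (_, _)).
have := nullh_adj (f := fun i => f i - g i) H x; rewrite ntEB => ->.
by rewrite addrK cidxx addrAC subrr add0r.
Qed.
Definition pth_lift : chom X pth := CHom (chomP lP).
End lift.

Lemma pth_nullh (X : cpx k e) (l : chom X pth) :
  nullh (fun i => nt_comp (pth0 i) (l i) - nt_comp (pth1 i) (l i)).
Proof.
exists (fun i j => nt_comp (cid Y (i - 1) j) (nt_comp (ssnd _ _) (nt_comp (ssnd _ _) (l i)))) => i n x.
have E : l (i + 1) n x = ((l (i + 1) n x).1, ((l (i + 1) n x).2.1, (l (i + 1) n x).2.2)).
  by case: (l (i + 1) n x) => [? []].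
rewrite ntEB; have := @chP _ _ _ _ l (i + 1) (i + 1 + 1) n x.
rewrite [in X in _ = X]E pthE => /(congr1 (fun u => u.2.2)) /= ->.
move: (l (i + 1) n x).1 (l (i + 1) n x).2.1 (l (i + 1) n x).2.2 => a b c.
rewrite [cid Y _ (i + 1) n (_ - _)]ntB cid_trans ?addrK // cidxx cid_cd ?addrK ?subrK //.
move: (a - b) c => u; rewrite addrK => c; by rewrite !cidxx addrCA subrr addr0.
Qed.
End pth.

Definition kpath (Y : khat k) : khat k := fun e => pth (Y e).
Definition kpath0 Y : khom (kpath Y) Y := kof (fun e => pth0 (Y e)).
Definition kpath1 Y : khom (kpath Y) Y := kof (fun e => pth1 (Y e)).
Definition kdiag Y : khom Y (kpath Y) := kof (fun e => pth_diag (Y e)).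
Lemma kdiag_qis Y : qis (kdiag Y). Proof. by move=> e; apply: pth_diag_qis. Qed.
Lemma kpath0_diag Y : khom_comp (kpath0 Y) (kdiag Y) = khom_id Y. Proof. exact: khom_ext. Qed.
Lemma kpath1_diag Y : khom_comp (kpath1 Y) (kdiag Y) = khom_id Y. Proof. exact: khom_ext. Qed.

Lemma khmt_path X Y (f g : khom X Y) : khmt f g <->
  exists l : khom X (kpath Y), f = khom_comp (kpath0 Y) l /\ g = khom_comp (kpath1 Y) l.
Proof.
split=> [h|[l [-> ->]] e]; last first.
  by apply: nullh_eq (pth_nullh (kch l e)) => i n x; rewrite [RHS]khomB [LHS]ntEB.
have H e : exists h : forall i j, nt (X e i) (Y e j), forall i n (x : X e (i + 1) n),
    (kch f e (i + 1) - kch g e (i + 1)) n x = cd (Y e) i (i + 1) n (h (i + 1) i n x) +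
       h (i + 1 + 1) (i + 1) n (cd (X e) (i + 1) (i + 1 + 1) n x).
  by have [u U] := h e; exists u => i n x; rewrite -U [LHS]ntEB [RHS]khomB.
exists (kof (fun e => pth_lift (svalP (boolp.cid (H e))))).
by split; apply: khom_ext.
Qed.

Lemma conc_path d Y : conc d Y -> conc d (kpath Y).
Proof. by move=> c e ne i n [x [y z]]; congr (_, (_, _)); apply: c. Qed.
End path_objects.

Section derived_categories.
Variable k : finFieldType.
Local Notation DK := (Loc (@qis k)).
Local Notation kloc := (loc (@qis k)).
Local Notation dloc d := (loc (@qis_d k d)).

Definition czero e (X Y : cpx k e) : chom X Y.
Proof. by refine (@CHom k e X Y (fun i => 0) _) => i j n x; rewrite !ntE0 nt0. Defined.

(** Resolving only the degrees selected by [b] and taking 0 elsewhere keeps a resolution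
    concentrated where Y is. *)
Lemma kresolution_on (b : pdeg -> bool) (Y : khat k) :
  (forall e : pdeg, ~~ b e -> forall i n (x : Y e i n), x = 0) ->
  exists (P : khat k) (q : khom P Y),
    [/\ khp P, qis q & forall e : pdeg, ~~ b e -> forall i n (x : P e i n), x = 0].
Proof.
move=> Y0.
have H (e : pdeg) : exists (P : cpx k e) (q : chom P (Y e)),
    [/\ hproj P, cpx_qis q & ~~ b e -> forall i n (x : P i n), x = 0].
  have [be|nb] := boolP (b e).
    by exists (semifree (Y e)), (semifree_map (Y e)); split=> //; [exact: semifree_hproj|exact: semifree_qis].
  exists (cpx0 k e), (czero _ _); split.
  - by move=> A g _; apply: nullh0 => i n x; rewrite (spf0_eq x 0) nt0.
  - by apply: qis_bij => i n y; [rewrite (spf0_eq y 0)|exists 0; rewrite [RHS](Y0 e nb)].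
  - by move=> _ i n x; apply: spf0_eq.
pose P e := sval (boolp.cid (H e)); have HP e := svalP (boolp.cid (H e)).
pose q e : chom (P e) (Y e) := sval (boolp.cid (HP e)); have Hq e := svalP (boolp.cid (HP e)).
exists P, (kof q); split=> e; [have [h _ _] := Hq e|have [_ h _] := Hq e|have [_ _ h] := Hq e]; exact: h.
Qed.

Lemma kresolution (Y : KP k) : exists (P : KP k) (q : lmor P Y), khp P /\ qis q.
Proof. by have [//|P [q [? ? _]]] := @kresolution_on (fun => true) Y; exists P, q. Qed.
Lemma dresolution d (Y : KPd k d) : exists (P : KPd k d) (q : lmor P Y), khp (sval P) /\ @qis_d k d _ _ q.
Proof.
have [|P [q [hP qq P0]]] := @kresolution_on (fun e => dval e == d) (sval Y); first exact: (svalP Y).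
by exists (exist _ P P0), q.
Qed.

(** The two projections of the path object have the diagonal as a common section. It is a
    quasi-isomorphism, so the projections agree in the localisation. *)
Lemma loc_khmt (X Y : KP k) (f g : lmor X Y) : khmt (f : khom _ _) g ->
  fmap kloc f = fmap kloc g.
Proof.
move=> /khmt_path [l [-> ->]].
have E : fmap kloc (kpath0 Y : mor (c := KP k) _ _) = fmap kloc (kpath1 Y : mor (c := KP k) _ _).
  apply: (iso_epi (loc_iso (W := @qis k) (@kdiag_qis k Y))).
  rewrite -!fmapM; congr (fmap _ _); exact: etrans (kpath0_diag Y) (esym (kpath1_diag Y)).
rewrite [LHS](fmapM kloc (kpath0 Y : mor (c := KP k) _ _) (l : mor (c := KP k) _ _)) E.
by rewrite -fmapM.
Qed.
Lemma dloc_khmt d (X Y : KPd k d) (f g : lmor X Y) : khmt (f : khom _ _) g ->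
  fmap (dloc d) f = fmap (dloc d) g.
Proof.
move=> /khmt_path [l [-> ->]].
pose PY : KPd k d := exist _ _ (conc_path (svalP Y)).
have qd : @qis_d k d Y PY (kdiag (sval Y)) by apply: kdiag_qis.
have E : fmap (dloc d) (kpath0 (sval Y) : mor (c := KPd k d) PY Y) =
    fmap (dloc d) (kpath1 (sval Y) : mor (c := KPd k d) PY Y).
  apply: (iso_epi (loc_iso qd)).
  rewrite -!fmapM; congr (fmap _ _); exact: etrans (kpath0_diag (sval Y)) (esym (kpath1_diag (sval Y))).
rewrite [LHS](fmapM (dloc d) (kpath0 (sval Y) : mor (c := KPd k d) PY Y) (l : mor (c := KPd k d) X PY)) E.
by rewrite -fmapM.
Qed.

Section strict.
Variable P : KP k.
Hypothesis hP : khp P.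
Let r (Y : KP k) (f g : lmor P Y) := khmt (f : khom _ _) g.
Lemma kstrict (Y : KP k) (h : mor (c := DK) P Y) : exists f, h = fmap kloc f.
Proof.
apply: (@loc_strict (KP k) (@qis k) P r) => [A B w Ww f|A f g]; first exact: khp_surj.
exact: loc_khmt.
Qed.
Lemma kstrict_eq (Y : KP k) (f g : lmor P Y) :
  fmap kloc f = fmap kloc g <-> khmt (f : khom _ _) g.
Proof.
split; last exact: loc_khmt.
apply: (@loc_strict_eq (KP k) (@qis k) P r) => [A ?|A ? ?|A ? ? ?|A B ? ? ?|A B w Ww f0|A B w Ww ? ?].
- exact: khmt_refl.
- exact: khmt_sym.
- exact: khmt_trans.
- exact: khmt_compl.
- exact: khp_surj.
- exact: khp_inj.
Qed.
End strict.

Section dstrict.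
Variables (d : nat) (P : KPd k d).
Hypothesis hP : khp (sval P).
Let r (Y : KPd k d) (f g : lmor P Y) := khmt (f : khom _ _) g.
Lemma dstrict (Y : KPd k d) (h : mor (c := DP k d) P Y) : exists f, h = fmap (dloc d) f.
Proof.
apply: (@loc_strict (KPd k d) (@qis_d k d) P r) => [A B w Ww f|A f g]; first exact: khp_surj.
exact: dloc_khmt.
Qed.
Lemma dstrict_eq (Y : KPd k d) (f g : lmor P Y) :
  fmap (dloc d) f = fmap (dloc d) g <-> khmt (f : khom _ _) g.
Proof.
split; last exact: dloc_khmt.
apply: (@loc_strict_eq (KPd k d) (@qis_d k d) P r) => [A ?|A ? ?|A ? ? ?|A B ? ? ?|A B w Ww f0|A B w Ww ? ?].
- exact: khmt_refl.
- exact: khmt_sym.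
- exact: khmt_trans.
- exact: khmt_compl.
- exact: khp_surj.
- exact: khp_inj.
Qed.
End dstrict.

Section inclusion.
Variable d : nat.
Definition dforget : functor (KPd k d) (KP k) :=
  @Functor (KPd k d) (KP k) (fun F => sval F) (fun F G f => f) (fun _ => erefl) (fun _ _ _ _ _ => erefl).
Definition dincl : functor (DP k d) DK := @Loc_map _ _ (@qis_d k d) (@qis k) dforget (fun F G f h => h).
Lemma dinclE (X Y : KPd k d) (f : lmor X Y) :
  fmap dincl (fmap (dloc d) f) = fmap kloc (f : mor (c := KP k) (sval X) (sval Y)).
Proof. exact: Loc_mapE. Qed.
(** The derived category in degree d is a full subcategory of that of all complexes: resolutions
    stay in degree d, and strict maps and homotopies are the same on both sides. *)
Lemma dincl_inj (X Y : KPd k d) (u v : mor (c := DP k d) X Y) : fmap dincl u = fmap dincl v -> u = v.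
Proof.
have [P [q [hP qq]]] := dresolution X => E; apply: (iso_epi (loc_iso qq)).
have [f Ef] := dstrict hP (u \oc fmap (dloc d) q).
have [g Eg] := dstrict hP (v \oc fmap (dloc d) q).
rewrite Ef Eg; apply/(dstrict_eq hP)/(kstrict_eq hP).
by rewrite -!dinclE -Ef -Eg !fmapM E.
Qed.
Lemma dincl_full (X Y : KPd k d) (w : mor (c := DK) (sval X) (sval Y)) :
  exists u : mor (c := DP k d) X Y, fmap dincl u = w.
Proof.
have [P [q [hP qq]]] := dresolution X.
have [f Ef] := kstrict hP (w \oc fmap kloc (q : mor (c := KP k) (sval P) (sval X))).
exists (fmap (dloc d) (f : mor (c := KPd k d) P Y) \oc iinv (loc_iso qq)).
apply: (iso_epi (loc_iso (W := @qis k) qq)); rewrite Ef -dinclE.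
by rewrite -(fmapM dincl) -compA iinvl compm1 dinclE.
Qed.
Lemma dincl_iso (X Y : KPd k d) (u : mor (c := DP k d) X Y) : is_iso (fmap dincl u) -> is_iso u.
Proof.
move=> [w [wu uw]]; have [v Ev] := dincl_full w.
by exists v; split; apply: dincl_inj; rewrite fmapM Ev fmap1.
Qed.
End inclusion.
End derived_categories.

(** * The functor K' *)

Section hom_complexes.
Variables (k : finFieldType) (a b : nat) (X : bicpx k a b).
Hypotheses (X_fd : findim_bicpx X) (X_proj : forall i m, projective (C := Pcat k b) (X i m)).
Implicit Types F G : cpx k b.

Lemma bislice_hproj m : hproj (bislice X m).
Proof.
apply: bounded_projective_hproj => [|i]; last exact: X_proj.
by have [[N hN] _] := X_fd; exists N => i lt n x; apply: hN.
Qed.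

Section hat.
Variables (F : cpx k b) (N : int) (m : nat).
Lemma hcB (f g : hc X F N m) i j o x : (f - g) i j o x = f i j o x - g i j o x.
Proof. by rewrite -[LHS]/(f i j o x + (-1) *: g i j o x) scaleN1r. Qed.
Lemma hc_dE (f : hc X F N m) i j o (x : X i m o) : (cd (hom_cpx X F) N (N + 1) m f : hc X F _ m) i j o x =
  cd F (j - 1) j o (f i (j - 1) o x) - (-1) ^ N *: f (i + 1) j o (bd X i (i + 1) m o x).
Proof. by rewrite [LHS]/= /hc_d_fun eqxx [LHS]ntEB. Qed.
(** Degree N cocycles of the Hom complex are chain maps into F[N], and coboundaries are the null
    homotopic ones; the sign in the differential of F[N] absorbs the sign (-1)^N of the Hom
    differential. *)
Definition hhat (g : hc X F N m) i : nt (bislice X m i) (cpx_shift N F i) := g i (i + N).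
Lemma signNN (V : lmodType k) (v : V) : (-1 : k) ^ N *: ((-1) ^ N *: v) = v.
Proof. by rewrite scalerA -expfzMl mulrNN mul1r exp1rz scale1r. Qed.

Lemma hhat_chain (g : hc X F N m) : cd (hom_cpx X F) N (N + 1) m g = 0 ->
  forall i j n x, hhat g j n (cd (bislice X m) i j n x) = cd (cpx_shift N F) i j n (hhat g i n x).
Proof.
move=> dg; apply: chomP => i n x; have := @hc_dE g i (i + 1 + N) n x; rewrite dg ntE0 => /esym/eqP.
rewrite subr_eq0 (_ : i + 1 + N - 1 = i + N) => [/eqP|]; last by rewrite addrAC addrK.
by move=> E; rewrite [RHS]cd_shiftE -[hhat g i n x]/(g i (i + N) n x) E signNN.
Qed.

Section unhat.
Variable c : chom (bislice X m) (cpx_shift N F).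
Let u i j : nt (X i m) (F j) := nt_comp (cid F (i + N) j) (c i).
Let u0 i j : j != i + N -> u i j = 0.
Proof. by move=> ne; rewrite /u cid0 1?eq_sym // nt_comp0l. Qed.
Definition unhat : hc X F N m := HC u0.
Lemma unhatE i n x : hhat unhat i n x = c i n x.
Proof. by rewrite -[LHS]/(cid F _ _ n (c i n x)) cidxx. Qed.
Lemma unhat_cocycle : cd (hom_cpx X F) N (N + 1) m unhat = 0.
Proof.
apply: hc_ext => i j; apply: nt_ext => n x; rewrite hc_dE.
rewrite -[unhat i _ n x]/(cid F _ _ n (c i n x)) -[unhat (i + 1) _ n _]/(cid F _ _ n (c (i + 1) n _)).
have := @chP _ _ _ _ c i (i + 1) n x; rewrite cd_shiftE => E.
rewrite -[bd X i (i + 1) m n x]/(cd (bislice X m) i (i + 1) n x) E.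
rewrite cd_cid subrK; have [->|ne] := eqVneq j (i + 1 + N).
  by rewrite cidxx ntZ signNN addrAC cidxx subrr.
rewrite cidxx cdE0; last by rewrite addrAC.
by rewrite cid0 1?eq_sym // ntE0 scaler0 subr0.
Qed.
End unhat.
End hat.

Lemma hhat_null F N m (g : hc X F (N + 1) m) :
  (exists y : hc X F N m, g = cd (hom_cpx X F) N (N + 1) m y) <-> nullh (hhat g).
Proof.
have sg (V : lmodType k) (v : V) : (-1 : k) ^ (N + 1) *: v = - ((-1) ^ N *: v).
  by rewrite expfzDr ?oppr_eq0 ?oner_eq0 // expr1z mulrN1 scaleNr.
split=> [[y Ey]|[h H]].
  exists (fun i j => (-1) ^ (N + 1) *: y i (j + (N + 1))) => i n x.
  rewrite /hhat Ey hc_dE cd_shiftE !ntEZ ntZ signNN sg; congr (_ - _).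
  by rewrite (_ : i + 1 + (N + 1) - 1 = i + (N + 1)) // [i + 1 + _]addrAC addrK.
pose y' i j : nt (X i m) (F j) := (-1) ^ (N + 1) *: nt_comp (cid F (i - 1 + (N + 1)) j) (h i (i - 1)).
have y0 i j : j != i + N -> y' i j = 0.
  move=> ne; rewrite /y' cid0 ?nt_comp0l ?scaler0 // eq_sym; apply: contra ne => /eqP ->.
  by rewrite [N + 1]addrC addrA subrK.
exists (HC y0); apply: hc_ext => i j; apply: nt_ext => n x.
have [->|ne] := eqVneq j (i + (N + 1)); last by rewrite !hc0.
have := nullh_adj H x; rewrite cd_shiftE -[hhat _ _ _ _]/(g i (i + (N + 1)) n x) => ->.
rewrite hc_dE -[HC y0 i _ n x]/((-1) ^ (N + 1) *: cid F _ _ n (h i (i - 1) n x)).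
rewrite -[HC y0 (i + 1) _ n _]/((-1) ^ (N + 1) *: cid F _ _ n (h (i + 1) (i + 1 - 1) n _)).
rewrite (_ : i + (N + 1) - 1 = i - 1 + (N + 1)); last by rewrite addrAC.
rewrite cidxx ntZ !sg scalerN opprK signNN; congr (_ + _).
move: (h (i + 1)) => h'; by rewrite addrK cidxx.
Qed.

(** The cohomology of the Hom complex consists of homotopy classes of maps from a homotopically
    projective complex to shifts, and these see only quasi-isomorphism types. *)
Lemma hc_map_qis F G (f : chom F G) (phi : chom (hom_cpx X F) (hom_cpx X G)) :
  (forall N m (g : hc X F N m) i j, (phi N m g : hc X G N m) i j = nt_comp (f j) (g i j)) ->
  cpx_qis f -> cpx_qis phi.
Proof.
move=> phiE qf; apply/qisP => N m; set M := N + 1.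
have qs := shift_qis M qf; have hP := @bislice_hproj m.
split=> [x dx /hhat_null h|y dy].
  apply/hhat_null; apply: (hproj_inj hP qs (f := CHom (hhat_chain dx))).
  by apply: nullh_eq h => i n z; rewrite -[LHS]/((phi M m x : hc _ _ _ _) _ _ n z) phiE.
have [c Hc] := hproj_surj hP qs (CHom (hhat_chain dy)).
have [|z Ez] := proj2 (hhat_null (phi M m (unhat c) - y : hc X G (N + 1) m)).
  apply: nullh_eq Hc => i n z; rewrite [LHS]ntEB [RHS]hcB; congr (_ - _).
  by rewrite [in RHS]phiE -[RHS]/(f _ n (hhat (unhat c) i n z)) unhatE.
exists (unhat c), z; split; first exact: unhat_cocycle.
by rewrite -Ez addrC subrK.
Qed.
End hom_complexes.

Section Kprime.
Variables (k : finFieldType) (p : nat) (pk : p \in [pchar k]).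
Variable X : forall e : pdeg, bicpx k e (pmul pk e).
Hypothesis X_res : forall e : pdeg, good_resolution pk (erefl (p * e)%N) (X e).
Local Notation K' := (Kp X).

Lemma Kp_qis (Y Z : KP k) (f : lmor Y Z) : qis f -> qis (fmap K' f).
Proof.
move=> qf e; have [X_fd X_proj _] := X_res e.
apply: (@hc_map_qis k e (pmul pk e) (X e) X_fd X_proj (Y (pmul pk e)) (Z (pmul pk e))
  (kch (f : khom Y Z) (pmul pk e)) (kch (Kp_map X f) e) _ (qf (pmul pk e))).
by [].
Qed.

Section theta.
Variables (Y : khat k) (e : pdeg).
Let S N m := kpath (Kp_ob X Y) e N m.
Let tv N m (u : S N m) i j : nt (X e i m) (kpath Y (pmul pk e) j) :=
  snpair ((u.1 : hc _ _ _ _) i j) (snpair ((u.2.1 : hc _ _ _ _) i j) ((u.2.2 : hc _ _ _ _) i (j - 1))).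
Let tv0 N m (u : S N m) i j : j != i + N -> tv u i j = 0.
Proof.
move=> ne; rewrite /tv !hc0 //; first exact: nt_ext.
by apply: contra ne; rewrite addrA => /eqP/addIr ->.
Qed.
(** A homotopy between two elements of the Hom complex, read as a Hom into the path object. The
    compatibility is strict, which lets homotopies pass through [K'] before any localisation. *)
Program Definition ktheta_nt N : nt (kpath (Kp_ob X Y) e N) (Kp_ob X (kpath Y) e N) :=
  @Nt k e (kpath (Kp_ob X Y) e N) (Kp_ob X (kpath Y) e N) (fun m u => HC (tv0 u)) _ _.
Next Obligation. by move=> N m c u u'; apply: hc_ext => i j; apply: nt_ext. Qed.
Next Obligation. by move=> N l m h u; apply: hc_ext => i j; apply: nt_ext. Qed.
Lemma ktheta_chain N N' m u :
  ktheta_nt N' m (cd (kpath (Kp_ob X Y) e) N N' m u) = cd (Kp_ob X (kpath Y) e) N N' m (ktheta_nt N m u).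
Proof.
move: N N' m u; apply: chomP => N m [f [g h]]; apply: hc_ext => i j; apply: nt_ext => n x.
pose HY := hom_cpx (X e) (Y (pmul pk e)).
have -> : cd (kpath (Kp_ob X Y) e) N (N + 1) m (f, (g, h)) = (cd HY N (N + 1) m f, (cd HY N (N + 1) m g,
  cid HY N (N + 1 - 1) m ((f : HY N m) - g) - cd HY (N - 1) (N + 1 - 1) m h)) by exact: pthE.
transitivity ((cd HY N (N + 1) m f : hc _ _ _ _) i j n x, ((cd HY N (N + 1) m g : hc _ _ _ _) i j n x,
  (cid HY N (N + 1 - 1) m ((f : HY N m) - g) - cd HY (N - 1) (N + 1 - 1) m h : hc _ _ _ _) i (j - 1) n x)).
  by [].
rewrite [RHS](hc_dE (F := pth (Y (pmul pk e)))) !hc_dE.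
have Ek i' j' o z : (ktheta_nt N m (f, (g, h)) : hc (X e) (pth (Y (pmul pk e))) N m) i' j' o z =
  ((f : hc _ _ _ _) i' j' o z, ((g : hc _ _ _ _) i' j' o z, (h : hc _ _ _ _) i' (j' - 1) o z)) by [].
rewrite !Ek pthE; congr (_, (_, _)).
have dh N' : N' = N - 1 + 1 -> (cd HY (N - 1) N' m h : hc _ _ _ _) i (j - 1) n x =
    cd (Y (pmul pk e)) (j - 1 - 1) (j - 1) n ((h : hc _ _ _ _) i (j - 1 - 1) n x) +
    (-1) ^ N *: (h : hc _ _ _ _) (i + 1) (j - 1) n (bd (X e) i (i + 1) m n x).
  move=> ->; rewrite hc_dE; congr (_ + _).
  by rewrite expfzDr ?oppr_eq0 ?oner_eq0 // exprN1 invrN1 mulrN1 scaleNr opprK.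
rewrite [LHS]hcB dh; last by rewrite addrK subrK.
rewrite addrK !cidxx hcB opprD addrA //.
Qed.
End theta.
Definition ktheta Y : khom (kpath (Kp_ob X Y)) (Kp_ob X (kpath Y)) :=
  kof (fun e => CHom (@ktheta_chain Y e)).
Lemma ktheta0 Y : khom_comp (Kp_map X (kpath0 Y)) (ktheta Y) = kpath0 (Kp_ob X Y).
Proof. by apply: khom_ext => e N m [f [g h]]; apply: hc_ext => i j; apply: nt_ext. Qed.
Lemma ktheta1 Y : khom_comp (Kp_map X (kpath1 Y)) (ktheta Y) = kpath1 (Kp_ob X Y).
Proof. by apply: khom_ext => e N m [f [g h]]; apply: hc_ext => i j; apply: nt_ext. Qed.
End Kprime.

(** * Compactness and sequential colimits *)

Section compactness.
Variables (k : finFieldType) (e : nat).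

Lemma eventually_all (T : eqType) (Q : T -> nat -> Prop) (s : seq T) :
  (forall x a, Q x a -> Q x a.+1) -> (forall x, exists a, Q x a) -> exists a, forall x, x \in s -> Q x a.
Proof.
move=> Qs Qe; have Qle x a b : (a <= b)%N -> Q x a -> Q x b.
  by move=> /subnK <-; elim: (b - a)%N => // c IH /IH /Qs.
elim: s => [|x s [a Ha]]; first by exists 0%N.
have [b Hb] := Qe x; exists (maxn a b) => y; rewrite inE => /predU1P [->|/Ha].
  exact: Qle (leq_maxr _ _) Hb.
exact: Qle (leq_maxl _ _).
Qed.

Section functors.
Variables (C : nat -> spf k e) (t : forall j, nt (C j) (C j.+1)).

Lemma compact_zero (P : spf k e) j (f : nt P (C j)) : fd P ->
  (forall n x, sin t j n (f n x) = 0) -> exists m, forall n x, tr t j m n (f n x) = 0.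
Proof.
move=> fP f0; have [s hs] := proj1 (fin_dimP _) (fP e).
have [|x|m Hm] := @eventually_all _ (fun (x : P e) m => tr t j m e (f e x) = 0) s.
- by move=> x m; rewrite /= => ->; rewrite nt0.
- exact: sin_zero (f0 e x).
exists m; apply: generated => [|x]; last by apply: Hm; apply: hs.
split=> [n|n n' g x E]; last by rewrite !ntP E sact0.
by split=> [|a x y E E']; rewrite ?nt0 // !nt_lin E E' scaler0 addr0.
Qed.

(** P is generated by the finite set [P e]. One stage contains the images of all its elements, so
    the map lifts on the free functor on them, of which P is a retract. *)
Lemma compact_lift (P : spf k e) (f : nt P (scolim t)) : fd P -> projective (C := Pcat k e) P ->
  exists j (g : nt P (C j)), forall n x, sin t j n (g n x) = f n x.
Proof.
move=> fP pP; have [s hs] := proj1 (fin_dimP _) (fP e).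
have [|x|j Hj] := @eventually_all _ (fun (x : P e) j => exists y, f e x = sin t j e y) s.
- by move=> x j [y ->]; exists (t j e y); rewrite sin_step.
- exact: sin_surj.
have {}Hj x : exists y, f e x = sin t j e y by apply: Hj.
pose v x := sval (boolp.cid (Hj x)); have vE x : f e x = sin t j e (v x) := svalP (boolp.cid (Hj x)).
pose q := @fsum k e (P e) (fun=> e) P id; pose u := @fsum k e (P e) (fun=> e) (C j) v.
have qs n x : exists y, q n y = x.
  move: n x; apply: generated => [|x]; last by exists (@delta k e (P e) (fun=> e) x e (gid k e e));
    rewrite fsum_delta sact1.
  split=> [n|m n g _ [y <-]]; last by exists (sact g y); rewrite ntP.
  by split=> [|a _ _ [y <-] [z <-]]; [exists 0; rewrite nt0|exists (a *: y + z); rewrite nt_lin].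
have [r Er] := projective_lift (nt_id P) pP qs.
have uq n x : sin t j n (u n x) = f n (q n x).
  rewrite [x]free_delta !nt_sum; apply: eq_bigr => i _.
  by rewrite !fsum_delta !ntP vE.
by exists j, (nt_comp u r) => n x; rewrite [LHS]uq Er.
Qed.
End functors.

Section complexes.
Variables (C : nat -> cpx k e) (t : forall j, chom (C j) (C j.+1)).
Variables (P : int -> spf k e) (B : nat).
Hypotheses (PB : forall i : int, (B < `|i|)%N -> forall n (x : P i n), x = 0) (Pfd : forall i, fd (P i)).

Lemma eventually_int (Q : int -> nat -> Prop) :
  (forall i a, Q i a -> Q i a.+1) -> (forall i, exists a, Q i a) ->
  (forall i, (B < `|i|)%N -> forall a, Q i a) -> exists a, forall i, Q i a.
Proof.
move=> Qs Qe Q0; have [a Ha] := eventually_all [seq j%:Z - B%:Z | j <- iota 0 (B + B).+1] Qs Qe.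
exists a => i; have [le|lt] := leqP `|i|%N B; last exact: Q0.
apply: Ha; apply/mapP; exists `|(i + B%:Z)%R|%N; rewrite ?mem_iota; lia.
Qed.

Lemma compact_lifts (s : int -> int) J (g : forall i, nt (P i) (ccolim t (s i))) :
  (forall i, projective (C := Pcat k e) (P i)) ->
  exists M (G : forall i, nt (P i) (C (M + J) (s i))), forall i n x, ccin t (M + J) (s i) n (G i n x)
    = g i n x.
Proof.
move=> pP.
have [|i|i lt M|M HM] := @eventually_int (fun i M => exists G : nt (P i) (C (M + J) (s i)),
  forall n x, ccin t (M + J) (s i) n (G n x) = g i n x).
- move=> i M [G EG]; exists (nt_comp (t (M + J) (s i)) G) => n x; rewrite -EG; exact: ccin_step.
- have [j [G EG]] := compact_lift (g i) (Pfd i) (pP i); exists j; rewrite addnC.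
  by exists (nt_comp (ctr t j J (s i)) G) => n x; rewrite -EG; apply: (@ccin_tr _ _ _ t j J).
- by exists 0 => n x; rewrite (PB lt x) !nt0.
by exists M, (fun i => sval (boolp.cid (HM i))) => i; exact: (svalP (boolp.cid (HM i))).
Qed.

Lemma compact_zeros (s : int -> int) J (G : forall i, nt (P i) (C J (s i))) :
  (forall i n x, ccin t J (s i) n (G i n x) = 0) ->
  exists M, forall i n x, ctr t J M (s i) n (G i n x) = 0.
Proof.
move=> G0; apply: eventually_int => [i M E n x|i|i lt M n x].
- by rewrite -[LHS]/(t _ _ n (ctr t J M (s i) n (G i n x))) E nt0.
- have [M E] := compact_zero (Pfd i) (G0 i).
  by exists M => n x; rewrite ctrE.
- by rewrite (PB lt x) !nt0.
Qed.
End complexes.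

Section maps.
Variables (C : nat -> cpx k e) (t : forall j, chom (C j) (C j.+1)) (P : cpx k e).
Hypotheses (bP : bounded P) (pP : forall i, projective (C := Pcat k e) (P i)) (fP : forall i, fd (P i)).

(** The terms lift to a common stage as P is bounded. The lifts commute with the differentials only
    in the colimit, hence also at some later stage. *)
Lemma ccolim_factor (f : chom P (ccolim t)) : exists J (g : chom P (C J)),
  forall i n x, ccin t J i n (g i n x) = f i n x.
Proof.
have [B PB] := bP; have [J0 [G EG]] := compact_lifts (s := id) PB fP 0 f pP.
set J := (J0 + 0)%N in G EG.
have [|M EM] := @compact_zeros _ t P B PB fP (fun i => i + 1) J
    (fun i => nt_comp (G (i + 1)) (cd P i (i + 1)) - nt_comp (cd (C J) i (i + 1)) (G i)).
  move=> i n x; rewrite [X in ccin _ _ _ _ X]ntEB ntB.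
  rewrite -[nt_comp (G _) _ n x]/(G (i + 1) n _) -[nt_comp (cd _ _ _) _ n x]/(cd (C J) i (i + 1) n (G i n x)).
  by rewrite chP !EG chP subrr.
have c i n x : ctr t J M (i + 1) n (G (i + 1) n (cd P i (i + 1) n x)) =
    cd (C (M + J)) i (i + 1) n (ctr t J M i n (G i n x)).
  by rewrite -chP; apply/eqP; rewrite -subr_eq0 -ntB; apply/eqP; have := EM i n x; rewrite ntEB.
exists (M + J)%N, (CHom (chomP (f := fun i => nt_comp (ctr t J M i) (G i)) c)) => i n x.
by rewrite -EG; apply: (@ccin_tr _ _ _ t J M).
Qed.

(** Two passages to later stages: one to lift the homotopy termwise, one to kill its defect [D]. *)
Lemma ccolim_homotopy J (f f' : chom P (C J)) : hmt (ccomp (ccin t J) f) (ccomp (ccin t J) f') ->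
  exists M M', hmt (ccomp (ctr t (M + J) M') (ccomp (ctr t J M) f)) (ccomp (ctr t (M + J) M') (ccomp
    (ctr t J M) f')).
Proof.
move=> [h Hh]; have [B PB] := bP.
have [M [H EH]] := compact_lifts (s := fun i => i - 1) PB fP J (fun i => h i (i - 1)) pP.
pose D i : nt (P i) (C (M + J) i) := nt_comp (ctr t J M i) (f i - f' i)
  - (nt_comp (cd (C (M + J)) (i - 1) i) (H i) + nt_comp (cid (C (M + J)) (i + 1 - 1) i) (nt_comp (H
    (i + 1)) (cd P i (i + 1)))).
have DE i n x : D i n x = ctr t J M i n (f i n x) - ctr t J M i n (f' i n x) -
  (cd (C (M + J)) (i - 1) i n (H i n x) + cid (C (M + J)) (i + 1 - 1) i n (H (i + 1) n (cd P i (i + 1) n x))).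
  rewrite [LHS]ntEB; congr (_ - _); rewrite -ntB; congr (ctr _ _ _ _ _ _); exact: ntEB.
have [|M' EM'] := @compact_zeros _ t P B PB fP id (M + J) D.
  move=> i n x; rewrite DE !ntB ntD !(@ccin_tr _ _ _ t J M) chP EH.
  rewrite (cid_nat (ccin t (M + J))) EH.
  have := @nullh_adj _ _ P (ccolim t) (fun i => ccomp (ccin t J) f i - ccomp (ccin t J) f' i) h Hh i
    n x; rewrite ntEB -[ccomp _ _ i n x]/(ccin t J i n (f i n x)).
  rewrite -[ccomp (ccin t J) f' i n x]/(ccin t J i n (f' i n x)) => ->.
  move: (h (i + 1)) => h'; by rewrite addrK cidxx subrr.
exists M, M', (fun i j => nt_comp (cid (C (M' + (M + J))) (i - 1) j) (nt_comp (ctr t (M + J) M' (i -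
  1)) (H i))) => i n x.
have := EM' (i + 1) n x; rewrite DE !ntB ntD => /eqP; rewrite subr_eq0 => /eqP E.
rewrite ntEB; apply: etrans E _; congr (_ + _).
  rewrite chP -[nt_comp _ _ n x]/(cid _ _ _ n (ctr t (M + J) M' (i + 1 - 1) n (H (i + 1) n x))).
  by move: (H (i + 1) n x); rewrite addrK => z; rewrite cidxx.
by rewrite (cid_nat (ctr t (M + J) M')).
Qed.
End maps.
End compactness.

Lemma kcompA (k : finFieldType) (Y Z V W : khat k) (h : khom V W) (g : khom Z V) (f : khom Y Z) :
  khom_comp h (khom_comp g f) = khom_comp (khom_comp h g) f.
Proof. exact: khom_ext. Qed.

Section khat_colimits.
Variables (k : finFieldType) (C : nat -> khat k) (t : forall j, khom (C j) (C j.+1)).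

Definition kcolim : khat k := fun e => ccolim (fun j => kch (t j) e).
Definition kcin j : khom (C j) kcolim := kof (fun e => ccin (fun j => kch (t j) e) j).
Fixpoint ktr j m : khom (C j) (C (m + j)) :=
  match m with 0 => khom_id (C j) | m'.+1 => khom_comp (t (m' + j)) (ktr j m') end.
Lemma ktrE j m e i n x : ktr j m e i n x = ctr (fun j => kch (t j) e) j m i n x.
Proof. by elim: m => [//|m IH]; rewrite /= IH. Qed.
Lemma kcin_step j : khom_comp (kcin j.+1) (t j) = kcin j.
Proof. by apply: khom_ext => e i n x; apply: (@ccin_step _ _ _ (fun j => kch (t j) e)). Qed.
Lemma kcin_tr j m : khom_comp (kcin (m + j)) (ktr j m) = kcin j.
Proof.
apply: khom_ext => e i n x; rewrite -[LHS]/(ccin (fun j => kch (t j) e) (m + j) i n (ktr j m e i n x)) ktrE.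
exact: ccin_tr.
Qed.
Lemma kcin_surj e i n (y : kcolim e i n) : exists j x, y = kcin j e i n x.
Proof. exact: ccin_surj. Qed.
Lemma kcin_zero j e i n (x : C j e i n) : kcin j e i n x = 0 -> exists m, ktr j m e i n x = 0.
Proof. by move=> /ccin_zero [m E]; exists m; rewrite ktrE. Qed.
Lemma kcin_trE j m e i n x : kcin (m + j) e i n (ktr j m e i n x) = kcin j e i n x.
Proof. exact: (congr1 (fun v : khom _ _ => v e i n x) (kcin_tr j m)). Qed.
Lemma kcin_stepE j e i n x : kcin j.+1 e i n (t j e i n x) = kcin j e i n x.
Proof. exact: (congr1 (fun v : khom _ _ => v e i n x) (kcin_step j)). Qed.
Lemma kcin_ge J e i n (y : kcolim e i n) : exists m x, y = kcin (m + J) e i n x.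
Proof.
by have [j [x ->]] := kcin_surj y; exists j; rewrite addnC; exists (ktr j J e i n x); rewrite kcin_trE.
Qed.
Lemma kcolim_ext Y (f g : khom kcolim Y) : (forall j, khom_comp f (kcin j) = khom_comp g (kcin j)) -> f = g.
Proof.
move=> h; apply: khom_ext => e i n y; have [j [x ->]] := kcin_surj y.
exact: (congr1 (fun u : khom _ _ => u e i n x) (h j)).
Qed.
Section lift.
Variables (Y : khat k) (f : forall j, khom (C j) Y) (ft : forall j, khom_comp (f j.+1) (t j) = f j).
Let ft' e j i n x : kch (f j.+1) e i n (kch (t j) e i n x) = kch (f j) e i n x.
Proof. exact: (congr1 (fun u : khom _ _ => u e i n x) (ft j)). Qed.
Definition kclift : khom kcolim Y := kof (fun e => cclift (@ft' e)).
Lemma kcliftE j : khom_comp kclift (kcin j) = f j.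
Proof. by apply: khom_ext => e i n x; apply: (ccliftE (@ft' e)). Qed.
End lift.

Lemma kcolim_conc d : (forall j, conc d (C j)) -> conc d kcolim.
Proof. by move=> h e ne i n y; have [j [x ->]] := kcin_surj y; rewrite (h j e ne i n x) nt0. Qed.

Section compact.
Variables (d : nat) (d_gt0 : (0 < d)%N) (P : khat k).
Hypotheses (P_conc : conc d P) (bP : forall e, bounded (P e))
  (pP : forall (e : pdeg) i, projective (C := Pcat k e) (P e i)) (fP : forall (e : pdeg) i, fd (P e i)).

Let one_degree (Q : forall e : pdeg, Prop) : Q (PDeg d_gt0) -> (forall e : pdeg, dval e != d -> Q e)
  -> forall e, Q e.
Proof.
move=> h0 h1 e; have [E|] := eqVneq (dval e) d; last exact: h1.
suff -> : e = PDeg d_gt0 by [].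
by case: e E => m m0 /= E; subst m; congr PDeg; apply: bool_irrelevance.
Qed.
Lemma kcompact_lift (f : khom P kcolim) : exists J (g : khom P (C J)), khom_comp (kcin J) g = f.
Proof.
pose e0 := PDeg d_gt0; have [J [g Eg]] := ccolim_factor (bP e0) (@pP e0) (fP e0) (kch f e0).
have H (e : pdeg) : exists g : chom (P e) (C J e), forall i n x, kcin J e i n (g i n x) = f e i n x.
  move: e; apply: one_degree => [|e ne]; first by exists g.
  by exists (czero _ _) => i n x; rewrite (P_conc ne x) !nt0.
exists J, (kof (fun e => sval (boolp.cid (H e)))); apply: khom_ext => e i n x.
exact: (svalP (boolp.cid (H e))).
Qed.

Lemma kcompact_zero J (f f' : khom P (C J)) : khmt (khom_comp (kcin J) f) (khom_comp (kcin J) f') ->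
  exists M M', khmt (khom_comp (ktr (M + J) M') (khom_comp (ktr J M) f))
    (khom_comp (ktr (M + J) M') (khom_comp (ktr J M) f')).
Proof.
move=> h; pose e0 := PDeg d_gt0.
have [|M [M' H]] := @ccolim_homotopy _ _ _ (fun j => kch (t j) e0) (P e0) (bP e0) (@pP e0) (fP e0) J
  (kch f e0) (kch f' e0).
  by apply: nullh_eq (h e0) => i n x; rewrite [LHS]khomB [RHS]ntEB.
exists M, M'; apply: one_degree => [|e ne]; last by apply: nullh0 => i n x; rewrite (P_conc ne x) nt0.
by apply: nullh_eq H => i n x; rewrite [RHS]khomB [LHS]ntEB /= !ktrE.
Qed.
End compact.
End khat_colimits.

Section colimit_maps.
Variable k : finFieldType.
Section two_towers.
Variables (C D : nat -> khat k) (t : forall j, khom (C j) (C j.+1)) (u : forall j, khom (D j) (D j.+1)).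
Variables (f : forall j, khom (C j) (D j)).
Hypothesis ft : forall j, khom_comp (f j.+1) (t j) = khom_comp (u j) (f j).
Let g j : khom (C j) (kcolim u) := khom_comp (kcin u j) (f j).
Let gt j : khom_comp (g j.+1) (t j) = g j.
Proof.
have <- : khom_comp (khom_comp (kcin u j.+1) (u j)) (f j) = g j by rewrite kcin_step.
by rewrite -kcompA -ft kcompA.
Qed.
Definition kcmap : khom (kcolim t) (kcolim u) := kclift gt.
Lemma kcmapE j : khom_comp kcmap (kcin t j) = khom_comp (kcin u j) (f j).
Proof. exact: kcliftE. Qed.
Lemma kcmap_in j e i n x : kcmap e i n (kcin t j e i n x) = kcin u j e i n (f j e i n x).
Proof. exact: (congr1 (fun v : khom _ _ => v e i n x) (kcmapE j)). Qed.
Lemma ktr_nat j m e i n x : f (m + j) e i n (ktr t j m e i n x) = ktr u j m e i n (f j e i n x).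
Proof.
elim: m => [//|m IH]; rewrite /= -IH.
exact: (congr1 (fun v : khom _ _ => v e i n (ktr t j m e i n x)) (ft (m + j))).
Qed.

Lemma kcmap_qis : (forall j, qis (f j)) -> qis kcmap.
Proof.
move=> qf e; apply/(qisP (kch kcmap e)) => i n.
have Q j := proj1 (qisP (kch (f j) e)) (qf j e) i n.
split=> [x dx [y Ey]|y dy].
  have [j0 [z0 Ez0]] := kcin_surj x; subst x.
  have [m0 dz0] := kcin_zero (etrans (@kcE k _ _ (kcin t j0) e _ _ n z0) dx).
  have E0 : kcin t j0 e (i + 1) n z0 = kcin t (m0 + j0) e (i + 1) n (ktr t j0 m0 e (i + 1) n z0) by
    rewrite kcin_trE.
  have {}Ey := etrans (esym (@kcmap_in _ _ _ _ _)) (etrans (congr1 (kcmap e (i + 1) n) (esym E0)) Ey).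
  rewrite {}E0.
  rewrite kcE in dz0; move: (m0 + j0)%N (ktr t j0 m0 e (i + 1) n z0) dz0 Ey => {dx z0 m0} j z dz Ey.
  have [m [w Ew]] := kcin_ge j y; subst y; pose z' := ktr t j m e (i + 1) n z.
  have [m' Em'] : exists m', ktr u (m + j) m' e (i + 1) n (f (m + j)%N e (i + 1) n z' - cd (D (m +
    j)%N e) i (i + 1) n w) = 0.
    by apply: kcin_zero; rewrite ntB kcE -Ey ktr_nat kcin_trE subrr.
  have [||v Ev] := proj1 (Q (m' + (m + j))%N) (ktr t (m + j) m' e (i + 1) n z').
  - by rewrite -!kcE dz !nt0.
  - exists (ktr u (m + j) m' e i n w); rewrite -[kch _ _ _ _ _]/(f (m' + (m + j))%N e _ _ _) ktr_nat -kcE.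
    by apply/eqP; rewrite -subr_eq0 -ntB; apply/eqP.
  by exists (kcin t (m' + (m + j)) e i n v); rewrite -kcE -Ev !kcin_trE.
have [j [w Ew]] := kcin_surj y; subst y.
have [m dw] := kcin_zero (etrans (@kcE k _ _ (kcin u j) e _ _ n w) dy).
rewrite -(@kcin_trE _ _ u j m);
  have [|x [z [dx Ex]]] := proj2 (Q (m + j)%N) (ktr u j m e (i + 1) n w); first by rewrite -kcE.
exists (kcin t (m + j) e (i + 1) n x), (kcin u (m + j) e i n z); rewrite -!kcE dx nt0; split=> //.
by apply: etrans (@kcmap_in _ _ _ _ _) _; rewrite -ntD -Ex.
Qed.
End two_towers.

(** Comparison with the constant tower, whose colimit is C 0. *)
Lemma kcin0_qis (C : nat -> khat k) (t : forall j, khom (C j) (C j.+1)) :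
  (forall j, qis (t j)) -> qis (kcin t 0).
Proof.
move=> qt; pose s := fix s j : khom (C 0%N) (C j) :=
  match j with 0 => khom_id _ | j'.+1 => khom_comp (t j') (s j') end.
have qs j : qis (s j).
  elim: j => [|j IH] e; first exact: (qis_id (C 0%N e)).
  exact: (@qis_comp _ _ _ _ _ (kch (t j) e) (kch (s j) e) (IH e) (qt j e)).
have st j : khom_comp (s j.+1) (khom_id (C 0%N)) = khom_comp (t j) (s j) by apply: khom_ext.
pose c := kcin (fun j => khom_id (C 0%N)) 0.
have E : khom_comp (kcmap st) c = kcin t 0 by rewrite kcmapE; apply: khom_ext.
have qc : qis c.
  move=> e; apply: (qis_bij (f := kch c e)) => i n x; last first.
    have [j [y ->]] := kcin_surj x; exists y; elim: j y => [//|j IH] y.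
    by rewrite IH; apply: (esym (@kcin_stepE k (fun=> C 0%N) (fun j => khom_id (C 0%N)) j e i n y)).
  by move=> /kcin_zero [m]; elim: m => [//|m IH] /IH.
rewrite -E => e; exact: (@qis_comp _ _ _ _ _ (kch (kcmap st) e) (kch c e) (qc e) (kcmap_qis st qs e)).
Qed.
End colimit_maps.

Section Kprime_colimits.
Variables (k : finFieldType) (p : nat) (pk : p \in [pchar k]).
Variable X : forall e : pdeg, bicpx k e (pmul pk e).
Hypothesis X_res : forall e : pdeg, good_resolution pk (erefl (p * e)%N) (X e).
Variables (C : nat -> khat k) (t : forall j, khom (C j) (C j.+1)).

Lemma Kp_colim_surj e N m (y : Kp_ob X (kcolim t) e N m) :
  exists J x, y = Kp_map X (kcin t J) e N m x.
Proof.
have [[[B PB] Xfd] Xp _] := X_res e; pose e' := pmul pk e.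
have [M [G EG]] := @compact_lifts k e' (fun j => C j e') (fun j => kch (t j) e') (fun i => X e i m) B
  (fun i lt n x => PB i lt m n x) (fun i n => Xfd i m n) (fun i => i + N) 0 (fun i => (y : hc _ _ _
    _) i (i + N)) (fun i => Xp i m).
set J := (M + 0)%N in G EG.
pose x i j : nt (X e i m) (C J e' j) := nt_comp (cid (C J e') (i + N) j) (G i).
have x0 i j : j != i + N -> x i j = 0 by move=> ne; rewrite /x cid0 1?eq_sym // nt_comp0l.
exists J, (HC x0); apply: hc_ext => i j; apply: nt_ext => n z.
rewrite -[RHS]/(kcin t J e' j n (cid (C J e') (i + N) j n (G i n z))).
have [->|ne] := eqVneq j (i + N); first by rewrite cidxx [RHS]EG.
by rewrite hc0 // cid0 1?eq_sym // !ntE0 nt0.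
Qed.

Lemma Kp_colim_zero J e N m (x : Kp_ob X (C J) e N m) :
  Kp_map X (kcin t J) e N m x = 0 -> exists M, Kp_map X (ktr t J M) e N m x = 0.
Proof.
move=> x0; have [[[B PB] Xfd] Xp _] := X_res e; pose e' := pmul pk e.
have [|M EM] := @compact_zeros k e' (fun j => C j e') (fun j => kch (t j) e') (fun i => X e i m) B
  (fun i lt n x => PB i lt m n x) (fun i n => Xfd i m n) (fun i => i + N) J (fun i => (x : hc _ _ _
    _) i (i + N)).
  by move=> i n z; apply: (congr1 (fun u : hc _ _ _ _ => u i (i + N) n z) x0).
exists M; apply: hc_ext => i j; apply: nt_ext => n z.
rewrite -[LHS]/(ktr t J M e' j n ((x : hc _ _ _ _) i j n z)) ktrE.
have [->|ne] := eqVneq j (i + N); first exact: EM.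
by rewrite hc0 // !ntE0 nt0.
Qed.
End Kprime_colimits.

(** * Spectra and their colimits *)

Section spectra.
Variables (k : finFieldType) (p : nat) (pk : p \in [pchar k]).
Variable X : forall e : pdeg, bicpx k e (pmul pk e).
Hypothesis X_res : forall e : pdeg, good_resolution pk (erefl (p * e)%N) (X e).
Variables (C' : functor (KP k) (KP k)) (adj : adjunction C' (Kp X)).
Local Notation K' := (Kp X).
Local Notation adjt := (adjoint_map adj).
Local Notation coadj := (coadjoint_map adj).
Local Notation spec := (spectrum C').
Implicit Types F G H : khat k.
Implicit Types E : spec.

Lemma KpM F G H (g : khom G H) (f : khom F G) :
  Kp_map X (khom_comp g f) = khom_comp (Kp_map X g) (Kp_map X f).
Proof. exact: (@fmapM _ _ K' F G H g f). Qed.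
Lemma Kp1 F : Kp_map X (khom_id F) = khom_id (Kp_ob X F).
Proof. exact: (@fmap1 _ _ K' F). Qed.
Lemma C'M F G H (g : khom G H) (f : khom F G) :
  (fmap C' (khom_comp g f) : khom _ _) = khom_comp (fmap C' g) (fmap C' f).
Proof. exact: (@fmapM _ _ C' F G H g f). Qed.
Lemma C'1 F : (fmap C' (khom_id F) : khom _ _) = khom_id (C' F).
Proof. exact: (@fmap1 _ _ C' F). Qed.
Lemma kcomp1m F G (f : khom F G) : khom_comp (khom_id G) f = f. Proof. exact: khom_ext. Qed.
Lemma kcompm1 F G (f : khom F G) : khom_comp f (khom_id F) = f. Proof. exact: khom_ext. Qed.

Lemma adjt_pre F F' G (f : khom (C' F) G) (a : khom F' F) :
  adjt (khom_comp f (fmap C' a)) = khom_comp (adjt f) a.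
Proof.
rewrite /adjoint_map KpM -!kcompA; congr khom_comp.
exact: esym (ntcP (adj_unit adj) a).
Qed.
Lemma adjt_post F G H (g : khom G H) (f : khom (C' F) G) :
  adjt (khom_comp g f) = khom_comp (Kp_map X g) (adjt f).
Proof. by rewrite /adjoint_map KpM kcompA. Qed.
Lemma coadjK F G (f : khom F (Kp_ob X G)) : adjt (coadj f) = f.
Proof.
rewrite /coadjoint_map adjt_pre /adjoint_map; rewrite -[RHS]kcomp1m; congr khom_comp.
exact: (adj_triangleR adj G).
Qed.
Lemma adjt_inj F G (f g : khom (C' F) G) : adjt f = adjt g -> f = g.
Proof. by move=> E; rewrite -(adjoint_mapK adj f) E adjoint_mapK. Qed.
Lemma coadj_pre F F' G (f : khom F (Kp_ob X G)) (a : khom F' F) :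
  coadj (khom_comp f a) = khom_comp (coadj f) (fmap C' a).
Proof. by apply: adjt_inj; rewrite adjt_pre !coadjK. Qed.
Lemma coadj_post F G H (g : khom G H) (f : khom F (Kp_ob X G)) :
  coadj (khom_comp (Kp_map X g) f) = khom_comp g (coadj f).
Proof. by apply: adjt_inj; rewrite adjt_post !coadjK. Qed.
Lemma coadj_lin F G c (f g : khom F (Kp_ob X G)) : coadj (c *: f + g) = c *: coadj f + coadj g.
Proof. by rewrite /coadjoint_map (C'_lin adj); exact: (@lcmp_linr _ (KP k)). Qed.

(* The isomorphism K'(path Y) = path(K'Y) makes the adjunction bijective on homotopy classes. *)
Lemma coadj_khmt F G (f g : khom F (Kp_ob X G)) : khmt f g -> khmt (coadj f) (coadj g).
Proof.
move=> /khmt_path [l [-> ->]]; apply/khmt_path; exists (coadj (khom_comp (ktheta X G) l)).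
by rewrite -!coadj_post !kcompA ktheta0 ktheta1.
Qed.
Lemma C'_khmt F G (f g : khom F G) : khmt f g -> khmt (fmap C' f : khom _ _) (fmap C' g).
Proof.
move=> /(khmt_compl (adjt (khom_id (C' G)))) /coadj_khmt.
by rewrite -!adjt_pre !adjoint_mapK !kcomp1m.
Qed.
(** A complex in a single degree [e] is extended by 0 to the other degrees; the equation [e = e']
    stays a hypothesis because the types depend on the degree. *)
Lemma khpP P : (forall A : khat k, (forall e, acyclic (A e)) -> forall g : khom P A, knull g) -> khp P.
Proof.
move=> h e A g ac.
have H (e' : pdeg) : exists Bg : {B : cpx k e' & chom (P e') B},
    acyclic (tag Bg) /\ (e = e' -> nullh (tagged Bg) -> nullh g).
  have [E|ne] := pselect (e = e'); first by subst e'; exists (existT _ A g).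
  by exists (existT _ (cpx0 k e') (czero _ _)); split=> // i n x _; exists 0; apply: spf0_eq.
pose B e' := tag (sval (boolp.cid (H e'))).
apply: (proj2 (svalP (boolp.cid (H e))) erefl).
apply: (h B _ (kof (fun e' => tagged (sval (boolp.cid (H e')))))) => e'.
exact: (proj1 (svalP (boolp.cid (H e')))).
Qed.
Lemma Kp_acyclic (A : khat k) : (forall e, acyclic (A e)) -> forall e, acyclic (Kp_ob X A e).
Proof.
move=> ac e; pose Z : khat k := fun e => cpx0 k e; pose z : khom Z A := kof (fun e => czero _ _).
have qz : qis z.
  move=> e'; apply/(qisP (kch z e')) => i n; split=> [x _ _|y dy]; first by exists 0; apply: spf0_eq.
  have [w ->] := ac e' i n y dy; exists 0, (- w); rewrite !nt0; split=> //.
  by rewrite ntN subrr.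
move=> i n y dy; have [_ /(_ y dy) [x [w [_]]]] := proj1 (qisP (kch (Kp_map X z) e)) (Kp_qis X_res qz e) i n.
rewrite (_ : kch _ _ _ _ _ = 0) => [/eqP|]; last by apply: hc_ext => a b; apply: nt_ext.
by rewrite eq_sym addr_eq0 => /eqP ->; exists (- w); rewrite ntN.
Qed.
(** A map from C'P to an acyclic A is adjoint to a map from P to [K'] A, which is again acyclic, and
    a null homotopy of the latter carries over. *)
Lemma C'_khp P : khp P -> khp (C' P).
Proof.
move=> hP; apply: khpP => A ac g; have := coadj_khmt (f := adjt g) (g := 0).
have -> : coadj (0 : khom P (Kp_ob X A)) = 0 by rewrite /coadjoint_map (C'_0 adj) khom_comp0r.
rewrite adjoint_mapK /khmt !subr0; apply=> e.
by apply: (@hP e _ (kch (adjt g) e)); apply: Kp_acyclic.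
Qed.

Definition shs E : spec := Spectrum (slev := fun j => E j.+1) (fun j => stau E j.+1).
Definition shm E E' (f : smor E E') : smor (shs E) (shs E') :=
  @SMor _ _ (shs E) (shs E') (fun j => f j.+1) (fun j => Defs.smP f j.+1).

Lemma adjt_stau E E' (f : smor E E') i :
  khom_comp (Kp_map X (f i.+1)) (adjt (stau E i)) = khom_comp (adjt (stau E' i)) (f i).
Proof. by rewrite -adjt_post Defs.smP adjt_pre. Qed.

(** With [K'] iterated on the left, the transition maps are given by recursion on the spectrum with
    its level 0 dropped. The statement iterates on the right; [rho] compares the two. *)
Fixpoint tl j E : khom (fiterl K' j (E j)) (fiterl K' j.+1 (E j.+1)) :=
  match j return khom (fiterl K' j (E j)) (fiterl K' j.+1 (E j.+1)) with
  | 0 => adjt (stau E 0)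
  | j'.+1 => Kp_map X (tl j' (shs E))
  end.
Definition LL E : khat k := kcolim (fun j => tl j E).
Definition LLin j E : khom (fiterl K' j (E j)) (LL E) := kcin (fun j => tl j E) j.
Lemma LLin_step j E : khom_comp (LLin j.+1 E) (tl j E) = LLin j E.
Proof. exact: kcin_step. Qed.

Lemma LLin_stepE j E e i n x : LLin j.+1 E e i n (tl j E e i n x) = LLin j E e i n x.
Proof. exact: (congr1 (fun u : khom _ _ => u e i n x) (LLin_step j E)). Qed.

Definition fitm j F G (f : khom F G) : khom (fiterl K' j F) (fiterl K' j G) := fmap (fiterl K' j) f.
Lemma fitm_comp j F G H (g : khom G H) (f : khom F G) : fitm j (khom_comp g f) = khom_comp (fitm j g)
  (fitm j f).
Proof. exact: (@fmapM _ _ (fiterl K' j) F G H g f). Qed.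
Lemma fitm1 j F : fitm j (khom_id F) = khom_id (fiterl K' j F).
Proof. exact: (@fmap1 _ _ (fiterl K' j) F). Qed.
Lemma fitmS j F G (f : khom F G) : fitm j.+1 f = Kp_map X (fitm j f). Proof. by []. Qed.
Lemma fitm_lin j F G c (f g : khom F G) : fitm j (c *: f + g) = c *: fitm j f + fitm j g.
Proof. by elim: j => [//|j IH]; rewrite !fitmS IH Kp_lin. Qed.
Lemma fitm_qis j F G (f : khom F G) : qis f -> qis (fitm j f).
Proof. by move=> qf; elim: j => [//|j IH]; exact: (Kp_qis X_res IH). Qed.

Lemma tl_nat j E E' (f : smor E E') : khom_comp (fitm j.+1 (f j.+1)) (tl j E) = khom_comp (tl j E')
  (fitm j (f j)).
Proof.
elim: j E E' f => [|j IH] E E' f; first exact: adjt_stau.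
by have /(congr1 (@Kp_map _ _ _ X _ _)) := IH _ _ (shm f); rewrite !KpM.
Qed.
Definition LLmap E E' (f : smor E E') : khom (LL E) (LL E') := kcmap (fun j => tl_nat j f).
Lemma LLmap_in E E' (f : smor E E') j : khom_comp (LLmap f) (LLin j E) = khom_comp (LLin j E') (fitm j (f j)).
Proof. exact: kcmapE. Qed.
Lemma LLmap1 E : LLmap (smor_id E) = khom_id (LL E).
Proof. by apply: kcolim_ext => j; rewrite [LHS]LLmap_in fitm1 kcompm1 kcomp1m. Qed.
Lemma LLmapM E E' E'' (g : smor E' E'') (f : smor E E') :
  LLmap (smor_comp g f) = khom_comp (LLmap g) (LLmap f).
Proof.
apply: kcolim_ext => j; rewrite [LHS]LLmap_in -kcompA -[kcin _ j]/(LLin j E) LLmap_in.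
by rewrite kcompA LLmap_in -kcompA -fitm_comp.
Qed.
Lemma LLmap_lin E E' c (f g : lmor (l := Spectra adj) E E') :
  LLmap (c *: f + g : lmor _ _) = c *: LLmap f + LLmap g.
Proof.
apply: kcolim_ext => j; rewrite [LHS]LLmap_in fitm_lin.
rewrite khom_compDr khom_compZr -!LLmap_in -khom_compZl -khom_compDl //.
Qed.
Lemma LLmap_qis E E' (f : smor E E') : (forall i, qis (f i)) -> qis (LLmap f).
Proof. by move=> qf; apply: kcmap_qis => j; apply: fitm_qis. Qed.

Definition sigma_at j E : khom (fiterl K' j (E j)) (Kp_ob X (LL (shs E))) :=
  khom_comp (Kp_map X (LLin j (shs E))) (tl j E).
Lemma sigma_step j E : khom_comp (sigma_at j.+1 E) (tl j E) = sigma_at j E.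
Proof. by rewrite /sigma_at -(KpM _ (tl j (shs E))) LLin_step. Qed.
Definition sigma E : khom (LL E) (Kp_ob X (LL (shs E))) := kclift (sigma_step^~ E).
Lemma sigma_in E j : khom_comp (sigma E) (LLin j E) = sigma_at j E.
Proof. exact: kcliftE. Qed.
Lemma sigmaS E j : khom_comp (sigma E) (LLin j.+1 E) = Kp_map X (LLin j (shs E)).
Proof. by rewrite sigma_in /sigma_at -(KpM _ (tl j (shs E))) LLin_step. Qed.
Lemma sigma_nat E E' (f : smor E E') :
  khom_comp (Kp_map X (LLmap (shm f))) (sigma E) = khom_comp (sigma E') (LLmap f).
Proof.
apply: kcolim_ext => j; rewrite -!kcompA -[kcin _ j]/(LLin j E) sigma_in LLmap_in kcompA sigma_in.
by rewrite /sigma_at kcompA -KpM LLmap_in KpM -!kcompA -(tl_nat j f).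
Qed.
(** [K'] commutes with the colimit, and a tower without its first stage has the same colimit. *)
Lemma sigma_qis E : qis (sigma E).
Proof.
move=> e; apply: (qis_bij (f := kch (sigma E) e)) => i n y; last first.
  have [j [x ->]] := Kp_colim_surj X_res y; exists (LLin j.+1 E e i n x).
  exact: (congr1 (fun u : khom _ _ => u e i n x) (sigmaS E j)).
have [j [x ->]] := kcin_surj y; rewrite -[kcin _ j e i n x]LLin_stepE; set z := tl j E e i n x => E0.
have {}E0 : Kp_map X (kcin (fun j => tl j (shs E)) j) e i n z = 0.
  by rewrite -E0; apply: esym; exact: (congr1 (fun u : khom _ _ => u e i n z) (sigmaS E j)).
have [M EM] := Kp_colim_zero X_res E0.
suff <- : LLin (M + j).+1 E e i n (Kp_map X (ktr (fun j => tl j (shs E)) j M) e i n z) = LLin j.+1 E e i n z.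
  by rewrite EM nt0.
elim: M {EM} => [|M IH]; first by rewrite Kp1.
rewrite -IH -[in RHS](LLin_step (M + j).+1 E) -[tl _ E]/(Kp_map X (tl (M + j) (shs E))).
by rewrite -[ktr _ j M.+1]/(khom_comp (tl (M + j) (shs E)) (ktr (fun j => tl j (shs E)) j M)) KpM.
Qed.

Fixpoint Linf i E : khat k := match i with 0 => LL E | i'.+1 => Linf i' (shs E) end.
Fixpoint sinf i E : khom (Linf i E) (Kp_ob X (Linf i.+1 E)) :=
  match i return khom (Linf i E) (Kp_ob X (Linf i.+1 E)) with 0 => sigma E | i'.+1 => sinf i' (shs E) end.
Fixpoint eta_lev i E : khom (E i) (Linf i E) :=
  match i return khom (E i) (Linf i E) with 0 => LLin 0 E | i'.+1 => eta_lev i' (shs E) end.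
Fixpoint Linfmap i E E' (f : smor E E') : khom (Linf i E) (Linf i E') :=
  match i return khom (Linf i E) (Linf i E') with 0 => LLmap f | i'.+1 => Linfmap i' (shm f) end.

(* A fibrant replacement: G^oo_i is the colimit of K'^j G_(i+j). *)
Definition Ginf E : spec := Spectrum (slev := Linf^~ E) (fun i => coadj (sinf i E)).
Lemma sinf_nat i E E' (f : smor E E') :
  khom_comp (Kp_map X (Linfmap i.+1 f)) (sinf i E) = khom_comp (sinf i E') (Linfmap i f).
Proof. by elim: i E E' f => [|i IH] E E' f; [exact: sigma_nat|exact: (IH _ _ (shm f))]. Qed.
Lemma Ginfmap_proof E E' (f : smor E E') i :
  khom_comp (Linfmap i.+1 f) (stau (Ginf E) i) = khom_comp (stau (Ginf E') i) (fmap C' (Linfmap i f)).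
Proof. by rewrite /= -coadj_post sinf_nat coadj_pre. Qed.
Definition Ginfmap E E' (f : smor E E') : smor (Ginf E) (Ginf E') :=
  @SMor _ _ (Ginf E) (Ginf E') (fun i => Linfmap i f) (Ginfmap_proof f).
Lemma eta_sinf i E : khom_comp (Kp_map X (eta_lev i.+1 E)) (adjt (stau E i)) = khom_comp (sinf i E)
  (eta_lev i E).
Proof. by elim: i E => [|i IH] E; [exact: esym (sigma_in E 0)|exact: (IH (shs E))]. Qed.
Lemma eta_proof E i : khom_comp (eta_lev i.+1 E) (stau E i) = khom_comp (stau (Ginf E) i) (fmap C'
  (eta_lev i E)).
Proof. by apply: adjt_inj; rewrite adjt_post adjt_pre coadjK eta_sinf. Qed.
Definition eta E : smor E (Ginf E) := @SMor _ _ E (Ginf E) (fun i => eta_lev i E) (eta_proof E).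

Lemma eta_lev_nat i E E' (f : smor E E') : khom_comp (Linfmap i f) (eta_lev i E) = khom_comp (eta_lev
  i E') (f i).
Proof. by elim: i E E' f => [|i IH] E E' f; [exact: (LLmap_in f 0)|exact: (IH _ _ (shm f))]. Qed.
Lemma eta_nat E E' (f : smor E E') : smor_comp (Ginfmap f) (eta E) = smor_comp (eta E') f.
Proof. by apply: smor_ext => i; exact: eta_lev_nat. Qed.
Lemma Linfmap1 i E : Linfmap i (smor_id E) = khom_id (Linf i E).
Proof.
elim: i E => [|i IH] E; first exact: LLmap1.
by rewrite -[RHS](IH (shs E)) /=; congr Linfmap; apply: smor_ext.
Qed.
Lemma LinfmapM i E E' E'' (g : smor E' E'') (f : smor E E') :
  Linfmap i (smor_comp g f) = khom_comp (Linfmap i g) (Linfmap i f).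
Proof.
elim: i E E' E'' g f => [|i IH] E E' E'' g f; first exact: LLmapM.
by rewrite -[RHS]IH /=; congr Linfmap; apply: smor_ext.
Qed.
Lemma Linfmap_qis i E E' (f : smor E E') : (forall j, qis (f j)) -> qis (Linfmap i f).
Proof. by elim: i E E' f => [|i IH] E E' f h; [exact: LLmap_qis|apply: (IH _ _ (shm f)) => j; apply: h]. Qed.

Definition Ginf_fun : functor (Spectra adj) (Spectra adj) :=
  @Functor (Spectra adj) (Spectra adj) Ginf (fun E E' f => Ginfmap f)
    (fun E => smor_ext (f := Ginfmap (smor_id E)) (g := smor_id (Ginf E)) (Linfmap1^~ E))
    (fun E E' E'' g f => smor_ext (f := Ginfmap (smor_comp g f)) (g := smor_comp (Ginfmap g) (Ginfmap f))
       (fun i => LinfmapM i g f)).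

Local Notation lvl := (@level_we _ _ _ _ _ adj).
Local Notation lloc := (loc lvl).
Local Notation smorS E E' := (lmor (l := Spectra adj) E E').

Lemma Ginf_level E E' (f : smorS E E') : lvl f -> lvl (fmap Ginf_fun f).
Proof. by move=> h i; apply: Linfmap_qis. Qed.
Lemma Ginf_omega E : omega_spectrum adj (Ginf E).
Proof. by move=> i; rewrite /= coadjK; elim: i E => [|i IH] E; [exact: sigma_qis|exact: (IH (shs E))]. Qed.
Lemma LLin0_qis E : omega_spectrum adj E -> qis (LLin 0 E).
Proof.
move=> oE; apply: (@kcin0_qis k (fun j => fiterl K' j (E j)) (fun j => tl j E)) => j.
elim: j E oE => [|j IH] E oE; first exact: (oE 0%N).
by apply: (Kp_qis X_res); apply: (IH (shs E)) => i; apply: oE.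
Qed.
Lemma eta_level E : omega_spectrum adj E -> lvl (eta E : smorS E (Ginf E)).
Proof.
move=> oE i; elim: i E oE => [|i IH] E oE; first exact: LLin0_qis.
by apply: (IH (shs E)) => j; apply: oE.
Qed.

Fixpoint sj j E : khom (E 0%N) (fiterl K' j (E j)) :=
  match j return khom (E 0%N) (fiterl K' j (E j)) with
  | 0 => khom_id (E 0%N)
  | j'.+1 => khom_comp (tl j' E) (sj j' E)
  end.
Lemma sj_in j E : khom_comp (LLin j E) (sj j E) = LLin 0 E.
Proof. by elim: j => [|j IH]; rewrite ?kcompm1 //= kcompA LLin_step. Qed.
Lemma sjS j E : sj j.+1 E = khom_comp (Kp_map X (sj j (shs E))) (adjt (stau E 0)).
Proof.
elim: j => [|j IH]; first by rewrite /= Kp1 kcompm1 kcomp1m.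
by rewrite -[LHS]/(khom_comp (tl j.+1 E) (sj j.+1 E)) IH kcompA -(KpM (tl j (shs E))).
Qed.
Lemma sj_eta j E : khom_comp (sj j (Ginf E)) (LLin j E) = fitm j (eta_lev j E).
Proof.
elim: j E => [|j IH] E; first by rewrite kcomp1m.
rewrite sjS -kcompA; rewrite [adjt _]coadjK sigmaS -[Kp_map X (sj j _)]/(Kp_map X (sj j (Ginf (shs E)))).
by rewrite -KpM; exact: (congr1 (fun u => Kp_map X u) (IH (shs E))).
Qed.
(** At level 0 the replacement of [eta E] equals [eta] of the replacement. The latter is a
    quasi-isomorphism since the replacement is an Omega-spectrum, and this is what makes [eta] a
    stable equivalence. *)
Lemma LL_eta E : LLmap (eta E) = LLin 0 (Ginf E).
Proof. by apply: kcolim_ext => j; rewrite [LHS]LLmap_in -(sj_in j) -kcompA -sj_eta. Qed.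
Lemma Linf_eta i E : qis (Linfmap i (eta E)).
Proof.
elim: i E => [|i IH] E; first by have := LLin0_qis (Ginf_omega E); rewrite -LL_eta.
by rewrite /= (_ : shm (eta E) = eta (shs E)) //; apply: smor_ext.
Qed.

Definition RGinf : functor (Loc lvl) (Loc lvl) := Loc_map (F := Ginf_fun) Ginf_level.
Lemma RGinfE E E' (f : smorS E E') : fmap RGinf (fmap lloc f) = fmap lloc (fmap Ginf_fun f).
Proof. exact: Loc_mapE. Qed.
Lemma Leta_nat E E' (h : mor (c := Loc lvl) E E') :
  fmap lloc (eta E' : smorS E' (Ginf E')) \oc h = fmap RGinf h \oc fmap lloc (eta E : smorS E (Ginf E)).
Proof.
apply: (@Loc_natural _ lvl (Loc lvl) (fid _) RGinf (fun E => fmap lloc (eta E : smorS E (Ginf E))))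
  => {E E' h} E E' f.
rewrite [fmap RGinf _]RGinfE -[fmap (fid _) _]/(fmap lloc f).
rewrite -!(fmapM lloc); exact: (congr1 (fun u : smorS E (Ginf E') => fmap lloc u) (esym (eta_nat f))).
Qed.
(** For an Omega-spectrum Z the map [eta Z] is a level equivalence, so a map into Z is recovered
    from its replacement, and that from its restriction along [eta E]. *)
Lemma eta_stable E : stable_we (eta E : smorS E (Ginf E)).
Proof.
move=> Z oZ; have iZ := loc_iso (W := lvl) (eta_level oZ); apply: bij_of_inj_surj => [h h' Eh|g].
  apply: (iso_mono iZ); rewrite !Leta_nat; congr (_ \oc _).
  have /loc_iso iE : lvl (fmap Ginf_fun (eta E : smorS E (Ginf E))) by move=> i; exact: Linf_eta.
  apply: (iso_epi iE); by rewrite -RGinfE -!(fmapM RGinf) Eh.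
exists (iinv iZ \oc fmap RGinf g).
by rewrite -compA -Leta_nat compA iinvl comp1m.
Qed.
(** A Whitehead argument: the replacement of [f] induces bijections on maps into Omega-spectra, and
    its own source and target are such. *)
Lemma Ginf_stable E E' (f : smorS E E') : stable_we f -> is_iso (fmap lloc (Ginfmap f : smorS _ _)).
Proof.
move=> sf; have N : fmap lloc (Ginfmap f : smorS _ _) \oc fmap lloc (eta E : smorS _ _) =
    fmap lloc (eta E' : smorS _ _) \oc fmap lloc f.
  by rewrite -!fmapM; congr (fmap _ _); exact: eta_nat.
have inj Z : omega_spectrum adj Z -> injective (fun h : mor (c := Loc lvl) (Ginf E') Z => h \oc fmap
  lloc (Ginfmap f : smorS _ _)).
  move=> oZ h h' Eh0; have {Eh0} Eh : h \oc _ = h' \oc _ := Eh0; apply: (bij_inj (eta_stable E' oZ));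
    apply: (bij_inj (sf Z oZ)).
  by rewrite -!compA -!N !compA Eh.
have [u _ uK] := sf _ (Ginf_omega E); have [v _ vK] := eta_stable E' (Ginf_omega E).
pose w := v (u (fmap lloc (eta E : smorS _ _))).
have wf : w \oc fmap lloc (Ginfmap f : smorS _ _) = idm _.
  apply: (bij_inj (eta_stable E (Ginf_omega E))).
  by rewrite -compA N compA [w \oc _]vK [LHS]uK comp1m.
exists w; split=> //; apply: (inj _ (Ginf_omega E')).
by rewrite -compA wf compm1 comp1m.
Qed.

Definition ev0 : functor (Spectra adj) (KP k) :=
  @Functor (Spectra adj) (KP k) (fun E => E 0%N) (fun E E' f => smv f 0%N) (fun _ => erefl) (fun _ _
    _ _ _ => erefl).
Lemma LL_stable E E' (f : smorS E E') : stable_we f -> is_iso (fmap (loc (@qis k)) (LLmap f : lmor (l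
  := KP k) _ _)).
Proof.
move=> /Ginf_stable /(fmap_iso (Loc_map (F := ev0) (fun E E' f (h : lvl f) => h 0%N))).
by rewrite Loc_mapE.
Qed.
End spectra.

Section path_maps.
Variable k : finFieldType.
Section pth_map.
Variables (e : nat) (A B : cpx k e) (f : chom A B).
Let m i : nt (pth A i) (pth B i) := snpair (nt_comp (f i) (sfst _ _))
  (snpair (nt_comp (f i) (nt_comp (sfst _ _) (ssnd _ _))) (nt_comp (f (i - 1)) (nt_comp (ssnd _ _)
    (ssnd _ _)))).
Let mE i n x y z : m i n (x, (y, z)) = (f i n x, (f i n y, f (i - 1) n z)). Proof. by []. Qed.
Let mP i j n x : m j n (cd (pth A) i j n x) = cd (pth B) i j n (m i n x).
Proof. by case: x => x [y z]; rewrite pthE !mE pthE !chP ntB cid_nat !chP ntB. Qed.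
Definition pth_map : chom (pth A) (pth B) := CHom mP.
End pth_map.
Definition kpath_map (F G : khat k) (f : khom F G) : khom (kpath F) (kpath G) := kof (fun e =>
  pth_map (kch f e)).
Lemma kpath_map0 F G (f : khom F G) : khom_comp (kpath0 G) (kpath_map f) = khom_comp f (kpath0 F).
Proof. exact: khom_ext. Qed.
Lemma kpath_map1 F G (f : khom F G) : khom_comp (kpath1 G) (kpath_map f) = khom_comp f (kpath1 F).
Proof. exact: khom_ext. Qed.
Lemma kpath_map_diag F G (f : khom F G) : khom_comp (kpath_map f) (kdiag F) = khom_comp (kdiag G) f.
Proof. by apply: khom_ext => e i n x; congr (_, (_, _)); exact: nt0. Qed.
End path_maps.

(** * Maps out of a suspension spectrum *)

Section stable_category.
Variables (k : finFieldType) (p : nat) (pk : p \in [pchar k]).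
Variable X : forall e : pdeg, bicpx k e (pmul pk e).
Hypothesis X_res : forall e : pdeg, good_resolution pk (erefl (p * e)%N) (X e).
Variables (C' : functor (KP k) (KP k)) (adj : adjunction C' (Kp X)).
Local Notation K' := (Kp X).
Local Notation adjt := (adjoint_map adj).
Local Notation coadj := (coadjoint_map adj).
Local Notation spec := (spectrum C').

Section hat.
Variables (P : khat k) (E : spec).
(** The structure maps of a suspension spectrum are identities, so a map out of it is determined by
    level 0. *)
Lemma Cinf_ext (f g : smor (Cinf_ob C' P) E) : f 0%N = g 0%N -> f = g.
Proof.
move=> E0; apply: smor_ext; elim=> [//|i IH].
by have := Defs.smP f i; rewrite IH -(Defs.smP g i) => /(congr1 (fun u : khom _ _ => u)); rewrite !kcompm1.
Qed.
Fixpoint hat_lev (a : khom P (E 0%N)) i : khom (fiterl C' i P) (E i) :=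
  match i return khom (fiterl C' i P) (E i) with
  | 0 => a
  | i'.+1 => khom_comp (stau E i') (fmap C' (hat_lev a i'))
  end.
Definition hat (a : khom P (E 0%N)) : smor (Cinf_ob C' P) E :=
  @SMor _ _ (Cinf_ob C' P) E (hat_lev a) (fun i => kcompm1 (hat_lev a i.+1)).
End hat.

Lemma ktheta_diag (Y : khat k) : khom_comp (ktheta X Y) (kdiag (Kp_ob X Y)) = Kp_map X (kdiag Y).
Proof. by apply: khom_ext => e N m f; apply: hc_ext => i j; apply: nt_ext. Qed.

Section path_spectrum.
Variable E : spec.
Let tau i : khom (C' (kpath (E i))) (kpath (E i.+1)) :=
  coadj (khom_comp (ktheta X (E i.+1)) (kpath_map (adjt (stau E i)))).
Definition spath : spec := Spectrum (slev := fun i => kpath (E i)) tau.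
Lemma spath0_proof i : khom_comp (kpath0 (E i.+1)) (tau i) = khom_comp (stau E i) (fmap C' (kpath0 (E i))).
Proof. by apply: (adjt_inj (adj := adj)); rewrite adjt_post adjt_pre coadjK kcompA ktheta0 kpath_map0. Qed.
Lemma spath1_proof i : khom_comp (kpath1 (E i.+1)) (tau i) = khom_comp (stau E i) (fmap C' (kpath1 (E i))).
Proof. by apply: (adjt_inj (adj := adj)); rewrite adjt_post adjt_pre coadjK kcompA ktheta1 kpath_map1. Qed.
Lemma sdiag_proof i : khom_comp (kdiag (E i.+1)) (stau E i) = khom_comp (tau i) (fmap C' (kdiag (E i))).
Proof.
apply: (adjt_inj (adj := adj)); rewrite adjt_post adjt_pre coadjK -kcompA kpath_map_diag kcompA.
by rewrite ktheta_diag.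
Qed.
Definition spath0 : smor spath E := @SMor _ _ spath E (fun i => kpath0 (E i)) spath0_proof.
Definition spath1 : smor spath E := @SMor _ _ spath E (fun i => kpath1 (E i)) spath1_proof.
Definition sdiag : smor E spath := @SMor _ _ E spath (fun i => kdiag (E i)) sdiag_proof.
End path_spectrum.

Lemma level_stable (E E' : Spectra adj) (f : lmor E E') : level_we f -> stable_we f.
Proof.
move=> /(loc_iso (W := @level_we _ _ _ _ _ adj)) h Z _; exists (fun g => g \oc iinv h) => g.
  by rewrite -compA iinvr compm1.
by rewrite -compA iinvl compm1.
Qed.

Lemma fiterl_conc j d (F : khat k) : conc (d * p ^ j) F -> conc d (fiterl K' j F).
Proof.
elim: j d => [|j IH] d h; first by rewrite muln1 in h.
by apply: conc_Kp; apply: IH; rewrite -mulnA mulnCA -expnS.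
Qed.
Lemma LL_conc d (E : spec) : inSPd p d E -> conc d (LL adj E).
Proof. by move=> h; apply: kcolim_conc => j; apply: fiterl_conc; apply: h. Qed.
Lemma Linf_conc i d (E : spec) : inSPd p d E -> conc (d * p ^ i) (Linf adj i E).
Proof.
elim: i d E => [|i IH] d E h; first by rewrite muln1; exact: LL_conc.
have -> : (d * p ^ i.+1 = p * d * p ^ i)%N by rewrite expnS mulnCA mulnA.
apply: (IH _ (shs E)) => j; have -> : (p * d * p ^ j = d * p ^ j.+1)%N by rewrite expnS mulnCA mulnA.
exact: h.
Qed.

Section degree.
Hypothesis C'_deg : forall (e : nat) (F : khat k), conc e F -> conc (p * e) (C' F).
Variable d : nat.
Local Notation dloc := (locKP k d).
Local Notation sloc := (locSP adj d).
Local Notation CI := (Cinf adj C'_deg d).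

Definition LLd (G : SPd adj d) : KPd k d := exist _ (LL adj (sval G)) (LL_conc (svalP G)).
Definition LLd_fun : functor (SPd adj d) (KPd k d) :=
  @Functor (SPd adj d) (KPd k d) LLd (fun G G' g => LLmap adj g)
    (fun G => LLmap1 adj (sval G)) (fun G G' G'' g f => LLmapM adj g f).
Lemma LLd_stable (G G' : SPd adj d) (g : lmor G G') : stable_d g -> is_iso (fmap (fcomp dloc LLd_fun) g).
Proof. by move=> sg; apply: dincl_iso; rewrite dinclE; exact: (LL_stable X_res sg). Qed.
Definition Rbar : functor (DSP adj d) (DP k d) := @Loc_ext (SPd adj d) (@stable_d _ _ _ _ _ adj d)
  (DP k d) (fcomp dloc LLd_fun) LLd_stable.
Lemma RbarE (G G' : SPd adj d) (g : lmor G G') : fmap Rbar (fmap sloc g) = fmap dloc (LLmap adj g :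
  lmor (LLd G) (LLd G')).
Proof. exact: Loc_extE. Qed.

(** A homotopy at level 0 extends to a map of spectra into the path spectrum, whose projections
    agree in the stable category. *)
Lemma hat_khmt (P : KPd k d) (G : SPd adj d) (a b : khom (sval P) (sval G 0%N)) : khmt a b ->
  fmap sloc (hat a : lmor (CI P) G) = fmap sloc (hat b : lmor (CI P) G).
Proof.
move=> /khmt_path [l [-> ->]]; pose PG : SPd adj d := exist (inSPd p d) (spath (sval G)) (fun i =>
  conc_path (svalP G i)).
pose s0 : lmor PG G := spath0 (sval G); pose s1 : lmor PG G := spath1 (sval G);
  pose dg : lmor G PG := sdiag (sval G).
have E : fmap sloc s0 = fmap sloc s1.
  have sd : stable_d dg by apply: level_stable => i; exact: kdiag_qis.
  apply: (iso_epi (loc_iso sd)); rewrite -!(fmapM sloc).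
  apply: (congr1 (fun u : lmor G G => fmap sloc u)); apply: smor_ext => i.
  exact: etrans (kpath0_diag _) (esym (kpath1_diag _)).
have H (s : smor (spath (sval G)) (sval G)) : fmap sloc (hat (khom_comp (s 0%N) l) : lmor (CI P) G) =
  fmap sloc (s : lmor PG G) \oc fmap sloc (@hat (sval P) (sval PG) l : lmor (CI P) PG).
  by rewrite -(fmapM sloc); congr (fmap sloc _); exact: Cinf_ext.
by rewrite (H s0) (H s1) E.
Qed.

Definition Gd (G : SPd adj d) : SPd adj d := exist (inSPd p d) (Ginf adj (sval G)) (fun i =>
  @Linf_conc i d (sval G) (svalP G)).
Definition etad (G : SPd adj d) : lmor G (Gd G) := eta adj (sval G).
Lemma etad_iso G : is_iso (fmap sloc (etad G)).
Proof. by apply: loc_iso; exact: (eta_stable X_res). Qed.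

Section represent.
Variable P : KPd k d.
Hypothesis hP : khp (sval P).
Definition in0 : lmor P (LLd (CI P)) := LLin adj 0 (sval (CI P)).
Definition Nmap (G : SPd adj d) (h : mor (c := DSP adj d) (CI P) G) : mor (c := DP k d) P (LLd G) :=
  fmap Rbar h \oc fmap dloc in0.
Definition hatL (G : SPd adj d) (a : lmor P (LLd G)) : lmor (CI P) (Gd G) := @hat (sval P) (sval (Gd G)) a.
(** L(G) is level 0 of the fibrant replacement, so a strict representative extends to a map of
    spectra into it, after which the replacement map is inverted. The choice of representative is
    harmless by [hat_khmt]. *)
Definition Mmap (G : SPd adj d) (b : mor (c := DP k d) P (LLd G)) : mor (c := DSP adj d) (CI P) G :=
  iinv (etad_iso G) \oc fmap sloc (hatL (sval (boolp.cid (dstrict hP b)))).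
Lemma etad_Mmap (G : SPd adj d) (a : lmor P (LLd G)) :
  fmap sloc (etad G) \oc Mmap (fmap dloc a) = fmap sloc (hatL a).
Proof.
rewrite compA iinvr comp1m; apply: (hat_khmt (G := Gd G)).
apply: (proj1 (dstrict_eq hP (Y := LLd G) _ a)).
exact: esym (svalP (boolp.cid (dstrict hP (fmap dloc a)))).
Qed.
(** After composition with the replacement map the claim is [LL_eta]. *)
Lemma Nmap_Mmap G b : Nmap (Mmap b) = b :> mor (c := DP k d) P (LLd G).
Proof.
have [a ->] := dstrict hP b; apply: (iso_mono (fmap_iso Rbar (etad_iso G))).
rewrite compA -(fmapM Rbar) etad_Mmap !RbarE -!(fmapM dloc); congr (fmap dloc _).
exact: (etrans (LLmap_in adj (hatL a) 0) (esym (congr1 (fun u => khom_comp u a) (LL_eta adj (sval G))))).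
Qed.
(** For a strict map this is the naturality of [eta]; a formal inverse is treated by cancelling the
    stable equivalence. *)
Lemma Mmap_nat (G G' : SPd adj d) (h : mor (c := DSP adj d) G G') b : Mmap (fmap Rbar h \oc b) = h \oc Mmap b.
Proof.
have strict (A B : SPd adj d) (g : lmor A B) c : Mmap (fmap Rbar (fmap sloc g) \oc c) = fmap sloc g
  \oc Mmap c.
  have [a ->] := dstrict hP c; apply: (iso_mono (etad_iso B)).
  rewrite RbarE -(fmapM dloc) etad_Mmap compA.
  have -> : fmap sloc (etad B) \oc fmap sloc g = fmap sloc (Ginfmap adj g : lmor (Gd A) (Gd B)) \oc
    fmap sloc (etad A).
    by rewrite -!(fmapM sloc); congr (fmap sloc _); exact: esym (eta_nat adj g).
  rewrite -compA etad_Mmap -(fmapM sloc); congr (fmap sloc _); exact: Cinf_ext.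
move: G G' h b; apply: (@Loc_ind _ (@stable_d _ _ _ _ _ adj d) (fun A B h => forall b, Mmap (fmap
  Rbar h \oc b) = h \oc Mmap b)).
- by move=> A b; rewrite fmap1 !comp1m.
- by move=> A B D f g IH b; rewrite fmapM -compA strict IH compA.
- move=> A B D w g g' Ww IH E0 b; have {E0} E : fmap sloc w \oc g' = g := E0.
  have E' : fmap Rbar (fmap sloc w) \oc fmap Rbar g' = fmap Rbar g by rewrite -(fmapM Rbar) E.
  apply: (iso_mono (loc_iso (W := @stable_d _ _ _ _ _ adj d) Ww)); rewrite -[LHS]strict compA E' IH.
  by rewrite -[in LHS]E -[LHS]compA.
Qed.
(** A Yoneda argument: by naturality only the identity of the suspension spectrum remains. *)
Lemma Mmap_Nmap G h : Mmap (Nmap h) = h :> mor (c := DSP adj d) (CI P) G.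
Proof.
rewrite Mmap_nat (_ : Mmap _ = idm _) ?compm1 //; apply: (iso_mono (etad_iso (CI P))).
by rewrite etad_Mmap compm1; congr (fmap sloc _); exact: Cinf_ext.
Qed.
End represent.
End degree.
End stable_category.

(** * Hom-spaces and their colimits *)

Section colimit_sets.
Variable k : pzRingType.

Definition vadd_total (A : vset k) := forall x y : A, exists z, vadd x y z.
Definition vadd_uniq (A : vset k) := forall x y z z' : A, vadd x y z -> vadd x y z' -> z = z'.
Definition vscl_total (A : vset k) := forall c (x : A), exists y, vscl c x y.
Definition vscl_uniq (A : vset k) := forall c (x y y' : A), vscl c x y -> vscl c x y' -> y = y'.
Definition vhom (A B : vset k) (f : A -> B) :=
  (forall x y z, vadd x y z -> vadd (f x) (f y) (f z)) /\ (forall c x y, vscl c x y -> vscl c (f x) (f y)).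

(** Addition and scaling are relations, so an isomorphism must reflect them; this follows when
    results exist in the source and are unique in the target. *)
Lemma viso_hom (A B : vset k) (f : A -> B) : bijective f -> vhom f ->
  vadd_total A -> vscl_total A -> vadd_uniq B -> vscl_uniq B -> viso f.
Proof.
move=> bf [fD fZ] tD tZ uD uZ; split=> // [x y z|c x y]; split; auto.
  move=> h; have [z' hz'] := tD x y; have := uD _ _ _ _ h (fD _ _ _ hz').
  by move=> /(bij_inj bf) ->.
move=> h; have [y' hy'] := tZ c x; have := uZ _ _ _ _ h (fZ _ _ _ hy').
by move=> /(bij_inj bf) ->.
Qed.
Lemma viso_comp (A B C : vset k) (g : B -> C) (f : A -> B) : viso f -> viso g -> viso (g \o f).
Proof.
move=> [bf fD fZ] [bg gD gZ]; split; first exact: bij_comp.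
  by move=> x y z; rewrite fD gD.
by move=> c x y; rewrite fZ gZ.
Qed.
Lemma viso_inv (A B : vset k) (f : A -> B) : viso f -> exists g : B -> A, [/\ viso g, cancel f g &
  cancel g f].
Proof.
move=> [[g fK gK] fD fZ]; exists g; split=> //; split; first by exists f.
  by move=> x y z; rewrite fD !gK.
by move=> c x y; rewrite fZ !gK.
Qed.

Section colim_map.
Variables (A : nat -> vset k) (t : forall i, A i -> A i.+1) (B : vset k) (f : forall i, A i -> B).
Hypotheses (ft : forall i x, f (t x) = f (i := i) x) (f_hom : forall i, vhom (@f i)) (t_hom : forall
  i, vhom (@t i)).
Hypotheses (AD : forall i, vadd_total (A i)) (AZ : forall i, vscl_total (A i)) (BD : vadd_uniq B) (BZ
  : vscl_uniq B).
Hypotheses (f_surj : forall y, exists i x, f (i := i) x = y)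
  (f_inj : forall i (x x' : A i), f x = f x' -> colim_in t x = colim_in t x').

Lemma colim_inE i (x : A i) : colim_in t (t x) = colim_in t x.
Proof.
apply: eq_cls; [exact: colim_sym|exact: colim_trans|].
by apply: colim_sym; apply: colim_step.
Qed.
Lemma colim_cls i j (x : A i) (y : A j) : colim_in t x = colim_in t y -> colim_eq t (existT _ i x)
  (existT _ j y).
Proof. by apply: cls_eq => z; apply: colim_refl. Qed.
Lemma colim_surj (z : colim t) : exists i (x : A i), z = colim_in t x.
Proof. by have [[i x] ->] := cls_surj z; exists i, x. Qed.
Fixpoint tower m i (x : A i) : A (m + i) := match m with 0 => x | m'.+1 => t (tower m' x) end.
Lemma tower_in m i (x : A i) : colim_in t (tower m x) = colim_in t x.
Proof. by elim: m => [//|m IH]; rewrite /= colim_inE. Qed.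
Lemma tower_f m i (x : A i) : f (tower m x) = f x.
Proof. by elim: m => [//|m IH]; rewrite /= ft. Qed.
Let ge j (i : nat) (x : A i) : exists m (x' : A (m + j)), colim_in t x = colim_in t x' /\ f x = f x'.
Proof. by exists i; rewrite addnC; exists (tower j x); rewrite tower_in tower_f. Qed.
Lemma colim_eq_f u v : colim_eq t u v -> f (tagged u) = f (tagged v).
Proof.
elim=> [//|x y _ -> //|x y z _ -> _ -> //|i a]; by rewrite /= ft.
Qed.
Let f_eq i j (x : A i) (y : A j) : f x = f y -> colim_in t x = colim_in t y.
Proof.
have [m [x' [-> ->]]] := ge j x; rewrite -(tower_in m y) -(tower_f m y); exact: f_inj.
Qed.
Let H (z : colim t) : {b : B | exists i (x : A i), z = colim_in t x /\ f x = b}.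
Proof. by apply: boolp.cid; have [i [x ->]] := colim_surj z; exists (f x), i, x. Qed.
Definition colim_map (z : colim t) : B := sval (H z).
Lemma colim_mapE i (x : A i) : colim_map (colim_in t x) = f x.
Proof.
rewrite /colim_map; case: (H _) => b /= [j [y [/colim_cls /colim_eq_f E <-]]].
exact: esym E.
Qed.
Lemma colim_map_viso : viso colim_map.
Proof.
have two (i j : nat) (x : A i) (y : A j) : exists l (x' y' : A l), [/\ colim_in t x = colim_in t x',
  colim_in t y = colim_in t y', f x = f x' & f y = f y'].
  by have [m [x' [E E']]] := ge j x; exists (m + j)%N, x', (tower m y); rewrite tower_in tower_f.
apply: viso_hom => //.
- apply: bij_of_inj_surj => [z z'|b].
    have [[i [x ->]] [j [y ->]]] := (colim_surj z, colim_surj z').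
    by rewrite !colim_mapE; apply: f_eq.
  by have [i [x <-]] := f_surj b; exists (colim_in t x); rewrite colim_mapE.
- split=> [x y z [i [a [b [c [-> -> -> h]]]]]|c x y [i [a [b [-> -> h]]]]]; rewrite !colim_mapE.
    exact: (proj1 (@f_hom i)).
  exact: (proj2 (@f_hom i)).
- move=> z z'; have [[i [x ->]] [j [y ->]]] := (colim_surj z, colim_surj z').
  have [l [x' [y' [-> -> _ _]]]] := two _ _ x y.
  by have [w hw] := AD x' y'; exists (colim_in t w), l, x', y', w.
- move=> c z; have [i [x ->]] := colim_surj z; have [w hw] := AZ c x.
  by exists (colim_in t w), i, x, w.
Qed.
End colim_map.
End colimit_sets.

Section linear_functions.
Variables (k : pzRingType) (V W : lmodType k) (f : V -> W).
Hypothesis f_lin : linear f.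
Lemma lin0 : f 0 = 0.
Proof. by apply: (@addrI _ (f 0)); rewrite addr0; have := f_lin 1 0 0; rewrite !scale1r addr0. Qed.
Lemma linD x y : f (x + y) = f x + f y.
Proof. by have := f_lin 1 x y; rewrite !scale1r. Qed.
Lemma linZ c x : f (c *: x) = c *: f x.
Proof. by have := f_lin c x 0; rewrite lin0 !addr0. Qed.
End linear_functions.

Section loc_hom.
Variables (k : pzRingType) (C : lincat k) (W : mclass C).
Local Notation loc := (loc W).
Local Notation LH := (LocHom W).
Lemma scl_mid (x y : C) (g : lmor x y) c : lcmp g (c *: lid x) = lcmp (c *: lid y) g.
Proof. by rewrite (linZ (lcmp_linr g)) (linZ (lcmp_linl g)) lcmp1m lcmpm1. Qed.
Lemma loc_scl (x y : C) (h : mor (c := Loc W) x y) c :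
  fmap loc (c *: lid y) \oc h = h \oc fmap loc (c *: lid x).
Proof.
apply: (@Loc_natural _ W _ (fid _) (fid _) (fun x => fmap loc (c *: lid x))) => {x y h} x y f.
rewrite /= -[LHS](fmapM loc) -[RHS](fmapM loc); congr (fmap loc _); exact: esym (scl_mid f c).
Qed.
Lemma vscl_loc (x y : C) c (f g : LH x y) : vscl c f g <-> g = fmap loc (c *: lid y) \oc f.
Proof. by []. Qed.
Lemma LocHom_pre (x x' y : C) (v : mor (c := Loc W) x' x) :
  vhom (A := LH x y) (B := LH x' y) (fun f => f \oc v).
Proof.
split=> [f1 f2 f3 [z [u [a [b [-> -> ->]]]]]|c f1 f2 E].
  by exists z, (u \oc v), a, b; rewrite !compA.
have {}E : f2 = fmap loc (c *: lid y) \oc f1 by [].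
by rewrite E -compA.
Qed.
Lemma LocHom_scl_total x y : vscl_total (LH x y).
Proof. by move=> c f; exists (fmap loc (c *: lid y) \oc f). Qed.
Lemma LocHom_scl_uniq x y : vscl_uniq (LH x y).
Proof. by move=> c f g g' E E'; apply: (etrans E (esym E')). Qed.
End loc_hom.

Section derived_hom.
Variables (k : finFieldType) (d : nat).
Local Notation dloc := (loc (@qis_d k d)).
Implicit Types F G : KPd k d.

Lemma khmtD (Y Z : khat k) (f f' g g' : khom Y Z) : khmt f f' -> khmt g g' -> khmt (f + g) (f' + g').
Proof.
move=> h h'; apply: knull_eq (knullD 1 h h').
by rewrite scale1r addrACA -opprD.
Qed.

(** Out of a homotopically projective P even the common denominator is strict, so adding fractions
    is adding chain maps up to homotopy. *)
Lemma dadd_strict (P G : KPd k d) (f g : lmor P G) (h : HomDP P G) : khp (sval P) ->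
  vadd (v := HomDP P G) (fmap dloc f) (fmap dloc g) h <-> h = fmap dloc (f + g).
Proof.
move=> hP; split=> [[Z [u [a [b [Ef Eg ->]]]]]|->]; last first.
  by exists P, (idm _), f, g; rewrite !compm1.
have [u0 Eu] := dstrict hP u; rewrite Eu in Ef Eg *.
rewrite -(fmapM dloc) in Ef; rewrite -(fmapM dloc) in Eg; rewrite -(fmapM dloc).
move/(dstrict_eq hP): Ef => Ef; move/(dstrict_eq hP): Eg => Eg; apply/(dstrict_eq hP).
by apply: khmt_trans (khmt_sym (khmtD Ef Eg)); rewrite -khom_compDl; apply: khmt_refl.
Qed.

Lemma dhom_total F G : vadd_total (HomDP F G).
Proof.
move=> f g; have [P [q [hP qq]]] := dresolution F.
have [f0 Ef] := dstrict hP (f \oc fmap dloc q); have [g0 Eg] := dstrict hP (g \oc fmap dloc q).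
exists (fmap dloc (f0 + g0 : lmor P G) \oc iinv (loc_iso qq)), P, (iinv (loc_iso qq)), f0, g0.
by split=> //; rewrite -?Ef -?Eg -compA iinvr compm1.
Qed.
Lemma dhom_uniq F G : vadd_uniq (HomDP F G).
Proof.
move=> f g h h' H H'; have [P [q [hP qq]]] := dresolution F.
have [f0 Ef] := dstrict hP (f \oc fmap dloc q); have [g0 Eg] := dstrict hP (g \oc fmap dloc q).
apply: (iso_epi (loc_iso qq)).
have H1 := proj1 (LocHom_pre (W := @qis_d k d) G (fmap dloc q)) f g _ H.
have H2 := proj1 (LocHom_pre (W := @qis_d k d) G (fmap dloc q)) f g _ H'.
have {}H1 : @vadd k (HomDP P G) (fmap dloc f0) (fmap dloc g0) (h \oc fmap dloc q) by rewrite -Ef -Eg;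
  exact: H1.
have {}H2 : @vadd k (HomDP P G) (fmap dloc f0) (fmap dloc g0) (h' \oc fmap dloc q) by rewrite -Ef
  -Eg; exact: H2.
by rewrite (proj1 (dadd_strict _ _ _ hP) H1) (proj1 (dadd_strict _ _ _ hP) H2).
Qed.

(** Fractions share a map out of the source, so composition with a zigzag on the target side is not
    evidently additive. Resolving G as well makes [phi] strict and reduces it to bilinearity of
    composition of chain maps. *)
Lemma dhom_post F G G' (phi : mor (c := DP k d) G G') :
  vhom (A := HomDP F G) (B := HomDP F G') (fun f => phi \oc f).
Proof.
split=> [f g h H|c f g E]; last first.
  have {}E : g = fmap dloc (c *: lid G) \oc f by [].
  by apply: (etrans (y := fmap dloc (c *: lid G') \oc (phi \oc f))) => //; rewrite E !compA loc_scl.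
have [P [q [hP qq]]] := dresolution F; have [Q [r [hQ qr]]] := dresolution G.
have [f0 Ef] := dstrict hP (iinv (loc_iso qr) \oc (f \oc fmap dloc q)).
have [g0 Eg] := dstrict hP (iinv (loc_iso qr) \oc (g \oc fmap dloc q)).
have [s Es] := dstrict hQ (phi \oc fmap dloc r).
have {}Ef : f = fmap dloc r \oc fmap dloc f0 \oc iinv (loc_iso qq).
  by rewrite -Ef compA iinvr comp1m -compA iinvr compm1.
have {}Eg : g = fmap dloc r \oc fmap dloc g0 \oc iinv (loc_iso qq).
  by rewrite -Eg compA iinvr comp1m -compA iinvr compm1.
have -> : h = fmap dloc r \oc fmap dloc (f0 + g0 : lmor P Q) \oc iinv (loc_iso qq).
  apply: (dhom_uniq H); rewrite Ef Eg; exists P, (iinv (loc_iso qq)), (lcmp r f0), (lcmp r g0).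
  by rewrite -!(fmapM dloc) -(linD (lcmp_linr r)).
exists P, (iinv (loc_iso qq)), (lcmp s f0), (lcmp s g0).
by rewrite -(linD (lcmp_linr s)) Ef Eg !compA Es -!(fmapM dloc).
Qed.

Lemma dhom_post_viso F G G' (phi : mor (c := DP k d) G G') : is_iso phi ->
  viso (A := HomDP F G) (B := HomDP F G') (fun f => phi \oc f).
Proof.
move=> [psi [pl pr]]; apply: viso_hom.
- by exists (fun f => psi \oc f) => f; rewrite compA ?pl ?pr comp1m.
- exact: dhom_post.
- exact: dhom_total.
- exact: LocHom_scl_total.
- exact: dhom_uniq.
- exact: LocHom_scl_uniq.
Qed.
Lemma dhom_pre_viso F F' G (v : mor (c := DP k d) F' F) : is_iso v ->
  viso (A := HomDP F G) (B := HomDP F' G) (fun f => f \oc v).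
Proof.
move=> [w [wl wr]]; apply: viso_hom.
- by exists (fun f => f \oc w) => f; rewrite -compA ?wl ?wr compm1.
- exact: LocHom_pre.
- exact: dhom_total.
- exact: LocHom_scl_total.
- exact: dhom_uniq.
- exact: LocHom_scl_uniq.
Qed.
End derived_hom.

(** * Direct sums *)

Section biproduct.
Variable k : finFieldType.
Section csum.
Variables (e : nat) (A B : cpx k e).
Program Definition csum : cpx k e :=
  @Cpx k e (fun i => spair (A i) (B i))
    (fun i j => snpair (nt_comp (cd A i j) (sfst _ _)) (nt_comp (cd B i j) (ssnd _ _))) _ _.
Next Obligation. by move=> i j ne; apply: nt_ext => n x; congr pair; rewrite /= cd0. Qed.
Next Obligation. by move=> i j l; apply: nt_ext => n x; congr pair; apply: cdK. Qed.
End csum.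
Variables F G : khat k.
Definition ksum : khat k := fun e => csum (F e) (G e).
Program Definition kin1 : khom F ksum := @KHom k F ksum (fun e i => snpair (nt_id _) 0) _.
Next Obligation. by move=> e i j; apply: nt_ext => n x; congr pair; rewrite /= nt0. Qed.
Program Definition kin2 : khom G ksum := @KHom k G ksum (fun e i => snpair 0 (nt_id _)) _.
Next Obligation. by move=> e i j; apply: nt_ext => n x; congr pair; rewrite /= nt0. Qed.
Program Definition kpr1 : khom ksum F := @KHom k ksum F (fun e i => sfst _ _) _.
Next Obligation. by move=> *; apply: nt_ext. Qed.
Program Definition kpr2 : khom ksum G := @KHom k ksum G (fun e i => ssnd _ _) _.
Next Obligation. by move=> *; apply: nt_ext. Qed.
Lemma kpr1in1 : khom_comp kpr1 kin1 = khom_id F. Proof. exact: khom_ext. Qed.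
Lemma kpr1in2 : khom_comp kpr1 kin2 = 0. Proof. exact: khom_ext. Qed.
Lemma kpr2in1 : khom_comp kpr2 kin1 = 0. Proof. exact: khom_ext. Qed.
Lemma kpr2in2 : khom_comp kpr2 kin2 = khom_id G. Proof. exact: khom_ext. Qed.
Lemma conc_ksum d : conc d F -> conc d G -> conc d ksum.
Proof. by move=> cF cG e ne i n [x y]; congr pair; [apply: cF|apply: cG]. Qed.
End biproduct.

Section spectrum_biproduct.
Variables (k : finFieldType) (p : nat) (pk : p \in [pchar k]).
Variable X : forall e : pdeg, bicpx k e (pmul pk e).
Variables (C' : functor (KP k) (KP k)) (adj : adjunction C' (Kp X)).
Variable E : spectrum C'.
Let S i := ksum (E i) (E i).
Let tau i : khom (C' (S i)) (S i.+1) :=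
  khom_comp (kin1 _ _) (khom_comp (stau E i) (fmap C' (kpr1 (E i) (E i)))) +
  khom_comp (kin2 _ _) (khom_comp (stau E i) (fmap C' (kpr2 (E i) (E i)))).
Definition ssum : spectrum C' := Spectrum (slev := S) tau.
Let tauM (F G H : khat k) (g : khom G H) (f : khom F G) :
  khom_comp (fmap C' g : khom (C' G) (C' H)) (fmap C' f) = fmap C' (khom_comp g f).
Proof. by rewrite C'M. Qed.
Lemma sin1_proof i : khom_comp (kin1 (E i.+1) (E i.+1)) (stau E i) = khom_comp (tau i) (fmap C' (kin1
  (E i) (E i))).
Proof.
rewrite /tau khom_compDl -!kcompA !tauM kpr1in1 kpr2in1 C'1 (C'_0 adj) !khom_comp0r addr0.
by rewrite kcompm1.
Qed.
Lemma sin2_proof i : khom_comp (kin2 (E i.+1) (E i.+1)) (stau E i) = khom_comp (tau i) (fmap C' (kin2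
  (E i) (E i))).
Proof.
rewrite /tau khom_compDl -!kcompA !tauM kpr1in2 kpr2in2 C'1 (C'_0 adj) !khom_comp0r add0r.
by rewrite kcompm1.
Qed.
Lemma spr1_proof i : khom_comp (kpr1 (E i.+1) (E i.+1)) (tau i) = khom_comp (stau E i) (fmap C' (kpr1
  (E i) (E i))).
Proof. by rewrite /tau khom_compDr !kcompA kpr1in1 kpr1in2 !khom_comp0l addr0 kcomp1m. Qed.
Lemma spr2_proof i : khom_comp (kpr2 (E i.+1) (E i.+1)) (tau i) = khom_comp (stau E i) (fmap C' (kpr2
  (E i) (E i))).
Proof. by rewrite /tau khom_compDr !kcompA kpr2in1 kpr2in2 !khom_comp0l add0r kcomp1m. Qed.
Definition sin1 : smor E ssum := @SMor _ _ E ssum (fun i => kin1 (E i) (E i)) sin1_proof.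
Definition sin2 : smor E ssum := @SMor _ _ E ssum (fun i => kin2 (E i) (E i)) sin2_proof.
Definition spr1 : smor ssum E := @SMor _ _ ssum E (fun i => kpr1 (E i) (E i)) spr1_proof.
Definition spr2 : smor ssum E := @SMor _ _ ssum E (fun i => kpr2 (E i) (E i)) spr2_proof.
End spectrum_biproduct.

Section compact_resolutions.
Variables (k : finFieldType) (d : nat).
Lemma compact_resolution (F : KPd k d) : findim F -> exists (P : KPd k d) (q : lmor P F),
  [/\ forall e, bounded (sval P e), forall (e : pdeg) i, projective (C := Pcat k e) (sval P e i),
     forall (e : pdeg) i, fd (sval P e i) & @qis_d k d _ _ q].
Proof.
move=> fF.
have H (e : pdeg) : exists (P : cpx k e) (q : chom P (sval F e)),
    [/\ bounded P, forall i, projective (C := Pcat k e) (P i), forall i, fd (P i), cpx_qis q &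
      dval e != d -> forall i n (x : P i n), x = 0].
  have [E|ne] := eqVneq (dval e) d.
    have [bF fdF] := fF e; have [P [bP pP fP [q qq]]] := perf_fd bF fdF.
    by exists P, q.
  exists (cpx0 k e), (czero _ _); split=> //.
  - by exists 0%N => i _ n x; apply: spf0_eq.
  - by move=> i A B r rs f; exists 0; apply: nt_ext => n x; rewrite (spf0_eq x 0) !nt0.
  - by move=> i n; exists 0%N, (fun=> 0) => x; exists (fun=> 0); apply: spf0_eq.
  - by apply: qis_bij => i n y; [move=> _; apply: spf0_eq|exists 0; rewrite [RHS](svalP F e ne)].
  - by move=> _ i n x; apply: spf0_eq.
pose P e := sval (boolp.cid (H e)); have HP e := svalP (boolp.cid (H e)).
pose q e : chom (P e) (sval F e) := sval (boolp.cid (HP e)).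
have Hq e : [/\ bounded (P e), forall i, projective (C := Pcat k e) (P e i), forall i, fd (P e i),
  cpx_qis (q e) &
      dval e != d -> forall i n (x : P e i n), x = 0] := svalP (boolp.cid (HP e)).
have cP : conc d P by move=> e ne; have [_ _ _ _] := Hq e; apply.
exists (exist _ P cP), (kof q); split=> e; have [h1 h2 h3 h4 _] := Hq e => //.
Qed.
End compact_resolutions.

(** * The first isomorphism *)

Section main_bijection.
Variables (k : finFieldType) (p : nat) (pk : p \in [pchar k]).
Variable X : forall e : pdeg, bicpx k e (pmul pk e).
Hypothesis X_res : forall e : pdeg, good_resolution pk (erefl (p * e)%N) (X e).
Variables (C' : functor (KP k) (KP k)) (adj : adjunction C' (Kp X)).
Hypothesis C'_deg : forall (e : nat) (F : khat k), conc e F -> conc (p * e) (C' F).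
Variable d : nat.
Local Notation K' := (Kp X).
Local Notation adjt := (adjoint_map adj).
Local Notation dloc := (locKP k d).
Local Notation sloc := (locSP adj d).
Local Notation CI := (Cinf adj C'_deg d).
Local Notation RB := (Rbar X_res adj d).
Variables (LC : functor (DP k d) (DSP adj d)) (eps : nattrans (fcomp LC dloc) (fcomp sloc CI)).
Hypothesis LC_derived : is_left_derived eps.

Lemma eps_iso (P : KPd k d) : khp (sval P) -> is_iso (eps P).
Proof.
apply: (@left_derived_iso_on (KPd k d) (SPd adj d) (@qis_d k d) (@stable_d _ _ _ _ _ adj d) CI (fun P
  => khp (sval P)) _ _ _ _ _ LC_derived).
- exact: dresolution.
- by move=> Q Y h hQ; exact: dstrict.
- move=> Q Y f g hQ /(dstrict_eq hQ) /(hat_khmt (adj := adj) C'_deg (P := Q) (G := CI Y)).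
  by congr (fmap sloc _ = fmap sloc _); exact: Cinf_ext.
Qed.

Section one_source.
Variable F : KPd k d.
Let HP := boolp.cid (dresolution F).
Definition resP : KPd k d := sval HP.
Definition resq : lmor resP F := sval (boolp.cid (svalP HP)).
Lemma resP_khp : khp (sval resP). Proof. exact: (proj1 (svalP (boolp.cid (svalP HP)))). Qed.
Lemma resq_qis : qis_d resq. Proof. exact: (proj2 (svalP (boolp.cid (svalP HP)))). Qed.
Lemma resq_iso : is_iso (fmap dloc resq). Proof. exact: loc_iso resq_qis. Qed.
Definition resC : mor (c := DSP adj d) (CI resP) (LC F) := fmap LC (fmap dloc resq) \oc iinv (eps_iso
  resP_khp).
Lemma resC_iso : is_iso resC.
Proof. by apply: iso_comp; [apply: fmap_iso; exact: resq_iso|exact: iinv_iso]. Qed.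
Definition unitF : mor (c := DP k d) F (RB (LC F)) := Nmap X_res (G := LC F) resC \oc iinv resq_iso.
Definition NF (G : SPd adj d) (h : mor (c := DSP adj d) (LC F) G) : mor (c := DP k d) F (LLd G) :=
  fmap RB h \oc unitF.
Lemma NF_res G (h : mor (c := DSP adj d) (LC F) G) : NF h \oc fmap dloc resq = Nmap X_res (h \oc resC).
Proof. by rewrite /NF /unitF -!compA iinvl compm1 /Nmap compA -fmapM. Qed.
Lemma NF_bij G : bijective (@NF G).
Proof.
apply: bij_of_inj_surj => [h h' E|b].
  apply: (iso_epi resC_iso); rewrite -(Mmap_Nmap X_res resP_khp (h \oc resC)) -NF_res E NF_res.
  exact: Mmap_Nmap.
exists (Mmap X_res C'_deg resP_khp (b \oc fmap dloc resq) \oc iinv resC_iso).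
by apply: (iso_epi resq_iso); rewrite NF_res -compA iinvl compm1 Nmap_Mmap.
Qed.
Lemma NF_hom G : vhom (A := HomDSP (LC F) G) (B := HomDP F (LLd G)) (@NF G).
Proof.
split=> [f g h [Z [u [a [b [-> -> ->]]]]]|c f g E].
  exists (LLd Z), (fmap RB u \oc unitF), (LLmap adj a : lmor (LLd Z) (LLd G)), (LLmap adj b : lmor
    (LLd Z) (LLd G)).
  rewrite /NF !(fmapM RB) ![fmap RB (fmap (loc _) _)]RbarE -!compA; split=> //.
  congr (fmap dloc _ \oc _); have := LLmap_lin 1 a b; by rewrite !scale1r.
apply/vscl_loc; rewrite (proj1 (vscl_loc _ _ _) E) /NF fmapM [fmap RB (fmap (loc _) _)]RbarE -compA.
have Z (A B : Spectra adj) (u : lmor A B) : LLmap adj (c *: u : lmor A B) = c *: LLmap adj u.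
  exact: (linZ (f := fun v : lmor A B => LLmap adj v) (fun c f g => LLmap_lin c f g)).
congr (fmap dloc _ \oc _).
by apply: etrans (Z _ _ _) _; congr (c *: _); exact: LLmap1.
Qed.

(** The common denominator of [f] and [g] is a map into the direct sum of G with itself. It is
    constructed in the derived category, where the components can be added, and brought back by the
    bijection [NF]. *)
Lemma dsp_total G : vadd_total (HomDSP (LC F) G).
Proof.
move=> f g; pose S : SPd adj d := exist (inSPd p d) (ssum (sval G)) (fun i => conc_ksum (svalP G i)
  (svalP G i)).
pose i1 : lmor G S := sin1 adj (sval G); pose i2 : lmor G S := sin2 adj (sval G).
pose p1 : lmor S G := spr1 (sval G); pose p2 : lmor S G := spr2 (sval G).
have [f0 Ef] := dstrict resP_khp (NF f \oc fmap dloc resq);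
  have [g0 Eg] := dstrict resP_khp (NF g \oc fmap dloc resq).
pose L (A B : SPd adj d) (m : lmor A B) : lmor (LLd A) (LLd B) := LLmap adj m.
have LM (A B D : SPd adj d) (m : lmor B D) (m' : lmor A B) : lcmp (L _ _ m) (L _ _ m') = L _ _ (lcmp m m').
  exact: esym (LLmapM adj m m').
have L1 : L G G (lid G) = lid (LLd G) by exact: LLmap1.
have L0 : L G G 0 = 0 by exact: (lin0 (f := fun v : lmor (l := Spectra adj) (sval G) (sval G) =>
  LLmap adj v) (fun c f g => LLmap_lin c f g)).
pose w0 : lmor resP (LLd S) := lcmp (L _ _ i1) f0 + lcmp (L _ _ i2) g0.
have [Ninv NK KN] := @NF_bij S.
pose u := Ninv (fmap dloc w0 \oc iinv resq_iso).
have Nu (q : lmor S G) (h : mor (c := DSP adj d) (LC F) G) (h0 : lmor resP (LLd G)) : NF h \oc fmap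
  dloc resq = fmap dloc h0 ->
    lcmp (L _ _ q) w0 = h0 -> h = fmap sloc q \oc u.
  move=> Eh Ew; apply: (bij_inj (@NF_bij G)); apply: (iso_epi resq_iso); rewrite Eh -Ew.
  rewrite /NF (fmapM RB) RbarE -[in RHS]compA [fmap RB u \oc _](KN _) -!compA iinvl compm1.
  exact: (fmapM dloc).
have q1 : lcmp (L _ _ p1) w0 = f0.
  rewrite (linD (lcmp_linr _)) !lcmpA !LM.
  have -> : lcmp p1 i1 = lid G by apply: smor_ext => i; exact: kpr1in1.
  have -> : lcmp p1 i2 = 0 by apply: smor_ext => i; exact: kpr1in2.
  by rewrite L1 L0 lcmp1m (lin0 (lcmp_linl g0)) addr0.
have q2 : lcmp (L _ _ p2) w0 = g0.
  rewrite (linD (lcmp_linr _)) !lcmpA !LM.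
  have -> : lcmp p2 i1 = 0 by apply: smor_ext => i; exact: kpr2in1.
  have -> : lcmp p2 i2 = lid G by apply: smor_ext => i; exact: kpr2in2.
  by rewrite L1 L0 lcmp1m (lin0 (lcmp_linl f0)) add0r.
exists (fmap sloc (p1 + p2) \oc u), S, u, p1, p2.
by split=> //; [apply: Nu Ef q1|apply: Nu Eg q2].
Qed.
Lemma NF_viso G : viso (A := HomDSP (LC F) G) (B := HomDP F (LLd G)) (@NF G).
Proof.
apply: viso_hom.
- exact: NF_bij.
- exact: NF_hom.
- exact: dsp_total.
- exact: LocHom_scl_total.
- exact: dhom_uniq.
- exact: LocHom_scl_uniq.
Qed.
End one_source.

Lemma Nmap_pre (P P' : KPd k d) (w : lmor P' P) (G : SPd adj d) (g : mor (c := DSP adj d) (CI P) G) :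
  Nmap X_res (g \oc fmap sloc (fmap CI w)) = Nmap X_res g \oc fmap dloc w.
Proof.
rewrite /Nmap (fmapM RB) RbarE -!compA -!(fmapM dloc); congr (_ \oc fmap dloc _).
exact: (LLmap_in adj (fmap CI w) 0).
Qed.
Lemma NF_pre (F F' : KPd k d) (v : mor (c := DP k d) F' F) (G : SPd adj d) (h : mor (c := DSP adj d)
  (LC F) G) :
  NF (h \oc fmap LC v) = NF h \oc v.
Proof.
apply: (iso_epi (resq_iso F')); rewrite NF_res -[X in Nmap _ X]compA -[RHS]compA.
have [w Ew] := dstrict (@resP_khp F') (iinv (resq_iso F) \oc (v \oc fmap dloc (resq F'))).
have {}Ew : v \oc fmap dloc (resq F') = fmap dloc (resq F) \oc fmap dloc w by rewrite -Ew compA iinvr comp1m.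
have epsN : fmap LC (fmap dloc w) \oc iinv (eps_iso (@resP_khp F')) = iinv (eps_iso (@resP_khp F))
  \oc fmap sloc (fmap CI w).
  apply: (iso_mono (eps_iso (@resP_khp F))); rewrite !compA iinvr comp1m.
  have -> : eps (resP F) \oc fmap LC (fmap dloc w) = fmap sloc (fmap CI w) \oc eps (resP F') by
    exact: (ntcP eps w).
  by rewrite -compA iinvr compm1.
have -> : fmap LC v \oc resC F' = resC F \oc fmap sloc (fmap CI w).
  by rewrite /resC compA -fmapM Ew fmapM -!compA epsN.
by rewrite [X in Nmap _ X]compA Nmap_pre Ew [RHS]compA NF_res.
Qed.
Lemma NF_post (F : KPd k d) (G G' : SPd adj d) (g : lmor G G') (h : mor (c := DSP adj d) (LC F) G) :
  NF (fmap sloc g \oc h) = fmap dloc (LLmap adj g : lmor (LLd G) (LLd G')) \oc NF h.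
Proof. rewrite /NF (fmapM RB) RbarE; exact: esym (compA _ _ _). Qed.
End main_bijection.

Section iterates.
Variables (k : finFieldType) (p : nat) (pk : p \in [pchar k]).
Variable X : forall e : pdeg, bicpx k e (pmul pk e).
Variables (C' : functor (KP k) (KP k)) (adj : adjunction C' (Kp X)).
Local Notation K' := (Kp X).
Local Notation adjt := (adjoint_map adj).
Implicit Types (Y : khat k) (E : spectrum C').

Definition fitrm i Y Y' (f : khom Y Y') : khom (fiterr K' i Y) (fiterr K' i Y') := fmap (fiterr K' i) f.
(** Iterating on the left and on the right agree only up to a propositional equality, so the
    identification is built as an isomorphism that is natural and compatible with the transition
    maps. *)
Fixpoint swap i Y : khom (fiterl K' i (Kp_ob X Y)) (Kp_ob X (fiterl K' i Y)) :=
  match i return khom (fiterl K' i (Kp_ob X Y)) (Kp_ob X (fiterl K' i Y)) with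
  | 0 => khom_id _
  | i'.+1 => Kp_map X (swap i' Y)
  end.
Fixpoint rho i Y : khom (fiterr K' i Y) (fiterl K' i Y) :=
  match i return khom (fiterr K' i Y) (fiterl K' i Y) with
  | 0 => khom_id Y
  | i'.+1 => khom_comp (swap i' Y) (rho i' (Kp_ob X Y))
  end.
Lemma swap_iso i Y : is_iso (swap i Y : mor (c := KP k) _ _).
Proof. by elim: i => [|i IH]; [exact: (@iso_id (KP k))|exact: (fmap_iso K' IH)]. Qed.
Lemma rho_iso i Y : is_iso (rho i Y : mor (c := KP k) _ _).
Proof.
elim: i Y => [|i IH] Y; first exact: (@iso_id (KP k)).
exact: (iso_comp (swap_iso i Y) (IH _)).
Qed.
Lemma swap_nat i Y Y' (f : khom Y Y') : khom_comp (swap i Y') (fitm X i (Kp_map X f)) = khom_comp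
  (Kp_map X (fitm X i f)) (swap i Y).
Proof.
elim: i => [|i IH]; first by rewrite kcomp1m kcompm1.
by rewrite fitmS -[swap i.+1 _]/(Kp_map X (swap i _)) -KpM IH KpM.
Qed.
Lemma rho_nat i Y Y' (f : khom Y Y') : khom_comp (rho i Y') (fitrm i f) = khom_comp (fitm X i f) (rho i Y).
Proof.
elim: i Y Y' f => [|i IH] Y Y' f; first by rewrite kcomp1m kcompm1.
by rewrite -[LHS]kcompA [X in khom_comp _ X](IH _ _ (Kp_map X f)) kcompA swap_nat -kcompA.
Qed.
Lemma swap_tl i E : khom_comp (swap i (E i.+1)) (fitm X i (adjt (stau E i))) = tl adj i E.
Proof.
elim: i E => [|i IH] E; first exact: kcomp1m.
by rewrite fitmS -[swap i.+1 _]/(Kp_map X (swap i _)) -KpM (IH (shs E)).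
Qed.
Lemma rho_step i E : khom_comp (rho i.+1 (E i.+1)) (fitrm i (adjt (stau E i))) = khom_comp (tl adj i
  E) (rho i (E i)).
Proof. by rewrite -[LHS]kcompA rho_nat kcompA swap_tl. Qed.
End iterates.

Section colimit_comparison.
Variables (k : finFieldType) (p : nat) (pk : p \in [pchar k]).
Variable X : forall e : pdeg, bicpx k e (pmul pk e).
Variables (C' : functor (KP k) (KP k)) (adj : adjunction C' (Kp X)).
Variables (d : nat) (d_gt0 : (0 < d)%N).
Local Notation K' := (Kp X).
Local Notation dloc := (locKP k d).

Section one_spectrum.
Variable G : SPd adj d.
Definition iota i : lmor (KG G i) (LLd G) := khom_comp (LLin adj i (sval G)) (rho X i (sval G i)).
Lemma iota_step i : lcmp (iota i.+1) (KG_step G i) = iota i.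
Proof.
rewrite /iota -[LHS]kcompA [X in khom_comp _ X](rho_step adj i (sval G)) kcompA.
by rewrite LLin_step.
Qed.
(** The stages of the tower that defines [LL], with [K'] iterated on the left; compactness is
    applied to them and carried to the stages of the statement by [rhod]. *)
Definition Tl i : KPd k d := exist _ (fiterl K' i (sval G i)) (fiterl_conc (svalP G i)).
Definition rhod i : lmor (KG G i) (Tl i) := rho X i (sval G i).
Lemma rhod_iso i : is_iso (fmap dloc (rhod i)).
Proof. apply: fmap_iso; exact: (rho_iso X i (sval G i)). Qed.

Variable F : KPd k d.
Local Notation A := (fun i => HomDP F (KG G i)).
Local Notation t := (fun i (a : A i) => fmap dloc (KG_step G i) \oc a : A i.+1).
Definition stage i (a : mor (c := DP k d) F (KG G i)) : mor (c := DP k d) F (LLd G) := fmap dloc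
  (iota i) \oc a.
Lemma stage_step i (a : mor (c := DP k d) F (KG G i)) : stage (fmap dloc (KG_step G i) \oc a) = stage a.
Proof. by rewrite /stage compA -(fmapM dloc); congr (fmap dloc _ \oc _); exact: iota_step. Qed.
Let tr j m : lmor (Tl j) (Tl (m + j)) := ktr (fun j => tl adj j (sval G)) j m.
Lemma tower_rho m i (a : A i) :
  fmap dloc (rhod (m + i)) \oc tower t m a = fmap dloc (tr i m) \oc (fmap dloc (rhod i) \oc a).
Proof.
elim: m => [|m IH]; first by rewrite (_ : tr i 0 = lid (Tl i)) // (fmap1 dloc) comp1m.
pose u : lmor (Tl (m + i)) (Tl (m + i).+1) := tl adj (m + i) (sval G).
rewrite -[tower t m.+1 a]/(fmap dloc (KG_step G (m + i)) \oc tower t m a) [LHS]compA -[in LHS](fmapM dloc).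
have -> : (rhod (m.+1 + i) : mor (c := KPd k d) _ _) \oc KG_step G (m + i) = (u : mor (c := KPd k d)
  _ _) \oc (rhod (m + i) : mor (c := KPd k d) _ _).
  exact: (rho_step adj (m + i) (sval G)).
rewrite [in LHS](fmapM dloc) -[LHS]compA IH [LHS]compA -(fmapM dloc); by [].
Qed.

Hypothesis fF : findim F.
Lemma stage_surj y : exists i x, stage (i := i) x = y.
Proof.
have [P [q [bP pP fP qq]]] := compact_resolution fF.
have hP : khp (sval P) by move=> e; apply: bounded_projective_hproj; [exact: bP|exact: pP].
have [y0 Ey] := dstrict hP (y \oc fmap dloc q).
have [J [g Eg]] := kcompact_lift d_gt0 (svalP P) bP pP fP y0.
exists J, (iinv (rhod_iso J) \oc (fmap dloc (g : lmor P (Tl J)) \oc iinv (loc_iso qq))).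
pose l : lmor (Tl J) (LLd G) := LLin adj J (sval G).
apply: (iso_epi (loc_iso qq)); rewrite /stage -!compA iinvl compm1 -[iota J]/((l : mor (c := KPd k d)
  _ _) \oc (rhod J : mor (c := KPd k d) _ _)).
rewrite (fmapM dloc) -compA [X in _ \oc X]compA iinvr comp1m -(fmapM dloc) Ey.
by congr (fmap dloc _).
Qed.
(** Equality in the colimit is a homotopy of strict representatives on a compact resolution;
    [kcompact_zero] realises it after [M] and then [M'] further transition maps. *)
Lemma stage_inj i (x x' : A i) : stage x = stage x' -> colim_in t x = colim_in t x'.
Proof.
have [P [q [bP pP fP qq]]] := compact_resolution fF.
have hP : khp (sval P) by move=> e; apply: bounded_projective_hproj; [exact: bP|exact: pP].
have [x0 Ex] := dstrict hP (x \oc fmap dloc q).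
have [x0' Ex'] := dstrict hP (x' \oc fmap dloc q) => E.
have {E} : khmt (khom_comp (LLin adj i (sval G)) (khom_comp (rho X i (sval G i)) x0)) (khom_comp
  (LLin adj i (sval G)) (khom_comp (rho X i (sval G i)) x0')).
  rewrite !kcompA; apply/(@dstrict_eq k d P hP (LLd G) (lcmp (iota i) x0) (lcmp (iota i) x0')).
  rewrite [LHS](fmapM dloc (iota i : mor (c := KPd k d) _ _)) [RHS](fmapM dloc (iota i : mor (c :=
    KPd k d) _ _)).
  by rewrite -[fmap _ x0]Ex -[fmap _ x0']Ex' !compA; congr (_ \oc _).
move=> /(kcompact_zero d_gt0 (svalP P) bP pP fP) [M [M' H]].
rewrite -(tower_in t M x) -(tower_in t M x') -(tower_in t M' (tower t M x)) -(tower_in t M' (tower t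
  M x')); congr colim_in.
apply: (iso_mono (rhod_iso (M' + (M + i)))); rewrite !tower_rho; apply: (iso_epi (loc_iso qq)).
rewrite -!compA.
have {}Ex : x \oc fmap dloc q = fmap dloc x0 := Ex; have {}Ex' : x' \oc fmap dloc q = fmap dloc x0' := Ex'.
rewrite [x \oc _]Ex [x' \oc _]Ex'.
have merge (z : lmor P (KG G i)) : fmap dloc (tr (M + i) M') \oc (fmap dloc (tr i M) \oc (fmap dloc
  (rhod i) \oc fmap dloc z)) =
    fmap dloc (lcmp (tr (M + i) M') (lcmp (tr i M) (lcmp (rhod i) z))).
  by rewrite -(fmapM dloc (rhod i)) -(fmapM dloc (tr i M)) -(fmapM dloc (tr (M + i) M')).
by rewrite !merge; apply/(dstrict_eq hP).
Qed.
Definition Theta : colim_KG F G -> HomDP F (LLd G) := @colim_map k A t (HomDP F (LLd G)) stage.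
Lemma Theta_in i (a : A i) : Theta (in_KG a) = stage a.
Proof. exact: (@colim_mapE k A t (HomDP F (LLd G)) stage stage_step). Qed.
Lemma Theta_viso : viso Theta.
Proof.
apply: (@colim_map_viso k A t (HomDP F (LLd G)) stage stage_step) => [i|i|i||||].
- exact: dhom_post.
- exact: dhom_total.
- exact: LocHom_scl_total.
- exact: dhom_uniq.
- exact: LocHom_scl_uniq.
- exact: stage_surj.
- exact: stage_inj.
Qed.
End one_spectrum.

Lemma stage_pre (G : SPd adj d) (F F' : KPd k d) (u : mor (c := DP k d) F' F) i (a : mor (c := DP k
  d) F (KG G i)) :
  stage (a \oc u) = stage a \oc u.
Proof. exact: compA. Qed.
Lemma stage_post (G G' : SPd adj d) (g : lmor G G') (F : KPd k d) i (a : mor (c := DP k d) F (KG G i)) :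
  stage (fmap dloc (KG_map g i) \oc a) = fmap dloc (LLmap adj g : lmor (LLd G) (LLd G')) \oc stage a.
Proof.
rewrite /stage !compA -!(fmapM dloc); congr (fmap dloc _ \oc _).
rewrite /iota -[LHS]kcompA [X in khom_comp _ X](rho_nat X i (smv g i)) kcompA.
by rewrite -LLmap_in -kcompA.
Qed.
End colimit_comparison.

Section hom_from_finite.
Variables (k : finFieldType) (p : nat) (pk : p \in [pchar k]).
Variable X : forall e : pdeg, bicpx k e (pmul pk e).
Hypothesis X_res : forall e : pdeg, good_resolution pk (erefl (p * e)%N) (X e).
Variables (C' : functor (KP k) (KP k)) (adj : adjunction C' (Kp X)).
Hypothesis C'_deg : forall (e : nat) (F : khat k), conc e F -> conc (p * e) (C' F).
Variables (d : nat) (d_gt0 : (0 < d)%N).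
Variables (LC : functor (DP k d) (DSP adj d)).
Variable eps : nattrans (fcomp LC (locKP k d)) (fcomp (locSP adj d) (Cinf adj C'_deg d)).
Hypothesis LC_derived : is_left_derived eps.
Local Notation NF := (NF X_res LC_derived).

Definition Phi (F : KPd k d) (G : SPd adj d) (fF : findim F) : HomDSP (LC F) G -> colim_KG F G :=
  sval (boolp.cid (viso_inv (Theta_viso d_gt0 G fF))) \o @NF F G.
Lemma Phi_viso F G (fF : findim F) : viso (@Phi F G fF).
Proof.
apply: (@viso_comp k (HomDSP (LC F) G) (HomDP F (LLd G)) (colim_KG F G)); first exact: NF_viso.
by case: (svalP (boolp.cid (viso_inv (Theta_viso d_gt0 G fF)))).
Qed.
Lemma Phi_in F G (fF : findim F) (h : mor (c := DSP adj d) (LC F) G) i (a : mor (c := DP k d) F (KG G i)) :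
  Phi fF h = in_KG a <-> NF h = stage a.
Proof.
have [_ TK KT] := svalP (boolp.cid (viso_inv (Theta_viso d_gt0 G fF))).
rewrite -Theta_in /Phi /=; split=> [<-|->]; [exact: esym (KT _)|exact: TK].
Qed.
Lemma Phi_pre (F F' : KPd k d) (G : SPd adj d) (fF : findim F) (fF' : findim F')
    (u : mor (c := DP k d) F' F) (h : mor (c := DSP adj d) (LC F) G) i (a : mor (c := DP k d) F (KG G i)) :
  Phi fF h = in_KG a -> Phi fF' (h \oc fmap LC u) = in_KG (a \oc u).
Proof. by move=> /Phi_in E; apply/Phi_in; rewrite NF_pre E stage_pre. Qed.
Lemma Phi_post (F : KPd k d) (G G' : SPd adj d) (fF : findim F) (g : lmor G G')
    (h : mor (c := DSP adj d) (LC F) G) i (a : mor (c := DP k d) F (KG G i)) :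
  Phi fF h = in_KG a -> Phi fF (fmap (locSP adj d) g \oc h) = in_KG (fmap (locKP k d) (KG_map g i) \oc a).
Proof. by move=> /Phi_in E; apply/Phi_in; rewrite NF_post E stage_post. Qed.
End hom_from_finite.

(** * Shifts *)

Section shifted_complexes.
Variables (k : finFieldType) (e : nat).
Implicit Types A B : cpx k e.

Lemma sign_inv s (V : lmodType k) (v : V) : (-1 : k) ^ s *: ((-1) ^ s *: v) = v.
Proof. by rewrite scalerA -expfzMl mulrNN mul1r exp1rz scale1r. Qed.
Lemma sign_opp s (V : lmodType k) (v : V) : (-1 : k) ^ s *: ((-1) ^ (- s) *: v) = v.
Proof. by rewrite scalerA -expfzDr ?oppr_eq0 ?oner_eq0 // subrr expr0z scale1r. Qed.

Lemma nullhE A B (f : forall i, nt (A i) (B i)) : nullh f <-> exists h : forall i j, nt (A i) (B j),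
  forall i j l n, j = i + 1 -> l = j + 1 -> forall x : A j n,
    f j n x = cd B i j n (h j i n x) + h l j n (cd A j l n x).
Proof.
split=> [[h H]|[h H]]; exists h; first by move=> i j l n -> ->; exact: H.
by move=> i n x; exact: H.
Qed.
Lemma cid_cd_eq A i i' j j' n (z : A i' n) : i' = i -> j' = j ->
  cid A j' j n (cd A i' j' n z) = cd A i j n (cid A i' i n z).
Proof. by move=> Ei Ej; subst i' j'; rewrite !cidxx. Qed.

Variable s : int.
Lemma shift_cd A i j n (x : A (i + s) n) : cd (cpx_shift s A) i j n x = (-1) ^ s *: cd A (i + s) (j + s) n x.
Proof. by []. Qed.
Let shift_succ (i j : int) : j = i + 1 -> j + s = i + s + 1.
Proof. by move=> ->; rewrite addrAC. Qed.

Lemma shift_nullh A B (f : forall i, nt (A i) (B i)) : nullh f ->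
  nullh (X := cpx_shift s A) (Y := cpx_shift s B) (fun i => f (i + s)).
Proof.
move=> /nullhE [h H]; apply/nullhE;
  exists (fun i j => (-1) ^ s *: h (i + s) (j + s)) => i j l n /shift_succ Ej /shift_succ El x.
by rewrite !shift_cd !ntEZ !ntZ !sign_inv (H _ _ _ _ Ej El).
Qed.
End shifted_complexes.

Section shift_functor.
Variables (k : finFieldType) (s : int).
Implicit Types A B Z : khat k.
Local Notation sh := (kshift_ob s).
Local Notation shm := (kshift_map s).

Lemma kshift_qis A B (f : khom A B) : qis f -> qis (shm f).
Proof. by move=> qf e; exact: (@shift_qis _ _ s _ _ (kch f e) (qf e)). Qed.
Lemma kshiftM A B Z (g : khom B Z) (f : khom A B) : shm (khom_comp g f) = khom_comp (shm g) (shm f).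
Proof. exact: khom_ext. Qed.

Program Definition unshift_map Z : khom (sh (kshift_ob (- s) Z)) Z :=
  @KHom k (sh (kshift_ob (- s) Z)) Z (fun e i => cid (Z e) (i + s - s) i) _.
Next Obligation.
move=> Z e i j; apply: nt_ext => n x.
rewrite -[LHS]/(cid (Z e) (j + s - s) j n ((-1) ^ s *: ((-1) ^ (- s) *: cd (Z e) (i + s - s) (j + s -
  s) n x))).
by rewrite sign_opp -[RHS]/(cd (Z e) i j n (cid (Z e) (i + s - s) i n x)); apply: cid_cd_eq; rewrite addrK.
Qed.
Lemma unshift_iso Z : is_iso (unshift_map Z : mor (c := KP k) _ _).
Proof.
apply: kbij_iso => e i n /= x.
  by move: x; rewrite addrK => x; rewrite cidxx.
by rewrite addrK; exists x; rewrite cidxx.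
Qed.
Lemma kshift_faithful A B (f g : khom A B) : shm f = shm g -> f = g.
Proof.
move=> E; apply: khom_ext => e j n; rewrite -(subrK s j) => x.
exact: (congr1 (fun u : khom (sh A) (sh B) => u e (j - s) n x) E).
Qed.
Lemma kshift_full A B (g : khom (sh A) (sh B)) : exists f, g = shm f.
Proof.
pose f e i := nt_comp (cid (B e) (i - s + s) i) (nt_comp (g e (i - s)) (cid (A e) i (i - s + s))).
have fP (e : pdeg) i j : nt_comp (f e j) (cd (A e) i j) = nt_comp (cd (B e) i j) (f e i).
  apply: nt_ext => n x.
  rewrite -[LHS]/(cid (B e) (j - s + s) j n (g e (j - s) n (cid (A e) j (j - s + s) n (cd (A e) i j n x)))).
  rewrite (@cid_cd_eq _ _ _ (i - s + s)) ?subrK //; set y := cid _ _ _ _ x.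
  rewrite -[cd _ _ _ _ y](sign_inv s) -shift_cd ntZ -[g e _ n _]/(g e (j - s) n (cd (sh A e) (i - s)
    (j - s) n y)).
  by rewrite kcE shift_cd sign_inv (@cid_cd_eq _ _ _ i) ?subrK.
exists (KHom fP); apply: khom_ext => e i n x.
have H i' : i' = i -> g e i n x = cid (B e) (i' + s) (i + s) n (g e i' n (cid (A e) (i + s) (i' + s) n x)).
  by move=> Ei; subst i'; rewrite !cidxx.
by apply: H; rewrite addrK.
Qed.
(** The shift is full, and Z is isomorphic to a shift. *)
Lemma unshift_factor A Z (h : khom (sh A) Z) : exists h', h = khom_comp (unshift_map Z) (shm (h' :
  khom A (kshift_ob (- s) Z))).
Proof.
have [w [wl wr]] := unshift_iso Z; have [h' Eh] := kshift_full (khom_comp w h).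
exists h'; rewrite -Eh kcompA; have -> : khom_comp (unshift_map Z) w = khom_id Z := wr.
by rewrite kcomp1m.
Qed.
Lemma khp_shift (P : khat k) : khp P -> khp (sh P).
Proof.
move=> hP; apply: khpP => A aA g; have [g' ->] := unshift_factor g.
apply: knull_compl => e; apply: (@shift_nullh _ _ s _ _ (fun i => g' e i)).
by apply: (hP e _ (kch g' e)); apply: shift_acyclic.
Qed.
End shift_functor.

Section Kprime_shift.
Variables (k : finFieldType) (p : nat) (pk : p \in [pchar k]).
Variable X : forall e : pdeg, bicpx k e (pmul pk e).
Variables (C' : functor (KP k) (KP k)) (adj : adjunction C' (Kp X)) (s : int).
Local Notation K' := (Kp X).
Local Notation adjt := (adjoint_map adj).
Local Notation coadj := (coadjoint_map adj).
Local Notation sh := (kshift_ob s).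
Local Notation shm := (kshift_map s).
Implicit Types Y Z : khat k.

Lemma Kp_shift_nat Y Z (f : khom Y Z) :
  khom_comp (Kp_map X (shm f)) (Kp_shift X s Y) = khom_comp (Kp_shift X s Z) (shm (Kp_map X f)).
Proof. by apply: khom_ext => e n m g; apply: hc_ext. Qed.
Lemma Kp_shift_iso Y : is_iso (Kp_shift X s Y : mor (c := KP k) _ _).
Proof.
apply: kbij_iso => e n m g.
  move=> E; apply: hc_ext => i j; rewrite -(subrK s j).
  exact: (congr1 (fun u : hc _ _ _ _ => u i (j - s)) E).
pose h i j := nt_comp (cid (Y (pmul pk e)) (j - s + s) j) ((g : hc _ _ _ _) i (j - s)).
have h0 i j : j != i + (n + s) -> h i j = 0.
  move=> ne; rewrite /h hc0 ?nt_comp0r //; apply: contra ne => /eqP E.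
  by rewrite addrA -E subrK.
exists (HC h0); apply: hc_ext => i j; apply: nt_ext => o x.
have H j' : j' = j -> cid (Y (pmul pk e)) (j' + s) (j + s) o ((g : hc _ _ _ _) i j' o x) = (g : hc _
  _ _ _) i j o x.
  by move=> Ej; subst j'; rewrite cidxx.
by apply: H; rewrite addrK.
Qed.

Definition tau_shift Y : khom (C' (sh Y)) (sh (C' Y)) :=
  coadj (khom_comp (Kp_shift X s (C' Y)) (shm (adjt (khom_id (C' Y))))).
(* The mate of the isomorphism K'(-)[s] -> K'(-[s]) is an isomorphism, by Yoneda. *)
Lemma tau_shift_iso Y : is_iso (tau_shift Y : mor (c := KP k) _ _).
Proof.
(* Under the adjunction, composition with [tau_shift] becomes composition with the isomorphism for
   [K'] and the shift; this gives both injectivity and surjectivity below. *)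
have pre Z (h : khom (C' Y) (kshift_ob (- s) Z)) :
    adjt (khom_comp (khom_comp (unshift_map s Z) (shm h)) (tau_shift Y)) =
    khom_comp (Kp_map X (unshift_map s Z)) (khom_comp (Kp_shift X s _) (shm (adjt h))).
  rewrite -kcompA 2!adjt_post /tau_shift coadjK; congr (khom_comp _ _).
  by rewrite kcompA Kp_shift_nat -kcompA -kshiftM -adjt_post kcompm1.
have cancel Z (u v : khom (sh Y) (sh (Kp_ob X (kshift_ob (- s) Z)))) :
    khom_comp (Kp_map X (unshift_map s Z)) (khom_comp (Kp_shift X s _) u) =
    khom_comp (Kp_map X (unshift_map s Z)) (khom_comp (Kp_shift X s _) v) -> u = v.
  move=> /(@iso_mono (KP k) _ _ _ _ _ _ (fmap_iso K' (unshift_iso s Z))).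
  exact: (@iso_mono (KP k) _ _ _ _ _ _ (Kp_shift_iso _)).
have inj Z (h h' : khom (sh (C' Y)) Z) : khom_comp h (tau_shift Y) = khom_comp h' (tau_shift Y) -> h = h'.
  have [[u ->] [u' ->]] := (unshift_factor h, unshift_factor h').
  move=> /(congr1 (fun v : khom _ _ => adjt v)); rewrite !pre => /cancel /kshift_faithful /adjt_inj -> //.
have surj Z (f : khom (C' (sh Y)) Z) : exists h, khom_comp h (tau_shift Y) = f.
  have [a [al ar]] := fmap_iso K' (unshift_iso s Z); have [b [bl br]] := Kp_shift_iso (kshift_ob (- s) Z).
  have [g Eg] := kshift_full (khom_comp b (khom_comp a (adjt f))).
  exists (khom_comp (unshift_map s Z) (shm (coadj g))); apply: (adjt_inj (adj := adj)).
  rewrite pre coadjK -Eg !kcompA -[in LHS](kcompA (Kp_map X _)).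
  have -> : khom_comp (Kp_shift X s (kshift_ob (- s) Z)) b = khom_id _ := br.
  rewrite kcompm1; have -> : khom_comp (Kp_map X (unshift_map s Z)) a = khom_id _ := ar.
  by rewrite kcomp1m.
have [v Ev] := surj _ (khom_id _); exists v; split; first exact: Ev.
by apply: inj; rewrite -kcompA Ev kcompm1 kcomp1m.
Qed.

Fixpoint kit j Y : khom (sh (fiterl K' j Y)) (fiterl K' j (sh Y)) :=
  match j return khom (sh (fiterl K' j Y)) (fiterl K' j (sh Y)) with
  | 0 => khom_id (sh Y)
  | j'.+1 => khom_comp (Kp_map X (kit j' Y)) (Kp_shift X s (fiterl K' j' Y))
  end.
Lemma kit_iso j Y : is_iso (kit j Y : mor (c := KP k) _ _).
Proof.
elim: j => [|j IH]; first exact: (@iso_id (KP k)).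
exact: (@iso_comp (KP k) _ _ _ _ _ (fmap_iso K' IH) (Kp_shift_iso _)).
Qed.
Lemma kit_tl j (E : spectrum C') :
  khom_comp (kit j.+1 (E j.+1)) (shm (tl adj j E)) = khom_comp (tl adj j (spectrum_shift adj s E))
    (kit j (E j)).
Proof.
elim: j E => [|j IH] E; first by rewrite [tl _ _ _ in RHS]coadjK /= Kp1 kcomp1m kcompm1.
rewrite -[tl _ _ (spectrum_shift _ _ _)]/(Kp_map X (tl adj j (spectrum_shift adj s (shs E)))).
rewrite -[kit j.+1 _ in RHS]/(khom_comp (Kp_map X (kit j (shs E j))) (Kp_shift X s _)) kcompA -KpM -IH KpM.
by rewrite -[in RHS]kcompA Kp_shift_nat kcompA.
Qed.
Definition colim_shift (E : spectrum C') : khom (kcolim (fun j => shm (tl adj j E))) (sh (LL adj E)) :=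
  kclift (fun j => etrans (esym (kshiftM s (LLin adj j.+1 E) (tl adj j E))) (congr1 (@kshift_map k s
    _ _) (LLin_step adj j E))).
Lemma colim_shift_qis E : qis (colim_shift E).
Proof.
have cE j e i n x : colim_shift E e i n (kcin (fun j => shm (tl adj j E)) j e i n x) = LLin adj j E e
  (i + s) n x.
  exact: (congr1 (fun u : khom _ _ => u e i n x) (kcliftE _ j)).
move=> e; apply: (qis_bij (f := kch (colim_shift E) e)) => i n y; last first.
  by have [j [x ->]] := kcin_surj y; exists (kcin (fun j => shm (tl adj j E)) j e i n x); exact: cE.
have [j [x ->]] := kcin_surj y; move=> /(etrans (esym (cE _ _ _ _ _))) /kcin_zero [m Em].
rewrite -(@kcin_trE _ _ _ j m).
suff -> : ktr (fun j => shm (tl adj j E)) j m e i n x = 0 by rewrite nt0.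
apply: etrans Em; elim: m => [//|m IH] /=; by rewrite IH.
Qed.
Definition colim_kit (E : spectrum C') := kcmap (fun j => kit_tl j E).
Lemma colim_kit_qis E : qis (colim_kit E).
Proof.
apply: kcmap_qis => j e; have [g [gl gr]] := kit_iso j (E j).
apply: (qis_bij (f := kch (kit j (E j)) e)) => i n x.
  move=> E0; have := congr1 (fun u : khom _ _ => u e i n x) gl.
  by move=> /= <-; rewrite [kit _ _ _ _ _ _]E0 nt0.
by exists (g e i n x); exact: (congr1 (fun u : khom _ _ => u e i n x) gr).
Qed.
End Kprime_shift.

(** * The second isomorphism *)

Section derived_twist.
Variables (k : finFieldType) (p : nat) (pk : p \in [pchar k]).
Variable X : forall e : pdeg, bicpx k e (pmul pk e).
Hypothesis X_res : forall e : pdeg, good_resolution pk (erefl (p * e)%N) (X e).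
Variables (C' : functor (KP k) (KP k)) (adj : adjunction C' (Kp X)).
Hypothesis C'_twist : left_derived_iso C' (Ctw pk).
Local Notation kloc := (loc (@qis k)).
Local Notation DK := (Loc (@qis k)).

(** On homotopically projective complexes the counits of both derived functors are isomorphisms, so
    the isomorphism of the derived functors descends to the underived values, naturally in strict
    maps. *)
Lemma twist_comparison : exists psi : forall Y : KP k, khp Y -> mor (c := DK) (C' Y) (Ctw pk Y),
  (forall Y hY, is_iso (psi Y hY)) /\
  forall (Y Z : KP k) hY hZ (c : lmor Y Z),
    fmap kloc (fmap (Ctw pk) c) \oc psi Y hY = psi Z hZ \oc fmap kloc (fmap C' c).
Proof.
have [LF [LG [eF [eG [dF dG [t t_iso]]]]]] := C'_twist.
have strict : forall (P Y : KP k) (h : mor (c := DK) P Y), khp P -> exists f, h = fmap kloc f.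
  by move=> P Y h hP; exact: kstrict.
have iF (Y : KP k) : khp Y -> is_iso (eF Y).
  apply: (@left_derived_iso_on (KP k) (KP k) (@qis k) (@qis k) C' (fun P => khp P) _ _ _ _ _ dF) => //.
    exact: kresolution.
  by move=> P Z f g hP /(kstrict_eq hP) /(C'_khmt adj); exact: loc_khmt.
have iG (Y : KP k) : khp Y -> is_iso (eG Y).
  apply: (@left_derived_iso_on (KP k) (KP k) (@qis k) (@qis k) (Ctw pk) (fun P => khp P) _ _ _ _ _ dG) => //.
    exact: kresolution.
  move=> P Z f g _ /(congr1 (fun u => fmap (Loc_map (F := Ctw pk) (fun Y Z f h => @Ctw_qis k p pk Y Z
    f h)) u)).
  by rewrite !Loc_mapE.
exists (fun Y hY => eG Y \oc t Y \oc iinv (iF Y hY)); split=> [Y hY|Y Z hY hZ c].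
  by apply: iso_comp (iinv_iso _); apply: iso_comp (t_iso _); exact: iG.
apply: (iso_epi (iF Y hY)); rewrite -!compA iinvl compm1.
have -> : fmap kloc (fmap C' c) \oc eF Y = eF Z \oc fmap LF (fmap kloc c) by exact: esym (ntcP eF c).
rewrite [X in _ = _ \oc (_ \oc X)]compA iinvl comp1m (ntcP t) !compA; congr (_ \oc _).
exact: esym (ntcP eG c).
Qed.
End derived_twist.

Section iterated_adjunction.
Variables (k : finFieldType) (p : nat) (pk : p \in [pchar k]).
Variable X : forall e : pdeg, bicpx k e (pmul pk e).
Hypothesis X_res : forall e : pdeg, good_resolution pk (erefl (p * e)%N) (X e).
Variables (C' : functor (KP k) (KP k)) (adj : adjunction C' (Kp X)).
Local Notation K' := (Kp X).
Local Notation adjt := (adjoint_map adj).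
Local Notation coadj := (coadjoint_map adj).
Implicit Types P Y : khat k.

(** The converse of [coadj_khmt]: homotopic maps agree in the localisation, [K'] preserves
    quasi-isomorphisms and so acts on it, and out of P equality there is homotopy. *)
Lemma adjt_khmt P Y (f g : khom (C' P) Y) : khp P -> khmt f g -> khmt (adjt f) (adjt g).
Proof.
move=> hP /(@loc_khmt k (C' P) Y) /(congr1 (fun u => fmap (Loc_map (F := K') (@Kp_qis _ _ _ _ X_res)) u)).
rewrite !Loc_mapE => E; apply/(kstrict_eq hP).
rewrite [LHS](fmapM (loc (@qis k)) (fmap K' f) (adj_unit adj P)).
by rewrite [RHS](fmapM (loc (@qis k)) (fmap K' g) (adj_unit adj P)) E.
Qed.
Lemma fiterl_khp i P : khp P -> khp (fiterl C' i P).
Proof. by move=> hP; elim: i => [//|i IH]; exact: (C'_khp X_res adj IH). Qed.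

(** Iteration on the right applies [K'] to Y first, so the recursion changes Y and the last
    adjunction step is outermost. *)
Fixpoint coit i P Y : khom P (fiterr K' i Y) -> khom (fiterl C' i P) Y :=
  match i return khom P (fiterr K' i Y) -> khom (fiterl C' i P) Y with
  | 0 => fun a => a
  | i'.+1 => fun a => coadj (@coit i' P (Kp_ob X Y) a)
  end.
Lemma coit_lin i P Y : linear (@coit i P Y).
Proof. by elim: i Y => [|i IH] Y c a b //=; rewrite (IH _ c a b) coadj_lin. Qed.
Lemma coit_surj i P Y b : exists a, @coit i P Y a = b.
Proof.
elim: i Y b => [|i IH] Y b; first by exists b.
by have [a Ea] := IH _ (adjt b); exists a; rewrite /= Ea adjoint_mapK.
Qed.
Lemma coit_khmt i P Y a b : khp P -> khmt (@coit i P Y a) (@coit i P Y b) <-> khmt a b.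
Proof.
move=> hP; elim: i Y a b => [//|i IH] Y a b; rewrite -[khmt a b](IH (Kp_ob X Y) a b) /=; split.
  by move=> /(adjt_khmt (@fiterl_khp i P hP)); rewrite !coadjK.
exact: coadj_khmt.
Qed.
Lemma coit_post i P Y Z (f : khom Y Z) a :
  coit (khom_comp (fitrm X i f) a) = khom_comp f (@coit i P Y a).
Proof.
elim: i Y Z f a => [//|i IH] Y Z f a.
have -> : khom_comp f (@coit i.+1 P Y a) = coadj (khom_comp (Kp_map X f) (@coit i P (Kp_ob X Y) a)).
  exact: esym (coadj_post adj f _).
by rewrite -IH.
Qed.
End iterated_adjunction.
Arguments coit {k p pk X C'} adj i P Y a.

Section colimit_transport.
Variables (k : pzRingType) (A B : nat -> vset k) (t : forall i, A i -> A i.+1) (u : forall i, B i -> B i.+1).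
Variables (b : forall i, A i -> B i) (Z : vset k) (f : forall i, A i -> Z).
Hypotheses (b_viso : forall i, viso (@b i)) (b_step : forall i a, b (t a) = u (b (i := i) a)).
Hypotheses (ft : forall i x, f (t x) = f (i := i) x) (f_hom : forall i, vhom (@f i)).
Hypotheses (BD : forall i, vadd_total (B i)) (BZ : forall i, vscl_total (B i)) (ZD : vadd_uniq Z) (ZZ
  : vscl_uniq Z).
Hypotheses (f_surj : forall y, exists i x, f (i := i) x = y)
  (f_inj : forall i (x x' : A i), f x = f x' -> colim_in t x = colim_in t x').

Lemma colim_in_step (v w : {i & vcar (A i)}) : colim_eq t v w ->
  colim_in u (b (tagged v)) = colim_in u (b (tagged w)).
Proof.
elim=> [//|x y _ -> //|x y z _ -> _ -> //|i a] /=.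
by rewrite b_step colim_inE.
Qed.
Lemma colim_transport : exists g : colim u -> Z, viso g.
Proof.
pose c i := sval (boolp.cid (viso_inv (b_viso i))).
have cP i : [/\ viso (c i), cancel (@b i) (c i) & cancel (c i) (@b i)] := svalP (boolp.cid (viso_inv
  (b_viso i))).
exists (colim_map (t := u) (fun i y => f (c i y))); apply: colim_map_viso => //.
- move=> i y; have [_ _ cK] := cP i; have [_ bK _] := cP i.+1.
  by rewrite -{1}(cK y) -b_step bK ft.
- move=> i; have [[_ cD cZ] _ _] := cP i; have [fD fZ] := f_hom i.
  by split=> [x y z /cD /fD|a x y /cZ /fZ].
- move=> y; have [i [x <-]] := f_surj y; have [_ bK _] := cP i.
  by exists i, (b x); rewrite bK.
- move=> i x x' /f_inj /colim_cls /colim_in_step /=.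
  by have [_ _ cK] := cP i; rewrite !cK.
Qed.
End colimit_transport.

Section derived_adjunction.
Variables (k : finFieldType) (p : nat) (pk : p \in [pchar k]).
Variable X : forall e : pdeg, bicpx k e (pmul pk e).
Hypothesis X_res : forall e : pdeg, good_resolution pk (erefl (p * e)%N) (X e).
Variables (C' : functor (KP k) (KP k)) (adj : adjunction C' (Kp X)).
Hypothesis C'_deg : forall (e : nat) (F : khat k), conc e F -> conc (p * e) (C' F).
Variables (d : nat) (P : KPd k d) (E : SPd adj d).
Hypothesis hP : khp (sval P).
Definition C'it i : KPd k (d * p ^ i) := exist _ (fiterl C' i (sval P)) (@conc_C'i k p C' C'_deg d i
  _ (svalP P)).
Definition lev i : KPd k (d * p ^ i) := exist _ (sval E i) (svalP E i).
Local Notation dloc := (locKP k d).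
Local Notation iloc i := (locKP k (d * p ^ i)).
Definition bet i (a : HomDP P (KG E i)) : HomDP (C'it i) (lev i) :=
  fmap (iloc i) (coit adj i (sval P) (sval E i) (sval (boolp.cid (dstrict hP a))) : lmor (C'it i) (lev i)).
Lemma C'it_khp i : khp (sval (C'it i)). Proof. exact: (fiterl_khp X_res adj hP). Qed.
Lemma betE i (a : lmor P (KG E i)) : bet (fmap dloc a) = fmap (iloc i) (coit adj i (sval P) (sval E
  i) a : lmor (C'it i) (lev i)).
Proof.
apply/(dstrict_eq (@C'it_khp i))/(coit_khmt X_res adj _ _ hP)/(dstrict_eq hP (Y := KG E i)).
exact: esym (svalP (boolp.cid (dstrict hP (fmap dloc a)))).
Qed.
Lemma bet_viso i : viso (@bet i).
Proof.
have sc (C : lincat k) (Y Z : C) x (u : lmor Y Z) : lcmp (x *: lid Z) u = x *: u.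
  by rewrite (linZ (lcmp_linl u)) lcmp1m.
apply: viso_hom.
- apply: bij_of_inj_surj => [a b|y].
    have [a0 ->] := dstrict hP a; have [b0 ->] := dstrict hP b; rewrite !betE.
    by move=> /(dstrict_eq (@C'it_khp i)) /(coit_khmt X_res adj _ _ hP) H; apply/(dstrict_eq hP).
  have [y0 ->] := dstrict (@C'it_khp i) y; have [a Ea] := @coit_surj _ _ _ _ _ adj i (sval P) (sval E i) y0.
  by exists (fmap dloc (a : lmor P (KG E i))); rewrite betE Ea.
- split=> [a b c|x a b].
    have [a0 ->] := dstrict hP a; have [b0 ->] := dstrict hP b => /(dadd_strict _ _ _ hP) ->.
    rewrite !betE; apply/(dadd_strict _ _ _ (@C'it_khp i)); congr (fmap (iloc i) _).
    exact: (linD (@coit_lin _ _ _ _ _ adj i (sval P) (sval E i))).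
  have [a0 ->] := dstrict hP a => E0.
  have {E0} -> : b = fmap dloc (x *: a0 : lmor P (KG E i)).
    by apply: etrans E0 _; rewrite -(fmapM dloc); congr (fmap dloc _); exact: sc.
  rewrite !betE; apply/vscl_loc; rewrite -(fmapM (iloc i)); congr (fmap (iloc i) _).
  apply: (etrans _ (esym (sc (KPd k (d * p ^ i)) (C'it i) (lev i) x _)));
    exact: (linZ (@coit_lin _ _ _ _ _ adj i (sval P) (sval E i))).
- exact: dhom_total.
- exact: LocHom_scl_total.
- exact: dhom_uniq.
- exact: LocHom_scl_uniq.
Qed.
End derived_adjunction.

Section shifted_suspension.
Variables (k : finFieldType) (p : nat) (pk : p \in [pchar k]).
Variable X : forall e : pdeg, bicpx k e (pmul pk e).
Hypothesis X_res : forall e : pdeg, good_resolution pk (erefl (p * e)%N) (X e).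
Variables (C' : functor (KP k) (KP k)) (adj : adjunction C' (Kp X)).
Hypothesis C'_deg : forall (e : nat) (F : khat k), conc e F -> conc (p * e) (C' F).
Hypothesis C'_twist : left_derived_iso C' (Ctw pk).
Variables (d : nat) (s : int) (SF SG P Q : KPd k d) (q : lmor P SF) (r : lmor Q SG).
Local Notation adjt := (adjoint_map adj).
Hypotheses (hP : khp (sval P)) (hQ : khp (sval Q)) (qq : qis_d q) (qr : qis_d r).
Local Notation dloc := (locKP k d).
Local Notation iloc i := (locKP k (d * p ^ i)).
Local Notation CI := (Cinf adj C'_deg d).
Local Notation E := (SPd_shift s (CI Q)).
Local Notation CP := (C'it C'_deg P).
Local Notation DT := (DCtwS pk d).

Let psi := sval (boolp.cid (twist_comparison adj C'_twist)).
Let psi_iso Y hY : is_iso (@psi Y hY) := proj1 (svalP (boolp.cid (twist_comparison adj C'_twist))) Y hY.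
Let psi_nat (Y Z : KP k) hY hZ (c : lmor Y Z) :
  fmap (loc (@qis k)) (fmap (Ctw pk) c) \oc @psi Y hY = @psi Z hZ \oc fmap (loc (@qis k)) (fmap C' c) :=
  proj2 (svalP (boolp.cid (twist_comparison adj C'_twist))) Y Z hY hZ c.

Section psi_in_degree.
Variable i : nat.
Definition C'd (Y : KPd k (d * p ^ i)) (hc : conc (d * p ^ i.+1) (C' (sval Y))) : KPd k (d * p ^
  i.+1) := exist _ (C' (sval Y)) hc.
(** The comparison [psi] lives in the derived category of all degrees; fullness of the inclusion
    brings it to a single degree. *)
Lemma psid_ex (Y : KPd k (d * p ^ i)) (hY : khp (sval Y)) hc :
  exists v : mor (c := DP k (d * p ^ i.+1)) (@C'd Y hc) (CtwS pk d i Y), fmap (dincl k _) v = psi hY.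
Proof. exact: (@dincl_full k (d * p ^ i.+1) (@C'd Y hc) (CtwS pk d i Y) (psi hY)). Qed.
Definition psid (Y : KPd k (d * p ^ i)) (hY : khp (sval Y)) hc := sval (boolp.cid (@psid_ex Y hY hc)).
Lemma psidE (Y : KPd k (d * p ^ i)) (hY : khp (sval Y)) hc : fmap (dincl k _) (psid hY hc) = psi hY.
Proof. exact: svalP (boolp.cid (@psid_ex Y hY hc)). Qed.
Lemma psid_iso (Y : KPd k (d * p ^ i)) (hY : khp (sval Y)) hc : is_iso (psid hY hc).
Proof. by apply: dincl_iso; rewrite psidE; exact: psi_iso. Qed.
Lemma psid_nat (Y Z : KPd k (d * p ^ i)) (hY : khp (sval Y)) (hZ : khp (sval Z)) hc hc' (c : lmor Y Z) :
  fmap (iloc i.+1) (fmap (CtwS pk d i) c) \oc psid hY hc =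
  psid hZ hc' \oc fmap (iloc i.+1) (fmap C' (c : lmor (l := KP k) (sval Y) (sval Z)) : lmor (@C'd Y
    hc) (@C'd Z hc')).
Proof. by apply: dincl_inj; rewrite !fmapM !psidE !dinclE; exact: psi_nat. Qed.
End psi_in_degree.

Lemma conc_C'S i (Y : khat k) : conc (d * p ^ i) Y -> conc (d * p ^ i.+1) (C' Y).
Proof. by rewrite expnS mulnCA; exact: C'_deg. Qed.
Lemma lev_khp i : khp (sval (lev E i)).
Proof. by apply: khp_shift; exact: (@fiterl_khp _ _ _ _ X_res _ adj i _ hQ). Qed.
Definition taud i : lmor (C'd (conc_C'S (svalP (lev E i)))) (lev E i.+1) := stau (sval E) i.
Lemma taud_iso i : is_iso (fmap (iloc i.+1) (taud i)).
Proof. by apply: fmap_iso; exact: (tau_shift_iso adj s (fiterl C' i (sval Q))). Qed.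
Lemma DCtwSE i (Y Z : KPd k (d * p ^ i)) (c : lmor Y Z) :
  fmap (DT i) (fmap (iloc i) c) = fmap (iloc i.+1) (fmap (CtwS pk d i) c).
Proof. exact: Loc_mapE. Qed.
Definition kap i : mor (CtwS pk d i (KPd_shift s (twisti pk SG i))) (KPd_shift s (twisti pk SG i.+1)) :=
  Ctw_shift pk s (sval (twisti pk SG i)).
Lemma kap_iso i : is_iso (fmap (iloc i.+1) (kap i)).
Proof.
apply: fmap_iso; apply: (@kbij_iso k _ _ (Ctw_shift pk s (sval (twisti pk SG i)))) => e j n /=.
  by rewrite /Ctw_shift_nt /kshift_ob /Ctw_ob; case: (proot pk e) => [[u h]|].
by rewrite /Ctw_shift_nt /kshift_ob /Ctw_ob; case: (proot pk e) => [[u h]|] y; exists y.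
Qed.

Fixpoint df i : mor (c := DP k (d * p ^ i)) (CP i) (twisti pk SF i) :=
  match i return mor (c := DP k (d * p ^ i)) (CP i) (twisti pk SF i) with
  | 0 => fmap (iloc 0) (q : lmor (CP 0) (twisti pk SF 0))
  | i'.+1 => fmap (DT i') (df i') \oc psid (Y := CP i') (@C'it_khp _ _ _ _ X_res _ adj C'_deg d P hP
    i') (@conc_C'i k p C' C'_deg d i'.+1 _ (svalP P))
  end.
(** E is a shifted suspension spectrum, so its structure maps are isomorphisms by [tau_shift_iso]
    and can be inverted; [kap] moves the shift past the twist. *)
Fixpoint dg i : mor (c := DP k (d * p ^ i)) (lev E i) (KPd_shift s (twisti pk SG i)) :=
  match i return mor (c := DP k (d * p ^ i)) (lev E i) (KPd_shift s (twisti pk SG i)) with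
  | 0 => fmap (iloc 0) (kshift_map s r : lmor (lev E 0) (KPd_shift s (twisti pk SG 0)))
  | i'.+1 => fmap (iloc i'.+1) (kap i') \oc (fmap (DT i') (dg i') \oc (psid (@lev_khp i') (conc_C'S
    (svalP (lev E i'))) \oc iinv (taud_iso i')))
  end.
Lemma df_iso i : is_iso (df i).
Proof.
elim: i => [|i IH]; first by apply: loc_iso; exact: qq.
by apply: (@iso_comp (DP k (d * p ^ i.+1))); [exact: fmap_iso|exact: psid_iso].
Qed.
Lemma dg_iso i : is_iso (dg i).
Proof.
elim: i => [|i IH]; first by apply: loc_iso; exact: (kshift_qis s qr).
apply: (@iso_comp (DP k (d * p ^ i.+1))); first exact: kap_iso.
apply: (@iso_comp (DP k (d * p ^ i.+1))); first exact: fmap_iso.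
by apply: (@iso_comp (DP k (d * p ^ i.+1))); [exact: psid_iso|exact: iinv_iso].
Qed.

Definition beta i (a : mor (c := DP k d) SF (KG E i)) :
    mor (c := DP k (d * p ^ i)) (twisti pk SF i) (KPd_shift s (twisti pk SG i)) :=
  dg i \oc (bet C'_deg (E := E) hP (a \oc fmap dloc q) \oc iinv (df_iso i)).
Lemma beta_viso i : viso (A := HomDP SF (KG E i)) (B := Ext s (twisti pk SF i) (twisti pk SG i)) (@beta i).
Proof.
have v1 := dhom_pre_viso (KG E i) (loc_iso qq).
have v2 := bet_viso X_res C'_deg E hP i.
have v3 := dhom_pre_viso (lev E i) (iinv_iso (df_iso i)).
have v4 := dhom_post_viso (twisti pk SF i) (dg_iso i).
exact: viso_comp (viso_comp (viso_comp v1 v2) v3) v4.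
Qed.
(** The adjunct of a transition map is C' of the previous adjunct followed by the structure map.
    Naturality of [psi] replaces C' by the twist, and the structure map cancels against the inverse
    inside [dg]. *)
Lemma beta_step i (a : mor (c := DP k d) SF (KG E i)) :
  beta (fmap dloc (KG_step E i) \oc a) = twist_step (pk := pk) (beta a).
Proof.
have [a0 Ea] := dstrict hP (a \oc fmap dloc q).
pose c : lmor (CP i) (lev E i) := coit adj i (sval P) (sval E i) a0.
pose C'c : lmor (CP i.+1) (C'd (conc_C'S (svalP (lev E i)))) := (fmap C' (c : khom (sval (CP i))
  (sval (lev E i))) : khom _ _).
have L : bet C'_deg (E := E) hP (fmap dloc (KG_step E i) \oc a \oc fmap dloc q) = fmap (iloc i.+1)
  (taud i) \oc fmap (iloc i.+1) C'c.
  rewrite -[X in bet _ _ X]compA Ea -(fmapM dloc) betE // -(fmapM (iloc i.+1)); congr (fmap (iloc i.+1) _).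
  rewrite /= (coit_post adj (adjt (stau (sval E) i))).
  apply: (adjt_inj (adj := adj)); rewrite coadjK; exact: esym (adjt_pre adj _ _).
have N : fmap (iloc i.+1) (fmap (CtwS pk d i) c) \oc psid (@C'it_khp _ _ _ _ X_res _ adj C'_deg d P
  hP i) (@conc_C'i k p C' C'_deg d i.+1 _ (svalP P))
    = psid (@lev_khp i) (conc_C'S (svalP (lev E i))) \oc fmap (iloc i.+1) C'c by exact: psid_nat.
rewrite /twist_step /beta L Ea betE // -/c.
apply: (iso_epi (df_iso i.+1)); rewrite -[LHS]compA -[X in _ \oc X]compA iinvl compm1.
rewrite -[LHS]compA -[X in _ \oc X]compA -[X in _ \oc (_ \oc X)]compA [X in _ \oc (_ \oc (_ \oc
  X))]compA iinvl comp1m -N.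
rewrite -[RHS]compA; congr (_ \oc _).
rewrite !(fmapM (DT i)) DCtwSE -!compA; congr (_ \oc (_ \oc _)).
by rewrite compA -(fmapM (DT i)) iinvl fmap1 comp1m.
Qed.
Lemma colim_twist_viso : (0 < d)%N -> findim SF ->
  exists g : colim (A := fun i => Ext s (twisti pk SF i) (twisti pk SG i)) (fun i a => twist_step a) ->
    HomDP SF (LLd E), viso g.
Proof.
move=> d_gt0 fF.
apply: (@colim_transport k (fun i => HomDP SF (KG E i)) (fun i => Ext s (twisti pk SF i) (twisti pk SG i))
  (fun i a => fmap dloc (KG_step E i) \oc a) (fun i a => twist_step a) beta (HomDP SF (LLd E))
    (@stage _ _ _ _ _ _ _ E SF)).
- exact: beta_viso.
- exact: beta_step.
- by move=> i x; exact: stage_step.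
- by move=> i; exact: dhom_post.
- by move=> i; exact: dhom_total.
- by move=> i; exact: LocHom_scl_total.
- exact: dhom_uniq.
- exact: LocHom_scl_uniq.
- exact: stage_surj.
- by move=> i x x'; exact: stage_inj.
Qed.
End shifted_suspension.

Section suspension.
Variables (k : finFieldType) (p : nat) (pk : p \in [pchar k]).
Variable X : forall e : pdeg, bicpx k e (pmul pk e).
Variables (C' : functor (KP k) (KP k)) (adj : adjunction C' (Kp X)) (d : nat) (s : int).
Local Notation dloc := (locKP k d).

Definition KPd_shift_fun : functor (KPd k d) (KPd k d) :=
  @Functor (KPd k d) (KPd k d) (KPd_shift s) (fun F G f => kshift_map s f)
    (fun F => fmap1 (kshift k s) (sval F)) (fun F G H g f => fmapM (kshift k s) g f).
Definition DP_shift : functor (DP k d) (DP k d) :=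
  @Loc_map _ _ (@qis_d k d) (@qis_d k d) KPd_shift_fun (fun F G f h => kshift_qis s h).
(** Both sides receive a quasi-isomorphism from the colimit of the shifted tower: one because
    colimits commute with shifts, the other because iterates of [K'] do. *)
Lemma LLd_shift (E : SPd adj d) : exists c : mor (c := DP k d) (KPd_shift s (LLd E)) (LLd (SPd_shift
  s E)), is_iso c.
Proof.
have cM : conc d (kcolim (fun j => kshift_map s (tl adj j (sval E)))).
  by apply: kcolim_conc => j; apply: conc_shift; apply: fiterl_conc; exact: (svalP E j).
pose M : KPd k d := exist _ _ cM.
have i1 : is_iso (fmap dloc (colim_shift adj s (sval E) : lmor M (KPd_shift s (LLd E)))).
  by apply: loc_iso; exact: colim_shift_qis.
have i2 : is_iso (fmap dloc (colim_kit adj s (sval E) : lmor M (LLd (SPd_shift s E)))).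
  by apply: loc_iso; exact: colim_kit_qis.
exists (fmap dloc (colim_kit adj s (sval E) : lmor M (LLd (SPd_shift s E))) \oc iinv i1).
exact: iso_comp i2 (iinv_iso _).
Qed.
End suspension.

Lemma findim_stalk (k : finFieldType) d (F : Pd k d) : findimP F -> findim (stalkd F).
Proof.
move=> fF e; split=> [|i n]; first by exists 0%N => i /=; have [->|ne] := eqVneq i 0 => // _ n x;
  exact: spf0_eq.
rewrite /=; case: (i == 0); first exact: fF.
by exists 0%N, (fun=> 0) => x; exists (fun=> 0); exact: spf0_eq.
Qed.

Theorem theorem4p6
  (k : finFieldType) (p : nat) (pk : p \in [pchar k]%R)
  (X : forall e : pdeg, bicpx k e (pmul pk e))
  (X_res : forall e : pdeg, good_resolution pk (erefl (p * e)%N) (X e))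
  (C' : functor (KP k) (KP k)) (adj : adjunction C' (Kp X))
  (C'_quillen : left_quillen C')
  (C'_deg : forall (e : nat) (F : khat k), conc e F -> conc (p * e) (C' F))
  (C'_twist : left_derived_iso C' (Ctw pk))
  (d : nat) (d_gt0 : (0 < d)%N)
  (LC : functor (DP k d) (DSP adj d))
  (eps : nattrans (fcomp LC (locKP k d)) (fcomp (locSP adj d) (Cinf adj C'_deg d)))
  (LC_derived : is_left_derived eps) :
  (exists Phi : forall (F : KPd k d) (G : SPd adj d),
                  findim F -> HomDSP (LC F) G -> colim_KG F G,
     [/\ forall F G (fF : findim F), viso (Phi F G fF),
         forall (F F' : KPd k d) (G : SPd adj d) (fF : findim F) (fF' : findim F')
             (u : mor (c := DP k d) F' F) (h : mor (c := DSP adj d) (LC F) G)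
             i (a : mor (c := DP k d) F (KG G i)),
           Phi F G fF h = in_KG a -> Phi F' G fF' (h \oc fmap LC u) = in_KG (a \oc u) &
         forall (F : KPd k d) (G G' : SPd adj d) (fF : findim F)
             (g : lmor G G') (h : mor (c := DSP adj d) (LC F) G)
             i (a : mor (c := DP k d) F (KG G i)),
           Phi F G fF h = in_KG a ->
           Phi F G' fF (fmap (locSP adj d) g \oc h) =
             in_KG (fmap (locKP k d) (KG_map g i) \oc a)]) /\
  (forall (F G : Pd k d) (s : int), findimP F ->
     exists Psi : HomDSP (LC (stalkd F)) (SPd_shift s (LC (stalkd G))) ->
                  colim_Ext pk s F G,
       viso Psi).
Proof.
split.
  exists (fun F G fF => Phi X_res d_gt0 LC_derived (G := G) fF); split.
  - by move=> F G fF; exact: Phi_viso.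
  - by move=> F F' G fF fF' u h i a; exact: Phi_pre.
  - by move=> F G G' fF g h i a; exact: Phi_post.
move=> F G s fF; have fF' := findim_stalk fF.
pose SF := stalkd F; pose SG := stalkd G; pose Q := resP SG; pose P := resP SF.
have [L vL] := colim_twist_viso X_res adj C'_deg C'_twist s (@resP_khp k d SF) (@resP_khp k d SG)
  (resq_qis SF) (resq_qis SG) d_gt0 fF'.
(* [LC SG] and the suspension spectrum of the resolution are isomorphic only in the stable category,
   while the shift is defined on spectra. The isomorphism is therefore applied to L, where the shift
   acts on the derived category, between two uses of [LLd_shift]. *)
have [c1 i1] := LLd_shift s (LC SG); have [c2 i2] := LLd_shift s (Cinf adj C'_deg d Q).
have i3 := fmap_iso (DP_shift k d s) (fmap_iso (Rbar X_res adj d) (resC_iso LC_derived SG)).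
have iso : is_iso (c2 \oc iinv i3 \oc iinv i1).
  by apply: iso_comp; [apply: iso_comp => //; exact: iinv_iso|exact: iinv_iso].
have v1 := NF_viso X_res LC_derived SF (SPd_shift s (LC SG)).
have v2 := dhom_post_viso SF iso.
have [L' [vL' _ _]] := viso_inv vL.
exists (fun h => L' (c2 \oc iinv i3 \oc iinv i1 \oc NF X_res LC_derived h)).
exact: viso_comp (viso_comp v1 v2) vL'.
Qed.
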